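(* Let $\omega$ be a subadditive weight function and let $L=\frac{\partial}{\partial t}+\sum_{j=1}^{N}(a_j+ib_j)(t)\frac{\partial}{\partial x_j}$ on $\mathbb{T}^{N+1}$, with $a_j,b_j$ real-valued functions in $\mathcal{E}_{\{\omega\}}(\mathbb{T}^1)$. The following are equivalent: \begin{itemize} \item $L$ is strongly $\{\omega\}$-solvable; \item $L$ is globally $\{\omega\}$-hypoelliptic; \item for each $\xi\in\mathbb{Z}^N$ the function $t\mapsto\langle\xi,\beta(t)\rangle$ does not change sign, and the pair $(\alpha_0,\beta_0)$ satisfies $(EDC)_1^{\{\omega\}}$. \end{itemize}
   Context: $\mathbb{T}^n=(\mathbb{R}/2\pi\mathbb{Z})^n$; coordinates on $\mathbb{T}^{N+1}$ are $(t,x)$. A weight function is an increasing continuous $\omega:[0,\infty)\to[0,\infty)$ such that: there is $K\ge0$ with $\omega(2t)\le K(\omega(t)+1)$; $\omega(t)=O(t)$; $\log t=o(\omega(t))$ as $t\to\infty$; $\varphi(t)=\omega(e^t)$ convex (one may assume $\omega=0$ on $[0,1]$). Subadditive: $\omega(s+t)\le\omega(s)+\omega(t)$. $\varphi^*(t)=\sup_{s\ge0}\{st-\varphi(s)\}$. $\|f\|_\lambda=\sup_{x}\sup_{\alpha}|\partial^\alpha f(x)|\exp(-\lambda\varphi^*(|\alpha|/\lambda))$; $\mathcal{E}_{\{\omega\}}(\mathbb{T}^n)=\{f\in C^\infty(\mathbb{T}^n):\|f\|_\lambda<\infty$ for some $\lambda>0\}$ with the inductive limit topology of the Banach spaces $\{f:\|f\|_{1/k}<\infty\}$;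 $\mathcal{E}'_{\{\omega\}}$ its strong dual. ${}^tL$ is the transpose of $L$ on $\mathcal{E}'_{\{\omega\}}(\mathbb{T}^{N+1})$ (${}^tL=-L$). Strongly $\{\omega\}$-solvable: $L\mathcal{E}_{\{\omega\}}(\mathbb{T}^{N+1})$ closed and $\ker{}^tL\subset\mathcal{E}'_{\{\omega\}}(\mathbb{T}^{N+1})$ finite dimensional. Globally $\{\omega\}$-hypoelliptic: $\mu\in\mathcal{E}'_{\{\omega\}}(\mathbb{T}^{N+1})$, $L\mu\in\mathcal{E}_{\{\omega\}}(\mathbb{T}^{N+1})$ imply $\mu\in\mathcal{E}_{\{\omega\}}(\mathbb{T}^{N+1})$. $\beta(t)=(b_1(t),\dots,b_N(t))$; $\alpha_0,\beta_0$ are the vectors of means over $[0,2\pi]$ of $(a_j)$ and $(b_j)$. $(\alpha,\beta)$ satisfies $(EDC)_1^{\{\omega\}}$ if for every $\epsilon>0$ there is $C_\epsilon>0$ with $|\tau+\langle\xi,\alpha+i\beta\rangle|\ge C_\epsilon e^{-\epsilon\omega(|(\tau,\xi)|)}$ for all $(\tau,\xi)\in\mathbb{Z}^{N+1}\setminus\{0\}$. A real function changes sign if it takes both strictly positive and strictly negative values. *)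

(* Defs.v *)
From Stdlib Require Import Reals.
From Coquelicot Require Import Coquelicot.
From mathcomp Require Import ssreflect ssrbool ssrfun eqtype ssrnat seq fintype.

Set Implicit Arguments.
Unset Strict Implicit.
Unset Printing Implicit Defensive.

Local Open Scope R_scope.

(** Points of R^n, and complex-valued functions on R^n
    (functions on T^n = 2pi-periodic functions on R^n). *)
Definition pt (n : nat) := 'I_n -> R.
Definition Fn (n : nat) := pt n -> C.

Definition upd (n : nat) (x : pt n) (j : 'I_n) (s : R) : pt n :=
  fun i => if i == j then s else x i.

Definition periodic (n : nat) (f : Fn n) : Prop :=
  forall (x : pt n) (j : 'I_n), f (upd x j (x j + 2 * PI)) = f x.

Definition partial (n : nat) (j : 'I_n) (f : Fn n) : Fn n :=
  fun x => (Derive (fun s => fst (f (upd x j s))) (x j),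
            Derive (fun s => snd (f (upd x j s))) (x j)).

Definition iterp (n : nat) (l : seq 'I_n) (f : Fn n) : Fn n :=
  foldr (fun j g => partial j g) f l.

Definition contC (n : nat) (f : Fn n) : Prop :=
  forall (x : pt n) (eps : R), 0 < eps -> exists delta, 0 < delta /\
    forall y : pt n, (forall j, Rabs (y j - x j) < delta) ->
      Cmod (Cminus (f y) (f x)) < eps.

Definition smooth (n : nat) (f : Fn n) : Prop :=
  forall l : seq 'I_n, contC (iterp l f) /\
    forall (x : pt n) (j : 'I_n),
      ex_derive (fun s => fst (iterp l f (upd x j s))) (x j) /\
      ex_derive (fun s => snd (iterp l f (upd x j s))) (x j).

Definition dalpha (n : nat) (al : 'I_n -> nat) (f : Fn n) : Fn n :=
  foldr (fun j g => iter (al j) (partial j) g) f (enum 'I_n).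

Definition absa (n : nat) (al : 'I_n -> nat) : nat :=
  foldr (fun j acc => (al j + acc)%nat) 0%nat (enum 'I_n).

Definition weight_function (om : R -> R) : Prop :=
  (forall s t, 0 <= s -> s <= t -> om s <= om t) /\
  (forall t, 0 <= t -> forall eps, 0 < eps -> exists delta, 0 < delta /\
      forall s, 0 <= s -> Rabs (s - t) < delta -> Rabs (om s - om t) < eps) /\
  (forall t, 0 <= t -> 0 <= om t) /\
  (exists K, 0 <= K /\ forall t, 0 <= t -> om (2 * t) <= K * (om t + 1)) /\
  (exists Cst T, forall t, T <= t -> om t <= Cst * t) /\
  (forall eps, 0 < eps -> exists T, forall t, T <= t -> Rabs (ln t) <= eps * om t) /\
  (forall x y th, 0 <= th <= 1 ->
      om (exp (th * x + (1 - th) * y)) <= th * om (exp x) + (1 - th) * om (exp y)).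

Definition subadditive (om : R -> R) : Prop :=
  forall s t, 0 <= s -> 0 <= t -> om (s + t) <= om s + om t.

Definition phi_star (om : R -> R) (t : R) : R :=
  real (Lub_Rbar (fun r => exists s, 0 <= s /\ r = s * t - om (exp s))).

Definition unorm (om : R -> R) (n : nat) (lam : R) (f : Fn n) : Rbar :=
  Lub_Rbar (fun r => exists (x : pt n) (al : 'I_n -> nat),
     r = Cmod (dalpha al f x) * exp (- lam * phi_star om (INR (absa al) / lam))).

Definition Eom (om : R -> R) (n : nat) (f : Fn n) : Prop :=
  periodic f /\ smooth f /\ exists lam, 0 < lam /\ is_finite (unorm om lam f).

Definition Estep (om : R -> R) (n : nat) (k : nat) (f : Fn n) : Prop :=
  periodic f /\ smooth f /\ is_finite (unorm om (/ INR k) f).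

Definition fadd (n : nat) (f g : Fn n) : Fn n := fun x => Cplus (f x) (g x).
Definition fscal (n : nat) (c : C) (f : Fn n) : Fn n := fun x => Cmult c (f x).

Definition absconvex (n : nat) (V : Fn n -> Prop) : Prop :=
  forall f g (c d : C), V f -> V g -> Cmod c + Cmod d <= 1 ->
    V (fadd (fscal c f) (fscal d g)).

(** open sets of the locally convex inductive limit topology of E_{omega}(T^n) *)
Definition openE (om : R -> R) (n : nat) (U : Fn n -> Prop) : Prop :=
  (forall u, U u -> Eom om u) /\
  forall u, U u -> exists V : Fn n -> Prop,
    (forall v, V v -> Eom om v) /\ absconvex V /\
    (forall k, (1 <= k)%nat -> exists eps, 0 < eps /\
        forall f, Estep om k f -> real (unorm om (/ INR k) f) < eps -> V f) /\
    (forall v, V v -> U (fadd u v)).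

Definition closedE (om : R -> R) (n : nat) (S : Fn n -> Prop) : Prop :=
  (forall f, S f -> Eom om f) /\ openE om (fun f => Eom om f /\ ~ S f).

(** E'_{omega}(T^n): continuous linear functionals on E_{omega}(T^n)
    (continuity on an inductive limit = continuity on every step). *)
Definition is_ultradist (om : R -> R) (n : nat) (mu : Fn n -> C) : Prop :=
  (forall f g (c : C), Eom om f -> Eom om g ->
      mu (fadd (fscal c f) g) = Cplus (Cmult c (mu f)) (mu g)) /\
  (forall k, (1 <= k)%nat -> exists M, forall f, Estep om k f ->
      Cmod (mu f) <= M * real (unorm om (/ INR k) f)).

Fixpoint int_coords (n : nat) (l : seq 'I_n) (f : Fn n) (x : pt n) : C :=
  match l with
  | [::] => f x
  | j :: l' => RInt (V := C_R_CompleteNormedModule)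
                 (fun s => int_coords l' f (upd x j s)) 0 (2 * PI)
  end.

Definition intT (n : nat) (f : Fn n) : C := int_coords (enum 'I_n) f (fun _ => 0).

Definition fdist (n : nat) (f : Fn n) : Fn n -> C :=
  fun g => intT (fun x => Cmult (f x) (g x)).

Definition sumC (n : nat) (F : 'I_n -> C) : C :=
  foldr (fun j acc => Cplus (F j) acc) (RtoC 0) (enum 'I_n).
Definition sumR (n : nat) (F : 'I_n -> R) : R :=
  foldr (fun j acc => F j + acc) 0 (enum 'I_n).

(** L = d/dt + sum_j (a_j + i b_j)(t) d/dx_j on T^{N+1};
    coordinate 0 is t, coordinate lift ord0 j is x_j. *)
Definition Lop (N : nat) (a b : 'I_N -> R -> R) (f : Fn N.+1) : Fn N.+1 :=
  fun p => Cplus (partial ord0 f p)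
     (sumC (fun j : 'I_N => Cmult (a j (p ord0), b j (p ord0))
                                  (partial (lift ord0 j) f p))).

Definition in_ker_tL (om : R -> R) (N : nat) (a b : 'I_N -> R -> R)
    (mu : Fn N.+1 -> C) : Prop :=
  is_ultradist om mu /\ forall f, Eom om f -> mu (Lop a b f) = RtoC 0.

Definition strongly_solvable (om : R -> R) (N : nat) (a b : 'I_N -> R -> R) : Prop :=
  closedE om (fun g => exists f, Eom om f /\ g = Lop a b f) /\
  exists (m : nat) (nu : 'I_m -> (Fn N.+1 -> C)),
    (forall i, in_ker_tL om a b (nu i)) /\
    forall mu, in_ker_tL om a b mu -> exists c : 'I_m -> C,
      forall f, Eom om f -> mu f = sumC (fun i => Cmult (c i) (nu i f)).

(** L acting on E' is the transpose of ^tL = -L:  (L mu)(h) = mu(-L h). *)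
Definition glob_hypoelliptic (om : R -> R) (N : nat) (a b : 'I_N -> R -> R) : Prop :=
  forall mu : Fn N.+1 -> C, is_ultradist om mu ->
    (exists g, Eom om g /\ forall h, Eom om h -> Copp (mu (Lop a b h)) = fdist g h) ->
    exists f, Eom om f /\ forall h, Eom om h -> mu h = fdist f h.

Definition changes_sign (g : R -> R) : Prop :=
  (exists t, 0 < g t) /\ (exists t, g t < 0).

Definition mean (a : R -> R) : R := / (2 * PI) * RInt a 0 (2 * PI).

Definition EDC1 (om : R -> R) (N : nat) (al be : 'I_N -> R) : Prop :=
  forall eps, 0 < eps -> exists Ce, 0 < Ce /\
    forall (tau : Z) (xi : 'I_N -> Z), (tau <> 0%Z \/ exists j, xi j <> 0%Z) ->
      Cmod (IZR tau + sumR (fun j => IZR (xi j) * al j),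
            sumR (fun j => IZR (xi j) * be j))
      >= Ce * exp (- eps * om (sqrt (IZR tau ^ 2 + sumR (fun j => IZR (xi j) ^ 2)))).

Definition condition3 (om : R -> R) (N : nat) (a b : 'I_N -> R -> R) : Prop :=
  (forall xi : 'I_N -> Z,
      ~ changes_sign (fun t => sumR (fun j => IZR (xi j) * b j t))) /\
  EDC1 om (fun j => mean (a j)) (fun j => mean (b j)).

(* Main.v *)
(** Everything is done on the Fourier side. A smooth periodic function is in E_{omega} iff its Fourier
    coefficients are bounded by A exp(-del omega(|k|)) for some del > 0: this is the Young inequality between
    phi and phi^*, and ultradistributions correspond in the same way to coefficients of growth exp(eps omega)
    for every eps. For fixed xi the equation L u = g becomes v' + i <xi, a + i b> v = h on the circle, whose
    periodic solutions are explicit through E = exp(i int <xi, a + i b>).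

    If <xi, b> has constant sign, |E| is monotone, so the solution satisfies |q - 1| |v| <= 2 pi max(1, |q|) sup |h|
    with q = E(2 pi), and the Diophantine condition bounds |q - 1| from below by exp(-eps omega). Decay in tau
    is recovered from tau v_tau = h_tau - (convolution), since the increments of omega are subadditive. This gives
    hypoellipticity and that the range consists of the g with vanishing integral.

    For the converse it suffices to find infinitely many xi with periodic v of sup norm 1 for which
    v' + i <xi, a + i b> v is exponentially small: summing these fibres with coefficient 1 contradicts
    hypoellipticity, and, when the fibre equations have no homogeneous solution, closedness of the range. If the
    Diophantine condition fails, v is the homogeneous solution with its multiplier shifted to be periodic; exact
    resonances give an infinite dimensional kernel instead. If <xi, b> changes sign, take for m xi as right-hand
    side a wave packet of width m^(-1/2) and critical frequency at the minimum s0 of B = int <xi, b>; it has only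
    O(m) frequencies, while its solution grows like exp(m eta) for some eta > 0. *)
Require Import Defs.
From Stdlib Require Import Reals.
From Coquelicot Require Import Coquelicot.
From mathcomp Require Import ssreflect ssrbool ssrfun eqtype ssrnat seq fintype.
From Stdlib Require Import Lra Lia Psatz FunctionalExtensionality Classical ClassicalEpsilon.
From mathcomp Require Import zify.
(* Coquelicot exports another [Fn]. *)
Import Defs.
Set Implicit Arguments.
Unset Strict Implicit.
Unset Printing Implicit Defensive.
Local Open Scope R_scope.

(** Localisation is done by the trigonometric polynomials [((1 + cos s) / 2) ^ p], which serve both
    for the uniqueness of Fourier coefficients and as envelopes of the wave packets. Topology enters
    through constants: [cd f A del] keeps size and rate of decay explicit, and the constants of the
    lemmas depend on the rate only. This turns continuity of functionals and neighbourhoods of the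
    inductive limit into estimates of coefficients. Rates are arbitrary positive numbers, so they
    may be halved whenever a factor has to be paid. The obstacle is decay in tau that is uniform in
    xi: the convolution couples all tau with a factor |xi|. It can be absorbed for |tau| >= C |xi|;
    the remaining tau cost exp(C del omega(xi)), which is paid by the decay of the right-hand side
    in xi for sufficiency, and by the smallness of the error for the shifted homogeneous solutions.
    For wave packets all frequencies are O(m) and omega(O(m)) = O(m), so that a gain exp(-eta m)
    outweighs every such loss once del is small. *)

(** * Limits of complex sequences *)

Definition Cconv (s : nat -> C) (l : C) : Prop :=
  forall eps, 0 < eps -> exists n0, forall n, (n0 <= n)%coq_nat ->
    Cmod (s n - l)%C < eps.

Lemma Cmod_minus_sym (x y : C) : Cmod (x - y)%C = Cmod (y - x)%C.
Proof. by rewrite -Cmod_opp; congr Cmod; ring. Qed.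

Lemma Cmod_triangle3 (x y z : C) : Cmod (x - z)%C <= Cmod (x - y)%C + Cmod (y - z)%C.
Proof. have -> : (x - z = (x - y) + (y - z))%C by ring. exact: Cmod_triangle. Qed.

Lemma Cmod_sub_le (x y : C) : Cmod x <= Cmod y + Cmod (x - y)%C.
Proof. have {1}-> : (x = y + (x - y))%C by ring. exact: Cmod_triangle. Qed.

Lemma Cmod_small_eq (x y : C) : (forall eps, 0 < eps -> Cmod (x - y)%C < eps) -> x = y.
Proof.
move=> H; have h0 : Cmod (x - y)%C = 0.
  have := Cmod_ge_0 (x - y)%C; case: (Rle_lt_or_eq_dec _ _ (Cmod_ge_0 (x - y)%C)) => // h.
  by have := H _ h; lra.
have e := Cmod_eq_0 _ h0.
have e2 : (x = (x - y) + y)%C by ring.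
by rewrite e2 e; ring.
Qed.

Lemma Cconv_unique (s : nat -> C) (l l' : C) : Cconv s l -> Cconv s l' -> l = l'.
Proof.
move=> H H'; apply: Cmod_small_eq => eps he.
have [n h] := H (eps / 2) ltac:(lra); have [n' h'] := H' (eps / 2) ltac:(lra).
have := h (n + n')%coq_nat ltac:(lia); have := h' (n + n')%coq_nat ltac:(lia).
have := Cmod_triangle3 l (s (n + n')%coq_nat) l'.
rewrite (Cmod_minus_sym l (s _)); lra.
Qed.

Lemma Cconv_ext (s s' : nat -> C) (l : C) : (forall n, s n = s' n) -> Cconv s l -> Cconv s' l.
Proof. by move=> e H eps he; have [n h] := H eps he; exists n => m hm; rewrite -e; apply: h. Qed.

Lemma Cconv_const (l : C) : Cconv (fun _ => l) l.
Proof.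
move=> eps he; exists 0%nat => n _.
have -> : (l - l = RtoC 0)%C by ring. by rewrite Cmod_0.
Qed.

Lemma Cconv_eventually (s : nat -> C) (l : C) n0 :
  (forall n, (n0 <= n)%coq_nat -> s n = l) -> Cconv s l.
Proof.
move=> H eps he; exists n0 => n hn; rewrite H //.
have -> : (l - l = RtoC 0)%C by ring. by rewrite Cmod_0.
Qed.

Lemma Cconv_plus (s s' : nat -> C) (l l' : C) :
  Cconv s l -> Cconv s' l' -> Cconv (fun n => s n + s' n)%C (l + l')%C.
Proof.
move=> H H' eps he.
have [n h] := H (eps / 2) ltac:(lra); have [n' h'] := H' (eps / 2) ltac:(lra).
exists (n + n')%coq_nat => m hm.
have h1 := h m ltac:(lia); have h2 := h' m ltac:(lia).
have -> : (s m + s' m - (l + l') = (s m - l) + (s' m - l'))%C by ring.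
have := Cmod_triangle (s m - l) (s' m - l'); lra.
Qed.

Lemma Cconv_scal (s : nat -> C) (l c : C) : Cconv s l -> Cconv (fun n => c * s n)%C (c * l)%C.
Proof.
move=> H eps he; have hc := Cmod_ge_0 c.
have [n h] := H (eps / (Cmod c + 1)) ltac:(by apply: Rdiv_lt_0_compat; lra).
exists n => m hm; have := h m hm.
have -> : (c * s m - c * l = c * (s m - l))%C by ring.
rewrite Cmod_mult => h1.
have h2 := Cmod_ge_0 (s m - l)%C.
have h3 : (Cmod c + 1) * Cmod (s m - l)%C < eps.
  apply: Rlt_le_trans (_ : (Cmod c + 1) * (eps / (Cmod c + 1)) <= _).
    by apply: Rmult_lt_compat_l; lra.
  by apply: Req_le; field; lra.
nra.
Qed.

Lemma Cconv_le (s : nat -> C) (l : C) b :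
  Cconv s l -> (forall n, Cmod (s n) <= b) -> Cmod l <= b.
Proof.
move=> H hb; apply: Rnot_lt_le => hlt.
have [n h] := H (Cmod l - b) ltac:(lra).
have := h n ltac:(lia); have := hb n; have := Cmod_sub_le l (s n).
rewrite Cmod_minus_sym; lra.
Qed.

Lemma Cconv_rate (s : nat -> C) (l : C) (e : nat -> R) g :
  is_lim_seq e 0 -> (forall n, Cmod (s n - l)%C <= g * e n) -> Cconv s l.
Proof.
move=> he H eps heps.
have hl : is_lim_seq (fun n => g * e n) (Rbar_mult g 0) by apply: is_lim_seq_scal_l.
rewrite Rbar_mult_0_r in hl.
move/is_lim_seq_spec: hl => /(_ (mkposreal _ heps)) [n0 /= h].
exists n0 => n hn; have := h n ltac:(lia); have := H n.
rewrite Rminus_0_r => h1 h2; have := Rle_abs (g * e n); lra.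
Qed.

(** Cauchy criterion with a real majorant: this is the form in which partial sums of dominated
    series arrive. *)
Lemma Cconv_ex_cauchy (s : nat -> C) (t : nat -> R) :
  (forall n m, (n <= m)%coq_nat -> Cmod (s m - s n)%C <= t m - t n) -> ex_finite_lim_seq t ->
  exists l, Cconv s l.
Proof.
move=> H [T hT].
have hc : forall eps, 0 < eps -> exists n0, forall n m, (n0 <= n)%coq_nat -> (n <= m)%coq_nat ->
    Cmod (s m - s n)%C < eps.
  move=> eps he; have he2 : 0 < eps / 2 by lra.
  move/is_lim_seq_spec: hT => /(_ (mkposreal _ he2)) [n0 /= h].
  exists n0 => n m hn hm; have := H n m hm; have := h n ltac:(lia); have := h m ltac:(lia).
  move=> /Rabs_def2 [h1 h2] /Rabs_def2 [h3 h4]; lra.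
have [l1 h1] : ex_finite_lim_seq (fun n => fst (s n)).
  apply/ex_lim_seq_cauchy_corr => eps; have [n0 h0] := hc eps (cond_pos eps).
  exists n0 => n m hn hm.
  case: (Nat.le_ge_cases n m) => hnm.
    rewrite Rabs_minus_sym.
    apply: Rle_lt_trans (h0 n m ltac:(lia) hnm).
    exact: (re_le_Cmod (s m - s n)%C).
  apply: Rle_lt_trans (h0 m n ltac:(lia) hnm).
  exact: (re_le_Cmod (s n - s m)%C).
have him : forall c : C, Rabs (snd c) <= Cmod c.
  by move=> c; apply: Rle_trans (Rmax_Cmod c); apply: Rmax_r.
have [l2 h2] : ex_finite_lim_seq (fun n => snd (s n)).
  apply/ex_lim_seq_cauchy_corr => eps; have [n0 h0] := hc eps (cond_pos eps).
  exists n0 => n m hn hm.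
  case: (Nat.le_ge_cases n m) => hnm.
    rewrite Rabs_minus_sym.
    apply: Rle_lt_trans (h0 n m ltac:(lia) hnm).
    exact: (him (s m - s n)%C).
  apply: Rle_lt_trans (h0 m n ltac:(lia) hnm).
  exact: (him (s n - s m)%C).
exists (l1, l2) => eps he; have he4 : 0 < eps / 4 by lra.
move/is_lim_seq_spec: h1 => /(_ (mkposreal _ he4)) [n1 /= h1].
move/is_lim_seq_spec: h2 => /(_ (mkposreal _ he4)) [n2 /= h2].
exists (n1 + n2)%coq_nat => n hn.
have e1 := h1 n ltac:(lia); have e2 := h2 n ltac:(lia).
apply: Rle_lt_trans (Cmod_2Rmax _) _ => /=.
have hs : sqrt 2 <= 2.
  rewrite -{2}(sqrt_square 2); last lra.
  apply: sqrt_le_1; lra.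
have hm : Rmax (Rabs ((s n).1 + - l1)) (Rabs ((s n).2 + - l2)) < eps / 4.
  by apply: Rmax_lub_lt.
have := Rle_trans _ _ _ (Rabs_pos _) (Rmax_l (Rabs ((s n).1 + - l1)) (Rabs ((s n).2 + - l2))).
have := sqrt_pos 2.
nra.
Qed.

(** * Symmetric sums over Z and over boxes in Z^n *)

Definition updz n (k : 'I_n -> Z) (j : 'I_n) (i : Z) : 'I_n -> Z :=
  fun m => if m == j then i else k m.

Lemma updz_same n (k : 'I_n -> Z) j i : updz k j i j = i.
Proof. by rewrite /updz eqxx. Qed.

Lemma updz_other n (k : 'I_n -> Z) j i m : m != j -> updz k j i m = k m.
Proof. by rewrite /updz => /negbTE ->. Qed.

(** Parametric in the carrier and its addition, because the same partial sums are needed in the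
    reals, in the complex numbers and in the space of functions. *)
Fixpoint zs (V : Type) (add : V -> V -> V) (r : nat) (F : Z -> V) : V :=
  match r with
  | O => F 0%Z
  | S r' => add (zs add r' F) (add (F (Z.of_nat r)) (F (- Z.of_nat r)%Z))
  end.

(** One coordinate at a time, like [int_coords]; [k] supplies the coordinates outside [l]. *)
Fixpoint bs n (V : Type) (add : V -> V -> V) (l : seq 'I_n) (r : nat)
    (F : ('I_n -> Z) -> V) (k : 'I_n -> Z) : V :=
  match l with
  | [::] => F k
  | j :: l' => zs add r (fun i => bs add l' r F (updz k j i))
  end.

(** Parametricity of the sum: a relation compatible with the additions passes from terms to sums.
    With [V' = unit] it is an induction principle for invariants such as continuity. *)
Lemma zs_rel (V V' : Type) (add : V -> V -> V) (add' : V' -> V' -> V') (Rel : V -> V' -> Prop)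
    r F G :
  (forall x y x' y', Rel x x' -> Rel y y' -> Rel (add x y) (add' x' y')) ->
  (forall i, (Z.abs i <= Z.of_nat r)%Z -> Rel (F i) (G i)) ->
  Rel (zs add r F) (zs add' r G).
Proof.
move=> Ha; elim: r => [|r IH] H /=; first by apply: H.
apply: (Ha); first by apply: IH => i hi; apply: H; lia.
by apply: Ha; apply: H; lia.
Qed.

Lemma bs_rel n (V V' : Type) (add : V -> V -> V) (add' : V' -> V' -> V') (Rel : V -> V' -> Prop)
    (l : seq 'I_n) r F G k :
  (forall x y x' y', Rel x x' -> Rel y y' -> Rel (add x y) (add' x' y')) ->
  (forall k', (forall j, j \notin l -> k' j = k j) -> Rel (F k') (G k')) ->
  Rel (bs add l r F k) (bs add' l r G k).
Proof.
move=> Ha; elim: l k => [|j l IH] k H /=; first by apply: H.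
apply: zs_rel => // i _; apply: IH => k' hk'; apply: H => m.
rewrite inE negb_or => /andP [h1 h2]; rewrite hk' //; exact: updz_other.
Qed.

Lemma zs_delta (V : Type) (add : V -> V -> V) (z : V) r F (i0 : Z) :
  (forall x, add x z = x) -> (forall x, add z x = x) ->
  (forall i, i <> i0 -> F i = z) ->
  zs add r F = if (Z.abs i0 <=? Z.of_nat r)%Z then F i0 else z.
Proof.
move=> h1 h2 H; elim: r => [|r IH] /=.
  case: (Z.eq_dec i0 0) => [->|hi] //=.
  rewrite (_ : (Z.abs i0 <=? 0)%Z = false); last by lia.
  by apply: H; lia.
rewrite IH; case: (Z.eq_dec (Z.abs i0) (Z.pos (Pos.of_succ_nat r))) => e.
  rewrite (_ : (Z.abs i0 <=? Z.of_nat r)%Z = false) ?h2; last by lia.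
  rewrite (_ : (Z.abs i0 <=? Z.pos (Pos.of_succ_nat r))%Z = true); last by lia.
  case: (Z.eq_dec i0 (Z.pos (Pos.of_succ_nat r))) => e'.
    by rewrite (H (Z.neg _)) ?h1 -?e' //; lia.
  have -> : Z.neg (Pos.of_succ_nat r) = i0 by lia.
  by rewrite (H (Z.pos (Pos.of_succ_nat r))) ?h2 //; lia.
rewrite (H (Z.pos (Pos.of_succ_nat r))) ?(H (Z.neg (Pos.of_succ_nat r))) ?h1 ?h1; [|lia|lia].
by have -> : (Z.abs i0 <=? Z.pos (Pos.of_succ_nat r))%Z = (Z.abs i0 <=? Z.of_nat r)%Z by lia.
Qed.

Lemma bs_zero n (V : Type) (add : V -> V -> V) (z : V) (l : seq 'I_n) r F k :
  add z z = z ->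
  (forall k', (forall j, j \notin l -> k' j = k j) -> F k' = z) -> bs add l r F k = z.
Proof.
move=> hz H.
apply: (@bs_rel n V unit add (fun _ _ => tt) (fun x _ => x = z) l r F (fun _ => tt) k) => //.
by move=> x y _ _ -> ->.
Qed.

Lemma bs_delta n (V : Type) (add : V -> V -> V) (z : V) (l : seq 'I_n) r F k k0 :
  (forall x, add x z = x) -> (forall x, add z x = x) -> uniq l ->
  (forall k', k' <> k0 -> F k' = z) -> (forall j, j \notin l -> k j = k0 j) ->
  bs add l r F k = if all (fun j => (Z.abs (k0 j) <=? Z.of_nat r)%Z) l then F k0 else z.
Proof.
move=> h1 h2 hu H; elim: l k hu => [|j l IH] k /= hu hk.
  by have -> : k = k0 by apply: functional_extensionality => j; apply: hk.
move/andP: hu => [hj hu].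
rewrite (@zs_delta V add z r _ (k0 j)) //; last first.
  move=> i hi; apply: bs_zero => // k' hk'; apply: H => e.
  by apply: hi; rewrite -e hk' // updz_same.
case: ifP => //= _; apply: IH => // m hm.
case: (eqVneq m j) => [->|hmj]; first by rewrite updz_same.
by rewrite updz_other //; apply: hk; rewrite inE negb_or hmj.
Qed.

(** * Summable weights on Z^n and dominated box sums *)

Definition dZ (i : Z) : R := / (1 + IZR i ^ 2).

Definition DD n (l : seq 'I_n) (k : 'I_n -> Z) : R :=
  foldr (fun j acc => dZ (k j) * acc) 1 l.

Lemma dZ_pos i : 0 < dZ i.
Proof. by apply: Rinv_0_lt_compat; have := pow2_ge_0 (IZR i); lra. Qed.

Lemma DD_pos n (l : seq 'I_n) k : 0 < DD l k.
Proof.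
elim: l => [|j l IH] /=; first lra.
by apply: Rmult_lt_0_compat => //; apply: dZ_pos.
Qed.

Lemma zs_dZ r : zs Rplus r dZ <= 5.
Proof.
(* The subtracted term makes the induction telescope: the two new terms are together at most
   4/((r+1)(r+2)) = 4/(r+1) - 4/(r+2). *)
suff : zs Rplus r dZ <= 5 - 4 / (INR r + 1).
  have : 0 < 4 / (INR r + 1); last by lra.
  by apply: Rdiv_lt_0_compat; have := pos_INR r; lra.
elim: r => [|r IH]; first by rewrite /= /dZ /=; apply: Req_le; field.
have e : zs Rplus r.+1 dZ = zs Rplus r dZ + (dZ (Z.of_nat r.+1) + dZ (- Z.of_nat r.+1)%Z) by [].
rewrite e; have -> : dZ (- Z.of_nat r.+1)%Z = dZ (Z.of_nat r.+1).
  by rewrite /dZ opp_IZR; congr Rinv; ring.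
have -> : dZ (Z.of_nat r.+1) = / (1 + (INR r + 1) ^ 2) by rewrite /dZ -INR_IZR_INZ S_INR.
rewrite S_INR; have h := pos_INR r; set x := INR r in IH h *.
have h1 : / (1 + (x + 1) ^ 2) <= 2 / ((x + 1) * (x + 2)).
  apply: (Rmult_le_reg_r (1 + (x + 1) ^ 2)); first nra.
  rewrite Rinv_l; last nra.
  apply: (Rmult_le_reg_r ((x + 1) * (x + 2))); first nra.
  have -> : 2 / ((x + 1) * (x + 2)) * (1 + (x + 1) ^ 2) * ((x + 1) * (x + 2)) = 2 * (1 + (x + 1) ^ 2).
    by field; split; lra.
  nra.
have h2 : 2 * (2 / ((x + 1) * (x + 2))) = 4 / (x + 1) - 4 / (x + 1 + 1) by field; split; lra.
move: IH h1 h2; move: (zs _ _ _) (/ (1 + _)) (2 / (_ * _)) (4 / (x + 1)) (4 / (x + 1 + 1)) => *; lra.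
Qed.

Lemma zs_scal r c F : zs Rplus r (fun i => c * F i) = c * zs Rplus r F.
Proof. by elim: r => [|r IH] //=; rewrite IH; ring. Qed.

Lemma zs_le r F G : (forall i, F i <= G i) -> zs Rplus r F <= zs Rplus r G.
Proof.
move=> H; apply: (@zs_rel _ _ Rplus Rplus Rle) => // x y x' y'; lra.
Qed.

Lemma bs_eq n (V : Type) (add : V -> V -> V) (l : seq 'I_n) r F G k :
  (forall k', (forall j, j \notin l -> k' j = k j) -> F k' = G k') ->
  bs add l r F k = bs add l r G k.
Proof.
move=> H; apply: (@bs_rel _ _ _ add add eq) => //.
by move=> x y x' y' -> ->.
Qed.

Lemma bs_scal n (l : seq 'I_n) r c F k :
  bs Rplus l r (fun k => c * F k) k = c * bs Rplus l r F k.
Proof.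
elim: l k => [|j l IH] k //=.
rewrite -zs_scal; apply: (@zs_rel _ _ Rplus Rplus eq) => //.
by move=> x y x' y' -> ->.
Qed.

Lemma bs_DD n (l : seq 'I_n) r k : uniq l -> bs Rplus l r (DD l) k <= 5 ^ (size l).
Proof.
elim: l k => [|j l IH] k /=; first by move=> _; lra.
move=> /andP [hj hu].
apply: Rle_trans (_ : zs Rplus r (fun i => 5 ^ size l * dZ i) <= _).
  apply: zs_le => i.
  rewrite (@bs_eq n R Rplus l r _ (fun k' => dZ i * DD l k')); last first.
    by move=> k' hk' /=; rewrite hk' // updz_same.
  rewrite bs_scal Rmult_comm; apply: Rmult_le_compat_r; last exact: IH.
  exact: Rlt_le (dZ_pos _).
rewrite zs_scal Rmult_comm; apply: Rmult_le_compat_r; last exact: zs_dZ.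
by apply: pow_le; lra.
Qed.

Lemma zs_dom_diff (F : Z -> C) (G : Z -> R) r :
  (forall i, Cmod (F i) <= G i) ->
  Cmod (zs Cplus r F) <= zs Rplus r G.
Proof.
move=> H; apply: (@zs_rel _ _ Cplus Rplus (fun x y => Cmod x <= y)) => //.
by move=> x y x' y' h1 h2; have := Cmod_triangle x y; lra.
Qed.

Lemma bs_le_dom n (l : seq 'I_n) (F : ('I_n -> Z) -> C) (G : ('I_n -> Z) -> R) r k :
  (forall k', (forall j, j \notin l -> k' j = k j) -> Cmod (F k') <= G k') ->
  Cmod (bs Cplus l r F k) <= bs Rplus l r G k.
Proof.
move=> H; apply: (@bs_rel _ _ _ Cplus Rplus (fun x y => Cmod x <= y)) => //.
by move=> x y x' y' h1 h2; have := Cmod_triangle x y; lra.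
Qed.

Lemma zs_diff_step (F F' : Z -> C) (G G' : Z -> R) r :
  (forall i, Cmod (F' i - F i)%C <= G' i - G i) ->
  Cmod (zs Cplus r F' - zs Cplus r F)%C <= zs Rplus r G' - zs Rplus r G.
Proof.
move=> H; elim: r => [|r IH] /=; first exact: H.
set a := zs _ _ F' in IH *; set b := zs _ _ F in IH *.
set p := Z.pos _; set q := Z.neg _.
have -> : (a + (F' p + F' q) - (b + (F p + F q)) = (a - b) + ((F' p - F p) + (F' q - F q)))%C by ring.
have := Cmod_triangle (a - b) ((F' p - F p) + (F' q - F q)).
have := Cmod_triangle (F' p - F p) (F' q - F q).
have := H p; have := H q; lra.
Qed.

(** Enlarging the box enlarges the inner boxes of the old slices and adds two outer slices. The
    first change is controlled by [zs_diff_step] and induction, the second by domination. *)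
Lemma bs_diff_step n (l : seq 'I_n) (F : ('I_n -> Z) -> C) (G : ('I_n -> Z) -> R) r k :
  (forall k, Cmod (F k) <= G k) ->
  Cmod (bs Cplus l r.+1 F k - bs Cplus l r F k)%C <= bs Rplus l r.+1 G k - bs Rplus l r G k.
Proof.
move=> H; elim: l k => [|j l IH] k.
  have -> : (bs Cplus [::] r.+1 F k - bs Cplus [::] r F k = RtoC 0)%C by rewrite /=; ring.
  by rewrite Cmod_0 /=; lra.
rewrite /bs -/(bs Cplus l) -/(bs Rplus l).
set A := fun i => bs Cplus l r.+1 F (updz k j i).
set B := fun i => bs Cplus l r F (updz k j i).
set A' := fun i => bs Rplus l r.+1 G (updz k j i).
set B' := fun i => bs Rplus l r G (updz k j i).
have h := @zs_diff_step B A B' A' r (fun i => IH _).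
have hA : forall i, Cmod (A i) <= A' i by move=> i; apply: bs_le_dom.
have e1 : zs Cplus r.+1 A = (zs Cplus r A + (A (Z.of_nat r.+1) + A (- Z.of_nat r.+1)%Z))%C by [].
have e2 : zs Rplus r.+1 A' = zs Rplus r A' + (A' (Z.of_nat r.+1) + A' (- Z.of_nat r.+1)%Z) by [].
rewrite e1 e2.
set p := Z.of_nat _; set q := (- _)%Z.
have -> : (zs Cplus r A + (A p + A q) - zs Cplus r B = (zs Cplus r A - zs Cplus r B) + (A p + A q))%C by ring.
have := Cmod_triangle (zs Cplus r A - zs Cplus r B) (A p + A q).
have := Cmod_triangle (A p) (A q).
have := hA p; have := hA q; lra.
Qed.

Lemma bs_diff n (l : seq 'I_n) (F : ('I_n -> Z) -> C) (G : ('I_n -> Z) -> R) r r' k :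
  (forall k, Cmod (F k) <= G k) -> (r <= r')%coq_nat ->
  Cmod (bs Cplus l r' F k - bs Cplus l r F k)%C <= bs Rplus l r' G k - bs Rplus l r G k.
Proof.
move=> H; elim=> [|m hm IH].
  have -> : (bs Cplus l r F k - bs Cplus l r F k = RtoC 0)%C by ring.
  by rewrite Cmod_0; lra.
have := Cmod_triangle3 (bs Cplus l m.+1 F k) (bs Cplus l m F k) (bs Cplus l r F k).
have := bs_diff_step l m k H; lra.
Qed.

(** The error sequence [e] is the tail of the majorant [DD] and is chosen before [F] and [g]. Hence
    Fourier series converge uniformly in the point, at a rate proportional to [g]. *)
Lemma bs_dominated n (l : seq 'I_n) (k : 'I_n -> Z) : uniq l ->
  exists e : nat -> R, is_lim_seq e 0 /\
   forall (F : ('I_n -> Z) -> C) g, (forall k, Cmod (F k) <= g * DD l k) ->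
    (forall r, Cmod (bs Cplus l r F k) <= g * 5 ^ size l) /\
    exists L, Cconv (fun r => bs Cplus l r F k) L /\
      forall r, Cmod (bs Cplus l r F k - L)%C <= g * e r.
Proof.
move=> hu; pose t r := bs Rplus l r (DD l) k.
have inc : forall r, t r <= t r.+1.
  move=> r; have := @bs_diff_step n l (fun k => RtoC (DD l k)) (DD l) r k.
  rewrite -/(t _) -/(t _) => h.
  have := Rle_trans _ _ _ (Cmod_ge_0 _) (h _); move=> h'.
  suff : 0 <= t r.+1 - t r by lra.
  by apply: h' => k'; rewrite Cmod_R Rabs_right; [lra | have := DD_pos l k'; lra].
have hex : ex_finite_lim_seq t.
  by apply: (@ex_finite_lim_seq_incr t (5 ^ size l)) => // r; apply: bs_DD.
have [T hT] := hex.
exists (fun r => T - t r); split.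
  rewrite -(Rminus_diag T).
  by apply: is_lim_seq_minus' => //; exact: is_lim_seq_const.
move=> F g H.
have hb : forall r, Cmod (bs Cplus l r F k) <= g * 5 ^ size l.
  move=> r; apply: Rle_trans (_ : bs Rplus l r (fun k => g * DD l k) k <= _).
    by apply: bs_le_dom => k' _.
  rewrite bs_scal; apply: Rmult_le_compat_l; last exact: bs_DD.
  have := Rle_trans _ _ _ (Cmod_ge_0 _) (H k); have := DD_pos l k; nra.
split=> //.
have hd : forall r r', (r <= r')%coq_nat -> Cmod (bs Cplus l r' F k - bs Cplus l r F k)%C <= g * t r' - g * t r.
  by move=> r r' hr; rewrite /t -!bs_scal; apply: bs_diff.
have [L hL] : exists L, Cconv (fun r => bs Cplus l r F k) L.
  apply: (Cconv_ex_cauchy (t := fun r => g * t r)) => //.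
  exists (g * T); exact: (is_lim_seq_scal_l t g T).
exists L; split=> // r.
have hg : 0 <= g by have := Rle_trans _ _ _ (Cmod_ge_0 _) (H k); have := DD_pos l k; nra.
have htT : forall r, t r <= T by move=> r'; apply: is_lim_seq_incr_compare.
rewrite Cmod_minus_sym.
apply: Rnot_lt_le => hlt.
have [n0 h] := hL (Cmod (L - bs Cplus l r F k)%C - g * (T - t r)) ltac:(lra).
have h1 := h (n0 + r)%coq_nat ltac:(lia).
have h2 := hd r (n0 + r)%coq_nat ltac:(lia).
have h3 := Cmod_triangle3 L (bs Cplus l (n0 + r)%coq_nat F k) (bs Cplus l r F k).
rewrite (Cmod_minus_sym L (bs _ _ (n0 + r)%coq_nat F k)) in h3.
rewrite -Rmult_minus_distr_l in h2.
have := Rmult_le_compat_l g _ _ hg (Rplus_le_compat_r (- t r) _ _ (htT (n0 + r)%coq_nat)).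
rewrite /Rminus in h2 h1 hlt *; lra.
Qed.

(** * Finite sums and the norm of frequencies *)

Lemma sumR_S N (F : 'I_N.+1 -> R) : sumR F = F ord0 + sumR (fun j => F (lift ord0 j)).
Proof. by rewrite /sumR enum_ordSl /= foldr_map. Qed.

Lemma sumC_S N (F : 'I_N.+1 -> C) : sumC F = (F ord0 + sumC (fun j => F (lift ord0 j)))%C.
Proof. by rewrite /sumC enum_ordSl /= foldr_map. Qed.

Lemma sumR_0 (F : 'I_0 -> R) : sumR F = 0.
Proof. by rewrite /sumR enum_ord0. Qed.

Lemma sumC_0 (F : 'I_0 -> C) : sumC F = RtoC 0.
Proof. by rewrite /sumC enum_ord0. Qed.

Lemma sumR_le n (F G : 'I_n -> R) : (forall j, F j <= G j) -> sumR F <= sumR G.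
Proof.
move=> H; rewrite /sumR; elim: (enum 'I_n) => [|j l IH] /=; first lra.
by have := H j; lra.
Qed.

Lemma sumR_ge0 n (F : 'I_n -> R) : (forall j, 0 <= F j) -> 0 <= sumR F.
Proof.
move=> H; rewrite /sumR; elim: (enum 'I_n) => [|j l IH] /=; first lra.
by have := H j; lra.
Qed.

Lemma sumR_plus n (F G : 'I_n -> R) : sumR (fun j => F j + G j) = sumR F + sumR G.
Proof. rewrite /sumR; elim: (enum 'I_n) => [|j l IH] /=; [|rewrite IH]; ring. Qed.

Lemma sumR_scal n c (F : 'I_n -> R) : sumR (fun j => c * F j) = c * sumR F.
Proof. rewrite /sumR; elim: (enum 'I_n) => [|j l IH] /=; [|rewrite IH]; ring. Qed.

Lemma sumR_ext n (F G : 'I_n -> R) : (forall j, F j = G j) -> sumR F = sumR G.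
Proof. by move=> H; congr sumR; apply: functional_extensionality. Qed.

Lemma sumC_ext n (F G : 'I_n -> C) : (forall j, F j = G j) -> sumC F = sumC G.
Proof. by move=> H; congr sumC; apply: functional_extensionality. Qed.

Lemma sumC_plus n (F G : 'I_n -> C) : sumC (fun j => F j + G j)%C = (sumC F + sumC G)%C.
Proof. rewrite /sumC; elim: (enum 'I_n) => [|j l IH] /=; [|rewrite IH]; ring. Qed.

Lemma sumC_scal n c (F : 'I_n -> C) : sumC (fun j => c * F j)%C = (c * sumC F)%C.
Proof. rewrite /sumC; elim: (enum 'I_n) => [|j l IH] /=; [|rewrite IH]; ring. Qed.

Lemma sumC_pair n (F : 'I_n -> C) : sumC F = (sumR (fun j => fst (F j)), sumR (fun j => snd (F j))).
Proof. by rewrite /sumC /sumR; elim: (enum 'I_n) => [|j l IH] //=; rewrite IH. Qed.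

Lemma Cmod_sumC n (F : 'I_n -> C) : Cmod (sumC F) <= sumR (fun j => Cmod (F j)).
Proof.
rewrite /sumC /sumR; elim: (enum 'I_n) => [|j l IH] /=; first by rewrite Cmod_0; lra.
have := Cmod_triangle (F j) (foldr (fun j acc => (F j + acc)%C) (RtoC 0) l); lra.
Qed.

Lemma sumR_ge_term n (F : 'I_n -> R) j : (forall j, 0 <= F j) -> F j <= sumR F.
Proof.
move=> H; rewrite /sumR; have : j \in enum 'I_n by rewrite mem_enum.
elim: (enum 'I_n) => [|i l IH] //=; rewrite inE => /orP [/eqP -> | /IH h].
  suff : 0 <= foldr (fun j acc => F j + acc) 0 l by lra.
  by elim: l {IH} => [|m l IH] /=; [lra | have := H m; lra].
by have := H i; lra.
Qed.

Lemma sumR_const n c : sumR (fun _ : 'I_n => c) = INR n * c.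
Proof.
elim: n => [|n IH]; first by rewrite sumR_0 /=; ring.
by rewrite sumR_S IH S_INR; ring.
Qed.

(** The l^1 norm splits exactly along (tau, xi). It is compared with the Euclidean norm of the
    Diophantine condition in [euclid_le] and [nrm1_le_euclid]; the factors are absorbed by
    [om_mulR]. *)
Definition nrm1 n (k : 'I_n -> Z) : R := sumR (fun j => Rabs (IZR (k j))).

Definition negz n (k : 'I_n -> Z) : 'I_n -> Z := fun j => (- k j)%Z.
Definition addz n (k l : 'I_n -> Z) : 'I_n -> Z := fun j => (k j + l j)%Z.
Definition zeroz n : 'I_n -> Z := fun _ => 0%Z.

Lemma nrm1_ge0 n (k : 'I_n -> Z) : 0 <= nrm1 k.
Proof. by apply: sumR_ge0 => j; apply: Rabs_pos. Qed.

Lemma nrm1_neg n (k : 'I_n -> Z) : nrm1 (negz k) = nrm1 k.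
Proof. by apply: sumR_ext => j; rewrite /negz opp_IZR Rabs_Ropp. Qed.

Lemma nrm1_add n (k l : 'I_n -> Z) : nrm1 (addz k l) <= nrm1 k + nrm1 l.
Proof.
rewrite /nrm1 -sumR_plus; apply: sumR_le => j; rewrite /addz plus_IZR; exact: Rabs_triang.
Qed.

Lemma nrm1_term n (k : 'I_n -> Z) j : Rabs (IZR (k j)) <= nrm1 k.
Proof. by apply: (sumR_ge_term (F := fun j => Rabs (IZR (k j)))) => i; apply: Rabs_pos. Qed.

Lemma nrm1_S N (k : 'I_N.+1 -> Z) :
  nrm1 k = Rabs (IZR (k ord0)) + nrm1 (fun j => k (lift ord0 j)).
Proof. exact: sumR_S. Qed.

Lemma negzK n (k : 'I_n -> Z) : negz (negz k) = k.
Proof. by apply: functional_extensionality => j; rewrite /negz; lia. Qed.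

Lemma Rabs_IZR_ge1 i : i <> 0%Z -> 1 <= Rabs (IZR i).
Proof. by move=> h; rewrite -abs_IZR; apply: IZR_le; lia. Qed.

(** Selects the coordinate whose pure derivatives will give the decay of the coefficient at [k]. *)
Lemma nrm1_max n (k : 'I_n -> Z) :
  nrm1 k = 0 \/ exists j, 1 <= Rabs (IZR (k j)) /\ nrm1 k <= INR n * Rabs (IZR (k j)).
Proof.
elim: n k => [|n IH] k; first by left; rewrite /nrm1 sumR_0.
have hn := pos_INR n.
pose k' : 'I_n -> Z := fun j => k (lift ord0 j).
have -> : nrm1 k = Rabs (IZR (k ord0)) + nrm1 k' by rewrite nrm1_S.
rewrite S_INR.
have h0 : Rabs (IZR (k ord0)) = 0 \/ 1 <= Rabs (IZR (k ord0)).
  case: (Z.eq_dec (k ord0) 0) => [-> | /Rabs_IZR_ge1]; [left; exact: Rabs_R0 | by right].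
case: (IH k') => [h | [j [h1 h2]]].
  rewrite h; case: h0 => h0; first by left; rewrite h0; ring.
  right; exists ord0; split=> //; nra.
right.
case: (Rle_dec (Rabs (IZR (k ord0))) (Rabs (IZR (k' j)))) => hc.
  by exists (lift ord0 j); rewrite (_ : k (lift ord0 j) = k' j) //; split=> //; lra.
exists ord0; split; first lra.
nra.
Qed.

Lemma exp_ln_pow r p : 0 < r -> r ^ p = exp (INR p * ln r).
Proof. by move=> h; rewrite -Rpower_pow. Qed.

Lemma exp_le x y : x <= y -> exp x <= exp y.
Proof. by case=> [/exp_increasing|->]; lra. Qed.

(** * Weight functions *)

Section Weight.
Variable om : R -> R.
Hypothesis Hw : weight_function om.
Hypothesis Hs : subadditive om.

Lemma om_mono s t : 0 <= s -> s <= t -> om s <= om t.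
Proof. by case: Hw => h _; apply: h. Qed.

Lemma om_ge0 t : 0 <= t -> 0 <= om t.
Proof. by case: Hw => _ [_ [h _]]; apply: h. Qed.

Lemma om_log eps : 0 < eps -> exists T, forall t, T <= t -> Rabs (ln t) <= eps * om t.
Proof. by case: Hw => _ [_ [_ [_ [_ [h _]]]]]; apply: h. Qed.

Lemma om_convex x y th : 0 <= th <= 1 ->
  om (exp (th * x + (1 - th) * y)) <= th * om (exp x) + (1 - th) * om (exp y).
Proof. by case: Hw => _ [_ [_ [_ [_ [_ h]]]]]; apply: h. Qed.

Lemma om_nat n r : 0 <= r -> om (INR n.+1 * r) <= INR n.+1 * om r.
Proof.
move=> hr; elim: n => [|n IH]; first by rewrite /= !Rmult_1_l; lra.
rewrite (S_INR n.+1) !Rmult_plus_distr_r !Rmult_1_l.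
have h : 0 <= INR n.+1 * r by apply: Rmult_le_pos => //; apply: pos_INR.
have := Hs h hr; lra.
Qed.

(** Subadditivity lets a factor leave the weight, after rounding it up to an integer. Every change
    of norm or of range of frequencies is paid for in this way. *)
Lemma om_mulR X r : 0 <= X -> 0 <= r -> om (X * r) <= (X + 1) * om r.
Proof.
move=> hX hr; have [h1 h2] := archimed X.
have hup : (0 < up X)%Z by apply: lt_IZR; lra.
have [m hm] : exists m, up X = Z.of_nat m.+1.
  by exists (Z.to_nat (up X - 1)); lia.
have e : IZR (up X) = INR m.+1 by rewrite hm INR_IZR_INZ.
have ho := om_ge0 hr.
apply: Rle_trans (_ : om (INR m.+1 * r) <= _).
  by apply: om_mono; [nra | apply: Rmult_le_compat_r => //; lra].
apply: Rle_trans (om_nat m hr) _; apply: Rmult_le_compat_r => //; lra.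
Qed.

Lemma om_log1 eps : 0 < eps -> exists K, 0 <= K /\ forall r, 0 <= r -> ln (1 + r) <= eps * om r + K.
Proof.
move=> he; have [T hT] := om_log he.
set M := Rmax T 1; exists (ln (1 + M) + ln 2).
have hM1 : 1 <= M by apply: Rmax_r. have hMT : T <= M by apply: Rmax_l.
have l0 : forall x, 1 <= x -> 0 <= ln x by move=> x hx; rewrite -ln_1; apply: ln_le; lra.
have h1 : 0 <= ln (1 + M) by apply: l0; lra.
have h2 : 0 <= ln 2 by apply: l0; lra.
split; first lra.
move=> r hr; have ho := om_ge0 hr; have hp : 0 <= eps * om r by apply: Rmult_le_pos; lra.
case: (Rle_dec r M) => h.
  have h4 : ln (1 + r) <= ln (1 + M) by apply: ln_le; lra.
  lra.
have h3 : ln (1 + r) <= ln (2 * r) by apply: ln_le; lra.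
rewrite ln_mult in h3; [|lra|lra].
have := hT r ltac:(lra); have := Rle_abs (ln r); lra.
Qed.

(** Polynomial factors cost an arbitrarily small part of the rate, because log t = o(omega(t)). *)
Lemma om_pow eps p : 0 < eps -> exists K, 0 < K /\ forall r, 0 <= r -> (1 + r) ^ p <= K * exp (eps * om r).
Proof.
move=> he; have hp := pos_INR p.
(* The denominator [INR p + 1] also covers p = 0. *)
have he' : 0 < eps / (INR p + 1) by apply: Rdiv_lt_0_compat; lra.
have [K [hK h]] := om_log1 he'.
exists (exp (INR p * K)); split; first exact: exp_pos.
move=> r hr; rewrite exp_ln_pow; last lra.
rewrite -exp_plus; apply: exp_le.
have h1 := Rmult_le_compat_l _ _ _ hp (h r hr); have ho := om_ge0 hr.
have : INR p * (eps / (INR p + 1) * om r) <= eps * om r.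
  rewrite -Rmult_assoc; apply: Rmult_le_compat_r => //.
  have -> : INR p * (eps / (INR p + 1)) = eps * (INR p / (INR p + 1)) by field; lra.
  rewrite -{2}(Rmult_1_r eps); apply: Rmult_le_compat_l; first lra.
  apply: (Rmult_le_reg_r (INR p + 1)); first lra.
  have -> : INR p / (INR p + 1) * (INR p + 1) = INR p by field; lra.
  lra.
lra.
Qed.

(** A linear bound on the whole half-line; with it an exponential gain in m pays for the decay
    demanded at frequencies of size O(m). *)
Lemma om_lin : exists c, 0 <= c /\ forall r, 0 <= r -> om r <= c * (1 + r).
Proof.
exists (om 1); split; first by apply: om_ge0; lra.
move=> r hr; have := @om_mulR r 1 hr ltac:(lra); rewrite Rmult_1_r; lra.
Qed.

Lemma om_infty B : exists T, 0 <= T /\ forall t, T <= t -> B <= om t.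
Proof.
have [T hT] := @om_log 1 ltac:(lra).
exists (Rmax T (exp B)); split.
  by apply: Rle_trans (Rmax_r _ _); apply: Rlt_le (exp_pos _).
move=> t ht.
have h1 : T <= t by apply: Rle_trans ht; apply: Rmax_l.
have h2 : exp B <= t by apply: Rle_trans ht; apply: Rmax_r.
have h3 := exp_pos B.
have := hT t h1; have := Rle_abs (ln t).
have : B <= ln t by rewrite -(ln_exp B); apply: ln_le.
lra.
Qed.

Definition W n (k : 'I_n -> Z) : R := om (nrm1 k).

Lemma W_ge0 n (k : 'I_n -> Z) : 0 <= W k.
Proof. by apply: om_ge0; apply: nrm1_ge0. Qed.

Lemma W_neg n (k : 'I_n -> Z) : W (negz k) = W k.
Proof. by rewrite /W nrm1_neg. Qed.

Lemma W_add n (k l : 'I_n -> Z) : W (addz k l) <= W k + W l.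
Proof.
apply: Rle_trans (Hs (nrm1_ge0 k) (nrm1_ge0 l)).
by apply: om_mono; [apply: nrm1_ge0 | apply: nrm1_add].
Qed.

Lemma DD_nrm1 n (l : seq 'I_n) (k : 'I_n -> Z) : 1 <= (1 + nrm1 k) ^ (2 * size l) * DD l k.
Proof.
have hr := nrm1_ge0 k.
elim: l => [|j l IH]; first by rewrite muln0 /=; lra.
have -> : (2 * size (j :: l))%N = (2 + 2 * size l)%coq_nat by rewrite /=; lia.
have -> : DD (j :: l) k = dZ (k j) * DD l k by [].
rewrite pow_add; move: IH; set a := (1 + nrm1 k) ^ (2 * size l)%N; set b := DD l k => IH.
have -> : (1 + nrm1 k) ^ 2 * a * (dZ (k j) * b) = ((1 + nrm1 k) ^ 2 * dZ (k j)) * (a * b) by ring.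
have h : 1 <= (1 + nrm1 k) ^ 2 * dZ (k j).
  rewrite /dZ; have h1 := nrm1_term k j; have h2 := Rabs_pos (IZR (k j)).
  rewrite -(pow2_abs (IZR (k j))).
  apply: (Rmult_le_reg_r (1 + Rabs (IZR (k j)) ^ 2)); first nra.
  rewrite Rmult_assoc Rinv_l; last nra.
  nra.
nra.
Qed.

(** Makes exponential weights summable over Z^n: [om_pow] absorbs the polynomial that separates them
    from [DD]. *)
Lemma W_DD n del : 0 < del -> exists K, 0 < K /\
  forall k : 'I_n -> Z, exp (- del * W k) <= K * DD (enum 'I_n) k.
Proof.
move=> hd; have [K [hK H]] := @om_pow del (2 * size (enum 'I_n)) hd.
exists K; split=> // k.
have h1 := H _ (nrm1_ge0 k); have h2 := DD_nrm1 (enum 'I_n) k; have h3 := DD_pos (enum 'I_n) k.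
have h4 := exp_pos (del * om (nrm1 k)).
rewrite Ropp_mult_distr_l_reverse exp_Ropp.
apply: (Rmult_le_reg_l (exp (del * W k))); first exact: exp_pos.
rewrite Rinv_r; last by have := exp_pos (del * W k); lra.
rewrite /W; have h := Rmult_le_compat_r _ _ _ (Rlt_le _ _ h3) h1.
by apply: Rle_trans h2 (Rle_trans _ _ _ h _); apply: Req_le; ring.
Qed.

(** * Young conjugate *)

(** An infinite [Lub_Rbar] would be sent to a default value by [real]. It is finite because log t =
    o(omega(t)), with constant 1/(t+1), makes [om (exp s)] exceed s (t + 1) for large s. *)
Lemma phi_star_lub t : 0 <= t ->
  is_lub (fun r => exists s, 0 <= s /\ r = s * t - om (exp s)) (phi_star om t).
Proof.
move=> ht; set E := fun r => _.
have hb : bound E.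
  have [T hT] := @om_log (/ (t + 1)) ltac:(apply: Rinv_0_lt_compat; lra).
  exists (Rmax 0 (T * t)) => r [s [hs ->]].
  have ho : 0 <= om (exp s) by apply: om_ge0; apply: Rlt_le (exp_pos _).
  case: (Rle_dec T (exp s)) => h.
    apply: Rle_trans (Rmax_l _ _).
    have := hT _ h; rewrite ln_exp Rabs_right; last lra.
    move=> h1; have h2 : s * (t + 1) <= om (exp s).
      apply: Rle_trans (_ : / (t + 1) * om (exp s) * (t + 1) <= _).
        by apply: Rmult_le_compat_r => //; lra.
      by apply: Req_le; field; lra.
    lra.
  apply: Rle_trans (Rmax_r _ _).
  have : s <= T by have := exp_ineq1_le s; lra.
  nra.
have hne : exists x, E x by exists (0 * t - om (exp 0)); exists 0; split=> //; lra.
have [m hm] := completeness E hb hne.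
have -> : phi_star om t = m; last by [].
rewrite /phi_star (is_lub_Rbar_unique _ (Rbar.Finite m)) //.
case: hm => h1 h2; split.
  by move=> x hx; apply: h1.
move=> [b | | ] hbb //=.
  by apply: h2 => x hx; apply: (hbb x hx).
by case: hne => x hx; apply: (hbb x hx).
Qed.

Lemma phi_star_ge t s : 0 <= t -> 0 <= s -> s * t - om (exp s) <= phi_star om t.
Proof. by move=> ht hs; case: (phi_star_lub ht) => h _; apply: h; exists s. Qed.

Lemma phi_star_le t b : 0 <= t -> (forall s, 0 <= s -> s * t - om (exp s) <= b) -> phi_star om t <= b.
Proof.
by move=> ht H; case: (phi_star_lub ht) => _ h; apply: h => r [s [hs ->]]; apply: H.
Qed.

(** Young's inequality at s = ln r and t = p / lam, multiplied by lam and exponentiated. *)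
Lemma pow_le_young lam p r : 0 < lam -> 1 <= r ->
  r ^ p <= exp (lam * phi_star om (INR p / lam) + lam * om r).
Proof.
move=> hl hr; rewrite exp_ln_pow; last lra.
apply: exp_le.
have hln : 0 <= ln r by rewrite -ln_1; apply: ln_le; lra.
have ht : 0 <= INR p / lam.
  by apply: Rmult_le_pos; [apply: pos_INR | apply: Rlt_le; apply: Rinv_0_lt_compat].
have := phi_star_ge ht hln; rewrite exp_ln; last lra.
move=> h; have := Rmult_le_compat_l _ _ _ (Rlt_le _ _ hl) h.
have -> : lam * (ln r * (INR p / lam) - om r) = INR p * ln r - lam * om r by field; lra.
lra.
Qed.

(** The slope is the supremum of the left difference quotients of the convex function [om (exp x)]
    at [s]; monotonicity makes it nonnegative. *)
Lemma subgradient s : exists t, 0 <= t /\ forall x, om (exp s) + t * (x - s) <= om (exp x).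
Proof.
have three : forall y x, y < s -> s < x ->
    (om (exp s) - om (exp y)) / (s - y) <= (om (exp x) - om (exp s)) / (x - s).
  move=> y x hy hx; pose th := (x - s) / (x - y).
  have hth : 0 <= th <= 1.
    split; first by apply: Rlt_le; apply: Rdiv_lt_0_compat; lra.
    apply: (Rmult_le_reg_r (x - y)); first lra.
    by rewrite /th /Rdiv Rmult_assoc Rinv_l; lra.
  have := om_convex y x hth.
  have -> : th * y + (1 - th) * x = s by rewrite /th; field; lra.
  move: (om (exp s)) (om (exp y)) (om (exp x)) => a b c h.
  have h2 : (x - y) * a <= (x - s) * b + (s - y) * c.
    have := Rmult_le_compat_l (x - y) _ _ ltac:(lra) h.
    have -> : (x - y) * (th * b + (1 - th) * c) = (x - s) * b + (s - y) * c by rewrite /th; field; lra.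
    by [].
  apply: (Rmult_le_reg_r ((s - y) * (x - s))); first nra.
  have -> : (a - b) / (s - y) * ((s - y) * (x - s)) = (a - b) * (x - s) by field; lra.
  have -> : (c - a) / (x - s) * ((s - y) * (x - s)) = (c - a) * (s - y) by field; lra.
  lra.
pose E r := exists y, y < s /\ r = (om (exp s) - om (exp y)) / (s - y).
have hb : bound E.
  exists ((om (exp (s + 1)) - om (exp s)) / (s + 1 - s)) => r [y [hy ->]].
  by apply: three; lra.
have hne : exists r, E r by exists ((om (exp s) - om (exp (s - 1))) / (s - (s - 1))); exists (s - 1); split; [lra|].
have [t [h1 h2]] := completeness E hb hne.
have mon : forall y, y < s -> 0 <= (om (exp s) - om (exp y)) / (s - y).
  move=> y hy; apply: Rmult_le_pos; last by apply: Rlt_le; apply: Rinv_0_lt_compat; lra.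
  have := @om_mono (exp y) (exp s) (Rlt_le _ _ (exp_pos _)) ltac:(apply: exp_le; lra); lra.
exists t; split.
  apply: Rle_trans (mon (s - 1) ltac:(lra)) _; apply: h1; exists (s - 1); split=> //; lra.
move=> x; case: (Rtotal_order x s) => [h | [-> | h]].
- have h3 : (om (exp s) - om (exp x)) / (s - x) <= t by apply: h1; exists x.
  have := Rmult_le_compat_r (s - x) _ _ ltac:(lra) h3.
  have -> : (om (exp s) - om (exp x)) / (s - x) * (s - x) = om (exp s) - om (exp x) by field; lra.
  lra.
- lra.
- have h3 : t <= (om (exp x) - om (exp s)) / (x - s).
    by apply: h2 => r [y [hy ->]]; apply: three.
  have := Rmult_le_compat_r (x - s) _ _ ltac:(lra) h3.
  have -> : (om (exp x) - om (exp s)) / (x - s) * (x - s) = om (exp x) - om (exp s) by field; lra.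
  lra.
Qed.

(** The equality case of Young's inequality occurs at the subgradient t. The order p must be an
    integer, and rounding lam t down costs at most one factor r. *)
Lemma young_attained lam r : 0 < lam -> 1 <= r ->
  exists p, exp (lam * phi_star om (INR p / lam)) <= r ^ p * (r * exp (- lam * om r)).
Proof.
move=> hl hr; set s := ln r.
have hs : 0 <= s by rewrite /s -ln_1; apply: ln_le; lra.
have er : exp s = r by rewrite exp_ln; lra.
have [t [ht H]] := subgradient s.
have hlt : 0 <= lam * t by apply: Rmult_le_pos; lra.
have [p [hp1 hp2]] := nfloor_ex (lam * t) hlt.
exists p; rewrite exp_ln_pow -/s; last lra.
rewrite -{1}er -!exp_plus; apply: exp_le.
have htp : 0 <= INR p / lam.
  by apply: Rmult_le_pos; [apply: pos_INR | apply: Rlt_le; apply: Rinv_0_lt_compat].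
have hle : INR p / lam <= t.
  by apply: (Rmult_le_reg_r lam) => //; rewrite /Rdiv Rmult_assoc Rinv_l; lra.
have key : phi_star om (INR p / lam) <= t * s - om r.
  apply: phi_star_le => // x hx; have := H x; rewrite er.
  have : x * (INR p / lam) <= x * t by apply: Rmult_le_compat_l.
  lra.
have := Rmult_le_compat_l _ _ _ (Rlt_le _ _ hl) key.
have : lam * t * s <= (INR p + 1) * s by apply: Rmult_le_compat_r => //; lra.
lra.
Qed.

End Weight.

(** * Continuity of complex-valued functions *)

Section Near.
Variables (T : Type) (near : R -> T -> Prop).
Hypothesis near_le : forall d d' y, d <= d' -> near d y -> near d' y.

(** [near] abstracts the neighbourhoods, so that sums and products are treated once for functions on
    R and on R^n. *)
Definition clim (f : T -> C) (l : C) : Prop :=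
  forall eps, 0 < eps -> exists delta, 0 < delta /\ forall y, near delta y -> Cmod (f y - l)%C < eps.

Lemma clim_plus f g a b : clim f a -> clim g b -> clim (fun y => f y + g y)%C (a + b)%C.
Proof.
move=> hf hg eps he.
have [d1 [h1 H1]] := hf (eps / 2) ltac:(lra); have [d2 [h2 H2]] := hg (eps / 2) ltac:(lra).
exists (Rmin d1 d2); split; first exact: Rmin_pos.
move=> y hy; have := H1 y (near_le (Rmin_l _ _) hy); have := H2 y (near_le (Rmin_r _ _) hy).
have -> : (f y + g y - (a + b) = (f y - a) + (g y - b))%C by ring.
have := Cmod_triangle (f y - a) (g y - b); lra.
Qed.

Lemma clim_mult f g a b : clim f a -> clim g b -> clim (fun y => f y * g y)%C (a * b)%C.
Proof.
move=> hf hg eps he.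
have ha := Cmod_ge_0 a; have hb := Cmod_ge_0 b.
set m := Cmod a + Cmod b + 1.
set e := Rmin 1 (eps / (2 * m)).
have hm : 0 < eps / (2 * m) by apply: Rdiv_lt_0_compat; rewrite /m; lra.
have he1 : 0 < e by apply: Rmin_pos; lra.
have he2 : e <= 1 by apply: Rmin_l.
have he3 : e * m <= eps / 2.
  apply: Rle_trans (_ : eps / (2 * m) * m <= _).
    by apply: Rmult_le_compat_r; [rewrite /m; lra | apply: Rmin_r].
  by apply: Req_le; field; rewrite /m; lra.
have [d1 [h1 H1]] := hf e he1; have [d2 [h2 H2]] := hg e he1.
exists (Rmin d1 d2); split; first exact: Rmin_pos.
move=> y hy; have k1 := H1 y (near_le (Rmin_l _ _) hy); have k2 := H2 y (near_le (Rmin_r _ _) hy).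
have -> : (f y * g y - a * b = (f y - a) * (g y - b) + ((f y - a) * b + a * (g y - b)))%C by ring.
have t1 := Cmod_triangle ((f y - a) * (g y - b)) ((f y - a) * b + a * (g y - b)).
have t2 := Cmod_triangle ((f y - a) * b) (a * (g y - b)).
rewrite !Cmod_mult in t1 t2.
have p1 := Cmod_ge_0 (f y - a)%C; have p2 := Cmod_ge_0 (g y - b)%C.
rewrite /m in he3; nra.
Qed.

Lemma clim_const c : clim (fun _ => c) c.
Proof.
move=> eps he; exists 1; split; first lra.
move=> y _; have -> : (c - c = RtoC 0)%C by ring. by rewrite Cmod_0.
Qed.

End Near.

Definition near1 (t : R) (d : R) (s : R) : Prop := Rabs (s - t) < d.
Definition nearn n (x : pt n) (d : R) (y : pt n) : Prop := forall j, Rabs (y j - x j) < d.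

Definition ccont (g : R -> C) : Prop := forall t, clim (near1 t) g (g t).

Lemma near1_le t d d' y : d <= d' -> near1 t d y -> near1 t d' y.
Proof. by rewrite /near1; lra. Qed.

Lemma nearn_le n (x : pt n) d d' y : d <= d' -> nearn x d y -> nearn x d' y.
Proof. by move=> h H j; have := H j; lra. Qed.

Lemma contC_plus n (f g : Fn n) : contC f -> contC g -> contC (fun x => f x + g x)%C.
Proof. by move=> hf hg x; apply: (clim_plus (@nearn_le n x)); [apply: hf | apply: hg]. Qed.

Lemma contC_mult n (f g : Fn n) : contC f -> contC g -> contC (fun x => f x * g x)%C.
Proof. by move=> hf hg x; apply: (clim_mult (@nearn_le n x)); [apply: hf | apply: hg]. Qed.

Lemma contC_const n (c : C) : contC (fun _ : pt n => c).
Proof. by move=> x; apply: clim_const. Qed.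

Lemma ccont_plus (f g : R -> C) : ccont f -> ccont g -> ccont (fun x => f x + g x)%C.
Proof. by move=> hf hg x; apply: (clim_plus (@near1_le x)); [apply: hf | apply: hg]. Qed.

Lemma ccont_mult (f g : R -> C) : ccont f -> ccont g -> ccont (fun x => f x * g x)%C.
Proof. by move=> hf hg x; apply: (clim_mult (@near1_le x)); [apply: hf | apply: hg]. Qed.

Lemma ccont_const (c : C) : ccont (fun _ => c).
Proof. by move=> x; apply: clim_const. Qed.

Lemma ccont_ext f g : (forall t, f t = g t) -> ccont f -> ccont g.
Proof. by move=> e; rewrite (_ : f = g) //; apply: functional_extensionality. Qed.

Lemma contC_ext n (f g : Fn n) : (forall t, f t = g t) -> contC f -> contC g.
Proof. by move=> e; rewrite (_ : f = g) //; apply: functional_extensionality. Qed.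

Lemma im_le_Cmod (c : C) : Rabs (snd c) <= Cmod c.
Proof. by apply: Rle_trans (Rmax_Cmod c); apply: Rmax_r. Qed.

Lemma Cmod_le_sum (c : C) : Cmod c <= Rabs (fst c) + Rabs (snd c).
Proof.
rewrite -[Rabs (fst c) + Rabs (snd c)](Rabs_right); last first.
  by have := Rabs_pos (fst c); have := Rabs_pos (snd c); lra.
rewrite -sqrt_Rsqr_abs; apply: sqrt_le_1_alt; rewrite /Rsqr.
rewrite -(pow2_abs (fst c)) -(pow2_abs (snd c)).
by have := Rabs_pos (fst c); have := Rabs_pos (snd c); nra.
Qed.

Lemma continuous_eps (f : R -> R) t :
  (forall eps, 0 < eps -> exists d, 0 < d /\ forall s, Rabs (s - t) < d -> Rabs (f s - f t) < eps) <->
  continuous f t.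
Proof.
split=> H.
  apply/filterlim_locally => eps; have [d [hd h]] := H eps (cond_pos eps).
  by exists (mkposreal _ hd) => s hs; apply: h.
move=> eps he; move/filterlim_locally: H => /(_ (mkposreal _ he)) [d h].
by exists d; split; [apply: cond_pos | move=> s hs; apply: h].
Qed.

Lemma ccont_comp g : ccont g <->
  (forall t, continuous (fun s => fst (g s)) t) /\ (forall t, continuous (fun s => snd (g s)) t).
Proof.
split=> [H | [H1 H2]].
  split=> t; apply/continuous_eps => eps he; have [d [hd h]] := H t eps he; exists d; split=> // s hs.
    by apply: Rle_lt_trans (re_le_Cmod (g s - g t)%C) (h s hs).
  by apply: Rle_lt_trans (im_le_Cmod (g s - g t)%C) (h s hs).
move=> t eps he; have he2 : 0 < eps / 2 by lra.
have [d1 [hd1 h1]] := proj2 (continuous_eps _ _) (H1 t) _ he2.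
have [d2 [hd2 h2]] := proj2 (continuous_eps _ _) (H2 t) _ he2.
exists (Rmin d1 d2); split; first exact: Rmin_pos.
move=> s hs; have a1 := h1 s (near1_le (Rmin_l _ _) hs); have a2 := h2 s (near1_le (Rmin_r _ _) hs).
apply: Rle_lt_trans (Cmod_le_sum _) _; rewrite /=; rewrite /Rminus in a1 a2; lra.
Qed.

Lemma ccont_of_real (f : R -> R) : (forall t, continuous f t) -> ccont (fun t => RtoC (f t)).
Proof. by move=> h; apply/ccont_comp; split=> // t; apply: continuous_const. Qed.

(** * Characters of the torus *)

Definition cis (t : R) : C := (cos t, sin t).

Lemma cis_add a b : cis (a + b) = (cis a * cis b)%C.
Proof. by rewrite /cis /Cmult /= cos_plus sin_plus; congr pair; ring. Qed.

Lemma cis_0 : cis 0 = RtoC 1.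
Proof. by rewrite /cis cos_0 sin_0. Qed.

Lemma Cmod_cis t : Cmod (cis t) = 1.
Proof.
rewrite /Cmod /= !Rmult_1_r; have := sin2_cos2 t; rewrite /Rsqr => h.
by rewrite Rplus_comm h sqrt_1.
Qed.

Lemma cis_neg t : (cis t * cis (- t))%C = RtoC 1.
Proof. by rewrite -cis_add Rplus_opp_r cis_0. Qed.

Lemma Rabs_sin_le x : Rabs (sin x) <= Rabs x.
Proof.
have hp : forall y, 0 <= y -> sin y <= y.
  move=> y [hy | <-]; last by rewrite sin_0; lra.
  by have := sin_lt_x y hy; lra.
have hq : forall y, 0 <= y -> Rabs (sin y) <= y.
  move=> y hy; apply: Rabs_le; split; last exact: hp.
  case: (Rle_dec y 1) => h1; last by have := SIN_bound y; lra.
  have := sin_ge_0 y hy ltac:(have := PI2_1; lra); lra.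
case: (Rle_dec 0 x) => h; first by rewrite (Rabs_right x); [exact: hq | lra].
have := hq (- x) ltac:(lra); rewrite sin_neg Rabs_Ropp (Rabs_left1 x); lra.
Qed.

Lemma cos_ge_quad x : 1 - x ^ 2 / 2 <= cos x.
Proof.
have -> : x = 2 * (x / 2) by field.
rewrite cos_2a_sin; have := Rabs_sin_le (x / 2).
have := Rabs_pos (sin (x / 2)); have e1 := pow2_abs (sin (x / 2)); have e2 := pow2_abs (x / 2).
nra.
Qed.

Lemma Cmod_le_sq (c : C) m : 0 <= m -> fst c ^ 2 + snd c ^ 2 <= m ^ 2 -> Cmod c <= m.
Proof.
move=> hm h; rewrite /Cmod -(sqrt_pow2 m hm); exact: sqrt_le_1_alt.
Qed.

Lemma cis_lip a : Cmod (cis a - RtoC 1)%C <= Rabs a.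
Proof.
apply: Cmod_le_sq; first exact: Rabs_pos.
rewrite pow2_abs /=; have := cos_ge_quad a; have := sin2_cos2 a; rewrite /Rsqr; nra.
Qed.

Lemma Rabs_sin_sub a : Rabs (sin a - a) <= Rabs a ^ 3.
Proof.
have [c [hc e]] : exists c, Rmin 0 a <= c <= Rmax 0 a /\
    (sin a - a) - (sin 0 - 0) = (cos c - 1) * (a - 0).
  apply: (MVT_gen (fun x => sin x - x)) => x _; first by auto_derive => //; ring.
  by apply: derivable_continuous_pt; reg.
have hca : Rabs c <= Rabs a.
  by move: hc; rewrite /Rmin /Rmax; case: Rle_dec => h [h1 h2];
    [rewrite !Rabs_right | rewrite !Rabs_left1]; lra.
rewrite sin_0 in e.
have -> : sin a - a = (cos c - 1) * a by lra.
rewrite Rabs_mult Rabs_left1; last by have := COS_bound c; lra.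
have := cos_ge_quad c; have e2 := pow2_abs c; have := Rabs_pos a; have := Rabs_pos c => p1 p2 h.
apply: Rle_trans (_ : Rabs a ^ 2 * Rabs a <= _); last by simpl; lra.
apply: Rmult_le_compat_r => //; nra.
Qed.

Lemma cis_taylor a : Cmod (cis a - RtoC 1 - (0, a))%C <= a ^ 2 + Rabs a ^ 3.
Proof.
apply: Rle_trans (Cmod_le_sum _) _; rewrite /cis /RtoC /Cminus /Cplus /Copp /fst /snd.
have h1 := cos_ge_quad a; have h2 := COS_bound a.
rewrite (_ : cos a + - (1) + - 0 = - (1 - cos a)); last ring.
rewrite Rabs_Ropp Rabs_right; last lra.
rewrite (_ : sin a + - 0 + - a = sin a - a); last ring.
have := Rabs_sin_sub a; nra.
Qed.

Definition dot n (k : 'I_n -> Z) (x : pt n) : R := sumR (fun j => IZR (k j) * x j).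
Definition ek n (k : 'I_n -> Z) : Fn n := fun x => cis (dot k x).

Lemma foldr_delta n (l : seq 'I_n) j c : uniq l ->
  foldr (fun i acc => (if i == j then c else 0) + acc) 0 l = if j \in l then c else 0.
Proof.
elim: l => [|i l IH] //= /andP [hi hu]; rewrite IH // inE eq_sym.
by case: eqP => [-> | _] /=; rewrite ?(negbTE hi); ring.
Qed.

Lemma sumR_upd n (F G : 'I_n -> R) j : (forall i, i != j -> F i = G i) ->
  sumR F = sumR G + (F j - G j).
Proof.
move=> H; rewrite (_ : F j - G j = sumR (fun i => if i == j then F j - G j else 0)).
  rewrite -sumR_plus; apply: sumR_ext => i.
  by case: (eqVneq i j) => [-> | /H ->]; ring.
by rewrite /sumR foldr_delta ?enum_uniq // mem_enum.
Qed.

Lemma upd_same n (x : pt n) j s : upd x j s j = s.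
Proof. by rewrite /upd eqxx. Qed.

Lemma upd_other n (x : pt n) j s i : i != j -> upd x j s i = x i.
Proof. by rewrite /upd => /negbTE ->. Qed.

Lemma upd_id n (x : pt n) j : upd x j (x j) = x.
Proof. by apply: functional_extensionality => i; rewrite /upd; case: eqP => [->|]. Qed.

Lemma upd_upd n (x : pt n) j s t : upd (upd x j s) j t = upd x j t.
Proof. by apply: functional_extensionality => i; rewrite /upd; case: eqP. Qed.

Lemma upd_comm n (x : pt n) j i s t : i != j -> upd (upd x j s) i t = upd (upd x i t) j s.
Proof.
move=> h; apply: functional_extensionality => m; rewrite /upd.
by case: (eqVneq m i) => [->|//]; rewrite (negbTE h).
Qed.

Lemma dot_upd n (k : 'I_n -> Z) x j s : dot k (upd x j s) = dot k x + IZR (k j) * (s - x j).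
Proof.
rewrite /dot (sumR_upd (G := fun i => IZR (k i) * x i) (j := j)); last by move=> i hi; rewrite upd_other.
by rewrite upd_same; ring.
Qed.

Lemma dot_add n (k l : 'I_n -> Z) x : dot (addz k l) x = dot k x + dot l x.
Proof. by rewrite /dot -sumR_plus; apply: sumR_ext => j; rewrite /addz plus_IZR; ring. Qed.

Lemma dot_zero n x : dot (@zeroz n) x = 0.
Proof.
by rewrite -(Rmult_0_l (sumR x)) -sumR_scal; apply: sumR_ext => j; rewrite /zeroz; ring.
Qed.

Lemma ek_add n (k l : 'I_n -> Z) x : ek (addz k l) x = (ek k x * ek l x)%C.
Proof. by rewrite /ek dot_add cis_add. Qed.

Lemma ek_zero n x : ek (@zeroz n) x = RtoC 1.
Proof. by rewrite /ek dot_zero cis_0. Qed.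

Lemma Cmod_ek n (k : 'I_n -> Z) x : Cmod (ek k x) = 1.
Proof. exact: Cmod_cis. Qed.

Lemma ek_upd n (k : 'I_n -> Z) x j s :
  ek k (upd x j s) = (cis (IZR (k j) * (s - x j)) * ek k x)%C.
Proof. by rewrite /ek dot_upd Rplus_comm cis_add. Qed.

Lemma dot_near n (k : 'I_n -> Z) (x y : pt n) d : 0 <= d -> nearn x d y ->
  Rabs (dot k y - dot k x) <= nrm1 k * d.
Proof.
move=> hd h.
have -> : dot k y - dot k x = sumR (fun j => IZR (k j) * (y j - x j)).
  rewrite /dot -(Rplus_0_r (sumR _ - _)).
  have -> : sumR (fun j => IZR (k j) * (y j - x j)) =
     sumR (fun j => IZR (k j) * y j) + sumR (fun j => -1 * (IZR (k j) * x j)).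
    by rewrite -sumR_plus; apply: sumR_ext => j; ring.
  rewrite sumR_scal; ring.
rewrite Rmult_comm /nrm1 -sumR_scal /sumR.
elim: (enum 'I_n) => [|j l IH] /=; first by rewrite Rabs_R0; lra.
apply: Rle_trans (Rabs_triang _ _) _; apply: Rplus_le_compat => //.
rewrite Rabs_mult Rmult_comm; apply: Rmult_le_compat_r; first exact: Rabs_pos.
exact: Rlt_le (h j).
Qed.

Lemma ek_contC n (k : 'I_n -> Z) : contC (ek k).
Proof.
move=> x eps he; have hk := nrm1_ge0 k.
exists (eps / (nrm1 k + 1)); split; first by apply: Rdiv_lt_0_compat; lra.
move=> y hy.
have := @dot_near n k x y (eps / (nrm1 k + 1)) ltac:(apply: Rlt_le; apply: Rdiv_lt_0_compat; lra) hy => h.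
have -> : (ek k y - ek k x = ek k x * (cis (dot k y - dot k x) - RtoC 1))%C.
  rewrite /ek; have -> : dot k y = dot k x + (dot k y - dot k x) by ring.
  rewrite cis_add; have -> : dot k x + (dot k y - dot k x) - dot k x = dot k y - dot k x by ring.
  ring.
rewrite Cmod_mult Cmod_ek Rmult_1_l.
apply: Rle_lt_trans (cis_lip _) _; apply: Rle_lt_trans h _.
apply: (Rmult_lt_reg_r (nrm1 k + 1)); first lra.
have -> : nrm1 k * (eps / (nrm1 k + 1)) * (nrm1 k + 1) = eps * nrm1 k by field; lra.
nra.
Qed.

Lemma cos_2piZ (k : Z) : cos (IZR k * (2 * PI)) = 1.
Proof.
have hn : forall n : nat, cos (INR n * (2 * PI)) = 1.
  move=> n; have := cos_period 0 n; rewrite cos_0 => <-; congr cos; ring.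
have [m [e | e]] : exists m, k = Z.of_nat m \/ k = (- Z.of_nat m)%Z by exists (Z.abs_nat k); lia.
  by rewrite e -INR_IZR_INZ hn.
by rewrite e opp_IZR Ropp_mult_distr_l_reverse cos_neg -INR_IZR_INZ hn.
Qed.

Lemma sin_2piZ (k : Z) : sin (IZR k * (2 * PI)) = 0.
Proof.
have := sin2_cos2 (IZR k * (2 * PI)); rewrite cos_2piZ /Rsqr => h; nra.
Qed.

Lemma cis_2piZ (k : Z) : cis (IZR k * (2 * PI)) = RtoC 1.
Proof. by rewrite /cis cos_2piZ sin_2piZ. Qed.

Lemma ek_periodic n (k : 'I_n -> Z) : periodic (ek k).
Proof.
move=> x j; rewrite ek_upd; have -> : x j + 2 * PI - x j = 2 * PI by ring.
by rewrite cis_2piZ; ring.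
Qed.

(** * Integrals *)

(** Componentwise, so that the real theory applies directly; [CRInt_eq] identifies it with the
    integral used in [int_coords] for continuous integrands. *)
Definition Cint (g : R -> C) (a b : R) : C :=
  (RInt (fun s => fst (g s)) a b, RInt (fun s => snd (g s)) a b).

Lemma ex_RInt_cont (f : R -> R) a b : (forall t, continuous f t) -> ex_RInt f a b.
Proof. by move=> h; apply: (ex_RInt_continuous (V := R_CompleteNormedModule)) => z _; apply: h. Qed.

Lemma is_Cint (g : R -> C) (a b : R) : ccont g -> is_RInt (V := C_R_NormedModule) g a b (Cint g a b).
Proof.
move=> /ccont_comp [h1 h2].
by apply: is_RInt_fct_extend_pair; apply: RInt_correct; apply: ex_RInt_cont.
Qed.

Lemma CRInt_eq (g : R -> C) a b : ccont g -> RInt (V := C_R_CompleteNormedModule) g a b = Cint g a b.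
Proof. by move=> h; apply: is_RInt_unique; apply: is_Cint. Qed.

Lemma Cint_bound (g : R -> C) a b M : ccont g -> a <= b ->
  (forall s, a <= s <= b -> Cmod (g s) <= M) -> Cmod (Cint g a b) <= (b - a) * M.
Proof.
move=> h hab H; rewrite Cmod_norm.
apply: (@norm_RInt_le_const C_R_NormedModule g a b _ M hab _ (@is_Cint g a b h)) => x hx.
by have := H x hx; rewrite Cmod_norm.
Qed.

Lemma Cint_le (g : R -> C) (m : R -> R) a b : ccont g -> (forall t, continuous m t) -> a <= b ->
  (forall s, a <= s <= b -> Cmod (g s) <= m s) -> Cmod (Cint g a b) <= RInt m a b.
Proof.
move=> h hm hab H.
rewrite Cmod_norm; apply: (@norm_RInt_le C_R_NormedModule g m a b _ _ hab _ (@is_Cint g a b h)).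
  by move=> x hx; have := H x hx; rewrite Cmod_norm.
by apply: RInt_correct; apply: ex_RInt_cont.
Qed.

Lemma RInt_extR (f g : R -> R) a b : (forall s, f s = g s) -> RInt f a b = RInt g a b.
Proof. by move=> h; apply: RInt_ext => s _; apply: h. Qed.

Lemma continuous_lin (f g : R -> R) a b t : continuous f t -> continuous g t ->
  continuous (fun s => a * f s + b * g s) t.
Proof.
move=> hf hg; apply: (continuous_plus (fun s => a * f s) (fun s => b * g s)).
  exact: (continuous_scal_r a f t hf).
exact: (continuous_scal_r b g t hg).
Qed.

Lemma RInt_lin (f g : R -> R) a b c d :
  (forall t, continuous f t) -> (forall t, continuous g t) ->
  RInt (fun s => c * f s + d * g s) a b = c * RInt f a b + d * RInt g a b.
Proof.
move=> hf hg; apply: is_RInt_unique.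
apply: (is_RInt_plus (V := R_NormedModule) (fun s => c * f s) (fun s => d * g s)).
  by apply: (is_RInt_scal (V := R_NormedModule) f a b c); apply: RInt_correct; apply: ex_RInt_cont.
by apply: (is_RInt_scal (V := R_NormedModule) g a b d); apply: RInt_correct; apply: ex_RInt_cont.
Qed.

Lemma Cint_lin (f g : R -> C) a b c : ccont f -> ccont g ->
  Cint (fun s => c * f s + g s)%C a b = (c * Cint f a b + Cint g a b)%C.
Proof.
move=> /ccont_comp [f1 f2] /ccont_comp [g1 g2]; rewrite /Cint /Cplus /Cmult /=; congr pair.
  have -> : RInt (fun s => fst c * fst (f s) - snd c * snd (f s) + fst (g s)) a b =
      RInt (fun s => 1 * (fst c * fst (f s) + (- snd c) * snd (f s)) + 1 * fst (g s)) a b.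
    by apply: RInt_extR => s; ring.
  rewrite RInt_lin //; last by move=> t; apply: continuous_lin.
  by rewrite RInt_lin //; ring.
have -> : RInt (fun s => fst c * snd (f s) + snd c * fst (f s) + snd (g s)) a b =
    RInt (fun s => 1 * (fst c * snd (f s) + snd c * fst (f s)) + 1 * snd (g s)) a b.
  by apply: RInt_extR => s; ring.
rewrite RInt_lin //; last by move=> t; apply: continuous_lin.
by rewrite RInt_lin //; ring.
Qed.

Lemma Cint_ext f g a b : (forall s, Rmin a b < s < Rmax a b -> f s = g s) -> Cint f a b = Cint g a b.
Proof. by move=> h; rewrite /Cint; congr pair; apply: RInt_ext => s hs; rewrite h. Qed.

Lemma Cint_zero a b : Cint (fun _ => RtoC 0) a b = RtoC 0.
Proof. by rewrite /Cint /= !RInt_const /RtoC; congr pair; rewrite /scal /= /mult /=; ring. Qed.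

Lemma Cint_scal (f : R -> C) a b c : ccont f -> Cint (fun s => c * f s)%C a b = (c * Cint f a b)%C.
Proof.
move=> hf; have := @Cint_lin f (fun _ => RtoC 0) a b c hf (ccont_const _).
rewrite Cint_zero => e; rewrite (_ : (fun s => c * f s)%C = (fun s => c * f s + RtoC 0)%C).
  by rewrite e; ring.
by apply: functional_extensionality => s; ring.
Qed.

Lemma Cint_plus (f g : R -> C) a b : ccont f -> ccont g ->
  Cint (fun s => f s + g s)%C a b = (Cint f a b + Cint g a b)%C.
Proof.
move=> hf hg; have := @Cint_lin f g a b (RtoC 1) hf hg.
rewrite (_ : (fun s => RtoC 1 * f s + g s)%C = (fun s => f s + g s)%C).
  by move=> ->; ring.
by apply: functional_extensionality => s; ring.
Qed.

Lemma RInt_shift (f : R -> R) a b h : (forall t, continuous f t) ->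
  RInt (fun s => f (s + h)) a b = RInt f (a + h) (b + h).
Proof.
move=> hf; have := @RInt_comp_lin R_CompleteNormedModule f 1 h a b (ex_RInt_cont _ _ hf).
rewrite !Rmult_1_l => <-; apply: RInt_ext => s _.
by rewrite /scal /= /mult /= !Rmult_1_l.
Qed.

Lemma RInt_periodic (f : R -> R) P a : (forall t, continuous f t) -> (forall t, f (t + P) = f t) ->
  RInt f a (a + P) = RInt f 0 P.
Proof.
move=> hf hp.
have ex : forall u v, ex_RInt f u v by move=> u v; apply: ex_RInt_cont.
have h1 := RInt_Chasles f a 0 (a + P) (ex _ _) (ex _ _).
have h2 := RInt_Chasles f 0 P (a + P) (ex _ _) (ex _ _).
have h3 : RInt f P (a + P) = RInt f 0 a.
  rewrite -{1}(Rplus_0_l P) -RInt_shift //; apply: RInt_ext => s _; exact: hp.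
have h4 := opp_RInt_swap f a 0 (ex a 0).
rewrite /plus /= /opp /= in h1 h2 h4 *; lra.
Qed.

Lemma Cint_shift (f : R -> C) a b h : ccont f ->
  Cint (fun s => f (s + h)) a b = Cint f (a + h) (b + h).
Proof. by move=> /ccont_comp [h1 h2]; rewrite /Cint; congr pair; apply: RInt_shift. Qed.

Lemma Cint_periodic (f : R -> C) P a : ccont f -> (forall t, f (t + P) = f t) ->
  Cint f a (a + P) = Cint f 0 P.
Proof.
move=> /ccont_comp [h1 h2] hp; rewrite /Cint; congr pair; apply: RInt_periodic => // t; by rewrite hp.
Qed.

Lemma pi2_pos : 0 < 2 * PI. Proof. by have := PI_RGT_0; lra. Qed.

(** * Iterated integrals over coordinates *)

Lemma nearn_upd n (x y : pt n) j s t d : nearn x d y -> Rabs (s - t) < d -> nearn (upd x j t) d (upd y j s).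
Proof. by move=> h1 h2 i; rewrite /upd; case: eqP => _ //; apply: h1. Qed.

Lemma nearn_refl n (x : pt n) d : 0 < d -> nearn x d x.
Proof. by move=> h j; rewrite Rminus_diag Rabs_R0. Qed.

Lemma contC_upd n (f : Fn n) x j : contC f -> ccont (fun s => f (upd x j s)).
Proof.
move=> hf t eps he; have [d [hd h]] := hf (upd x j t) eps he.
by exists d; split=> // s hs; apply: h; apply: nearn_upd => //; apply: nearn_refl.
Qed.

(** Compactness of [a, b] gives, from the pointwise moduli [dl], one radius that is valid for all
    values of the integration variable. *)
Lemma contC_Cint n (f : Fn n) j a b : a <= b -> contC f -> contC (fun x => Cint (fun s => f (upd x j s)) a b).
Proof.
move=> hab hf x eps he.
set e := eps / (4 * (b - a + 1)).
have he1 : 0 < e by apply: Rdiv_lt_0_compat; lra.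
have hch : forall t, exists d : posreal, forall y, nearn (upd x j t) (2 * d) y -> Cmod (f y - f (upd x j t))%C < e.
  move=> t; have [d [hd h]] := hf (upd x j t) e he1.
  have hd2 : 0 < d / 2 by lra.
  exists (mkposreal _ hd2) => y hy; apply: h => i; have := hy i => /=; lra.
pose dl t := proj1_sig (constructive_indefinite_description _ (hch t)).
have hdl : forall t y, nearn (upd x j t) (2 * dl t) y -> Cmod (f y - f (upd x j t))%C < e.
  by move=> t; apply: (proj2_sig (constructive_indefinite_description _ (hch t))).
have [d hd] := compactness_value_1d a b dl.
exists d; split; first exact: cond_pos.
move=> y hy.
have hc : forall z, ccont (fun s => f (upd z j s)) by move=> z; apply: contC_upd.
have -> : (Cint (fun s => f (upd y j s)) a b - Cint (fun s => f (upd x j s)) a b =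
           Cint (fun s => RtoC (-1) * f (upd x j s) + f (upd y j s)) a b)%C.
  by rewrite Cint_lin //; ring.
apply: Rle_lt_trans (Cint_bound (M := 2 * e) _ hab _) _.
- apply: ccont_plus => //; apply: ccont_mult => //; exact: ccont_const.
- move=> s hs; apply: Rnot_lt_le => hlt; apply: (hd s hs) => -[t [ht [h1 h2]]].
  have hp := cond_pos d.
  have k1 : Cmod (f (upd y j s) - f (upd x j t))%C < e.
    by apply: hdl; apply: nearn_upd; [move=> i; have := hy i; lra | lra].
  have k2 : Cmod (f (upd x j s) - f (upd x j t))%C < e.
    by apply: hdl; apply: nearn_upd; [apply: nearn_refl; lra | lra].
  have := Cmod_triangle3 (f (upd y j s)) (f (upd x j t)) (f (upd x j s)).
  rewrite (Cmod_minus_sym (f (upd x j t)) (f (upd x j s))).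
  have e1 : (RtoC (-1) * f (upd x j s) + f (upd y j s) = f (upd y j s) - f (upd x j s))%C by ring.
  rewrite e1 in hlt; lra.
- have : (b - a) * (2 * e) < eps; last by [].
  rewrite /e; apply: (Rmult_lt_reg_r (4 * (b - a + 1))); first lra.
  have -> : (b - a) * (2 * (eps / (4 * (b - a + 1)))) * (4 * (b - a + 1)) = 2 * eps * (b - a) by field; lra.
  nra.
Qed.

Lemma ic_contC n (l : seq 'I_n) (f : Fn n) : contC f -> contC (int_coords l f).
Proof.
move=> hf; elim: l => [|j l IH] //=.
apply: contC_ext (contC_Cint j (Rlt_le _ _ pi2_pos) IH) => x /=.
by rewrite -CRInt_eq //; apply: contC_upd.
Qed.

Lemma ic_cons n (l : seq 'I_n) j (f : Fn n) x : contC f ->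
  int_coords (j :: l) f x = Cint (fun s => int_coords l f (upd x j s)) 0 (2 * PI).
Proof. by move=> hf /=; rewrite CRInt_eq //; apply: contC_upd; apply: ic_contC. Qed.

Lemma ic_lin n (l : seq 'I_n) (f g : Fn n) c x : contC f -> contC g ->
  int_coords l (fun y => c * f y + g y)%C x = (c * int_coords l f x + int_coords l g x)%C.
Proof.
move=> hf hg; have hc : contC (fun y => c * f y + g y)%C.
  by apply: contC_plus => //; apply: contC_mult => //; apply: contC_const.
elim: l x => [|j l IH] x //; rewrite !ic_cons //.
rewrite -Cint_lin; [| apply: contC_upd; exact: ic_contC | apply: contC_upd; exact: ic_contC].
by apply: Cint_ext => s _; apply: IH.
Qed.

Lemma ic_bound n (l : seq 'I_n) (f : Fn n) M x : contC f -> (forall x, Cmod (f x) <= M) ->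
  Cmod (int_coords l f x) <= (2 * PI) ^ size l * M.
Proof.
move=> hf hM; elim: l x => [|j l IH] x; first by rewrite /= Rmult_1_l.
rewrite ic_cons //.
apply: Rle_trans (Cint_bound (M := (2 * PI) ^ size l * M) _ (Rlt_le _ _ pi2_pos) _) _ => //.
  by apply: contC_upd; apply: ic_contC.
by rewrite /=; lra.
Qed.

Definition transl n (j : 'I_n) h (f : Fn n) : Fn n := fun x => f (upd x j (x j + h)).

Lemma ic_transl_out n (l : seq 'I_n) j h (f : Fn n) x : j \notin l ->
  int_coords l (transl j h f) x = int_coords l f (upd x j (x j + h)).
Proof.
elim: l x => [|i l IH] x //=; rewrite inE negb_or => /andP [hij hj].
apply: (@RInt_ext C_R_CompleteNormedModule) => s _; rewrite IH // upd_other // upd_comm //.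
Qed.

Lemma contC_transl n (j : 'I_n) h (f : Fn n) : contC f -> contC (transl j h f).
Proof.
move=> hf x eps he; have [d [hd H]] := hf (upd x j (x j + h)) eps he.
exists d; split=> // y hy; apply: H; apply: nearn_upd => //.
by have -> : y j + h - (x j + h) = y j - x j by ring.
Qed.

Lemma periodic_transl n (j : 'I_n) (f : Fn n) : periodic f -> transl j (2 * PI) f = f.
Proof. by move=> hp; apply: functional_extensionality => x; apply: hp. Qed.

Lemma ic_periodic n (l : seq 'I_n) j (f : Fn n) x s : periodic f -> j \notin l ->
  int_coords l f (upd x j (s + 2 * PI)) = int_coords l f (upd x j s).
Proof.
move=> hp hj; rewrite -{2}(periodic_transl j hp) ic_transl_out // upd_same upd_upd //.
Qed.

(** Only the integral in the translated variable feels the shift, and there a periodic integrand is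
    shifted over a full period. Orthogonality of characters and the coefficients of derivatives are
    deduced from this invariance, without exchanging the order of integration. *)
Lemma ic_transl_in n (l : seq 'I_n) j h (f : Fn n) x : contC f -> periodic f -> uniq l -> j \in l ->
  int_coords l (transl j h f) x = int_coords l f x.
Proof.
move=> hf hp; elim: l x => [|i l IH] x //=; rewrite inE => /andP [hi hu].
case: (eqVneq j i) => [-> | hne] /= hj; last by apply: (@RInt_ext C_R_CompleteNormedModule) => s _; apply: IH.
have hc : ccont (fun s => int_coords l f (upd x i s)) by apply: contC_upd; apply: ic_contC.
rewrite (CRInt_eq _ _ hc) -(Cint_periodic h hc); last by move=> t; apply: ic_periodic.
rewrite CRInt_eq; last by apply: contC_upd; apply: ic_contC; apply: contC_transl.
rewrite Rplus_comm -{2}(Rplus_0_l h) -Cint_shift //; apply: Cint_ext => s _.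
by rewrite ic_transl_out // upd_same upd_upd.
Qed.

Lemma size_enum n : size (enum 'I_n) = n.
Proof. by rewrite -cardE card_ord. Qed.

Lemma intT_lin n (f g : Fn n) c : contC f -> contC g ->
  intT (fun y => c * f y + g y)%C = (c * intT f + intT g)%C.
Proof. exact: ic_lin. Qed.

Lemma intT_bound n (f : Fn n) M : contC f -> (forall x, Cmod (f x) <= M) ->
  Cmod (intT f) <= (2 * PI) ^ n * M.
Proof. by move=> hf hM; have := ic_bound (enum 'I_n) (fun _ => 0) hf hM; rewrite size_enum. Qed.

Lemma intT_transl n (j : 'I_n) h (f : Fn n) : contC f -> periodic f -> intT (transl j h f) = intT f.
Proof. by move=> hf hp; apply: ic_transl_in => //; rewrite ?enum_uniq ?mem_enum. Qed.

Lemma intT_one n : intT (fun _ : pt n => RtoC 1) = RtoC ((2 * PI) ^ n).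
Proof.
have -> : (2 * PI) ^ n = (2 * PI) ^ size (enum 'I_n) by rewrite size_enum.
rewrite /intT; elim: (enum 'I_n) (fun _ => 0) => [|j l IH] x //.
rewrite ic_cons; last exact: contC_const.
rewrite (Cint_ext (g := fun _ => RtoC ((2 * PI) ^ size l))); last by move=> s _; apply: IH.
by rewrite /Cint /= !RInt_const /scal /= /mult /= /RtoC; congr pair; ring.
Qed.

(** Translation by pi / k_j changes the sign of the character and preserves its integral. *)
Lemma intT_ek n (k : 'I_n -> Z) : k <> @zeroz n -> intT (ek k) = RtoC 0.
Proof.
move=> hk; have [j hj] : exists j, k j <> 0%Z.
  apply: NNPP => h; apply: hk; apply: functional_extensionality => j.
  by apply: NNPP => h2; apply: h; exists j.
have hkj : IZR (k j) <> 0 by move=> /eq_IZR.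
have := intT_transl j (PI / IZR (k j)) (@ek_contC n k) (@ek_periodic n k).
rewrite (_ : transl j (PI / IZR (k j)) (ek k) = fun x => (RtoC (-1) * ek k x + RtoC 0)%C).
  rewrite intT_lin; [|exact: ek_contC | exact: contC_const].
  rewrite (_ : intT (fun _ => RtoC 0) = RtoC 0); last first.
    have := @intT_lin n (fun _ => RtoC 0) (fun _ => RtoC 0) (RtoC (-1)) (contC_const _) (contC_const _).
    rewrite (_ : (fun _ : pt n => RtoC (-1) * RtoC 0 + RtoC 0)%C = fun _ => RtoC 0).
      by move=> e; rewrite e; ring.
    by apply: functional_extensionality => x; ring.
  case: (intT (ek k)) => u v [h1 h2]; congr pair; lra.
apply: functional_extensionality => x; rewrite /transl ek_upd.
have -> : IZR (k j) * (x j + PI / IZR (k j) - x j) = PI by field.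
by rewrite /cis cos_PI sin_PI -/(RtoC (-1)); ring.
Qed.

(** * Fourier coefficients *)

Definition coef n (f : Fn n) (k : 'I_n -> Z) : C :=
  (RtoC (/ (2 * PI) ^ n) * intT (fun x => f x * ek (negz k) x))%C.

Lemma vol_pos n : 0 < (2 * PI) ^ n.
Proof. by apply: pow_lt; apply: pi2_pos. Qed.

Lemma contC_ek_mul n (f : Fn n) k : contC f -> contC (fun x => f x * ek k x)%C.
Proof. by move=> hf; apply: contC_mult => //; apply: ek_contC. Qed.

Lemma coef_lin n (f g : Fn n) c k : contC f -> contC g ->
  coef (fun x => c * f x + g x)%C k = (c * coef f k + coef g k)%C.
Proof.
move=> hf hg; rewrite /coef.
rewrite (_ : (fun x => (c * f x + g x) * ek (negz k) x)%C =
  (fun x => c * (f x * ek (negz k) x) + g x * ek (negz k) x)%C).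
  by rewrite intT_lin; [ring | exact: contC_ek_mul | exact: contC_ek_mul].
by apply: functional_extensionality => x; ring.
Qed.

Lemma coef_bound n (f : Fn n) M k : contC f -> (forall x, Cmod (f x) <= M) -> Cmod (coef f k) <= M.
Proof.
move=> hf hM; rewrite /coef Cmod_mult Cmod_R.
have hv := vol_pos n; have hi := Rinv_0_lt_compat _ hv.
rewrite Rabs_right; last lra.
apply: (Rmult_le_reg_l ((2 * PI) ^ n)) => //.
rewrite -Rmult_assoc Rinv_r ?Rmult_1_l; last lra.
apply: intT_bound; first exact: contC_ek_mul.
by move=> x; rewrite Cmod_mult Cmod_ek Rmult_1_r.
Qed.

Lemma addz_negz n (k : 'I_n -> Z) : addz k (negz k) = @zeroz n.
Proof. by apply: functional_extensionality => j; rewrite /addz /negz /zeroz; lia. Qed.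

Lemma coef_ek_same n (k : 'I_n -> Z) : coef (ek k) k = RtoC 1.
Proof.
rewrite /coef (_ : (fun x => ek k x * ek (negz k) x)%C = fun _ => RtoC 1).
  rewrite intT_one -RtoC_mult Rinv_l //; have := vol_pos n; lra.
by apply: functional_extensionality => x; rewrite -ek_add addz_negz ek_zero.
Qed.

Lemma coef_ek_diff n (k l : 'I_n -> Z) : k <> l -> coef (ek k) l = RtoC 0.
Proof.
move=> h; rewrite /coef (_ : (fun x => ek k x * ek (negz l) x)%C = ek (addz k (negz l))).
  rewrite intT_ek; first by ring.
  move=> e; apply: h; apply: functional_extensionality => j.
  by have := congr1 (fun f => f j) e; rewrite /addz /negz /zeroz; lia.
by apply: functional_extensionality => x; rewrite ek_add.
Qed.

(** Relational companion of [partial]: it carries the existence of the derivative, which the total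
    function [Derive] does not. *)
Definition pder n (j : 'I_n) (f f' : Fn n) : Prop := forall x,
  is_derive (fun s => fst (f (upd x j s))) (x j) (fst (f' x)) /\
  is_derive (fun s => snd (f (upd x j s))) (x j) (snd (f' x)).

Lemma pder_partial n (j : 'I_n) (f f' : Fn n) : pder j f f' -> partial j f = f'.
Proof.
move=> H; apply: functional_extensionality => x; have [h1 h2] := H x.
by rewrite /partial (is_derive_unique _ _ _ h1) (is_derive_unique _ _ _ h2); case: (f' x).
Qed.

Lemma pder_line n (j : 'I_n) (f f' : Fn n) x t : pder j f f' ->
  is_derive (fun s => fst (f (upd x j s))) t (fst (f' (upd x j t))) /\
  is_derive (fun s => snd (f (upd x j s))) t (snd (f' (upd x j t))).
Proof.
move=> H; have [h1 h2] := H (upd x j t).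
rewrite upd_same in h1 h2; split.
  by apply: is_derive_ext h1 => s; rewrite upd_upd.
by apply: is_derive_ext h2 => s; rewrite upd_upd.
Qed.

Lemma mvt_bound (u u' : R -> R) M a b : (forall t, is_derive u t (u' t)) ->
  (forall t, Rmin a b <= t <= Rmax a b -> Rabs (u' t) <= M) -> Rabs (u b - u a) <= M * Rabs (b - a).
Proof.
move=> hu hM; have [c [hc ->]] : exists c, Rmin a b <= c <= Rmax a b /\ u b - u a = u' c * (b - a).
  apply: (MVT_gen u) => x _ //.
  by apply/continuity_pt_filterlim; apply: (ex_derive_continuous u); exists (u' x).
by rewrite Rabs_mult; apply: Rmult_le_compat_r; [apply: Rabs_pos | apply: hM].
Qed.

Lemma taylor2 (u u' u'' : R -> R) M t h : 0 <= h ->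
  (forall t, is_derive u t (u' t)) -> (forall t, is_derive u' t (u'' t)) ->
  (forall t, Rabs (u'' t) <= M) -> Rabs (u (t + h) - u t - h * u' t) <= M * h ^ 2.
Proof.
move=> hh h1 h2 hM.
have hd : forall s, is_derive (fun s => u s - s * u' t) s (u' s - u' t).
  move=> s; apply: (is_derive_minus u (fun s => s * u' t)) => //.
  by auto_derive => //; ring.
have := @mvt_bound _ _ (M * h) t (t + h) hd.
have -> : u (t + h) - (t + h) * u' t - (u t - t * u' t) = u (t + h) - u t - h * u' t by ring.
have -> : t + h - t = h by ring.
rewrite (Rabs_right h); last lra.
move=> H; apply: Rle_trans (H _) _; last by simpl; lra.
move=> s; rewrite Rmin_left ?Rmax_right; [|lra|lra] => hs.
have hM0 : 0 <= M by have := Rabs_pos (u'' t); have := hM t; lra.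
apply: Rle_trans (_ : M * Rabs (s - t) <= _); first exact: mvt_bound h2 (fun t _ => hM t).
by apply: Rmult_le_compat_l => //; rewrite Rabs_right; lra.
Qed.

Lemma coef_transl n (j : 'I_n) h (f : Fn n) k : contC f -> periodic f ->
  coef (transl j h f) k = (cis (IZR (k j) * h) * coef f k)%C.
Proof.
move=> hf hp; rewrite /coef.
have hp' : periodic (fun x => f x * ek (negz k) x)%C.
  by move=> x i; rewrite hp ek_periodic.
rewrite -(intT_transl j h (contC_ek_mul (negz k) hf) hp').
rewrite (_ : (fun x => transl j h f x * ek (negz k) x)%C =
  (fun x => cis (IZR (k j) * h) * transl j h (fun x => f x * ek (negz k) x) x + RtoC 0)%C).
  rewrite intT_lin; [|by apply: contC_transl; apply: contC_ek_mul | exact: contC_const].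
  have -> : intT (fun _ : pt n => RtoC 0) = RtoC 0.
    have := @intT_lin n (fun _ => RtoC 0) (fun _ => RtoC 0) (RtoC (-1)) (contC_const _) (contC_const _).
    rewrite (_ : (fun _ : pt n => RtoC (-1) * RtoC 0 + RtoC 0)%C = fun _ => RtoC 0).
      by move=> e; rewrite e; ring.
    by apply: functional_extensionality => x; ring.
  ring.
apply: functional_extensionality => x; rewrite /transl ek_upd.
have -> : IZR (negz k j) * (x j + h - x j) = - (IZR (k j) * h) by rewrite /negz opp_IZR; ring.
have := cis_neg (IZR (k j) * h).
set c := cis _; set c' := cis _; set e := ek _ _; set z := f _ => hc.
have -> : (c * (z * (c' * e)) + 0 = (c * c') * (z * e))%C by ring.
by rewrite hc; ring.
Qed.

(** The difference quotient of step h converges to f' uniformly, at rate O(h) because f'' is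
    bounded, and by invariance its coefficient is (cis (k_j h) - 1) / h times that of f. *)
Lemma coef_pder n (j : 'I_n) (f f' f'' : Fn n) M k : contC f -> contC f' -> periodic f ->
  pder j f f' -> pder j f' f'' -> (forall x, Cmod (f'' x) <= M) ->
  coef f' k = ((0, IZR (k j)) * coef f k)%C.
Proof.
move=> hf hf' hp d1 d2 hM.
set z := coef f k; set m := IZR (k j).
have hM0 : 0 <= M by have := Cmod_ge_0 (f'' (fun _ => 0)); have := hM (fun _ => 0); lra.
have hz := Cmod_ge_0 z; have hm := Rabs_pos m.
(* The constant of the total error K h: [2 * M] from the Taylor remainders of real and imaginary
   part, the rest from replacing (cis (m h) - 1) / h by i m. *)
set K := 2 * M + (m ^ 2 + Rabs m ^ 3) * Cmod z.
have hK : 0 <= K.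
  have := pow2_ge_0 m; have := pow_le _ 3 hm; rewrite /K => a1 a2.
  have : 0 <= (m ^ 2 + Rabs m ^ 3) * Cmod z by apply: Rmult_le_pos; lra.
  lra.
have key : forall h, 0 < h -> h <= 1 -> Cmod (coef f' k - (0, m) * z)%C <= K * h.
  move=> h h0 h2'.
  pose r := (fun x => RtoC (/ h) * (RtoC (-1) * f x + transl j h f x) + RtoC (-1) * f' x)%C.
  have cr0 : contC (fun x => RtoC (-1) * f x + transl j h f x)%C.
    by apply: contC_plus; [apply: contC_mult => //; exact: contC_const | exact: contC_transl].
  have cr1 : contC (fun x => RtoC (-1) * f' x)%C.
    by apply: contC_mult => //; exact: contC_const.
  have cr : contC r.
    by apply: contC_plus => //; apply: contC_mult => //; exact: contC_const.
  have rb : forall x, Cmod (r x) <= 2 * M * h.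
    move=> x.
    have t1 := @taylor2 _ (fun s => fst (f' (upd x j s))) (fun s => fst (f'' (upd x j s))) M (x j) h
      (Rlt_le _ _ h0) (fun t => proj1 (pder_line x t d1)) (fun t => proj1 (pder_line x t d2))
      (fun t => Rle_trans _ _ _ (re_le_Cmod _) (hM _)).
    have t2 := @taylor2 _ (fun s => snd (f' (upd x j s))) (fun s => snd (f'' (upd x j s))) M (x j) h
      (Rlt_le _ _ h0) (fun t => proj2 (pder_line x t d1)) (fun t => proj2 (pder_line x t d2))
      (fun t => Rle_trans _ _ _ (im_le_Cmod _) (hM _)).
    have fin : forall a b c : R, Rabs (a - b - h * c) <= M * h ^ 2 ->
       Rabs (/ h * (-1 * b + a) + -1 * c) <= M * h.
      move=> a b c H.
      have -> : / h * (-1 * b + a) + -1 * c = / h * (a - b - h * c) by field; lra.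
      rewrite Rabs_mult Rabs_right; last by apply: Rle_ge; apply: Rlt_le; apply: Rinv_0_lt_compat.
      apply: (Rmult_le_reg_l h) => //; rewrite -Rmult_assoc Rinv_r ?Rmult_1_l; last lra.
      by simpl in H; lra.
    apply: Rle_trans (Cmod_le_sum _) _.
    rewrite upd_id in t1 t2.
    have := fin _ _ _ t1; have := fin _ _ _ t2.
    rewrite /r /transl /RtoC /Cmult /Cplus /=.
    move: (f (upd x j (x j + h))) (f x) (f' x) => [a1 a2] [b1 b2] [c1 c2] /= e2 e1.
    have -> : / h * (-1 * b1 - 0 * b2 + a1) - 0 * (-1 * b2 + 0 * b1 + a2) + (-1 * c1 - 0 * c2) =
       / h * (-1 * b1 + a1) + -1 * c1 by ring.
    have -> : / h * (-1 * b2 + 0 * b1 + a2) + 0 * (-1 * b1 - 0 * b2 + a1) + (-1 * c2 + 0 * c1) =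
       / h * (-1 * b2 + a2) + -1 * c2 by ring.
    lra.
  have e : coef r k = (RtoC (/ h) * ((cis (m * h) - RtoC 1) * z) - coef f' k)%C.
    rewrite /r coef_lin // coef_lin ?coef_transl //; last exact: contC_transl.
    have -> : coef (fun x => RtoC (-1) * f' x)%C k = (RtoC (-1) * coef f' k)%C.
      rewrite (_ : (fun x => RtoC (-1) * f' x)%C = (fun x => RtoC (-2) * f' x + f' x)%C).
        by rewrite coef_lin //; ring.
      by apply: functional_extensionality => x; ring.
    by rewrite -/z -/m; ring.
  have hb := coef_bound k cr rb; rewrite e in hb.
  have e2 : (coef f' k - (0, m) * z = RtoC (/ h) * ((cis (m * h) - RtoC 1 - (0, (m * h)%R)) * z) -
     (RtoC (/ h) * ((cis (m * h) - RtoC 1) * z) - coef f' k))%C.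
    have -> : ((0, (m * h)%R) : C) = (RtoC h * (0, m))%C by rewrite /Cmult /RtoC /=; congr pair; ring.
    have : (RtoC (/ h) * RtoC h = RtoC 1)%C by rewrite -RtoC_mult Rinv_l //; lra.
    set c := cis _; set w := coef f' k; set i := (0, m) => hh.
    have -> : (RtoC (/ h) * ((c - RtoC 1 - RtoC h * i) * z) - (RtoC (/ h) * ((c - RtoC 1) * z) - w) =
       w - (RtoC (/ h) * RtoC h) * (i * z))%C by ring.
    by rewrite hh; ring.
  rewrite e2; apply: Rle_trans (Cmod_triangle _ _) _; rewrite Cmod_opp (Cmod_mult (RtoC (/ h))) (Cmod_mult _ z) Cmod_R.
  have hi : 0 < / h by apply: Rinv_0_lt_compat.
  rewrite (Rabs_right (/ h)); last lra.
  have h3 : / h * (Cmod (cis (m * h) - RtoC 1 - (0, (m * h)%R))%C * Cmod z) <= (m ^ 2 + Rabs m ^ 3) * Cmod z * h.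
    apply: (Rmult_le_reg_l h) => //; rewrite -Rmult_assoc Rinv_r ?Rmult_1_l; last lra.
    have -> : h * ((m ^ 2 + Rabs m ^ 3) * Cmod z * h) = ((m ^ 2 + Rabs m ^ 3) * h ^ 2) * Cmod z by ring.
    apply: Rmult_le_compat_r => //; apply: Rle_trans (cis_taylor _) _.
    rewrite Rabs_mult (Rabs_right h); last lra.
    have -> : (m * h) ^ 2 + (Rabs m * h) ^ 3 = m ^ 2 * h ^ 2 + (Rabs m ^ 3 * h ^ 2) * h by ring.
    have hc : 0 <= Rabs m ^ 3 * h ^ 2 by apply: Rmult_le_pos; [apply: pow_le | apply: pow2_ge_0].
    have := Rmult_le_compat_l _ _ _ hc h2'; lra.
  rewrite /K; lra.
apply: Cmod_small_eq => eps he.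
pose h := Rmin 1 (eps / (2 * (K + 1))).
have hh : 0 < eps / (2 * (K + 1)) by apply: Rdiv_lt_0_compat; lra.
have h1 : 0 < h by apply: Rmin_pos; lra.
have h2 : h <= 1 by apply: Rmin_l.
have h3 : h <= eps / (2 * (K + 1)) by apply: Rmin_r.
apply: Rle_lt_trans (key h h1 h2) _.
apply: Rle_lt_trans (_ : (K + 1) * (eps / (2 * (K + 1))) < _); last first.
  have -> : (K + 1) * (eps / (2 * (K + 1))) = eps / 2 by field; lra.
  lra.
apply: Rmult_le_compat => //; lra.
Qed.

(** The difference quotients coincide, so the identity also holds where [Derive] is a default
    value. *)
Lemma Derive_shift (g : R -> R) t c : Derive g (t + c) = Derive (fun s => g (s + c)) t.
Proof.
rewrite /Derive; congr real; congr Lim.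
apply: functional_extensionality => h; congr (( _ - _) / _).
by congr g; ring.
Qed.

Lemma partial_periodic n (j : 'I_n) (f : Fn n) : periodic f -> periodic (partial j f).
Proof.
move=> hp x i; rewrite /partial; case: (eqVneq i j) => [-> | hij].
  rewrite upd_same.
  rewrite !Derive_shift; congr pair; congr Derive; apply: functional_extensionality => s;
  by have := hp (upd x j s) j; rewrite upd_same !upd_upd => ->.
rewrite upd_other; last by rewrite eq_sym.
congr pair; congr Derive; apply: functional_extensionality => s;
  by rewrite upd_comm 1?eq_sym //; have := hp (upd x j s) i; rewrite upd_other // => ->.
Qed.

(** * Uniqueness of Fourier coefficients *)

(** This is cos^2(s/2). Its powers form a positive kernel concentrating at 0 that consists of
    trigonometric polynomials, the n-th of degree n. *)
Definition yk (s : R) : R := (1 + cos s) / 2.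
Definition Ik (n : nat) : R := RInt (fun s => yk s ^ n) 0 (2 * PI).

Lemma yk_range s : 0 <= yk s <= 1.
Proof. by rewrite /yk; have := COS_bound s; lra. Qed.

Lemma yk_cont n c t : continuous (fun s => yk (s - c) ^ n) t.
Proof. by apply: (ex_derive_continuous (V := R_NormedModule)); rewrite /yk; auto_derive. Qed.

Lemma yk_cont0 n t : continuous (fun s => yk s ^ n) t.
Proof. by apply: (ex_derive_continuous (V := R_NormedModule)); rewrite /yk; auto_derive. Qed.

Arguments yk_cont : clear implicits.
Arguments yk_cont0 : clear implicits.

Lemma yk_periodic s : yk (s + 2 * PI) = yk s.
Proof. by rewrite /yk cos_plus cos_2PI sin_2PI; lra. Qed.

Lemma Ik_shift n a c : RInt (fun s => yk (s - c) ^ n) a (a + 2 * PI) = Ik n.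
Proof.
rewrite RInt_periodic.
- have := @RInt_shift (fun s => yk s ^ n) 0 (2 * PI) (- c) (fun t => yk_cont0 n t).
  rewrite /Rminus => ->; rewrite Rplus_0_l (Rplus_comm (2 * PI)).
  by apply: RInt_periodic => t; [exact: yk_cont0 | rewrite yk_periodic].
- by move=> t; apply: yk_cont.
- by move=> t; rewrite (_ : t + 2 * PI - c = t - c + 2 * PI) ?yk_periodic //; ring.
Qed.

(* The integral over a period of the derivative of [sin s * yk s ^ n] vanishes. *)
Lemma Ik_rec n : (2 * INR n + 2) * Ik n.+1 = (2 * INR n + 1) * Ik n.
Proof.
pose df s := (2 * INR n + 2) * yk s ^ n.+1 + (- (2 * INR n + 1)) * yk s ^ n.
have hd : forall s, is_derive (fun s => sin s * yk s ^ n) s (df s).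
  move=> s; rewrite /yk; auto_derive => //.
  have e : (1 + cos s) * (1 - cos s) = sin s ^ 2.
    by have := sin2_cos2 s; rewrite /Rsqr => h; simpl; lra.
  rewrite /df /yk; case: n {df} => [|n] /=; first by field.
  rewrite -/(INR n.+1).
  have -> : sin s * (1 * - sin s * / 2 * (INR n.+1 * ((1 + cos s) * / 2) ^ n)) =
     - (INR n.+1 / 2 * ((1 + cos s) * / 2) ^ n) * sin s ^ 2 by rewrite /=; field.
  by rewrite -e /Rdiv; move: (pow _ n) => p; field.
have h := @is_RInt_derive R_CompleteNormedModule _ df 0 (2 * PI) (fun s _ => hd s)
  (fun s _ => @continuous_lin _ _ _ _ _ (yk_cont0 _ s) (yk_cont0 _ s)).
have := is_RInt_unique _ _ _ _ h; rewrite /df.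
rewrite RInt_lin; [|exact: yk_cont0|exact: yk_cont0].
rewrite sin_2PI sin_0 -/(Ik _) -/(Ik _) /minus /plus /opp /=; lra.
Qed.

Lemma Ik_pos n : 0 < Ik n.
Proof.
elim: n => [|n IH].
  rewrite /Ik /= RInt_const /scal /= /mult /=; have := pi2_pos; lra.
have := Ik_rec n; have := pos_INR n; nra.
Qed.

(** With respect to the normalised kernel the mean of [1 - yk] is 1/(2n+2): this is the
    concentration at 0, in quantitative form. *)
Lemma Ik_diff n : Ik n - Ik n.+1 = Ik n / (2 * INR n + 2).
Proof.
have := Ik_rec n; have h := pos_INR n => e.
have -> : Ik n.+1 = (2 * INR n + 1) * Ik n / (2 * INR n + 2).
  by rewrite -e; field; lra.
by field; lra.
Qed.

Lemma yk_cis s x0 : RtoC (yk (s - x0)) =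
  (RtoC (1/2) + RtoC (1/4) * (cis (- x0) * cis s) + RtoC (1/4) * (cis x0 * cis (- s)))%C.
Proof.
rewrite -!cis_add /yk /cis /RtoC /Cmult /Cplus /=.
have -> : - x0 + s = s - x0 by ring.
have -> : x0 + - s = - (s - x0) by ring.
rewrite cos_neg sin_neg; congr pair; field.
Qed.

Lemma cis_contR a : ccont (fun s => cis (a * s)).
Proof.
apply/ccont_comp; split=> t; apply: (ex_derive_continuous (V := R_NormedModule)); rewrite /cis /=; auto_derive => //.
Qed.

Lemma yk_ccont n x0 : ccont (fun s => RtoC (yk (s - x0) ^ n)).
Proof. by apply: ccont_of_real => t; apply: yk_cont. Qed.

(** Each factor [yk] spreads the spectrum by one unit. A negative [d] means that all coefficients of
    [g] vanish. *)
Lemma yk_moment (g : R -> C) (d : Z) n x0 : ccont g ->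
  (forall k : Z, (d < Z.abs k)%Z -> Cint (fun s => g s * cis (IZR k * s))%C 0 (2 * PI) = RtoC 0) ->
  forall k : Z, (d + Z.of_nat n < Z.abs k)%Z ->
   Cint (fun s => g s * RtoC (yk (s - x0) ^ n) * cis (IZR k * s))%C 0 (2 * PI) = RtoC 0.
Proof.
move=> hg H; elim: n => [|n IH] k hk.
  rewrite -(H k); last lia.
  by apply: Cint_ext => s _ /=; ring.
pose F k s := (g s * RtoC (yk (s - x0) ^ n) * cis (IZR k * s))%C.
have cF : forall k, ccont (F k).
  move=> k'; apply: ccont_mult; last exact: cis_contR.
  by apply: ccont_mult => //; apply: yk_ccont.
have cc : forall c k, ccont (fun s => c * F k s)%C.
  by move=> c k'; apply: ccont_mult => //; apply: ccont_const.
rewrite (@Cint_ext _ (fun s => RtoC (1/2) * F k s + ((RtoC (1/4) * cis (- x0)) * F (k + 1)%Z s + (RtoC (1/4) * cis x0) * F (k - 1)%Z s))%C).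
  rewrite Cint_lin //; last by apply: ccont_plus.
  rewrite Cint_lin // (Cint_scal _ _ _ (cF _)) !IH; [ring | lia | lia | lia].
move=> s _; rewrite /F plus_IZR minus_IZR /=.
have -> : (IZR k + 1) * s = IZR k * s + s by ring.
have -> : (IZR k - 1) * s = IZR k * s + - s by ring.
rewrite !cis_add (RtoC_mult (yk (s - x0))) yk_cis; ring.
Qed.

Lemma ccont_bounded (g : R -> C) a b : ccont g -> a <= b ->
  exists M, 0 <= M /\ forall s, a <= s <= b -> Cmod (g s) <= M.
Proof.
move=> hg hab.
have [mx [h1 h2]] : exists mx, (forall c, a <= c <= b -> Cmod (g c) <= Cmod (g mx)) /\ a <= mx <= b.
  apply: continuity_ab_maj => // c _; apply/continuity_pt_filterlim.
  suff : continuous (fun s => Cmod (g s)) c by [].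
  apply/continuous_eps => eps he.
  have [d [hd h]] := hg c eps he; exists d; split=> // s hs; apply: Rle_lt_trans (h s hs).
  apply: Rabs_le; have := Cmod_sub_le (g s) (g c); have := Cmod_sub_le (g c) (g s).
  rewrite (Cmod_minus_sym (g c) (g s)); lra.
by exists (Cmod (g mx)); split; [apply: Cmod_ge_0|].
Qed.

(** Since g is orthogonal to the kernels centred at t, g(t) times their mass is the integral of g(t)
    - g(s) against them, which concentration makes small. *)
Lemma cint_uniq (g : R -> C) : ccont g -> (forall t, g (t + 2 * PI) = g t) ->
  (forall k : Z, Cint (fun s => g s * cis (IZR k * s))%C 0 (2 * PI) = RtoC 0) ->
  forall t, g t = RtoC 0.
Proof.
move=> hg hp H t; apply: Cmod_small_eq => eps he.
have -> : (g t - RtoC 0 = g t)%C by ring.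
have hpi := PI_RGT_0.
have [d0 [hd0 h0]] := hg t (eps / 4) ltac:(lra).
pose d := Rmin d0 1.
have hd : 0 < d by apply: Rmin_pos; lra.
have hd1 : d <= 1 by apply: Rmin_r.
have hdd : d <= d0 by apply: Rmin_l.
have [M [hM0 hM]] := @ccont_bounded g (t - PI) (t + PI) hg ltac:(lra).
have hcd : cos d < 1.
  by rewrite -cos_0; apply: cos_decreasing_1; have := PI2_1; lra.
pose eta := (1 - cos d) / 2.
have heta : 0 < eta by rewrite /eta; lra.
pose Cc := 2 * M / eta.
have hCc : 0 <= Cc by apply: Rmult_le_pos; [lra | apply: Rlt_le; apply: Rinv_0_lt_compat].
(* One bound for near and far points: away from t the quantity [1 - yk] is at least [eta], and
   [Cc * eta = 2 * M] pays for any oscillation. *)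
have hb : forall s, t - PI <= s <= t + PI -> Cmod (g t - g s)%C <= eps / 4 + Cc * (1 - yk (s - t)).
  move=> s hs; have hy := yk_range (s - t).
  case: (Rlt_dec (Rabs (s - t)) d) => hst.
    have := h0 s ltac:(rewrite /near1; lra); rewrite Cmod_minus_sym => h.
    have : 0 <= Cc * (1 - yk (s - t)) by apply: Rmult_le_pos; lra.
    lra.
  have hc : cos (s - t) <= cos d.
    have -> : cos (s - t) = cos (Rabs (s - t)).
      by rewrite /Rabs; case: Rcase_abs => _ //; rewrite cos_neg.
    have ha : Rabs (s - t) <= PI by apply: Rabs_le; lra.
    apply: cos_decr_1; have := PI2_1; lra.
  have h1 : eta <= 1 - yk (s - t) by rewrite /eta /yk; lra.
  have h2 : 2 * M <= Cc * (1 - yk (s - t)).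
    apply: Rle_trans (_ : Cc * eta <= _); first by rewrite /Cc; apply: Req_le; field; lra.
    by apply: Rmult_le_compat_l.
  have := Cmod_triangle (g t) (- g s); rewrite Cmod_opp -/(Cminus _ _).
  have := hM t ltac:(lra); have := hM s hs; lra.
have key : forall n, Cmod (g t) <= eps / 4 + Cc / (2 * INR n + 2).
  move=> n.
  have hI := Ik_pos n.
  have hyc := yk_ccont n t.
  have e0 : Cint (fun s => g s * RtoC (yk (s - t) ^ n))%C (t - PI) (t + PI) = RtoC 0.
    have -> : t + PI = t - PI + 2 * PI by ring.
    rewrite Cint_periodic.
    (* Here d + n = -1, so the conclusion includes the frequency 0. *)
    - have := @yk_moment g (- Z.of_nat n - 1)%Z n t hg (fun k _ => H k) 0%Z ltac:(lia).
      move=> <-; apply: Cint_ext => s _; rewrite Rmult_0_l cis_0; ring.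
    - by apply: ccont_mult.
    - move=> s; rewrite hp; have -> : s + 2 * PI - t = s - t + 2 * PI by ring.
      by rewrite yk_periodic.
  have e1 : Cint (fun s => (g t - g s) * RtoC (yk (s - t) ^ n))%C (t - PI) (t + PI) = (g t * RtoC (Ik n))%C.
    rewrite (@Cint_ext _ (fun s => g t * RtoC (yk (s - t) ^ n) + RtoC (-1) * (g s * RtoC (yk (s - t) ^ n)))%C); last first.
      by move=> s _; ring.
    have c2 : ccont (fun s => g s * RtoC (yk (s - t) ^ n))%C by apply: ccont_mult.
    rewrite Cint_lin //; last by apply: ccont_mult => //; apply: ccont_const.
    rewrite Cint_scal // e0.
    have -> : Cint (fun s => RtoC (yk (s - t) ^ n)) (t - PI) (t + PI) = RtoC (Ik n).
      rewrite /Cint /= /RtoC; congr pair.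
        have -> : t + PI = t - PI + 2 * PI by ring.
        by rewrite Ik_shift.
      by rewrite RInt_const /scal /= /mult /=; ring.
    ring.
  have b1 : Cmod (g t * RtoC (Ik n))%C <=
     RInt (fun s => (eps / 4 + Cc) * yk (s - t) ^ n + (- Cc) * yk (s - t) ^ n.+1) (t - PI) (t + PI).
    rewrite -e1; apply: Cint_le.
    - apply: ccont_mult => //; apply: (@ccont_ext (fun s => g t + RtoC (-1) * g s)%C); first by move=> s; ring.
      by apply: ccont_plus; [exact: ccont_const | apply: ccont_mult => //; exact: ccont_const].
    - by move=> s; apply: continuous_lin; apply: yk_cont.
    - lra.
    - move=> s hs; rewrite Cmod_mult Cmod_R.
      have hy := pow_le _ n (proj1 (yk_range (s - t))).
      rewrite Rabs_right; last lra.
      have := Rmult_le_compat_r _ _ _ hy (hb s hs); simpl; lra.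
  rewrite RInt_lin in b1; [|exact: yk_cont|exact: yk_cont].
  have e2 : t + PI = t - PI + 2 * PI by ring.
  rewrite e2 !Ik_shift in b1.
  rewrite Cmod_mult Cmod_R Rabs_right in b1; last lra.
  have := Ik_diff n => e3.
  apply: (Rmult_le_reg_r (Ik n)) => //.
  have -> : (eps / 4 + Cc / (2 * INR n + 2)) * Ik n = eps / 4 * Ik n + Cc * (Ik n / (2 * INR n + 2)).
    by field; have := pos_INR n; lra.
  rewrite -e3; lra.
have [n hn] := INR_unbounded (4 * Cc / eps).
apply: Rle_lt_trans (key n) _.
have : Cc / (2 * INR n + 2) <= eps / 4.
  have hnp := pos_INR n.
  apply: (Rmult_le_reg_r (2 * INR n + 2)); first lra.
  have -> : Cc / (2 * INR n + 2) * (2 * INR n + 2) = Cc by field; lra.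
  have h4 : Cc = 4 * Cc / eps * (eps / 4) by field; lra.
  have h5 : 4 * Cc / eps * (eps / 4) <= INR n * (eps / 4) by apply: Rmult_le_compat_r; lra.
  nra.
lra.
Qed.

Lemma ic_scal_out n (l : seq 'I_n) j (c : R -> C) (F : Fn n) x : contC F -> contC (fun y => c (y j) * F y)%C ->
  j \notin l -> int_coords l (fun y => c (y j) * F y)%C x = (c (x j) * int_coords l F x)%C.
Proof.
move=> hF hcF; elim: l x => [|i l IH] x //; rewrite inE negb_or => /andP [hij hj].
rewrite !ic_cons // -Cint_scal; last by apply: contC_upd; apply: ic_contC.
by apply: Cint_ext => s _; rewrite IH // upd_other.
Qed.

(** Induction on the coordinates: as a function of the first one, the integral over the others is
    continuous and periodic with vanishing coefficients, hence zero by [cint_uniq]. *)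
Lemma ic_uniq n (l : seq 'I_n) (f : Fn n) x : uniq l -> contC f -> periodic f ->
  (forall k, int_coords l (fun y => f y * ek k y)%C x = RtoC 0) ->
  forall x', (forall j, j \notin l -> x' j = x j) -> f x' = RtoC 0.
Proof.
move=> hu hf hp; elim: l x hu => [|j l IH] x.
  move=> _ H x' hx'; have -> : x' = x by apply: functional_extensionality => j; apply: hx'.
  by have := H (@zeroz n); rewrite /= ek_zero => <-; ring.
move=> /= /andP [hj hu] H x' hx'.
apply: (IH (upd x j (x' j)) hu); last first.
  move=> i hi; case: (eqVneq i j) => [-> | hij]; first by rewrite upd_same.
  by rewrite upd_other // hx' // inE negb_or hij.
move=> k.
pose F := (fun y => f y * ek k y)%C.
have cF : contC F by apply: contC_ek_mul.
apply: (@cint_uniq (fun s => int_coords l F (upd x j s))).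
- by apply: contC_upd; apply: ic_contC.
- by move=> t; apply: ic_periodic => // y i; rewrite /F hp ek_periodic.
move=> m.
pose k' := updz k j (k j + m)%Z.
have ek' : forall y, ek k' y = (cis (IZR m * y j) * ek k y)%C.
  move=> y; rewrite /ek -cis_add; congr cis.
  rewrite /dot (@sumR_upd n _ (fun i => IZR (k i) * y i) j); last by move=> i hi; rewrite /k' updz_other.
  by rewrite /k' updz_same plus_IZR; ring.
have e : (fun y => f y * ek k' y)%C = (fun y => cis (IZR m * y j) * F y)%C.
  by apply: functional_extensionality => y; rewrite ek' /F; ring.
have cF' : contC (fun y => cis (IZR m * y j) * F y)%C by rewrite -e; apply: contC_ek_mul.
have := H k'; rewrite -/(int_coords (j :: l) _ x) ic_cons; last exact: contC_ek_mul.
move=> <-; apply: Cint_ext => s _.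
rewrite e (@ic_scal_out n l j (fun t => cis (IZR m * t))) // upd_same; ring.
Qed.

Lemma coef_uniq n (f : Fn n) : contC f -> periodic f -> (forall k, coef f k = RtoC 0) ->
  forall x, f x = RtoC 0.
Proof.
move=> hf hp H x; apply: (@ic_uniq n (enum 'I_n) f (fun _ => 0)) => //; first exact: enum_uniq.
  move=> k; have := H (negz k); rewrite /coef negzK /intT.
  have hv := vol_pos n; have hi := Rinv_0_lt_compat _ hv.
  set z := int_coords _ _ _ => e.
  have : (RtoC ((2 * PI) ^ n) * (RtoC (/ (2 * PI) ^ n) * z) = z)%C.
    rewrite Cmult_assoc -RtoC_mult Rinv_r; [ring | lra].
  by rewrite e => <-; ring.
by move=> j; rewrite mem_enum.
Qed.

(** * Decay of Fourier coefficients *)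

Lemma smooth_pder n (f : Fn n) l j : smooth f -> pder j (iterp l f) (iterp (j :: l) f).
Proof.
move=> /(_ l) [_ h] x; have [h1 h2] := h x j.
by split; apply: Derive_correct.
Qed.

Lemma iterp_nseq n (f : Fn n) j p : iterp (nseq p j) f = iter p (partial j) f.
Proof. by elim: p => [|p IH] //=; rewrite -IH. Qed.

Definition sg n (j : 'I_n) (p : nat) : 'I_n -> nat := fun i => if i == j then p else 0%N.

Lemma foldr_sg n (l : seq 'I_n) j p (f : Fn n) : uniq l ->
  foldr (fun i g => iter (sg j p i) (partial i) g) f l = if j \in l then iter p (partial j) f else f.
Proof.
elim: l => [|i l IH] //= /andP [hi hu]; rewrite IH // inE /sg eq_sym.
by case: (eqVneq j i) hi => [<- hi | //]; rewrite (negbTE hi).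
Qed.

Lemma dalpha_sg n (j : 'I_n) p (f : Fn n) : dalpha (sg j p) f = iter p (partial j) f.
Proof. by rewrite /dalpha foldr_sg ?enum_uniq // mem_enum. Qed.

Lemma absa_sg n (j : 'I_n) p : absa (sg j p) = p.
Proof.
rewrite /absa; have : forall l, uniq l ->
  foldr (fun i acc => (sg j p i + acc)%nat) 0%nat l = if j \in l then p else 0%N.
  elim=> [|i l IH] //= /andP [hi hu]; rewrite IH // inE /sg eq_sym.
  by case: (eqVneq j i) hi => [<- hi | //]; rewrite (negbTE hi) addn0.
by move=> ->; rewrite ?enum_uniq // mem_enum.
Qed.

Lemma is_lub_Rbar_bounded (E : R -> Prop) b x0 : E x0 -> (forall r, E r -> r <= b) ->
  is_finite (Lub_Rbar E) /\ real (Lub_Rbar E) <= b /\ forall r, E r -> r <= real (Lub_Rbar E).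
Proof.
move=> h0 hb; have [h1 h2] := Lub_Rbar_correct E.
have := h2 (Rbar.Finite b) (fun r hr => hb r hr); have := h1 x0 h0.
case: (Lub_Rbar E) h1 => [l||] //= h1 _ h3; split=> //; split=> // r hr; exact: (h1 r hr).
Qed.

Lemma Cpow_imag_mod (m : R) p : Cmod ((0, m) ^ p)%C = Rabs m ^ p.
Proof.
rewrite Cmod_pow; congr pow.
rewrite /Cmod /= -(sqrt_Rsqr_abs m) /Rsqr; congr sqrt; ring.
Qed.

Definition dal_list n (al : 'I_n -> nat) (l : seq 'I_n) : seq 'I_n :=
  flatten (map (fun j => nseq (al j) j) l).

Lemma dalpha_list n (al : 'I_n -> nat) (f : Fn n) :
  dalpha al f = iterp (dal_list al (enum 'I_n)) f.
Proof.
rewrite /dalpha /dal_list; elim: (enum 'I_n) => [|j l IH] //=.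
by rewrite /iterp foldr_cat -/(iterp _ f) -IH -/(iterp _ _) iterp_nseq.
Qed.

Lemma size_dal_list n (al : 'I_n -> nat) : size (dal_list al (enum 'I_n)) = absa al.
Proof.
rewrite /dal_list /absa; elim: (enum 'I_n) => [|j l IH] //=.
by rewrite size_cat size_nseq IH.
Qed.

Lemma is_derive_eps (u : R -> R) t v :
  (forall eps, 0 < eps -> exists d, 0 < d /\ forall s, Rabs (s - t) < d ->
     Rabs (u s - u t - (s - t) * v) <= eps * Rabs (s - t)) -> is_derive u t v.
Proof.
move=> H; split; first exact: is_linear_scal_l.
move=> x hx; have -> : x = t by symmetry; apply: (is_filter_lim_locally_unique (K := R_AbsRing) (V := R_NormedModule)).
move=> eps; have [d [hd h]] := H eps (cond_pos eps).
by exists (mkposreal _ hd) => s hs; apply: h.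
Qed.

(** Termwise differentiation with a rate: the mean value theorem is applied to [u r] minus the
    linear function of slope [v0 t]. *)
Lemma is_derive_unif (u : nat -> R -> R) (v : nat -> R -> R) (u0 v0 : R -> R) e g t :
  is_lim_seq e 0 -> (forall r s, is_derive (u r) s (v r s)) -> continuous v0 t ->
  (forall r s, Rabs (u r s - u0 s) <= g * e r) -> (forall r s, Rabs (v r s - v0 s) <= g * e r) ->
  is_derive u0 t (v0 t).
Proof.
move=> he hd hc hu hv; apply: is_derive_eps => eps heps.
have [d [hd0 h]] := proj2 (continuous_eps _ _) hc (eps / 2) ltac:(lra).
exists d; split=> // s hs.
have hge : is_lim_seq (fun r => g * e r) 0.
  by have := is_lim_seq_scal_l e g 0 he; rewrite /= Rmult_0_r.
have key : forall r, Rabs (u0 s - u0 t - (s - t) * v0 t) <= (g * e r + eps / 2) * Rabs (s - t) + 2 * (g * e r).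
  move=> r.
  have hd' : forall z, is_derive (fun z => u r z - z * v0 t) z (v r z - v0 t).
    move=> z; apply: (is_derive_minus (u r) (fun s => s * v0 t)) => //.
    by auto_derive => //; ring.
  have := @mvt_bound _ _ (g * e r + eps / 2) t s hd'.
  have -> : u r s - s * v0 t - (u r t - t * v0 t) = u r s - u r t - (s - t) * v0 t by ring.
  move=> hm; have {}hm := hm _.
  have h1 : Rabs (u r s - u r t - (s - t) * v0 t) <= (g * e r + eps / 2) * Rabs (s - t).
    apply: hm => z hz; have h2 := hv r z.
    have hz' : Rabs (z - t) < d.
      apply: Rle_lt_trans hs; move: hz; rewrite /Rmin /Rmax; case: Rle_dec => hts [q1 q2].
        by rewrite !Rabs_right; lra.
      by rewrite !Rabs_left1; lra.
    have h3 := h z hz'; have -> : v r z - v0 t = (v r z - v0 z) + (v0 z - v0 t) by ring.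
    have := Rabs_triang (v r z - v0 z) (v0 z - v0 t); lra.
  have h4 := hu r s; have h5 := hu r t.
  have -> : u0 s - u0 t - (s - t) * v0 t =
     (u r s - u r t - (s - t) * v0 t) + (- (u r s - u0 s) + (u r t - u0 t)) by ring.
  have := Rabs_triang (u r s - u r t - (s - t) * v0 t) (- (u r s - u0 s) + (u r t - u0 t)).
  have := Rabs_triang (- (u r s - u0 s)) (u r t - u0 t); rewrite Rabs_Ropp; lra.
have hst := Rabs_pos (s - t).
case: (Req_dec (Rabs (s - t)) 0) => h0.
  have e0 : s = t by move: h0; rewrite /Rabs; case: Rcase_abs => _; lra.
  by rewrite e0 !Rminus_diag Rmult_0_l Rminus_diag Rabs_R0; lra.
have hst' : 0 < Rabs (s - t) by lra.
(* The index r is chosen after s, so that the uniform error can be compared with |s - t|. *)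
have hsm : 0 < eps / 2 * Rabs (s - t) / (Rabs (s - t) + 2).
  by apply: Rdiv_lt_0_compat; [apply: Rmult_lt_0_compat|]; lra.
move/is_lim_seq_spec: hge => /(_ (mkposreal _ hsm)) [r0 /= hr0].
have := hr0 r0 ltac:(lia); rewrite Rminus_0_r => hr.
have := key r0; have hr' := Rle_lt_trans _ _ _ (Rle_abs _) hr.
have h6 : (g * e r0) * (Rabs (s - t) + 2) <= eps / 2 * Rabs (s - t).
  apply: Rle_trans (Rmult_le_compat_r (Rabs (s - t) + 2) _ _ ltac:(lra) (Rlt_le _ _ hr')) _.
  by apply: Req_le; field; lra.
lra.
Qed.

Lemma contC_unif n (S : nat -> Fn n) (f : Fn n) e g : is_lim_seq e 0 ->
  (forall r, contC (S r)) -> (forall r x, Cmod (S r x - f x)%C <= g * e r) -> contC f.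
Proof.
move=> he hS H x eps heps.
have hge : is_lim_seq (fun r => g * e r) 0.
  by have := is_lim_seq_scal_l e g 0 he; rewrite /= Rmult_0_r.
have h3 : 0 < eps / 3 by lra.
move/is_lim_seq_spec: hge => /(_ (mkposreal _ h3)) [r /= hr].
have := hr r ltac:(lia); rewrite Rminus_0_r => /(Rle_lt_trans _ _ _ (Rle_abs _)) {}hr.
have [d [hd h]] := hS r x _ h3; exists d; split=> // y hy.
have h1 := H r x; have h2 := H r y; have h4 := h y hy.
have t1 := Cmod_triangle3 (f y) (S r y) (f x); have t2 := Cmod_triangle3 (S r y) (S r x) (f x).
rewrite (Cmod_minus_sym (f y) (S r y)) in t1; lra.
Qed.

Lemma pder_plus n (j : 'I_n) (f g f' g' : Fn n) : pder j f f' -> pder j g g' ->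
  pder j (fun x => f x + g x)%C (fun x => f' x + g' x)%C.
Proof.
move=> hf hg x; have [f1 f2] := hf x; have [g1 g2] := hg x; split.
  exact: (is_derive_plus _ _ _ _ _ f1 g1).
exact: (is_derive_plus _ _ _ _ _ f2 g2).
Qed.

Lemma pder_ek n (j : 'I_n) k (c : C) :
  pder j (fun x => c * ek k x)%C (fun x => c * (0, IZR (k j)) * ek k x)%C.
Proof.
move=> x; split; rewrite /ek /cis /Cmult /=.
  apply: (is_derive_ext (fun s => fst c * cos (dot k x + IZR (k j) * (s - x j)) - snd c * sin (dot k x + IZR (k j) * (s - x j)))).
    by move=> s; rewrite dot_upd.
  by auto_derive => //; rewrite Rplus_opp_r Rmult_0_r Rplus_0_r; ring.
apply: (is_derive_ext (fun s => fst c * sin (dot k x + IZR (k j) * (s - x j)) + snd c * cos (dot k x + IZR (k j) * (s - x j)))).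
  by move=> s; rewrite dot_upd.
by auto_derive => //; rewrite Rplus_opp_r Rmult_0_r Rplus_0_r; ring.
Qed.

Section Decay.
Variable om : R -> R.
Hypothesis Hw : weight_function om.
Hypothesis Hs : subadditive om.
Notation W := (W om).

(** Size [A] and rate [del] are parameters, so that not only membership in the class but also bounds
    of norms are expressed by coefficients. *)
Definition cd n (f : Fn n) (A del : R) : Prop :=
  contC f /\ periodic f /\ forall k, Cmod (coef f k) <= A * exp (- del * W k).

Lemma unorm_dalpha n lam (f : Fn n) : is_finite (unorm om lam f) ->
  forall x al, Cmod (dalpha al f x) <= real (unorm om lam f) * exp (lam * phi_star om (INR (absa al) / lam)).
Proof.
rewrite /unorm; set E := fun r => _ => hfin x al.
have [h1 _] := Lub_Rbar_correct E.
have := h1 (Cmod (dalpha al f x) * exp (- lam * phi_star om (INR (absa al) / lam))) ltac:(by exists x, al).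
rewrite -hfin /= => h.
have hp := exp_pos (lam * phi_star om (INR (absa al) / lam)).
have := Rmult_le_compat_r _ _ _ (Rlt_le _ _ hp) h.
by rewrite Rmult_assoc -exp_plus (_ : - lam * _ + _ = 0) ?exp_0 ?Rmult_1_r //; ring.
Qed.

Lemma unorm_ge0 n lam (f : Fn n) : is_finite (unorm om lam f) -> 0 <= real (unorm om lam f).
Proof.
move=> h; have := unorm_dalpha h (fun _ => 0) (fun _ => 0%N).
have := Cmod_ge_0 (dalpha (fun _ => 0%N) f (fun _ => 0)).
have := exp_pos (lam * phi_star om (INR (@absa n (fun=> 0%N)) / lam)); nra.
Qed.

Lemma iter_bound n lam (f : Fn n) j p x : is_finite (unorm om lam f) ->
  Cmod (iter p (partial j) f x) <= real (unorm om lam f) * exp (lam * phi_star om (INR p / lam)).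
Proof.
by move=> h; have := unorm_dalpha h x (sg j p); rewrite dalpha_sg absa_sg.
Qed.

Lemma coef_iter n lam (f : Fn n) j p k : periodic f -> smooth f -> is_finite (unorm om lam f) ->
  coef (iter p (partial j) f) k = ((0, IZR (k j)) ^ p * coef f k)%C.
Proof.
move=> hp hs hf; elim: p => [|p IH]; first by rewrite /=; ring.
have hpp : forall q, periodic (iter q (partial j) f).
  by elim=> [|q IHq] //=; apply: partial_periodic.
have d : forall q, pder j (iter q (partial j) f) (iter q.+1 (partial j) f).
  by move=> q; have := @smooth_pder n f (nseq q j) j hs; rewrite (iterp_nseq f j q.+1) iterp_nseq.
have c : forall q, contC (iter q (partial j) f).
  by move=> q; rewrite -iterp_nseq; case: (hs (nseq q j)).
rewrite (coef_pder k (c p) (c p.+1) (hpp p) (d p) (d p.+1) (fun x => iter_bound j p.+2 x hf)) IH /=.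
ring.
Qed.

(** The derivatives in the largest coordinate are used, with the order given by [young_attained].
    The lost factor r is absorbed by half of lam, and the passage from the largest coordinate to the
    l^1 norm divides the other half by n + 1. *)
Lemma Eom_cd n lam : 0 < lam -> exists K del, 0 < K /\ 0 < del /\
  forall f : Fn n, periodic f -> smooth f -> is_finite (unorm om lam f) ->
    cd f (K * real (unorm om lam f)) del.
Proof.
move=> hl.
have [K1 [hK1 H1]] := @om_pow om Hw (lam / 2) 1 ltac:(lra).
have hn := pos_INR n.
pose del := lam / 2 / (INR n + 1).
have hdel : 0 < del by apply: Rdiv_lt_0_compat; lra.
(* The share of the zero frequency, where derivatives give nothing. *)
pose K0 := exp (lam * phi_star om (INR 0 / lam)) * exp (del * om 0).
have hK0 : 0 < K0 by apply: Rmult_lt_0_compat; apply: exp_pos.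
exists (K0 + K1), del; split; [lra | split => //] => f hp hs hf.
split; first by case: (hs [::]).
split=> // k.
have hU := unorm_ge0 hf; set U := real _ in hU *.
have hexp := exp_pos (- del * W k).
case: (nrm1_max k) => [h0 | [j [hj1 hj2]]].
  apply: Rle_trans (_ : U * exp (lam * phi_star om (INR 0 / lam)) <= _).
    apply: coef_bound; first by case: (hs [::]).
    move=> x; have := unorm_dalpha hf x (fun _ => 0%N).
    have -> : dalpha (fun=> 0%N) f = f by rewrite /dalpha; elim: (enum 'I_n).
    by have -> : @absa n (fun=> 0%N) = 0%N by rewrite /absa; elim: (enum 'I_n).
  have -> : (K0 + K1) * U * exp (- del * W k) = U * exp (lam * phi_star om (INR 0 / lam)) +
     K1 * U * exp (- del * W k).
    rewrite /W h0 /K0.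
    have -> : (exp (lam * phi_star om (INR 0 / lam)) * exp (del * om 0) + K1) * U * exp (- del * om 0) =
      U * exp (lam * phi_star om (INR 0 / lam)) * (exp (del * om 0) * exp (- del * om 0)) + K1 * U * exp (- del * om 0) by ring.
    rewrite -exp_plus (_ : del * om 0 + - del * om 0 = 0) ?exp_0; ring.
  have : 0 <= K1 * U * exp (- del * W k) by apply: Rmult_le_pos; [apply: Rmult_le_pos|]; lra.
  lra.
have [p Hp] := @young_attained om Hw lam _ hl hj1.
set r := Rabs (IZR (k j)) in hj1 hj2 Hp *.
have hb : r ^ p * Cmod (coef f k) <= U * exp (lam * phi_star om (INR p / lam)).
  rewrite -(Cpow_imag_mod (IZR (k j)) p) -Cmod_mult -(@coef_iter n lam f j p k hp hs hf).
  apply: coef_bound; last by move=> x; apply: iter_bound.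
  by rewrite -iterp_nseq; case: (hs (nseq p j)).
have hrp : 0 < r ^ p by apply: pow_lt; lra.
have h2 : Cmod (coef f k) <= U * (r * exp (- lam * om r)).
  apply: (Rmult_le_reg_l (r ^ p)) => //; apply: Rle_trans hb _.
  have -> : r ^ p * (U * (r * exp (- lam * om r))) = U * (r ^ p * (r * exp (- lam * om r))) by ring.
  exact: Rmult_le_compat_l.
have h3 : r <= K1 * exp (lam / 2 * om r) by have := H1 r ltac:(lra); rewrite /=; lra.
have ho : 0 <= om r by apply: om_ge0 => //; lra.
have h4 : W k <= (INR n + 1) * om r.
  apply: Rle_trans (_ : om (INR n * r) <= _).
    by apply: om_mono => //; apply: nrm1_ge0.
  by apply: om_mulR => //; lra.
have h5 : r * exp (- lam * om r) <= K1 * exp (- del * W k).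
  apply: Rle_trans (_ : K1 * exp (lam / 2 * om r) * exp (- lam * om r) <= _).
    by apply: Rmult_le_compat_r => //; apply: Rlt_le; apply: exp_pos.
  rewrite Rmult_assoc -exp_plus; apply: Rmult_le_compat_l; first lra.
  apply: exp_le; have := Rmult_le_compat_l _ _ _ (Rlt_le _ _ hdel) h4.
  have -> : del * ((INR n + 1) * om r) = lam / 2 * om r by rewrite /del; field; lra.
  lra.
have h6 : U * (r * exp (- lam * om r)) <= U * (K1 * exp (- del * W k)) by apply: Rmult_le_compat_l.
have : 0 <= K0 * U * exp (- del * W k) by apply: Rmult_le_pos; [apply: Rmult_le_pos|]; lra.
lra.
Qed.

(** * Functions with prescribed coefficients *)

Definition mono n (l : seq 'I_n) (k : 'I_n -> Z) : C :=
  foldr (fun j acc => (acc * (0, IZR (k j)))%C) (RtoC 1) l.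

Lemma Cmod_imag (m : R) : Cmod (0, m) = Rabs m.
Proof. by have := Cpow_imag_mod m 1; rewrite /= Cmult_1_r Rmult_1_r. Qed.

Lemma mono_bound n (l : seq 'I_n) k : Cmod (mono l k) <= Rmax 1 (nrm1 k) ^ size l.
Proof.
have h1 := Rmax_l 1 (nrm1 k); have h2 := Rmax_r 1 (nrm1 k).
elim: l => [|j l IH] /=; first by rewrite Cmod_1; lra.
rewrite Cmod_mult Cmod_imag Rmult_comm; apply: Rmult_le_compat => //.
- exact: Rabs_pos.
- exact: Cmod_ge_0.
by have := nrm1_term k j; lra.
Qed.

(** Young's inequality at r = max(1, |k|): half of the rate pays for the monomial, the other half
    leaves a summable weight. The constant does not depend on [lam] and [l], as the norms
    require. *)
Lemma mono_decay n del : 0 < del -> exists K, 0 < K /\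
  forall (a : ('I_n -> Z) -> C) A, (forall k, Cmod (a k) <= A * exp (- del * W k)) ->
  forall lam l, 0 < lam -> lam <= del / 2 -> forall k,
   Cmod (a k * mono l k)%C <= A * K * exp (lam * phi_star om (INR (size l) / lam)) * DD (enum 'I_n) k.
Proof.
move=> hd; have [K1 [hK1 H1]] := @W_DD om Hw n (del / 2) ltac:(lra).
have ho1 : 0 <= om 1 by apply: om_ge0 => //; lra.
exists (exp (del * om 1) * K1); split; first by apply: Rmult_lt_0_compat => //; apply: exp_pos.
move=> a A Ha lam l hl hl2 k.
have hA : 0 <= A.
  have := Rle_trans _ _ _ (Cmod_ge_0 _) (Ha k); have := exp_pos (- del * W k); nra.
rewrite Cmod_mult.
have h1 := Rmax_l 1 (nrm1 k); have hn := nrm1_ge0 k.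
have h2 := @pow_le_young om Hw lam (size l) (Rmax 1 (nrm1 k)) hl h1.
have h3 : om (Rmax 1 (nrm1 k)) <= om 1 + W k.
  have hW : 0 <= W k by apply: W_ge0.
  rewrite /Rmax; case: Rle_dec => _; rewrite -/(W k); lra.
apply: Rle_trans (_ : (A * exp (- del * W k)) * exp (lam * phi_star om (INR (size l) / lam) + lam * (om 1 + W k)) <= _).
  apply: Rmult_le_compat => //; [apply: Cmod_ge_0 | apply: Cmod_ge_0 |].
  apply: Rle_trans (mono_bound l k) _; apply: Rle_trans h2 _; apply: exp_le.
  by apply: Rplus_le_compat_l; apply: Rmult_le_compat_l => //; lra.
rewrite exp_plus.
set P := exp (lam * phi_star om _); have hP : 0 < P by apply: exp_pos.
have h4 : exp (- del * W k) * exp (lam * (om 1 + W k)) <= exp (del * om 1) * (K1 * DD (enum 'I_n) k).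
  apply: Rle_trans (_ : exp (del * om 1) * exp (- (del / 2) * W k) <= _); last first.
    by apply: Rmult_le_compat_l => //; apply: Rlt_le; apply: exp_pos.
  rewrite -!exp_plus; apply: exp_le.
  have hW : 0 <= W k by apply: W_ge0.
  nra.
have -> : A * exp (- del * W k) * (P * exp (lam * (om 1 + W k))) =
  A * P * (exp (- del * W k) * exp (lam * (om 1 + W k))) by ring.
have -> : A * (exp (del * om 1) * K1) * P * DD (enum 'I_n) k =
  A * P * (exp (del * om 1) * (K1 * DD (enum 'I_n) k)) by ring.
by apply: Rmult_le_compat_l => //; apply: Rmult_le_pos; lra.
Qed.

(** The sum is formed in the space of functions, so that [bs_rel] gives continuity, derivatives and
    coefficients term by term. *)
Definition psum n (a : ('I_n -> Z) -> C) (r : nat) : Fn n :=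
  bs (fun f g x => (f x + g x)%C) (enum 'I_n) r (fun k x => (a k * ek k x)%C) (@zeroz n).

Lemma psumE n (a : ('I_n -> Z) -> C) r x :
  psum a r x = bs Cplus (enum 'I_n) r (fun k => a k * ek k x)%C (@zeroz n).
Proof.
apply: (@bs_rel n (Fn n) C _ Cplus (fun F c => F x = c)) => //.
by move=> f g c d <- <-.
Qed.

Lemma psum_cont n (a : ('I_n -> Z) -> C) r : contC (psum a r).
Proof.
apply: (@bs_rel n (Fn n) unit _ (fun _ _ => tt) (fun F _ => contC F) _ _ _ (fun _ => tt)).
  by move=> f g _ _; apply: contC_plus.
by move=> k _; apply: contC_mult; [exact: contC_const | exact: ek_contC].
Qed.

Lemma psum_pder n (a : ('I_n -> Z) -> C) r j :
  pder j (psum a r) (psum (fun k => a k * (0, IZR (k j)))%C r).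
Proof.
apply: (@bs_rel n (Fn n) (Fn n) _ _ (pder j)).
  by move=> f g f' g'; apply: pder_plus.
by move=> k _; apply: pder_ek.
Qed.

Lemma psum_coef n (a : ('I_n -> Z) -> C) r k :
  coef (psum a r) k = if all (fun j => (Z.abs (k j) <=? Z.of_nat r)%Z) (enum 'I_n) then a k else RtoC 0.
Proof.
have e : coef (psum a r) k = bs Cplus (enum 'I_n) r (fun k' => coef (fun x => a k' * ek k' x)%C k) (@zeroz n).
  apply: (@proj2 (contC (psum a r))).
  apply: (@bs_rel n (Fn n) C _ Cplus (fun F c => contC F /\ coef F k = c)).
    move=> f g c d [hf <-] [hg <-]; split; first exact: contC_plus.
    have := coef_lin (RtoC 1) k hf hg.
    rewrite (_ : (fun x => RtoC 1 * f x + g x)%C = (fun x => f x + g x)%C) => [->|]; first ring.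
    by apply: functional_extensionality => x; ring.
  by move=> k' _; split=> //; apply: contC_mult; [exact: contC_const | exact: ek_contC].
have sc : forall k', coef (fun x => a k' * ek k' x)%C k = (a k' * coef (ek k') k)%C.
  move=> k'; have := coef_lin (a k' - RtoC 1)%C k (@ek_contC n k') (@ek_contC n k').
  rewrite (_ : (fun x => (a k' - RtoC 1) * ek k' x + ek k' x)%C = (fun x => a k' * ek k' x)%C) => [->|].
    by ring.
  by apply: functional_extensionality => x; ring.
rewrite e (@bs_delta n C Cplus (RtoC 0) (enum 'I_n) r _ (@zeroz n) k).
- by rewrite sc coef_ek_same Cmult_1_r.
- by move=> x; ring.
- by move=> x; ring.
- exact: enum_uniq.
- by move=> k' hk; rewrite sc coef_ek_diff //; ring.
- by move=> j; rewrite mem_enum.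
Qed.

Lemma psum_coef_eventually n (a : ('I_n -> Z) -> C) k :
  exists r0, forall r, (r0 <= r)%coq_nat -> coef (psum a r) k = a k.
Proof.
have [r0 h0] := INR_unbounded (nrm1 k).
exists r0 => r hr; rewrite psum_coef (_ : all _ _ = true) //.
apply/allP => j _; apply/Z.leb_le.
apply: le_IZR; rewrite abs_IZR -INR_IZR_INZ.
have := nrm1_term k j; have := le_INR _ _ hr; lra.
Qed.

(** Converse of [Eom_cd]: the series and all its formal derivatives [F l] converge uniformly, and
    each [F (j :: l)] is the derivative of [F l]. One [K] serves all [lam <= del / 2]. *)
Lemma synth n del : 0 < del -> exists K, 0 < K /\
  forall (a : ('I_n -> Z) -> C) A, (forall k, Cmod (a k) <= A * exp (- del * W k)) ->
  exists f, cd f A del /\ (forall k, coef f k = a k) /\ smooth f /\ (forall x, Cmod (f x) <= K * A) /\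
    forall lam, 0 < lam -> lam <= del / 2 -> is_finite (unorm om lam f) /\ real (unorm om lam f) <= K * A.
Proof.
move=> hd; have [K1 [hK1 H1]] := @mono_decay n del hd.
have ho1 : 0 <= om 1 by apply: om_ge0 => //; lra.
(* At order 0 the conjugate is at most 0, so the sup norm carries no exponential factor. *)
have ph0 : exp (del / 2 * phi_star om (INR 0 / (del / 2))) <= 1.
  rewrite -exp_0; apply: exp_le.
  have hle : phi_star om (INR 0 / (del / 2)) <= 0.
    have e0 : INR 0 / (del / 2) = 0 by rewrite /= /Rdiv Rmult_0_l.
    rewrite e0; apply: phi_star_le => //; first lra.
    move=> s hs'; have : 0 <= om (exp s) by apply: om_ge0 => //; apply: Rlt_le (exp_pos _).
    lra.
  nra.
have h5 : 0 < 5 ^ n by apply: pow_lt; lra.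
exists (K1 * 5 ^ n); split; first by apply: Rmult_lt_0_compat.
move=> a A Ha.
have hA : 0 <= A.
  have := Rle_trans _ _ _ (Cmod_ge_0 _) (Ha (@zeroz n)); have := exp_pos (- del * W (@zeroz n)); nra.
have [e [he HB]] := @bs_dominated n (enum 'I_n) (@zeroz n) (enum_uniq _).
pose al l k := (a k * mono l k)%C.
(* The parameter [lam] stays free: convergence uses [del / 2], the norms need every smaller
   value. *)
pose g lam (l : seq 'I_n) := A * K1 * exp (lam * phi_star om (INR (size l) / lam)).
have hal : forall lam l, 0 < lam -> lam <= del / 2 -> forall k x, Cmod (al l k * ek k x)%C <= g lam l * DD (enum 'I_n) k.
  by move=> lam l h1 h2 k x; rewrite Cmod_mult Cmod_ek Rmult_1_r; apply: H1.
have hex : forall l x, exists L, Cconv (fun r => psum (al l) r x) L /\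
   (forall r, Cmod (psum (al l) r x - L)%C <= g (del / 2) l * e r).
  move=> l x; have [_ [L [hL1 hL2]]] := HB _ _ (fun k => hal (del / 2) l ltac:(lra) ltac:(lra) k x).
  exists L; split; first by apply: Cconv_ext hL1 => r; rewrite psumE.
  by move=> r; rewrite psumE; apply: hL2.
pose F l x := proj1_sig (constructive_indefinite_description _ (hex l x)).
have hF1 : forall l x, Cconv (fun r => psum (al l) r x) (F l x).
  by move=> l x; case: (proj2_sig (constructive_indefinite_description _ (hex l x))).
have hF2 : forall l r x, Cmod (psum (al l) r x - F l x)%C <= g (del / 2) l * e r.
  by move=> l r x; case: (proj2_sig (constructive_indefinite_description _ (hex l x))) => _; apply.
have hFb : forall lam l x, 0 < lam -> lam <= del / 2 -> Cmod (F l x) <= g lam l * 5 ^ n.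
  move=> lam l x h1 h2; apply: (Cconv_le (hF1 l x)) => r; rewrite psumE.
  have [hb _] := HB _ _ (fun k => hal lam l h1 h2 k x).
  by have := hb r; rewrite size_enum.
have hFc : forall l, contC (F l).
  by move=> l; apply: (contC_unif he (fun r => psum_cont (al l) r) (hF2 l)).
have alj : forall l j, (fun k => al l k * (0, IZR (k j)))%C = al (j :: l).
  by move=> l j; apply: functional_extensionality => k; rewrite /al /=; ring.
(* A common rate for a derivative and the next one, as [is_derive_unif] asks for. *)
pose m l j := Rmax (g (del / 2) l) (g (del / 2) (j :: l)).
have hF3 : forall l j r x, Cmod (psum (al l) r x - F l x)%C <= m l j * e r /\
    Cmod (psum (al (j :: l)) r x - F (j :: l) x)%C <= m l j * e r.
  move=> l j r x; have he0 : 0 <= e r.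
    have := Rle_trans _ _ _ (Cmod_ge_0 _) (hF2 l r x).
    have hg : 0 <= g (del / 2) l.
      apply: Rmult_le_pos; [apply: Rmult_le_pos; lra | apply: Rlt_le; apply: exp_pos].
    case: hg => [hg | hg] hh; first nra.
    have [_ [L [_ hL]]] := HB (fun _ => RtoC 0) 1 ltac:(by move=> k; rewrite Cmod_0; have := DD_pos (enum 'I_n) k; lra).
    by have := Rle_trans _ _ _ (Cmod_ge_0 _) (hL r); lra.
  split; [apply: Rle_trans (hF2 l r x) _ | apply: Rle_trans (hF2 (j :: l) r x) _];
    apply: Rmult_le_compat_r => //; [exact: Rmax_l | exact: Rmax_r].
have hFd : forall l j, pder j (F l) (F (j :: l)).
  move=> l j x.
  have c := proj1 (ccont_comp _) (contC_upd x j (hFc (j :: l))).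
  have dl r s := @pder_line n j _ _ x s (psum_pder (al l) r j).
  have := @is_derive_unif (fun r s => fst (psum (al l) r (upd x j s))) (fun r s => fst (psum (al (j :: l)) r (upd x j s)))
    (fun s => fst (F l (upd x j s))) (fun s => fst (F (j :: l) (upd x j s))) e (m l j) (x j) he.
  have := @is_derive_unif (fun r s => snd (psum (al l) r (upd x j s))) (fun r s => snd (psum (al (j :: l)) r (upd x j s)))
    (fun s => snd (F l (upd x j s))) (fun s => snd (F (j :: l) (upd x j s))) e (m l j) (x j) he.
  rewrite upd_id => D2 D1; split; [apply: D1 | apply: D2].
  - by move=> r s; case: (dl r s); rewrite alj.
  - by case: c.
  - by move=> r s; apply: Rle_trans (re_le_Cmod (_ - _)%C) (proj1 (hF3 l j r _)).
  - by move=> r s; apply: Rle_trans (re_le_Cmod (_ - _)%C) (proj2 (hF3 l j r _)).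
  - by move=> r s; case: (dl r s); rewrite alj.
  - by case: c.
  - by move=> r s; apply: Rle_trans (im_le_Cmod (_ - _)%C) (proj1 (hF3 l j r _)).
  - by move=> r s; apply: Rle_trans (im_le_Cmod (_ - _)%C) (proj2 (hF3 l j r _)).
have hit : forall l, iterp l (F [::]) = F l.
  by elim=> [|j l IH] //=; rewrite IH; apply: pder_partial.
have hper : periodic (F [::]).
  move=> x j; apply: Cconv_unique (hF1 _ _) _.
  apply: Cconv_ext (hF1 [::] x) => r; rewrite !psumE; apply: bs_eq => k _.
  by rewrite ek_periodic.
have hcoef : forall k, coef (F [::]) k = a k.
  move=> k; apply: (@Cconv_unique (fun r => coef (psum (al [::]) r) k)).
    apply: (@Cconv_rate _ _ e (g (del / 2) [::])) => // r.
    have -> : (coef (psum (al [::]) r) k - coef (F [::]) k =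
       coef (fun x => RtoC (-1) * F [::] x + psum (al [::]) r x) k)%C.
      rewrite coef_lin //; [ring | exact: psum_cont].
    apply: coef_bound.
      apply: contC_plus; last exact: psum_cont.
      by apply: contC_mult => //; exact: contC_const.
    move=> x; have -> : (RtoC (-1) * F [::] x + psum (al [::]) r x = psum (al [::]) r x - F [::] x)%C by ring.
    exact: hF2.
  have [r0 hr0] := psum_coef_eventually (al [::]) k.
  apply: (@Cconv_eventually _ _ r0) => r hr; rewrite hr0 // /al /=; ring.
exists (F [::]); split; first by split=> //; split=> // k; rewrite hcoef.
split=> //; split; first by move=> l; rewrite hit; split=> // x j; split; [exists (fst (F (j :: l) x)) | exists (snd (F (j :: l) x))]; case: (hFd l j x).
split.
  move=> x; apply: Rle_trans (hFb (del / 2) [::] x ltac:(lra) ltac:(lra)) _; rewrite /g.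
  have -> : K1 * 5 ^ n * A = A * K1 * 5 ^ n * 1 by ring.
  have -> : A * K1 * exp (del / 2 * phi_star om (INR (size (Nil 'I_n)) / (del / 2))) * 5 ^ n =
     A * K1 * 5 ^ n * exp (del / 2 * phi_star om (INR (size (Nil 'I_n)) / (del / 2))) by ring.
  apply: Rmult_le_compat_l => //; apply: Rmult_le_pos; last lra.
  by apply: Rmult_le_pos; lra.
move=> lam hl1 hl2; rewrite /unorm; set E := fun r => _.
have hb : forall r, E r -> r <= K1 * 5 ^ n * A.
  move=> _ [x [q ->]]; rewrite dalpha_list hit.
  have := hFb lam (dal_list q (enum 'I_n)) x hl1 hl2; rewrite /g size_dal_list => h.
  have hp := exp_pos (- lam * phi_star om (INR (absa q) / lam)).
  apply: Rle_trans (Rmult_le_compat_r _ _ _ (Rlt_le _ _ hp) h) _.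
  apply: Req_le; set P := lam * phi_star om _.
  have -> : - lam * phi_star om (INR (absa q) / lam) = - P by rewrite /P; ring.
  have hh : exp P * exp (- P) = 1 by rewrite -exp_plus Rplus_opp_r exp_0.
  have -> : A * K1 * exp P * 5 ^ n * exp (- P) = A * K1 * 5 ^ n * (exp P * exp (- P)) by ring.
  by rewrite hh; ring.
have := @is_lub_Rbar_bounded E (K1 * 5 ^ n * A) _ ltac:(by exists (fun _ => 0), (fun _ => 0%N)) hb.
by case=> h1 [h2 _]; split.
Qed.

(** By uniqueness [f] is the function that [synth] builds from its coefficients, and inherits its
    bounds. *)
Lemma cd_Eom n del : 0 < del -> exists K, 0 < K /\ forall (f : Fn n) A, cd f A del ->
  smooth f /\ (forall x, Cmod (f x) <= K * A) /\
  forall lam, 0 < lam -> lam <= del / 2 -> is_finite (unorm om lam f) /\ real (unorm om lam f) <= K * A.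
Proof.
move=> hd; have [K [hK H]] := @synth n del hd; exists K; split=> // f A [hc [hp hf]].
have [g [[gc [gp _]] [hg Hg]]] := H (coef f) A hf.
have -> : f = g; last by [].
have hcf : contC (fun x => RtoC (-1) * g x + f x)%C.
  by apply: contC_plus => //; apply: contC_mult => //; exact: contC_const.
have hz : forall x, (RtoC (-1) * g x + f x)%C = RtoC 0.
  apply: coef_uniq => //; first by move=> x j; rewrite gp hp.
  by move=> k; rewrite coef_lin // hg; ring.
apply: functional_extensionality => x; have e := hz x.
have -> : (f x = (RtoC (-1) * g x + f x) + g x)%C by ring.
by rewrite e; ring.
Qed.

Lemma cd_fun_eq n (f g : Fn n) : contC f -> periodic f -> contC g -> periodic g ->
  (forall k, coef f k = coef g k) -> f = g.
Proof.
move=> fc fp gc gp h.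
have hz : forall x, (RtoC (-1) * g x + f x)%C = RtoC 0.
  apply: coef_uniq => //; first by apply: contC_plus => //; apply: contC_mult => //; exact: contC_const.
    by move=> x j; rewrite gp fp.
  by move=> k; rewrite coef_lin // h; ring.
apply: functional_extensionality => x; have e := hz x.
have -> : (f x = (RtoC (-1) * g x + f x) + g x)%C by ring.
by rewrite e; ring.
Qed.

Lemma Eom_iff n (f : Fn n) : Eom om f <-> exists A del, 0 < del /\ cd f A del.
Proof.
split.
  move=> [hp [hs [lam [hl hf]]]]; have [K [del [_ [hd H]]]] := @Eom_cd n lam hl.
  by exists (K * real (unorm om lam f)), del; split=> //; apply: H.
move=> [A [del [hd hf]]]; have [K [_ H]] := @cd_Eom n del hd.
have [h1 [_ h2]] := H f A hf; case: hf => _ [hp _].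
split=> //; split=> //; exists (del / 2); split; first lra.
by case: (h2 (del / 2) ltac:(lra) ltac:(lra)).
Qed.

End Decay.

(** * Ultradistributions *)

Lemma zs_lin r (c : C) F G :
  zs Cplus r (fun i => c * F i + G i)%C = (c * zs Cplus r F + zs Cplus r G)%C.
Proof. by elim: r => [|r IH] //=; rewrite IH; ring. Qed.

Lemma zs_ext (V : Type) (add : V -> V -> V) r F G : (forall i, F i = G i) -> zs add r F = zs add r G.
Proof. by move=> h; congr zs; apply: functional_extensionality. Qed.

Lemma bs_lin n (l : seq 'I_n) r (c : C) F G k :
  bs Cplus l r (fun k => c * F k + G k)%C k = (c * bs Cplus l r F k + bs Cplus l r G k)%C.
Proof. by elim: l k => [|j l IH] k //=; rewrite -zs_lin; apply: zs_ext. Qed.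

Section Ultra.
Variable om : R -> R.
Hypothesis Hw : weight_function om.
Hypothesis Hs : subadditive om.
Notation W := (W om).
Notation cd := (cd om).

Lemma cd_weaken n (f : Fn n) A del A' del' : cd f A del -> A <= A' -> del' <= del -> cd f A' del'.
Proof.
move=> [h1 [h2 h3]] hA hd; split=> //; split=> // k.
have h0 := Rle_trans _ _ _ (Cmod_ge_0 _) (h3 k).
have hA0 : 0 <= A by have := exp_pos (- del * W k); nra.
apply: Rle_trans (h3 k) _; apply: Rmult_le_compat => //; first exact: Rlt_le (exp_pos _).
by apply: exp_le; have := W_ge0 Hw k; nra.
Qed.

Lemma cd_A_ge0 n (f : Fn n) A del : cd f A del -> 0 <= A.
Proof.
move=> [_ [_ h]]; have := Rle_trans _ _ _ (Cmod_ge_0 _) (h (@zeroz n)).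
have := exp_pos (- del * W (@zeroz n)); nra.
Qed.

Lemma cd_lin n (f g : Fn n) A B del c : cd f A del -> cd g B del ->
  cd (fun x => c * f x + g x)%C (Cmod c * A + B) del.
Proof.
move=> [f1 [f2 f3]] [g1 [g2 g3]]; split.
  by apply: contC_plus => //; apply: contC_mult => //; exact: contC_const.
split; first by move=> x j; rewrite f2 g2.
move=> k; rewrite coef_lin //; apply: Rle_trans (Cmod_triangle _ _) _; rewrite Cmod_mult.
have := Rmult_le_compat_l _ _ _ (Cmod_ge_0 c) (f3 k); have := g3 k; lra.
Qed.

Lemma Eom_lin n (f g : Fn n) c : Eom om f -> Eom om g -> Eom om (fun x => c * f x + g x)%C.
Proof.
move=> /(Eom_iff Hw Hs) [A [d [hd hf]]] /(Eom_iff Hw Hs) [B [d' [hd' hg]]].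
apply/(Eom_iff Hw Hs); exists (Cmod c * A + B), (Rmin d d'); split; first exact: Rmin_pos.
apply: cd_lin; [apply: (cd_weaken hf) | apply: (cd_weaken hg)]; by [lra | apply: Rmin_l | apply: Rmin_r].
Qed.

Lemma cd_ek n (k : 'I_n -> Z) del : cd (ek k) (exp (del * W k)) del.
Proof.
split; first exact: ek_contC.
split; first exact: ek_periodic.
move=> l; rewrite -exp_plus; case: (classic (k = l)) => [<- | h].
  by rewrite coef_ek_same Cmod_1 (_ : _ + _ = 0) ?exp_0; [lra | ring].
by rewrite coef_ek_diff // Cmod_0; apply: Rlt_le; apply: exp_pos.
Qed.

Lemma Eom_ek n (k : 'I_n -> Z) : Eom om (ek k).
Proof. by apply/(Eom_iff Hw Hs); exists (exp (1 * W k)), 1; split; [lra | apply: cd_ek]. Qed.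

Lemma Eom_0 n : Eom om (fun _ : pt n => RtoC 0).
Proof.
have := @Eom_lin n _ _ (RtoC (-1)) (Eom_ek (@zeroz n)) (Eom_ek (@zeroz n)).
rewrite (_ : (fun x => RtoC (-1) * ek (@zeroz n) x + ek (@zeroz n) x)%C = fun _ => RtoC 0) //.
by apply: functional_extensionality => x; ring.
Qed.

Lemma Eom_scal n (f : Fn n) c : Eom om f -> Eom om (fun x => c * f x)%C.
Proof.
move=> hf; have := @Eom_lin n f _ c hf (Eom_0 n).
rewrite (_ : (fun x => c * f x + RtoC 0)%C = (fun x => c * f x)%C) //.
by apply: functional_extensionality => x; ring.
Qed.

Lemma Eom_plus n (f g : Fn n) : Eom om f -> Eom om g -> Eom om (fun x => f x + g x)%C.
Proof.
move=> hf hg; have := @Eom_lin n f g (RtoC 1) hf hg.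
rewrite (_ : (fun x => RtoC 1 * f x + g x)%C = (fun x => f x + g x)%C) //.
by apply: functional_extensionality => x; ring.
Qed.

Lemma cd_plus n (f g : Fn n) A B del : cd f A del -> cd g B del -> cd (fun x => f x + g x)%C (A + B) del.
Proof.
move=> hf hg; have := cd_lin (RtoC 1) hf hg.
rewrite Cmod_1 Rmult_1_l (_ : (fun x => RtoC 1 * f x + g x)%C = (fun x => f x + g x)%C) //.
by apply: functional_extensionality => x; ring.
Qed.

Lemma cd_0 n del : cd (fun _ : pt n => RtoC 0) 0 del.
Proof.
split; first exact: contC_const.
split=> // k; rewrite Rmult_0_l; apply: Rle_trans (coef_bound (M := 0) k (contC_const _) _) _; last lra.
by move=> _; rewrite Cmod_0; lra.
Qed.

Lemma cd_scal n (f : Fn n) A del c : cd f A del -> cd (fun x => c * f x)%C (Cmod c * A) del.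
Proof.
move=> hf; have := cd_lin c hf (cd_0 n del).
rewrite Rplus_0_r (_ : (fun x => c * f x + RtoC 0)%C = (fun x => c * f x)%C) //.
by apply: functional_extensionality => x; ring.
Qed.

Lemma coef_plus n (f g : Fn n) k : contC f -> contC g -> coef (fun x => f x + g x)%C k = (coef f k + coef g k)%C.
Proof.
move=> hf hg; have := coef_lin (RtoC 1) k hf hg.
rewrite (_ : (fun x => RtoC 1 * f x + g x)%C = (fun x => f x + g x)%C) => [->|]; first ring.
by apply: functional_extensionality => x; ring.
Qed.

Lemma coef_0 n k : coef (fun _ : pt n => RtoC 0) k = RtoC 0.
Proof.
have := @coef_lin n _ _ (RtoC (-1)) k (contC_const (RtoC 0)) (contC_const (RtoC 0)).
rewrite (_ : (fun _ : pt n => (RtoC (-1) * RtoC 0 + RtoC 0)%C) = fun _ => RtoC 0) => [->|]; first ring.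
by apply: functional_extensionality => x; ring.
Qed.

Lemma coef_scal n (f : Fn n) c k : contC f -> coef (fun x => c * f x)%C k = (c * coef f k)%C.
Proof.
move=> hf; have := coef_lin c k hf (contC_const (RtoC 0)).
rewrite coef_0 (_ : (fun x => c * f x + RtoC 0)%C = (fun x => c * f x)%C) => [->|]; first ring.
by apply: functional_extensionality => x; ring.
Qed.

Definition linE n (mu : Fn n -> C) : Prop :=
  forall f g (c : C), Eom om f -> Eom om g -> mu (fun x => c * f x + g x)%C = (c * mu f + mu g)%C.

(** Continuity in terms of coefficients, with one bound for each rate; [ultra_iff] translates it to
    the steps of the inductive limit. *)
Definition cbd n (mu : Fn n -> C) : Prop :=
  forall del, 0 < del -> exists M, 0 <= M /\ forall f A, cd f A del -> Cmod (mu f) <= M * A.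

Lemma ultra_iff n (mu : Fn n -> C) : is_ultradist om mu <-> linE mu /\ cbd mu.
Proof.
split=> [[h1 h2] | [h1 h2]].
  split=> // del hd; have [K [hK H]] := @cd_Eom om Hw n del hd.
  (* A step with 1/m <= del/2 contains all functions of rate del, with control of the norm. *)
  have [m hm] := INR_unbounded (2 / del).
  have h2d : 0 < 2 / del by apply: Rdiv_lt_0_compat; lra.
  have hm0 : 0 < INR m by lra.
  have hl : 0 < / INR m by apply: Rinv_0_lt_compat.
  have hl2 : / INR m <= del / 2.
    have -> : del / 2 = / (2 / del) by field; lra.
    by apply: Rinv_le_contravar; lra.
  have [M HM] := h2 m ltac:(by case: m hm0 {hm hl hl2} => //=; lra).
  exists (Rabs M * K); split; first by apply: Rmult_le_pos; [apply: Rabs_pos | lra].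
  move=> f A hf; have [s1 [_ s2]] := H f A hf; have [u1 u2] := s2 _ hl hl2.
  have hE : Estep om m f by split; [case: hf => _ [] | split].
  apply: Rle_trans (HM f hE) _.
  have hu := unorm_ge0 u1.
  apply: Rle_trans (_ : Rabs M * real (unorm om (/ INR m) f) <= _).
    by apply: Rmult_le_compat_r => //; apply: Rle_abs.
  by rewrite Rmult_assoc; apply: Rmult_le_compat_l => //; apply: Rabs_pos.
split=> // k hk.
have hk0 : 0 < INR k by case: k hk => // k _; rewrite S_INR; have := pos_INR k; lra.
have [K [del [hK [hd H]]]] := @Eom_cd om Hw Hs n (/ INR k) (Rinv_0_lt_compat _ hk0).
have [M [hM HM]] := h2 del hd.
exists (M * K) => f [f1 [f2 f3]]; rewrite Rmult_assoc; apply: HM; exact: H.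
Qed.

Lemma linE_plus n (mu : Fn n -> C) f g : linE mu -> Eom om f -> Eom om g ->
  mu (fun x => f x + g x)%C = (mu f + mu g)%C.
Proof.
move=> h hf hg; have := h f g (RtoC 1) hf hg.
rewrite (_ : (fun x => RtoC 1 * f x + g x)%C = (fun x => f x + g x)%C) => [->|]; first ring.
by apply: functional_extensionality => x; ring.
Qed.

Lemma linE_0 n (mu : Fn n -> C) : linE mu -> mu (fun _ => RtoC 0) = RtoC 0.
Proof.
move=> h; have := h _ _ (RtoC (-1)) (Eom_0 n) (Eom_0 n).
rewrite (_ : (fun _ : pt n => (RtoC (-1) * RtoC 0 + RtoC 0)%C) = fun _ => RtoC 0) => [->|]; first ring.
by apply: functional_extensionality => x; ring.
Qed.

Lemma linE_scal n (mu : Fn n -> C) f c : linE mu -> Eom om f -> mu (fun x => c * f x)%C = (c * mu f)%C.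
Proof.
move=> h hf; have := h f _ c hf (Eom_0 n).
rewrite (linE_0 h) (_ : (fun x => c * f x + RtoC 0)%C = (fun x => c * f x)%C) => [->|]; first ring.
by apply: functional_extensionality => x; ring.
Qed.

(** Half of the rate is traded for a small factor, so partial sums converge in the topology of the
    class and not only uniformly. *)
Lemma cd_tail n (f : Fn n) A del r : 0 < del -> cd f A del ->
  cd (fun x => RtoC (-1) * psum (coef f) r x + f x)%C (A * exp (- (del / 2) * om (INR r))) (del / 2).
Proof.
move=> hd hf; have hA := cd_A_ge0 hf; case: hf => [h1 [h2 h3]].
split; first by apply: contC_plus => //; apply: contC_mult; [exact: contC_const | exact: psum_cont].
split.
  move=> x j; rewrite h2; congr (_ * _ + _)%C; rewrite !psumE; apply: bs_eq => k _.
  by rewrite ek_periodic.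
move=> k; rewrite coef_lin //; last exact: psum_cont.
rewrite psum_coef; case: ifP => hall.
  have -> : (RtoC (-1) * coef f k + coef f k = RtoC 0)%C by ring.
  by rewrite Cmod_0; apply: Rmult_le_pos; [apply: Rmult_le_pos => // |]; apply: Rlt_le; apply: exp_pos.
have -> : (RtoC (-1) * RtoC 0 + coef f k = coef f k)%C by ring.
apply: Rle_trans (h3 k) _; rewrite Rmult_assoc; apply: Rmult_le_compat_l => //.
rewrite -exp_plus; apply: exp_le.
have hr : INR r <= nrm1 k.
  move/negbT: hall => /allPn [j _ /Z.leb_spec0 hj].
  apply: Rle_trans (nrm1_term k j); rewrite -abs_IZR INR_IZR_INZ; apply: IZR_le; lia.
have := @om_mono om Hw (INR r) (nrm1 k) (pos_INR r) hr; rewrite -/(W k) => ho.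
nra.
Qed.

Lemma exp_om_lim del : 0 < del -> is_lim_seq (fun r => exp (- del * om (INR r))) 0.
Proof.
move=> hd; apply/is_lim_seq_spec => eps.
have [T [hT0 hT]] := @om_infty om Hw (- ln eps / del + 1).
have [r0 hr0] := INR_unbounded T.
exists r0 => r hr; rewrite Rminus_0_r Rabs_right; last by apply: Rle_ge; apply: Rlt_le; apply: exp_pos.
have hT2 : T <= INR r by have := le_INR r0 r ltac:(lia); lra.
have h := hT _ hT2.
rewrite -[pos eps](exp_ln eps); last exact: cond_pos.
apply: exp_increasing.
have := Rmult_le_compat_l _ _ _ (Rlt_le _ _ hd) h.
have -> : del * (- ln eps / del + 1) = - ln eps + del by field; lra.
lra.
Qed.

Lemma cd_psum_unif n (f : Fn n) A del : 0 < del -> cd f A del ->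
  exists g, forall r x, Cmod (psum (coef f) r x - f x)%C <= g * exp (- (del / 2) * om (INR r)).
Proof.
move=> hd hf; have [K [hK H]] := @cd_Eom om Hw n (del / 2) ltac:(lra).
exists (K * A) => r x; have [_ [h _]] := H _ _ (cd_tail r hd hf).
rewrite Cmod_minus_sym; have := h x.
have -> : (RtoC (-1) * psum (coef f) r x + f x = f x - psum (coef f) r x)%C by ring.
lra.
Qed.

Lemma Eom_psum n (a : ('I_n -> Z) -> C) r (mu : Fn n -> C) : linE mu ->
  Eom om (psum a r) /\ mu (psum a r) = bs Cplus (enum 'I_n) r (fun k => a k * mu (ek k))%C (@zeroz n).
Proof.
move=> hmu.
apply: (@bs_rel n (Fn n) C _ Cplus (fun F c => Eom om F /\ mu F = c)).
  move=> f g c d [hf <-] [hg <-]; split; first exact: Eom_plus.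
  exact: linE_plus.
by move=> k _; split; [apply: Eom_scal; apply: Eom_ek | apply: linE_scal => //; apply: Eom_ek].
Qed.

(** Combines continuity of [mu] with [cd_tail]; consequently an ultradistribution is determined by
    its values on characters. *)
Lemma mu_conv n (mu : Fn n -> C) f : linE mu -> cbd mu -> Eom om f ->
  Cconv (fun r => bs Cplus (enum 'I_n) r (fun k => coef f k * mu (ek k))%C (@zeroz n)) (mu f).
Proof.
move=> h1 h2 hE; have /(Eom_iff Hw Hs) [A [del [hd hf]]] := hE.
have [M [hM HM]] := h2 (del / 2) ltac:(lra).
apply: (@Cconv_rate _ _ (fun r => exp (- (del / 2) * om (INR r))) (M * A)).
  by apply: exp_om_lim; lra.
move=> r; have [p1 p2] := Eom_psum (coef f) r h1.
rewrite -p2; have := HM _ _ (cd_tail r hd hf).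
rewrite h1 //; have -> : (RtoC (-1) * mu (psum (coef f) r) + mu f = mu f - mu (psum (coef f) r))%C by ring.
rewrite Cmod_minus_sym; lra.
Qed.

Lemma ultra_eq n (mu nu : Fn n -> C) : linE mu -> cbd mu -> linE nu -> cbd nu ->
  (forall k, mu (ek k) = nu (ek k)) -> forall f, Eom om f -> mu f = nu f.
Proof.
move=> h1 h2 h3 h4 H f hf; apply: Cconv_unique (mu_conv h1 h2 hf) _.
by apply: Cconv_ext (mu_conv h3 h4 hf) => r; apply: bs_eq => k _; rewrite H.
Qed.

(** Growth below every exponential of the weight, dual to decay at some rate. *)
Definition slow n (V : ('I_n -> Z) -> C) : Prop :=
  forall eps, 0 < eps -> exists K, forall k, Cmod (V k) <= K * exp (eps * W k).

(** The functional is the limit of the pairing of [V k] with the coefficient at -k; half of the rate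
    of [f] pays for the growth of [V]. The limit is picked by [epsilon], so that one functional
    serves all rates. *)
Lemma slow_ultra n (V : ('I_n -> Z) -> C) : slow V ->
  exists mu : Fn n -> C, is_ultradist om mu /\ forall k, mu (ek (negz k)) = V k.
Proof.
move=> hV.
pose S f r := bs Cplus (enum 'I_n) r (fun k => V k * coef f (negz k))%C (@zeroz n).
pose mu f := epsilon (inhabits (RtoC 0)) (fun l => Cconv (S f) l).
have key : forall del, 0 < del -> exists M, 0 <= M /\ forall f A, cd f A del ->
    Cconv (S f) (mu f) /\ Cmod (mu f) <= M * A.
  move=> del hd; have [K hK] := hV (del / 2) ltac:(lra).
  have [K1 [hK1 H1]] := @W_DD om Hw n (del / 2) ltac:(lra).
  have [e [he HB]] := @bs_dominated n (enum 'I_n) (@zeroz n) (enum_uniq _).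
  have hK0 : 0 <= K.
    have := Rle_trans _ _ _ (Cmod_ge_0 _) (hK (@zeroz n)); have := exp_pos (del / 2 * W (@zeroz n)); nra.
  have h5 : 0 < 5 ^ size (enum 'I_n) by apply: pow_lt; lra.
  exists (K * K1 * 5 ^ size (enum 'I_n)); split; first by apply: Rmult_le_pos; [apply: Rmult_le_pos|]; lra.
  move=> f A hf; have hA := cd_A_ge0 hf; case: hf => [_ [_ hf]].
  have hb : forall k, Cmod (V k * coef f (negz k))%C <= (K * K1 * A) * DD (enum 'I_n) k.
    move=> k; rewrite Cmod_mult.
    apply: Rle_trans (_ : (K * exp (del / 2 * W k)) * (A * exp (- del * W k)) <= _).
      apply: Rmult_le_compat => //; [apply: Cmod_ge_0 | apply: Cmod_ge_0 |].
      by have := hf (negz k); rewrite W_neg.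
    have -> : K * exp (del / 2 * W k) * (A * exp (- del * W k)) =
       K * A * (exp (del / 2 * W k) * exp (- del * W k)) by ring.
    have -> : K * K1 * A * DD (enum 'I_n) k = K * A * (K1 * DD (enum 'I_n) k) by ring.
    apply: Rmult_le_compat_l; first exact: Rmult_le_pos.
    rewrite -exp_plus (_ : _ + _ = - (del / 2) * W k); last field.
    exact: H1.
  have [b [L [hL _]]] := HB _ _ hb.
  have hmu : Cconv (S f) (mu f) by apply: (epsilon_spec (inhabits (RtoC 0)) (fun l => Cconv (S f) l)); exists L.
  split=> //; apply: (Cconv_le hmu) => r; apply: Rle_trans (b r) _; move: (5 ^ _) => z; lra.
exists mu; split; last first.
  move=> k; have [M [hM H]] := key 1 ltac:(lra).
  have [hc _] := H _ _ (cd_ek (negz k) 1).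
  have [r0 hr0] := psum_coef_eventually V k.
  apply: Cconv_unique hc _; apply: (@Cconv_eventually _ _ r0) => r hr.
  rewrite -(hr0 r hr) psum_coef /S (@bs_delta n C Cplus (RtoC 0) (enum 'I_n) r _ (@zeroz n) k).
  - by rewrite coef_ek_same Cmult_1_r.
  - by move=> x; ring.
  - by move=> x; ring.
  - exact: enum_uniq.
  - move=> k' hk; rewrite coef_ek_diff; first ring.
    by move=> e; apply: hk; rewrite -(negzK k') -e negzK.
  - by move=> j; rewrite mem_enum.
apply/ultra_iff; split; last by move=> del hd; have [M [hM H]] := key del hd; exists M; split=> // f A /H [].
move=> f g c hf hg; have hfg := Eom_lin c hf hg.
have cv : forall f, Eom om f -> Cconv (S f) (mu f).
  move=> h /(Eom_iff Hw Hs) [A [d [hd hh]]]; have [M [_ H]] := key d hd.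
  by case: (H _ _ hh).
apply: Cconv_unique (cv _ hfg) _.
apply: Cconv_ext (Cconv_plus (Cconv_scal c (cv _ hf)) (cv _ hg)) => r.
have cE : forall f : Fn n, Eom om f -> contC f.
  by move=> h /(Eom_iff Hw Hs) [A [d [_ hh]]]; case: hh.
rewrite /S -bs_lin; apply: bs_eq => k _; rewrite (coef_lin c _ (cE _ hf) (cE _ hg)); ring.
Qed.

End Ultra.

(** * Products with functions of the first variable *)

(** Functions of t are viewed on T^1, so that the n-dimensional results cover them. *)
Definition lift1 (c : R -> C) : Fn 1 := fun x => c (x ord0).
Definition cz (s : Z) : 'I_1 -> Z := fun _ => s.
Definition shz n (k : 'I_n.+1 -> Z) (s : Z) : 'I_n.+1 -> Z := updz k ord0 (k ord0 - s)%Z.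

Lemma enum_I1 : enum 'I_1 = [:: ord0].
Proof. by rewrite enum_ordSl enum_ord0. Qed.

Lemma dot_cz s x : dot (cz s) x = IZR s * x ord0.
Proof. by rewrite /dot sumR_S sumR_0 /cz; ring. Qed.

Lemma nrm1_cz s : nrm1 (cz s) = Rabs (IZR s).
Proof. by rewrite nrm1_S /nrm1 sumR_0 /cz; ring. Qed.

Lemma ord1_eq (j : 'I_1) : j = ord0.
Proof. by apply/val_inj; case: j => [[|m] hm]. Qed.

Lemma cz_eta (k : 'I_1 -> Z) : k = cz (k ord0).
Proof. by apply: functional_extensionality => j; rewrite (ord1_eq j). Qed.

Lemma pt1_eta (x : pt 1) : x = fun _ => x ord0.
Proof. by apply: functional_extensionality => j; rewrite (ord1_eq j). Qed.

Lemma bs1 (V : Type) (add : V -> V -> V) r F :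
  bs add (enum 'I_1) r F (@zeroz 1) = zs add r (fun s => F (cz s)).
Proof.
rewrite enum_I1 /=; apply: zs_ext => i; congr F.
by rewrite (cz_eta (updz _ _ _)) updz_same.
Qed.

Lemma psum1 a r (x : pt 1) : psum a r x = zs Cplus r (fun s => a (cz s) * cis (IZR s * x ord0))%C.
Proof. by rewrite psumE bs1; apply: zs_ext => i; rewrite /ek dot_cz. Qed.

Lemma ccont_lift1 c : contC (lift1 c) <-> ccont c.
Proof.
split=> h.
  by apply: ccont_ext (contC_upd (fun _ => 0) ord0 h) => t; rewrite /lift1 upd_same.
move=> x eps he; have [d [hd H]] := h (x ord0) eps he.
by exists d; split=> // y hy; apply: H; apply: hy.
Qed.

Lemma ccont_coord n (c : R -> C) : ccont c -> contC (fun x : pt n.+1 => c (x ord0)).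
Proof.
move=> h x eps he; have [d [hd H]] := h (x ord0) eps he.
by exists d; split=> // y hy; apply: H; apply: hy.
Qed.

Lemma periodic_lift1 c : periodic (lift1 c) <-> forall t, c (t + 2 * PI) = c t.
Proof.
split=> h; last by move=> x j; rewrite /lift1 (ord1_eq j) upd_same.
by move=> t; have := h (fun _ => t) ord0; rewrite /lift1 upd_same.
Qed.

Lemma periodic_coord n (c : R -> C) : (forall t, c (t + 2 * PI) = c t) ->
  periodic (fun x : pt n.+1 => c (x ord0)).
Proof.
move=> h x j; case: (eqVneq j ord0) => [-> | hj]; first by rewrite upd_same.
by rewrite upd_other // eq_sym.
Qed.

Lemma zs_const_le r F G (b : R) : (forall i, F i <= G i * b) -> 0 <= b -> zs Rplus r F <= zs Rplus r G * b.
Proof.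
move=> h hb; rewrite Rmult_comm -zs_scal; apply: zs_le => i; have := h i; lra.
Qed.

(** A relation, so that one notion serves coefficients of functions and of ultradistributions;
    uniqueness of limits makes it functional. *)
Definition is_conv (gam u : Z -> C) (tau : Z) (L : C) : Prop :=
  Cconv (fun r => zs Cplus r (fun s => gam s * u (tau - s)%Z)%C) L.

(* [g] is the sequence of coefficients in t of L u on the fibre xi, [gam j] being those of a_j + i b_j. *)
Definition L1rel N (gam : 'I_N -> Z -> C) (xi : 'I_N -> Z) (u g : Z -> C) : Prop :=
  forall tau, exists P : 'I_N -> C, (forall j, is_conv (gam j) u tau (P j)) /\
    g tau = ((0, IZR tau) * u tau + sumC (fun j => (0, IZR (xi j)) * P j))%C.

Definition consz N (tau : Z) (xi : 'I_N -> Z) : 'I_N.+1 -> Z :=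
  fun i => match unlift ord0 i with None => tau | Some j => xi j end.

Lemma consz0 N tau (xi : 'I_N -> Z) : consz tau xi ord0 = tau.
Proof. by rewrite /consz unlift_none. Qed.

Lemma consz_lift N tau (xi : 'I_N -> Z) j : consz tau xi (lift ord0 j) = xi j.
Proof. by rewrite /consz liftK. Qed.

Definition ztail N (k : 'I_N.+1 -> Z) : 'I_N -> Z := fun j => k (lift ord0 j).

Lemma consz_ztail N (k : 'I_N.+1 -> Z) : consz (k ord0) (ztail k) = k.
Proof. by apply: functional_extensionality => i; rewrite /consz; case: unliftP => [j ->|->]. Qed.

Lemma ztail_consz N tau (xi : 'I_N -> Z) : ztail (consz tau xi) = xi.
Proof. by apply: functional_extensionality => j; rewrite /ztail consz_lift. Qed.

Lemma shz_consz N tau s (xi : 'I_N -> Z) : shz (consz tau xi) s = consz (tau - s)%Z xi.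
Proof.
apply: functional_extensionality => i; rewrite /shz consz0.
case: (unliftP ord0 i) => [j ->|->]; last by rewrite updz_same consz0.
by rewrite updz_other ?consz_lift.
Qed.

Lemma negz_consz N tau (xi : 'I_N -> Z) : negz (consz tau xi) = consz (- tau)%Z (negz xi).
Proof.
apply: functional_extensionality => i; rewrite /negz.
by case: (unliftP ord0 i) => [j ->|->]; rewrite ?consz0 ?consz_lift.
Qed.

Lemma nrm1_consz N tau (xi : 'I_N -> Z) : nrm1 (consz tau xi) = Rabs (IZR tau) + nrm1 xi.
Proof.
rewrite nrm1_S consz0; congr Rplus; apply: sumR_ext => j; by rewrite consz_lift.
Qed.

Section Product.
Variable om : R -> R.
Hypothesis Hw : weight_function om.
Hypothesis Hs : subadditive om.
Notation W := (W om).
Notation cd := (cd om).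

Definition omZ (s : Z) : R := om (Rabs (IZR s)).

Lemma W_cz s : W (cz s) = omZ s.
Proof. by rewrite /W nrm1_cz. Qed.

Lemma omZ_ge0 s : 0 <= omZ s.
Proof. by apply: om_ge0 => //; apply: Rabs_pos. Qed.

Lemma omZ_add s t : omZ (s + t) <= omZ s + omZ t.
Proof.
rewrite /omZ plus_IZR; apply: Rle_trans (Hs (Rabs_pos _) (Rabs_pos _)).
by apply: om_mono => //; [apply: Rabs_pos | apply: Rabs_triang].
Qed.

Lemma W_consz N tau (xi : 'I_N -> Z) : W (consz tau xi) <= omZ tau + W xi.
Proof. by rewrite /W nrm1_consz; apply: Hs; [apply: Rabs_pos | apply: nrm1_ge0]. Qed.

Lemma W_consz_l N tau (xi : 'I_N -> Z) : omZ tau <= W (consz tau xi).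
Proof.
rewrite /W nrm1_consz; apply: om_mono => //; first exact: Rabs_pos.
by have := nrm1_ge0 xi; lra.
Qed.

Lemma W_consz_r N tau (xi : 'I_N -> Z) : W xi <= W (consz tau xi).
Proof.
rewrite /W nrm1_consz; apply: om_mono => //; first exact: nrm1_ge0.
by have := Rabs_pos (IZR tau); lra.
Qed.

Lemma zs_exp_omZ del : 0 < del -> exists K, 0 < K /\
  forall r, zs Rplus r (fun s => exp (- del * omZ s)) <= K.
Proof.
move=> hd; have [K [hK H]] := @W_DD om Hw 1 del hd.
exists (K * 5); split; first lra.
move=> r; apply: Rle_trans (_ : zs Rplus r (fun s => K * dZ s) <= _).
  by apply: zs_le => i; have := H (cz i); rewrite W_cz enum_I1 /DD /= Rmult_1_r.
by rewrite zs_scal; apply: Rmult_le_compat_l; [lra | apply: zs_dZ].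
Qed.

Lemma prod_cont n (c : R -> C) (f : Fn n.+1) : contC (lift1 c) -> contC f ->
  contC (fun x => c (x ord0) * f x)%C.
Proof. by move=> /ccont_lift1 hc hf; apply: contC_mult => //; apply: ccont_coord. Qed.

Lemma ek_shift_coord n (k : 'I_n.+1 -> Z) s x :
  (cis (IZR s * x ord0) * ek k x)%C = ek (updz k ord0 (k ord0 + s)%Z) x.
Proof.
rewrite /ek -cis_add; congr cis.
rewrite /dot [in RHS](@sumR_upd n.+1 _ (fun i => IZR (k i) * x i) ord0); last first.
  by move=> i hi; rewrite updz_other.
by rewrite updz_same plus_IZR; ring.
Qed.

Lemma prod_conv n (c : R -> C) (f : Fn n.+1) B del M k : 0 < del -> cd (lift1 c) B del ->
  contC f -> (forall x, Cmod (f x) <= M) ->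
  Cconv (fun r => zs Cplus r (fun s => coef (lift1 c) (cz s) * coef f (shz k s))%C)
     (coef (fun x => c (x ord0) * f x)%C k).
Proof.
move=> hd hc hf hM.
have hM0 : 0 <= M by have := hM (fun _ => 0); have := Cmod_ge_0 (f (fun _ => 0)); lra.
have [g hg] := cd_psum_unif Hw hd hc.
have cc : contC (lift1 c) by case: hc.
pose F s : Fn n.+1 := fun x => (coef (lift1 c) (cz s) * (cis (IZR s * x ord0) * f x))%C.
pose P r : Fn n.+1 := zs (fun f g x => (f x + g x)%C) r F.
have cF0 : forall s, contC (fun x : pt n.+1 => cis (IZR s * x ord0) * f x)%C.
  by move=> s; apply: contC_mult => //; apply: (@ccont_coord n (fun t => cis (IZR s * t))); apply: cis_contR.
have cF : forall s, contC (F s) by move=> s; apply: contC_mult => //; apply: contC_const.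
have hP : forall r, contC (P r) /\ coef (P r) k = zs Cplus r (fun s => coef (lift1 c) (cz s) * coef f (shz k s))%C.
  move=> r; apply: (@zs_rel (Fn n.+1) C _ Cplus (fun F z => contC F /\ coef F k = z)).
    move=> f1 f2 z1 z2 [h1 <-] [h2 <-]; split; first exact: contC_plus.
    exact: coef_plus.
  move=> s _; split=> //; rewrite coef_scal //; congr Cmult.
  rewrite /coef; congr Cmult; congr intT; apply: functional_extensionality => x.
  have -> : ek (negz (shz k s)) x = (cis (IZR s * x ord0) * ek (negz k) x)%C.
    rewrite ek_shift_coord; congr ek; apply: functional_extensionality => i.
    rewrite /negz /shz; case: (eqVneq i ord0) => [->|hi]; first by rewrite !updz_same; lia.
    by rewrite !updz_other.
  by ring.
have hPx : forall r x, P r x = (psum (coef (lift1 c)) r (fun _ => x ord0) * f x)%C.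
  move=> r x; rewrite psum1.
  apply: (@zs_rel (Fn n.+1) C _ Cplus (fun F z => F x = (z * f x)%C)).
    by move=> f1 f2 z1 z2 -> ->; ring.
  by move=> s _; rewrite /F; ring.
apply: (@Cconv_rate _ _ (fun r => exp (- (del / 2) * om (INR r))) (g * M)).
  by apply: exp_om_lim => //; lra.
move=> r; have [h1 <-] := hP r.
have -> : (coef (P r) k - coef (fun x => c (x ord0) * f x)%C k =
   coef (fun x => RtoC (-1) * (c (x ord0) * f x) + P r x)%C k)%C.
  by rewrite coef_lin //; [ring | apply: prod_cont].
apply: coef_bound.
  by apply: contC_plus => //; apply: contC_mult; [exact: contC_const | exact: prod_cont].
move=> x; rewrite hPx.
have -> : (RtoC (-1) * (c (x ord0) * f x) + psum (coef (lift1 c)) r (fun=> x ord0) * f x =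
   (psum (coef (lift1 c)) r (fun=> x ord0) - lift1 c (fun=> x ord0)) * f x)%C by rewrite /lift1; ring.
rewrite Cmod_mult; have h2 := hg r (fun=> x ord0).
have := Rmult_le_compat _ _ _ _ (Cmod_ge_0 _) (Cmod_ge_0 _) h2 (hM x); lra.
Qed.

(** By subadditivity half of the two rates yields decay in [k], and the remaining half of the rate
    of [c] makes the convolution summable. *)
Lemma prod_cd n del : 0 < del -> exists K, 0 < K /\ forall (c : R -> C) (f : Fn n.+1) A B,
  cd (lift1 c) B del -> cd f A del -> cd (fun x => c (x ord0) * f x)%C (B * A * K) (del / 2).
Proof.
move=> hd; have [K [hK H]] := @zs_exp_omZ (del / 2) ltac:(lra).
exists K; split=> // c f A B hc hf.
have hA := cd_A_ge0 hf; have hB := cd_A_ge0 hc.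
have [K2 [_ H2]] := @cd_Eom om Hw n.+1 del hd; have [_ [fb _]] := H2 _ _ hf.
split; first by apply: prod_cont; [case: hc | case: hf].
split.
  have h1 : periodic (fun x : pt n.+1 => c (x ord0)).
    by apply: periodic_coord; apply/periodic_lift1; case: hc => _ [].
  by move=> x j; rewrite h1; case: hf => _ [-> _].
move=> k.
apply: (Cconv_le (@prod_conv n c f B del (K2 * A) k hd hc (proj1 hf) fb)) => r.
apply: Rle_trans (@zs_dom_diff _ (fun s => exp (- (del / 2) * omZ s) * (B * A * exp (- (del / 2) * W k))) r _) _.
  move=> s; rewrite Cmod_mult.
  case: hc => _ [_ hc]; case: hf => _ [_ hf].
  apply: Rle_trans (Rmult_le_compat _ _ _ _ (Cmod_ge_0 _) (Cmod_ge_0 _) (hc (cz s)) (hf (shz k s))) _.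
  rewrite W_cz.
  have -> : B * exp (- del * omZ s) * (A * exp (- del * W (shz k s))) =
     B * A * (exp (- del * omZ s) * exp (- del * W (shz k s))) by ring.
  have -> : exp (- (del / 2) * omZ s) * (B * A * exp (- (del / 2) * W k)) =
     B * A * (exp (- (del / 2) * omZ s) * exp (- (del / 2) * W k)) by ring.
  apply: Rmult_le_compat_l; first exact: Rmult_le_pos.
  rewrite -!exp_plus; apply: exp_le.
  have h1 : W k <= omZ s + W (shz k s).
    apply: Rle_trans (_ : W (addz (consz s (@zeroz n)) (shz k s)) <= _).
      apply: Req_le; congr W; apply: functional_extensionality => i; rewrite /addz /shz.
      case: (unliftP ord0 i) => [j ->|->]; last by rewrite updz_same consz0; lia.
      by rewrite updz_other // consz_lift /zeroz.
    apply: Rle_trans (W_add Hw Hs _ _) _; apply: Rplus_le_compat_r.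
    rewrite /W /omZ nrm1_consz; have -> : nrm1 (@zeroz n) = 0.
      by rewrite /nrm1 /zeroz (sumR_ext (G := fun _ => 0)) ?sumR_const ?Rmult_0_r // => j; rewrite Rabs_R0.
    rewrite Rplus_0_r; lra.
  have := W_ge0 Hw (shz k s); have := omZ_ge0 s; nra.
apply: Rle_trans (@zs_const_le r _ (fun s => exp (- (del / 2) * omZ s)) (B * A * exp (- (del / 2) * W k)) _ _) _.
- by move=> i; lra.
- by apply: Rmult_le_pos; [apply: Rmult_le_pos | apply: Rlt_le; apply: exp_pos].
have h3 : 0 <= B * A * exp (- (del / 2) * W k).
  by apply: Rmult_le_pos; [apply: Rmult_le_pos | apply: Rlt_le; apply: exp_pos].
have := Rmult_le_compat_r _ _ _ h3 (H r); lra.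
Qed.

(** Uniform convergence is not enough for a functional: the tail of [c] is small in the sense of
    [cd], and [prod_cd] keeps it small after multiplication by a character. *)
Lemma mu_prod_conv n (mu : Fn n.+1 -> C) (c : R -> C) B del k : linE om mu -> cbd om mu ->
  0 < del -> cd (lift1 c) B del ->
  Cconv (fun r => zs Cplus r (fun s => coef (lift1 c) (cz s) * mu (ek (updz k ord0 (k ord0 + s)%Z)))%C)
    (mu (fun x => c (x ord0) * ek k x)%C).
Proof.
move=> h1 h2 hd hc.
have hd2 : 0 < del / 2 by lra.
have [K [hK HK]] := @prod_cd n (del / 2) hd2.
have [M [hM HM]] := h2 (del / 2 / 2) ltac:(lra).
have hp : forall r, Eom om (fun x : pt n.+1 => psum (coef (lift1 c)) r (fun _ => x ord0) * ek k x)%C /\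
   mu (fun x => psum (coef (lift1 c)) r (fun _ => x ord0) * ek k x)%C =
   zs Cplus r (fun s => coef (lift1 c) (cz s) * mu (ek (updz k ord0 (k ord0 + s)%Z)))%C.
  move=> r.
  have -> : (fun x : pt n.+1 => psum (coef (lift1 c)) r (fun _ => x ord0) * ek k x)%C =
    zs (fun f g x => (f x + g x)%C) r (fun s x => coef (lift1 c) (cz s) * ek (updz k ord0 (k ord0 + s)%Z) x)%C.
    apply: functional_extensionality => x; rewrite psum1; symmetry.
    apply: (@zs_rel (Fn n.+1) C _ Cplus (fun F z => F x = (z * ek k x)%C)).
      by move=> f1 f2 z1 z2 -> ->; ring.
    by move=> s _; rewrite -ek_shift_coord; ring.
  apply: (@zs_rel (Fn n.+1) C _ Cplus (fun F z => Eom om F /\ mu F = z)).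
    move=> f1 f2 z1 z2 [e1 <-] [e2 <-]; split; first exact: Eom_plus.
    exact: (linE_plus h1 e1 e2).
  by move=> s _; split; [apply: Eom_scal => //; apply: Eom_ek | apply: (linE_scal Hw Hs _ h1); apply: Eom_ek].
have hcE : Eom om (fun x : pt n.+1 => c (x ord0) * ek k x)%C.
  have [K3 [_ H3]] := @prod_cd n del hd.
  by apply/(Eom_iff Hw Hs); eexists; exists (del / 2); split; [lra | apply: H3 hc (cd_ek _ _ _)].
pose b r := exp (- (del / 2) * om (INR r)).
apply: (@Cconv_rate _ _ b (M * (B * exp (del / 2 * W k) * K))).
  by apply: exp_om_lim.
move=> r; have [p1 <-] := hp r.
have ht0 := cd_tail Hw r hd hc.
have et : (fun x => RtoC (-1) * psum (coef (lift1 c)) r x + lift1 c x)%C =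
    lift1 (fun t => RtoC (-1) * psum (coef (lift1 c)) r (fun _ => t) + c t)%C.
  by apply: functional_extensionality => x; rewrite /lift1 {1}(pt1_eta x).
rewrite et in ht0; have ht := HK _ _ _ _ ht0 (cd_ek om k (del / 2)).
have := HM _ _ ht.
rewrite (_ : (fun x : pt n.+1 => _) = (fun x => RtoC (-1) * (psum (coef (lift1 c)) r (fun _ => x ord0) * ek k x) + c (x ord0) * ek k x)%C); last first.
  by apply: functional_extensionality => x; ring.
rewrite h1 // => h.
rewrite Cmod_minus_sym.
have -> : (mu (fun x => c (x ord0) * ek k x) - mu (fun x => psum (coef (lift1 c)) r (fun _ => x ord0) * ek k x) =
  RtoC (-1) * mu (fun x => psum (coef (lift1 c)) r (fun _ => x ord0) * ek k x) + mu (fun x => c (x ord0) * ek k x))%C by ring.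
apply: Rle_trans h _; rewrite /b; lra.
Qed.

Lemma cd_partial n del : 0 < del -> exists K, 0 < K /\ forall (f : Fn n) A j, cd f A del ->
  pder j f (partial j f) /\ cd (partial j f) (K * A) (del / 2) /\
  forall k, coef (partial j f) k = ((0, IZR (k j)) * coef f k)%C.
Proof.
move=> hd; have [K [hK H]] := @om_pow om Hw (del / 2) 1 ltac:(lra).
have [K2 [hK2 H2]] := @cd_Eom om Hw n del hd.
exists K; split=> // f A j hf; have hA := cd_A_ge0 hf.
have [s1 [_ s2]] := H2 _ _ hf; have [u1 _] := s2 (del / 2) ltac:(lra) ltac:(lra).
case: hf => f1 [f2 f3].
have hc : forall k, coef (partial j f) k = ((0, IZR (k j)) * coef f k)%C.
  by move=> k; have := coef_iter j 1 k f2 s1 u1; rewrite /= Cmult_1_r.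
split; first exact: (smooth_pder [::] j s1).
split=> //; split; first by case: (s1 [:: j]).
split; first exact: partial_periodic.
move=> k; rewrite hc Cmod_mult Cmod_imag.
have h1 := H _ (nrm1_ge0 k); have h2 := nrm1_term k j.
apply: Rle_trans (_ : K * exp (del / 2 * W k) * (A * exp (- del * W k)) <= _).
  apply: Rmult_le_compat => //; [exact: Rabs_pos | exact: Cmod_ge_0 |].
  by rewrite /W; simpl in h1; lra.
have -> : K * exp (del / 2 * W k) * (A * exp (- del * W k)) =
  K * A * (exp (del / 2 * W k) * exp (- del * W k)) by ring.
by rewrite -exp_plus; apply: Req_le; congr Rmult; congr exp; field.
Qed.

Lemma pder_lin n (j : 'I_n) (f g f' g' : Fn n) c : pder j f f' -> pder j g g' ->
  pder j (fun x => c * f x + g x)%C (fun x => c * f' x + g' x)%C.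
Proof.
move=> hf hg; apply: pder_plus hg => x; have [f1 f2] := hf x; split => /=.
  apply: (is_derive_minus (fun s => fst c * fst (f (upd x j s))) (fun s => snd c * snd (f (upd x j s)))).
    exact: is_derive_scal.
  exact: is_derive_scal.
apply: (is_derive_plus (fun s => fst c * snd (f (upd x j s))) (fun s => snd c * fst (f (upd x j s)))).
  exact: is_derive_scal.
exact: is_derive_scal.
Qed.

Lemma sumC_rel n (V : Type) (add : V -> V -> V) z (Rel : (V -> C -> Prop)) (F : 'I_n -> V) (G : 'I_n -> C) :
  Rel z (RtoC 0) -> (forall x y x' y', Rel x x' -> Rel y y' -> Rel (add x y) (x' + y')%C) ->
  (forall j, Rel (F j) (G j)) -> Rel (foldr (fun j acc => add (F j) acc) z (enum 'I_n)) (sumC G).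
Proof.
by move=> h0 ha H; rewrite /sumC; elim: (enum 'I_n) => [|j l IH] //=; apply: ha.
Qed.

Lemma sumC_fold n m (F : 'I_n -> Fn m) :
  (fun x => sumC (fun j => F j x)) = foldr (fun j acc x => (F j x + acc x)%C) (fun _ => RtoC 0) (enum 'I_n).
Proof.
apply: functional_extensionality => x; rewrite /sumC; elim: (enum 'I_n) => [|j l IH] //=.
by rewrite IH.
Qed.

Lemma coef_sumC n m (F : 'I_n -> Fn m) k : (forall j, contC (F j)) ->
  contC (fun x => sumC (fun j => F j x)) /\
  coef (fun x => sumC (fun j => F j x)) k = sumC (fun j => coef (F j) k).
Proof.
move=> h; rewrite sumC_fold.
apply: (@sumC_rel n (Fn m) (fun f g x => (f x + g x)%C) _ (fun F z => contC F /\ coef F k = z)).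
- by split; [exact: contC_const | exact: coef_0].
- by move=> f g z w [h1 <-] [h2 <-]; split; [exact: contC_plus | exact: coef_plus].
- by [].
Qed.

Lemma cd_sumC n m (F : 'I_n -> Fn m) A del : (forall j, cd (F j) A del) ->
  cd (fun x => sumC (fun j => F j x)) (INR n * A) del.
Proof.
move=> h; rewrite sumC_fold; have -> : INR n = INR (size (enum 'I_n)) by rewrite size_enum.
elim: (enum 'I_n) => [|j l IH]; first by rewrite Rmult_0_l; apply: cd_0.
have -> : INR (size (j :: l)) * A = A + INR (size l) * A by rewrite (_ : size (j :: l) = (size l).+1) // S_INR; ring.
exact: cd_plus.
Qed.

Section Op.
Variables (N : nat) (cf : 'I_N -> R -> C) (B d0 : R).
Hypothesis Hd0 : 0 < d0.
Hypothesis Hcf : forall j, cd (lift1 (cf j)) B d0.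

Definition gam (j : 'I_N) (s : Z) : C := coef (lift1 (cf j)) (cz s).

(** Convertible to [Lop] when [cf j] is a_j + i b_j. Complex coefficients let each product be
    handled as a single convolution. *)
Definition LC (f : Fn N.+1) : Fn N.+1 :=
  fun p => (partial ord0 f p + sumC (fun j => cf j (p ord0) * partial (lift ord0 j) f p))%C.

Lemma gam_bound j s : Cmod (gam j s) <= B * exp (- d0 * omZ s).
Proof. by have [_ [_ h]] := Hcf j; have := h (cz s); rewrite W_cz. Qed.

Lemma LC_cd del : 0 < del -> exists K del', 0 < K /\ 0 < del' /\
  forall f A, cd f A del -> cd (LC f) (K * A) del'.
Proof.
move=> hd; have [K1 [hK1 H1]] := @cd_partial N.+1 del hd.
pose e := Rmin (del / 2) d0.
have he : 0 < e by apply: Rmin_pos; lra.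
have he1 : e <= del / 2 by apply: Rmin_l.
have he2 : e <= d0 by apply: Rmin_r.
have [K2 [hK2 H2]] := @prod_cd N e he.
have hN := pos_INR N.
exists (K1 + INR N * (Rabs B * K1 * K2)), (e / 2); split.
  have : 0 <= INR N * (Rabs B * K1 * K2).
    by apply: Rmult_le_pos => //; apply: Rmult_le_pos; [apply: Rmult_le_pos; [apply: Rabs_pos|]|]; lra.
  lra.
split; first lra.
move=> f A hf; rewrite Rmult_plus_distr_r.
apply: cd_plus.
  by have [_ [h _]] := H1 f A ord0 hf; apply: (cd_weaken Hw h); lra.
rewrite Rmult_assoc; apply: cd_sumC => j.
have [_ [h _]] := H1 f A (lift ord0 j) hf.
have h1 : cd (lift1 (cf j)) (Rabs B) e by apply: (cd_weaken Hw (Hcf j)) => //; apply: Rle_abs.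
have h2 : cd (partial (lift ord0 j) f) (K1 * A) e by apply: (cd_weaken Hw h) => //; lra.
have := H2 _ _ _ _ h1 h2.
by have -> : Rabs B * (K1 * A) * K2 = Rabs B * K1 * K2 * A by ring.
Qed.

Lemma LC_Eom f : Eom om f -> Eom om (LC f).
Proof.
move=> /(Eom_iff Hw Hs) [A [d [hd hf]]]; have [K [d' [_ [hd' H]]]] := LC_cd hd.
by apply/(Eom_iff Hw Hs); exists (K * A), d'; split=> //; apply: H.
Qed.

Lemma Eom_pder n (f : Fn n) j : Eom om f -> pder j f (partial j f).
Proof.
move=> /(Eom_iff Hw Hs) [A [d [hd hf]]]; have [K [_ H]] := @cd_partial n d hd.
by case: (H _ _ j hf).
Qed.

Lemma LC_lin f g c : Eom om f -> Eom om g ->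
  LC (fun x => c * f x + g x)%C = (fun x => c * LC f x + LC g x)%C.
Proof.
move=> hf hg; apply: functional_extensionality => p; rewrite /LC.
have hp : forall j, partial j (fun x => c * f x + g x)%C = (fun x => c * partial j f x + partial j g x)%C.
  by move=> j; apply: pder_partial; apply: pder_lin; apply: Eom_pder.
rewrite hp.
rewrite (sumC_ext (G := fun j => c * (cf j (p ord0) * partial (lift ord0 j) f p) + cf j (p ord0) * partial (lift ord0 j) g p)%C).
  by rewrite sumC_plus sumC_scal; ring.
by move=> j; rewrite hp; ring.
Qed.

Lemma LC_coef f xi : Eom om f ->
  L1rel gam xi (fun tau => coef f (consz tau xi)) (fun tau => coef (LC f) (consz tau xi)).
Proof.
move=> /(Eom_iff Hw Hs) [A [d [hd hf]]] tau.
have [K1 [hK1 H1]] := @cd_partial N.+1 d hd.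
have [K2 [_ H2]] := @cd_Eom om Hw N.+1 d hd; have [_ [fb _]] := H2 _ _ hf.
have [K3 [_ H3]] := @cd_Eom om Hw N.+1 (d / 2) ltac:(lra).
set k := consz tau xi.
exists (fun j => coef (fun x => cf j (x ord0) * f x)%C k); split.
  move=> j; have := @prod_conv N (cf j) f B d0 _ k Hd0 (Hcf j) (proj1 hf) fb.
  by apply: Cconv_ext => r; apply: zs_ext => s; rewrite shz_consz.
(* The factor i xi_j of the derivative in x_j is constant along the convolution, which only moves
   tau. *)
have hc : forall j, coef (fun x => cf j (x ord0) * partial (lift ord0 j) f x)%C k =
   ((0, IZR (xi j)) * coef (fun x => cf j (x ord0) * f x)%C k)%C.
  move=> j; have [_ [h1 h2]] := H1 _ _ (lift ord0 j) hf.
  have [_ [pb _]] := H3 _ _ h1.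
  have e1 := @prod_conv N (cf j) _ B d0 _ k Hd0 (Hcf j) (proj1 h1) pb.
  have e2 := Cconv_scal (0, IZR (xi j)) (@prod_conv N (cf j) f B d0 _ k Hd0 (Hcf j) (proj1 hf) fb).
  apply: Cconv_unique e1 _; apply: Cconv_ext e2 => r.
  apply: (@zs_rel C C Cplus Cplus (fun x y => ((0, IZR (xi j)) * x)%C = y)).
    by move=> x y x' y' <- <-; ring.
  by move=> s _; rewrite h2 shz_consz consz_lift; ring.
have hcont : forall j, contC (fun x => cf j (x ord0) * partial (lift ord0 j) f x)%C.
  by move=> j; have [_ [h1 _]] := H1 _ _ (lift ord0 j) hf; apply: prod_cont; [case: (Hcf j) | case: h1].
have [hs1 hs2] := coef_sumC k hcont.
have [_ [h1 h2]] := H1 _ _ ord0 hf.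
rewrite /LC coef_plus //; last by case: h1.
have e0 : k ord0 = tau by exact: consz0.
by rewrite hs2 h2 e0; congr Cplus; apply: sumC_ext => j; rewrite hc.
Qed.

(** Tested on conjugate characters, [mu] and L mu have values that behave like Fourier coefficients,
    so they satisfy the same relation on each fibre as functions do. *)
Lemma LC_mu (mu : Fn N.+1 -> C) xi : linE om mu -> cbd om mu ->
  L1rel gam xi (fun tau => mu (ek (negz (consz tau xi)))) (fun tau => Copp (mu (LC (ek (negz (consz tau xi)))))).
Proof.
move=> h1 h2 tau; set k := negz (consz tau xi).
exists (fun j => mu (fun x => cf j (x ord0) * ek k x)%C); split.
  move=> j; have := @mu_prod_conv N mu (cf j) B d0 k h1 h2 Hd0 (Hcf j).
  apply: Cconv_ext => r; apply: zs_ext => s; congr (_ * mu (ek _))%C.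
  apply: functional_extensionality => i; rewrite /k !negz_consz.
  case: (unliftP ord0 i) => [m ->|->]; first by rewrite updz_other // !consz_lift.
  by rewrite updz_same !consz0; lia.
have hp : forall j, partial j (ek k) = (fun x => (0, IZR (k j)) * ek k x)%C.
  move=> j; apply: pder_partial.
  have := @pder_ek N.+1 j k (RtoC 1).
  rewrite (_ : (fun x => RtoC 1 * ek k x)%C = ek k); last by apply: functional_extensionality => x; ring.
  rewrite (_ : (fun x => RtoC 1 * (0, IZR (k j)) * ek k x)%C = (fun x => (0, IZR (k j)) * ek k x)%C) //.
  by apply: functional_extensionality => x; ring.
have hE : forall j, Eom om (fun x : pt N.+1 => cf j (x ord0) * ek k x)%C.
  move=> j; have [K3 [_ H3]] := @prod_cd N d0 Hd0.
  by apply/(Eom_iff Hw Hs); eexists; exists (d0 / 2); split; [lra | apply: H3 (Hcf j) (cd_ek _ _ _)].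
have -> : LC (ek k) = (fun x => (0, IZR (k ord0)) * ek k x + sumC (fun j => (0, IZR (k (lift ord0 j))) * (cf j (x ord0) * ek k x)))%C.
  apply: functional_extensionality => x; rewrite /LC hp; congr Cplus; apply: sumC_ext => j.
  by rewrite hp; ring.
have [hs1 hs2] : Eom om (fun x => sumC (fun j => (0, IZR (k (lift ord0 j))) * (cf j (x ord0) * ek k x)))%C /\
   mu (fun x => sumC (fun j => (0, IZR (k (lift ord0 j))) * (cf j (x ord0) * ek k x)))%C =
   sumC (fun j => (0, IZR (k (lift ord0 j))) * mu (fun x => cf j (x ord0) * ek k x))%C.
  rewrite sumC_fold.
  apply: (@sumC_rel N (Fn N.+1) (fun f g x => (f x + g x)%C) _ (fun F z => Eom om F /\ mu F = z)).
  - by split; [exact: Eom_0 | exact: (linE_0 Hw Hs h1)].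
  - by move=> f g z w [e1 <-] [e2 <-]; split; [exact: Eom_plus | exact: (linE_plus h1 e1 e2)].
  - by move=> j; split; [exact: Eom_scal | exact: (linE_scal Hw Hs _ h1 (hE j))].
rewrite h1 //; last exact: Eom_ek.
rewrite hs2 -/k.
have e0 : k ord0 = (- tau)%Z by rewrite /k negz_consz consz0.
have ej : forall j, k (lift ord0 j) = (- xi j)%Z by move=> j; rewrite /k negz_consz consz_lift.
have im : forall m : R, ((0, - m) : C) = (RtoC (-1) * (0, m))%C.
  by move=> m; rewrite /RtoC /Cmult /=; congr pair; ring.
have es : sumC (fun j => (0, IZR (k (lift ord0 j))) * mu (fun x => cf j (x ord0) * ek k x))%C =
  (RtoC (-1) * sumC (fun j => (0, IZR (xi j)) * mu (fun x => cf j (x ord0) * ek k x)))%C.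
  by rewrite -sumC_scal; apply: sumC_ext => j; rewrite ej opp_IZR im; ring.
by rewrite e0 opp_IZR im es; ring.
Qed.

Lemma LC_ultra (mu : Fn N.+1 -> C) : linE om mu -> cbd om mu ->
  linE om (fun h => Copp (mu (LC h))) /\ cbd om (fun h => Copp (mu (LC h))).
Proof.
move=> h1 h2; split.
  move=> f g c hf hg; rewrite LC_lin // h1; [ring | exact: LC_Eom | exact: LC_Eom].
move=> del hd; have [K [d' [hK [hd' H]]]] := LC_cd hd; have [M [hM HM]] := h2 d' hd'.
exists (M * K); split; first by apply: Rmult_le_pos; lra.
by move=> f A hf; rewrite Cmod_opp Rmult_assoc; apply: HM; apply: H.
Qed.

End Op.

Lemma fdist_ultra n (f : Fn n) : Eom om f -> linE om (fdist f) /\ cbd om (fdist f).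
Proof.
move=> /(Eom_iff Hw Hs) [A [d [hd hf]]].
have [K [hK H]] := @cd_Eom om Hw n d hd; have [_ [fb _]] := H _ _ hf.
have hA := cd_A_ge0 hf.
have cE : forall h : Fn n, Eom om h -> contC h.
  by move=> h /(Eom_iff Hw Hs) [A' [d' [_ hh]]]; case: hh.
split.
  move=> g h c hg hh; rewrite /fdist -intT_lin; [|by apply: contC_mult; [case: hf | exact: cE]|by apply: contC_mult; [case: hf | exact: cE]].
  by congr intT; apply: functional_extensionality => x; ring.
move=> del hdel; have [K2 [hK2 H2]] := @cd_Eom om Hw n del hdel.
have hv := vol_pos n.
exists ((2 * PI) ^ n * (K * A) * K2); split.
  by apply: Rmult_le_pos; [apply: Rmult_le_pos; [|apply: Rmult_le_pos]|]; lra.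
move=> g A2 hg; have [_ [gb _]] := H2 _ _ hg.
rewrite !Rmult_assoc -(Rmult_assoc K A).
apply: intT_bound; first by apply: contC_mult; [case: hf | case: hg].
by move=> x; rewrite Cmod_mult; apply: Rmult_le_compat => //; apply: Cmod_ge_0.
Qed.

Lemma fdist_ek n (f : Fn n) k : fdist f (ek (negz k)) = (RtoC ((2 * PI) ^ n) * coef f k)%C.
Proof.
rewrite /coef /fdist Cmult_assoc -RtoC_mult Rinv_r; first by ring.
by have := vol_pos n; lra.
Qed.

End Product.

(** * The ordinary differential equation on a fibre *)

Definition cder (F F' : R -> C) : Prop := forall t,
  is_derive (fun s => fst (F s)) t (fst (F' t)) /\ is_derive (fun s => snd (F s)) t (snd (F' t)).

Lemma cder_cont F F' : cder F F' -> ccont F.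
Proof.
move=> h; apply/ccont_comp; split=> t.
  by apply: (ex_derive_continuous (V := R_NormedModule)); exists (fst (F' t)); case: (h t).
by apply: (ex_derive_continuous (V := R_NormedModule)); exists (snd (F' t)); case: (h t).
Qed.

Lemma cder_ext F F' G' : (forall t, F' t = G' t) -> cder F F' -> cder F G'.
Proof. by move=> e h t; rewrite -e. Qed.

Lemma cder_mult F F' G G' : cder F F' -> cder G G' ->
  cder (fun t => F t * G t)%C (fun t => F' t * G t + F t * G' t)%C.
Proof.
move=> hF hG t; have [f1 f2] := hF t; have [g1 g2] := hG t; split => /=.
  have e : fst (F' t) * fst (G t) - snd (F' t) * snd (G t) + (fst (F t) * fst (G' t) - snd (F t) * snd (G' t)) =
    minus (plus (scal (fst (F' t)) (fst (G t))) (scal (fst (F t)) (fst (G' t))))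
          (plus (scal (snd (F' t)) (snd (G t))) (scal (snd (F t)) (snd (G' t)))).
    by rewrite /minus /plus /opp /scal /= /mult /=; ring.
  rewrite e; apply: is_derive_minus; apply: is_derive_mult => //; exact: Rmult_comm.
have e : fst (F' t) * snd (G t) + snd (F' t) * fst (G t) + (fst (F t) * snd (G' t) + snd (F t) * fst (G' t)) =
    plus (plus (scal (fst (F' t)) (snd (G t))) (scal (fst (F t)) (snd (G' t))))
          (plus (scal (snd (F' t)) (fst (G t))) (scal (snd (F t)) (fst (G' t)))).
  by rewrite /plus /scal /= /mult /=; ring.
rewrite e; apply: is_derive_plus; apply: is_derive_mult => //; exact: Rmult_comm.
Qed.

Lemma cder_plus F F' G G' : cder F F' -> cder G G' -> cder (fun t => F t + G t)%C (fun t => F' t + G' t)%C.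
Proof.
move=> hF hG t; have [f1 f2] := hF t; have [g1 g2] := hG t; split.
  exact: (is_derive_plus _ _ _ _ _ f1 g1).
exact: (is_derive_plus _ _ _ _ _ f2 g2).
Qed.

Lemma cder_const c : cder (fun _ => c) (fun _ => RtoC 0).
Proof. by move=> t; split; apply: is_derive_const. Qed.

Lemma cder_cis (f f' : R -> R) : (forall t, is_derive f t (f' t)) ->
  cder (fun t => cis (f t)) (fun t => (0, f' t) * cis (f t))%C.
Proof.
move=> h t; split => /=.
  have -> : 0 * cos (f t) - f' t * sin (f t) = scal (f' t) (- sin (f t)) by rewrite /scal /= /mult /=; ring.
  by apply: (is_derive_comp cos f) => //; apply/is_derive_Reals; apply: derivable_pt_lim_cos.
have -> : 0 * sin (f t) + f' t * cos (f t) = scal (f' t) (cos (f t)) by rewrite /scal /= /mult /=; ring.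
by apply: (is_derive_comp sin f) => //; apply/is_derive_Reals; apply: derivable_pt_lim_sin.
Qed.

Lemma cder_exp (f f' : R -> R) : (forall t, is_derive f t (f' t)) ->
  cder (fun t => RtoC (exp (f t))) (fun t => RtoC (f' t) * RtoC (exp (f t)))%C.
Proof.
move=> h t; split => /=.
  have -> : f' t * exp (f t) - 0 * 0 = scal (f' t) (exp (f t)) by rewrite /scal /= /mult /=; ring.
  by apply: (is_derive_comp exp f) => //; apply/is_derive_Reals; apply: derivable_pt_lim_exp.
have -> : f' t * 0 + 0 * exp (f t) = 0 by ring.
exact: is_derive_const.
Qed.

Lemma Cint_der F F' a b : cder F F' -> ccont F' -> Cint F' a b = (F b - F a)%C.
Proof.
move=> h /ccont_comp [h1 h2]; rewrite /Cint.
have r1 := @is_RInt_derive R_CompleteNormedModule _ _ a b (fun s _ => proj1 (h s)) (fun s _ => h1 s).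
have r2 := @is_RInt_derive R_CompleteNormedModule _ _ a b (fun s _ => proj2 (h s)) (fun s _ => h2 s).
by rewrite (is_RInt_unique _ _ _ _ r1) (is_RInt_unique _ _ _ _ r2).
Qed.

Lemma RInt_der (f : R -> R) a t : (forall t, continuous f t) -> is_derive (fun t => RInt f a t) t (f t).
Proof.
move=> h; apply: (is_derive_RInt f (fun t => RInt f a t) a t) => //.
by exists (mkposreal _ Rlt_0_1) => y _; apply: RInt_correct; apply: ex_RInt_cont.
Qed.

Lemma cder_Cint G a : ccont G -> cder (fun t => Cint G a t) G.
Proof. by move=> /ccont_comp [h1 h2] t; split; apply: RInt_der. Qed.

Lemma cder_periodic F F' P : cder F F' -> (forall t, F (t + P) = F t) -> forall t, F' (t + P) = F' t.
Proof.
move=> h hp t.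
have [a1 a2] := h t; have [b1 b2] := h (t + P).
have s1 : is_derive (fun s => fst (F (s + P))) t (fst (F' (t + P))).
  have := is_derive_comp (fun s => fst (F s)) (fun s => s + P) t _ 1 b1 ltac:(auto_derive => //).
  by rewrite /scal /= /mult /= Rmult_1_l.
have s2 : is_derive (fun s => snd (F (s + P))) t (snd (F' (t + P))).
  have := is_derive_comp (fun s => snd (F s)) (fun s => s + P) t _ 1 b2 ltac:(auto_derive => //).
  by rewrite /scal /= /mult /= Rmult_1_l.
have e1 := is_derive_unique _ _ _ (is_derive_ext _ (fun s => fst (F s)) _ _ (fun s => congr1 fst (hp s)) s1).
have e2 := is_derive_unique _ _ _ (is_derive_ext _ (fun s => snd (F s)) _ _ (fun s => congr1 snd (hp s)) s2).
rewrite (is_derive_unique _ _ _ a1) in e1; rewrite (is_derive_unique _ _ _ a2) in e2.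
by case: (F' (t + P)) e1 e2 => x y /= <- <-; case: (F' t).
Qed.

Section ODE.
Variables al be : R -> R.
Hypothesis Hal : forall t, continuous al t.
Hypothesis Hbe : forall t, continuous be t.
Hypothesis Pal : forall t, al (t + 2 * PI) = al t.
Hypothesis Pbe : forall t, be (t + 2 * PI) = be t.

Definition At t := RInt al 0 t.
Definition Bt t := RInt be 0 t.
(** Integrating factor: (Ef V)' = Ef (V' + i (al + i be) V). Its modulus depends on [Bt] only. *)
Definition Ef t : C := (RtoC (exp (- Bt t)) * cis (At t))%C.
Definition Ei t : C := (RtoC (exp (Bt t)) * cis (- At t))%C.
Definition qf : C := Ef (2 * PI).

Lemma Ef_der : cder Ef (fun t => (0, 1) * (al t, be t) * Ef t)%C.
Proof.
have dA t : is_derive At t (al t) by apply: RInt_der.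
have dB t : is_derive (fun s => - Bt s) t (- be t).
  by apply: (is_derive_opp Bt); apply: RInt_der.
apply: cder_ext (cder_mult (cder_exp dB) (cder_cis dA)) => t.
rewrite /Ef.
have -> : ((0, 1) * (al t, be t) = RtoC (- be t) + (0, al t) :> C)%C.
  by rewrite /Cmult /Cplus /RtoC /=; congr pair; ring.
ring.
Qed.

Lemma Ei_der : cder Ei (fun t => RtoC (-1) * ((0, 1) * (al t, be t)) * Ei t)%C.
Proof.
have dA t : is_derive (fun s => - At s) t (- al t).
  by apply: (is_derive_opp At); apply: RInt_der.
have dB t : is_derive Bt t (be t) by apply: RInt_der.
apply: cder_ext (cder_mult (cder_exp dB) (cder_cis dA)) => t.
rewrite /Ei.
have -> : (RtoC (-1) * ((0, 1) * (al t, be t)) = RtoC (be t) + (0, (- al t)%R) :> C)%C.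
  by rewrite /Cmult /Cplus /RtoC /=; congr pair; ring.
ring.
Qed.

Lemma Ef_Ei t : (Ei t * Ef t = RtoC 1)%C.
Proof.
rewrite /Ef /Ei.
have -> : (RtoC (exp (Bt t)) * cis (- At t) * (RtoC (exp (- Bt t)) * cis (At t)) =
  (RtoC (exp (Bt t)) * RtoC (exp (- Bt t))) * (cis (At t) * cis (- At t)))%C by ring.
by rewrite cis_neg -RtoC_mult -exp_plus Rplus_opp_r exp_0; ring.
Qed.

Lemma Ef_mod t : Cmod (Ef t) = exp (- Bt t).
Proof. by rewrite Cmod_mult Cmod_cis Cmod_R Rmult_1_r Rabs_right //; apply: Rle_ge; apply: Rlt_le; apply: exp_pos. Qed.

Lemma RInt_quasi (f : R -> R) t : (forall t, continuous f t) -> (forall t, f (t + 2 * PI) = f t) ->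
  RInt f 0 (t + 2 * PI) = RInt f 0 (2 * PI) + RInt f 0 t.
Proof.
move=> hf hp; have := RInt_Chasles f 0 t (t + 2 * PI) (ex_RInt_cont _ _ hf) (ex_RInt_cont _ _ hf).
by rewrite RInt_periodic // /plus /= => <-; ring.
Qed.

Lemma Ef_quasi t : Ef (t + 2 * PI) = (qf * Ef t)%C.
Proof.
rewrite /qf /Ef /At /Bt !RInt_quasi // Ropp_plus_distr exp_plus RtoC_mult cis_add; ring.
Qed.

Lemma Bt_sub s t : Bt t - Bt s = RInt be s t.
Proof.
have := RInt_Chasles be 0 s t (ex_RInt_cont _ _ Hbe) (ex_RInt_cont _ _ Hbe).
by rewrite /plus /= /Bt => <-; ring.
Qed.

Lemma Bt_mono s t : (forall r, 0 <= be r) -> s <= t -> Bt s <= Bt t.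
Proof.
move=> h hst; have := Bt_sub s t.
have : 0 <= RInt be s t by apply: RInt_ge_0 => //; exact: ex_RInt_cont.
lra.
Qed.

Lemma Bt_anti s t : (forall r, be r <= 0) -> s <= t -> Bt t <= Bt s.
Proof.
move=> h hst; have := Bt_sub s t.
have : RInt be s t <= RInt (fun _ => 0) s t.
  by apply: RInt_le => //; [exact: ex_RInt_cont | apply: ex_RInt_const].
rewrite RInt_const /scal /= /mult /=; lra.
Qed.

Section Solution.
Variables V V' H : R -> C.
Hypothesis HV : cder V V'.
Hypothesis HH : ccont H.
Hypothesis Heq : forall t, (V' t + (0, 1) * (al t, be t) * V t)%C = H t.

Lemma ode_ccont : ccont (fun t => Ef t * H t)%C.
Proof. by apply: ccont_mult => //; apply: cder_cont Ef_der. Qed.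

Lemma ode_int a b : Cint (fun t => Ef t * H t)%C a b = (Ef b * V b - Ef a * V a)%C.
Proof.
rewrite -(@Cint_der (fun t => Ef t * V t)%C (fun t => Ef t * H t)%C) //; last exact: ode_ccont.
by apply: cder_ext (cder_mult Ef_der HV) => t; rewrite -Heq; ring.
Qed.

Hypothesis PV : forall t, V (t + 2 * PI) = V t.

Lemma ode_identity t : Cint (fun t => Ef t * H t)%C t (t + 2 * PI) = ((qf - RtoC 1) * (Ef t * V t))%C.
Proof. by rewrite ode_int PV Ef_quasi; ring. Qed.

(** As |Ef| decreases, on the period that starts at t it is at most its value at t, which cancels
    from [ode_identity]. *)
Lemma ode_bound_pos M t : (forall r, 0 <= be r) -> (forall r, Cmod (H r) <= M) ->
  Cmod (qf - RtoC 1)%C * Cmod (V t) <= 2 * PI * M.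
Proof.
move=> hb hM; have hp := pi2_pos.
have h1 : Cmod (Cint (fun t => Ef t * H t)%C t (t + 2 * PI)) <= (t + 2 * PI - t) * (exp (- Bt t) * M).
  apply: Cint_bound; [exact: ode_ccont | lra |] => s hs.
  rewrite Cmod_mult Ef_mod; apply: Rmult_le_compat => //; [apply: Rlt_le; apply: exp_pos | apply: Cmod_ge_0 |].
  by apply: exp_le; have := @Bt_mono t s hb ltac:(lra); lra.
rewrite ode_identity (Cmod_mult (qf - _)) (Cmod_mult (Ef t)) Ef_mod in h1.
have he := exp_pos (- Bt t).
apply: (Rmult_le_reg_l (exp (- Bt t))) => //; lra.
Qed.

(** Now |Ef| increases and is compared with its value at the end of the period, whence the factor
    |q|. *)
Lemma ode_bound_neg M t : (forall r, be r <= 0) -> (forall r, Cmod (H r) <= M) ->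
  Cmod (qf - RtoC 1)%C * Cmod (V t) <= Cmod qf * (2 * PI * M).
Proof.
move=> hb hM; have hp := pi2_pos.
have h1 : Cmod (Cint (fun t => Ef t * H t)%C t (t + 2 * PI)) <= (t + 2 * PI - t) * (Cmod qf * exp (- Bt t) * M).
  apply: Cint_bound; [exact: ode_ccont | lra |] => s hs.
  rewrite Cmod_mult -(Ef_mod t) -(Cmod_mult qf) -Ef_quasi !Ef_mod.
  apply: Rmult_le_compat => //; [apply: Rlt_le; apply: exp_pos | apply: Cmod_ge_0 |].
  by apply: exp_le; have := @Bt_anti s (t + 2 * PI) hb ltac:(lra); lra.
rewrite ode_identity (Cmod_mult (qf - _)) (Cmod_mult (Ef t)) Ef_mod in h1.
have he := exp_pos (- Bt t).
apply: (Rmult_le_reg_l (exp (- Bt t))) => //; lra.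
Qed.

Lemma ode_unique : qf <> RtoC 1 -> (forall t, H t = RtoC 0) -> forall t, V t = RtoC 0.
Proof.
move=> hq h0 t.
have e : Cint (fun t => Ef t * H t)%C t (t + 2 * PI) = RtoC 0.
  by rewrite (@Cint_ext _ (fun _ => RtoC 0)) ?Cint_zero // => s _; rewrite h0; ring.
rewrite ode_identity in e.
have hm : Cmod (qf - RtoC 1)%C * (Cmod (Ef t) * Cmod (V t)) = 0.
  by rewrite -(Cmod_mult (Ef t)) -Cmod_mult e Cmod_0.
have h1 : 0 < Cmod (qf - RtoC 1)%C.
  apply/Cmod_gt_0 => h; apply: hq.
  have -> : (qf = (qf - RtoC 1) + RtoC 1)%C by ring.
  by rewrite h; ring.
have h2 : 0 < Cmod (Ef t) by rewrite Ef_mod; apply: exp_pos.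
by apply: Cmod_eq_0; case: (Rmult_integral _ _ hm) => [|/Rmult_integral []]; lra.
Qed.

End Solution.

Lemma ode_exist H : ccont H -> (forall t, H (t + 2 * PI) = H t) -> qf <> RtoC 1 ->
  exists V V', cder V V' /\ ccont V' /\ (forall t, V (t + 2 * PI) = V t) /\
   forall t, (V' t + (0, 1) * (al t, be t) * V t)%C = H t.
Proof.
move=> hH pH hq.
have hE := cder_cont Ef_der.
have hG : ccont (fun t => Ef t * H t)%C by apply: ccont_mult.
pose P t := Cint (fun t => Ef t * H t)%C 0 t.
have dP : cder P (fun t => Ef t * H t)%C by apply: cder_Cint.
have hq1 : (qf - RtoC 1)%C <> RtoC 0.
  move=> h; apply: hq; have -> : (qf = (qf - RtoC 1) + RtoC 1)%C by ring.
  by rewrite h; ring.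
(* The initial value that closes the solution up: periodicity amounts to v0 + P(2 pi) = q v0. *)
pose v0 := (P (2 * PI)%R / (qf - RtoC 1))%C.
pose V t := (Ei t * (v0 + P t))%C.
pose V' t := (RtoC (-1) * ((0, 1) * (al t, be t)) * Ei t * (v0 + P t) + Ei t * (Ef t * H t))%C.
have dV : cder V V'.
  apply: cder_ext (cder_mult Ei_der (cder_plus (cder_const v0) dP)) => t; rewrite /V'; ring.
exists V, V'; split=> //.
have eq : forall t, (V' t + (0, 1) * (al t, be t) * V t)%C = H t.
  move=> t; transitivity ((Ei t * Ef t) * H t)%C; first by rewrite /V /V'; ring.
  by rewrite Ef_Ei; ring.
split.
  apply: (@ccont_ext (fun t => H t + RtoC (-1) * ((0, 1) * (al t, be t)) * V t)%C).
    by move=> t; rewrite -eq; ring.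
  apply: ccont_plus => //; apply: ccont_mult; last exact: cder_cont dV.
  apply: ccont_mult; first exact: ccont_const.
  apply: ccont_mult; first exact: ccont_const.
  by apply/ccont_comp; split=> t /=.
split=> // t.
have e1 : P (t + 2 * PI) = (P (2 * PI)%R + qf * P t)%C.
  have c1 := Cint_shift 0 t (2 * PI) hG.
  have -> : P (t + 2 * PI) = (P (2 * PI)%R + Cint (fun t => Ef t * H t)%C (2 * PI)%R (t + 2 * PI)%R)%C.
    have [h1 h2] := proj1 (ccont_comp _) hG.
    rewrite /P /Cint /Cplus /=; congr pair.
      by have := RInt_Chasles _ 0 (2 * PI) (t + 2 * PI) (ex_RInt_cont _ _ h1) (ex_RInt_cont _ _ h1).
    by have := RInt_Chasles _ 0 (2 * PI) (t + 2 * PI) (ex_RInt_cont _ _ h2) (ex_RInt_cont _ _ h2).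
  rewrite Rplus_0_l in c1; rewrite -c1 (@Cint_ext _ (fun s => qf * (Ef s * H s))%C).
    by rewrite Cint_scal.
  by move=> s _; rewrite pH Ef_quasi; ring.
have e2 : (Ei (t + 2 * PI)%R * qf = Ei t)%C.
  have h1 := Ef_Ei (t + 2 * PI); rewrite Ef_quasi in h1.
  have h2 := Ef_Ei t.
  have -> : (Ei (t + 2 * PI)%R * qf = Ei (t + 2 * PI)%R * qf * (Ei t * Ef t))%C by rewrite h2; ring.
  have -> : (Ei (t + 2 * PI)%R * qf * (Ei t * Ef t) = Ei (t + 2 * PI)%R * (qf * Ef t) * Ei t)%C by ring.
  by rewrite h1; ring.
have e3 : (v0 + P (2 * PI)%R = qf * v0)%C.
  have e4 : ((qf - RtoC 1) * v0 = P (2 * PI)%R)%C by rewrite /v0; field.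
  by rewrite -e4; ring.
rewrite /V e1 -e2.
have -> : (v0 + (P (2 * PI)%R + qf * P t) = (v0 + P (2 * PI)%R) + qf * P t)%C by ring.
by rewrite e3; ring.
Qed.

End ODE.

(** Two doublings of the angle starting from w = z/4 <= 1/2, where sin w >= 3w/4; this gives 21/64,
    rounded to 5/16. *)
Lemma sin_low z : 0 <= z <= PI / 2 -> 5 / 16 * z <= sin z.
Proof.
move=> [h0 h1]; have hpi := PI_4.
pose w := z / 4.
have hw : 0 <= w <= 1 / 2 by rewrite /w; lra.
have -> : z = 2 * (2 * w) by rewrite /w; field.
rewrite sin_2a sin_2a.
have s1 : 3 / 4 * w <= sin w.
  have := Rabs_sin_sub w; rewrite (Rabs_right w); last lra.
  move=> h; have := Rle_trans _ _ _ (Rle_abs _) (Req_le _ _ (Rabs_Ropp (sin w - w))); nra.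
have c1 := cos_ge_quad w; have c2 := cos_ge_quad (2 * w).
have k1 : 7 / 8 <= cos w by nra.
have k2 : 1 / 2 <= cos (2 * w) by nra.
have k3 : 21 / 16 * w <= 2 * sin w * cos w by nra.
nra.
Qed.

(** Relates the multiplier to the Diophantine quantity, -tau being an integer nearest to x. With d =
    tau + x and rho = exp(-2 pi y), the square of |q - 1| is (1 - rho)^2 + 4 rho sin^2(pi d). If rho
    > 1/2 the two terms dominate y^2 and d^2; otherwise |q - 1| >= 1/2. *)
Lemma qlow x y : 0 <= y -> exists tau : Z, Rabs (IZR tau + x) <= 1 / 2 /\
  Rmin (1 / 2) (Cmod (IZR tau + x, y)) <= Cmod (RtoC (exp (- (2 * PI * y))) * cis (2 * PI * x) - RtoC 1)%C.
Proof.
move=> hy.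
have [h1 h2] := archimed (x - 1 / 2).
pose n := up (x - 1 / 2).
exists (- n)%Z; rewrite opp_IZR.
pose d := - IZR n + x.
have hd : Rabs d <= 1 / 2 by apply: Rabs_le; rewrite /d /n; lra.
split=> //; rewrite -/d.
have hpi := PI_RGT_0; have hpi3 := PI2_3_2.
have e : cis (2 * PI * x) = cis (2 * PI * d).
  have -> : 2 * PI * x = 2 * PI * d + IZR n * (2 * PI) by rewrite /d; ring.
  by rewrite cis_add cis_2piZ; ring.
rewrite e; set rho := exp _.
have hr0 : 0 < rho by apply: exp_pos.
have hr1 : rho <= 1 by rewrite /rho -exp_0; apply: exp_le; nra.
case: (Rle_dec rho (1 / 2)) => hr.
  apply: Rle_trans (Rmin_l _ _) _.
  have := Cmod_sub_le (RtoC 1) (RtoC rho * cis (2 * PI * d))%C.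
  rewrite Cmod_1 Cmod_mult Cmod_cis Cmod_R Rabs_right ?Rmult_1_r; last lra.
  rewrite Cmod_minus_sym; lra.
apply: Rle_trans (Rmin_r _ _) _.
rewrite {1}/Cmod; rewrite /Cmod; apply: sqrt_le_1_alt => /=.
have hyr : y <= 1 - rho.
  have h3 : 1 + 2 * PI * y <= exp (2 * PI * y) by apply: exp_ineq1_le.
  have h4 : rho * exp (2 * PI * y) = 1 by rewrite /rho -exp_plus Rplus_comm Rplus_opp_r exp_0.
  have h5 : rho * (1 + 2 * PI * y) <= 1 by rewrite -h4; apply: Rmult_le_compat_l => //; lra.
  have h6 : 1 * y <= rho * (2 * PI) * y by apply: Rmult_le_compat_r => //; nra.
  lra.
have hs : d ^ 2 * (15 / 16) ^ 2 <= sin (PI * d) ^ 2.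
  have hz : 0 <= PI * Rabs d <= PI / 2 by have := Rabs_pos d; nra.
  have h7 := sin_low hz.
  have h8 : sin (PI * d) ^ 2 = sin (PI * Rabs d) ^ 2.
    rewrite /Rabs; case: Rcase_abs => _ //.
    by rewrite -Ropp_mult_distr_r sin_neg; ring.
  rewrite h8 -(pow2_abs d); have := Rabs_pos d => h9.
  have h10 : 15 / 16 * Rabs d <= sin (PI * Rabs d) by nra.
  nra.
have ec : cos (2 * PI * d) = 1 - 2 * sin (PI * d) ^ 2.
  have -> : 2 * PI * d = 2 * (PI * d) by ring.
  by rewrite cos_2a_sin; ring.
have esc : sin (2 * PI * d) ^ 2 = 1 - cos (2 * PI * d) ^ 2.
  by have := sin2_cos2 (2 * PI * d); rewrite /Rsqr => h; simpl; lra.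
have hsr : d * (d * 1) <= 4 * rho * sin (PI * d) ^ 2.
  have := pow2_ge_0 (sin (PI * d)); simpl in hs |- *; nra.
move: (sin (2 * PI * d)) (cos (2 * PI * d)) esc ec => S K esc ec.
have -> : (rho * K - 0 * S + - (1)) * ((rho * K - 0 * S + - (1)) * 1) + (rho * S + 0 * K + - 0) * ((rho * S + 0 * K + - 0) * 1) =
  rho ^ 2 * (K ^ 2 + S ^ 2) - 2 * rho * K + 1 by ring.
rewrite esc ec.
have : y ^ 2 <= (1 - rho) ^ 2 by apply: pow_incr; lra.
simpl in hsr |- *; lra.
Qed.

(** * Regularity in the first variable *)

Lemma periodic_shiftZ (T : Type) (f : R -> T) : (forall t, f (t + 2 * PI) = f t) ->
  forall (k : Z) t, f (t + IZR k * (2 * PI)) = f t.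
Proof.
move=> hp.
have hn : forall (m : nat) t, f (t + INR m * (2 * PI)) = f t.
  elim=> [|m IH] t; first by rewrite /= Rmult_0_l Rplus_0_r.
  by rewrite S_INR (_ : t + (INR m + 1) * (2 * PI) = t + INR m * (2 * PI) + 2 * PI) ?hp //; ring.
move=> k t; have [m [e | e]] : exists m, k = Z.of_nat m \/ k = (- Z.of_nat m)%Z by exists (Z.abs_nat k); lia.
  by rewrite e -INR_IZR_INZ hn.
rewrite e opp_IZR -INR_IZR_INZ -(hn m (t + _)); congr f; ring.
Qed.

Lemma periodic_reduce (T : Type) (f : R -> T) a t : (forall t, f (t + 2 * PI) = f t) ->
  exists s, a <= s <= a + 2 * PI /\ f t = f s.
Proof.
move=> hp; have h0 := pi2_pos.
have [h1 h2] := archimed ((t - a) / (2 * PI)).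
set n := up _ in h1 h2.
exists (t + IZR (1 - n) * (2 * PI)); split; last by rewrite periodic_shiftZ.
have e : (t - a) = (t - a) / (2 * PI) * (2 * PI) by field; lra.
rewrite minus_IZR; nra.
Qed.

Lemma periodic_bounded (g : R -> C) : ccont g -> (forall t, g (t + 2 * PI) = g t) ->
  exists M, 0 <= M /\ forall t, Cmod (g t) <= M.
Proof.
move=> hg hp; have [M [hM H]] := @ccont_bounded g 0 (2 * PI) hg (Rlt_le _ _ pi2_pos).
exists M; split=> // t; have [s [hs ->]] := periodic_reduce 0 t hp; apply: H; lra.
Qed.

Definition coef1 (V : R -> C) (tau : Z) : C := coef (lift1 V) (cz tau).

Lemma coef1_int V tau : ccont V ->
  coef1 V tau = (RtoC (/ (2 * PI)) * Cint (fun s => V s * cis (IZR (- tau) * s))%C 0 (2 * PI))%C.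
Proof.
move=> hV; rewrite /coef1 /coef pow_1; congr Cmult; rewrite /intT enum_I1 ic_cons.
  apply: Cint_ext => s _; rewrite /int_coords /lift1 upd_same /ek.
  have -> : negz (cz tau) = cz (- tau) by [].
  by rewrite dot_cz upd_same.
by apply: contC_ek_mul; apply/ccont_lift1.
Qed.

Lemma coef1_der V V' tau : cder V V' -> ccont V' -> (forall t, V (t + 2 * PI) = V t) ->
  coef1 V' tau = ((0, IZR tau) * coef1 V tau)%C.
Proof.
move=> hd hc hp; have cV := cder_cont hd; rewrite !coef1_int //.
pose m := IZR (- tau).
have dc : cder (fun s => cis (m * s)) (fun s => (0, m) * cis (m * s))%C.
  by apply: (@cder_cis (fun s => m * s) (fun _ => m)) => s; auto_derive => //; ring.
have cc : ccont (fun s => cis (m * s)) by apply: cis_contR.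
have dF := cder_mult hd dc.
have c1 : ccont (fun s => V' s * cis (m * s))%C by apply: ccont_mult.
have c2 : ccont (fun s => V s * cis (m * s))%C by apply: ccont_mult.
have cF : ccont (fun s => V' s * cis (m * s) + V s * ((0, m) * cis (m * s)))%C.
  by apply: ccont_plus => //; apply: ccont_mult => //; apply: ccont_mult => //; apply: ccont_const.
have h := Cint_der 0 (2 * PI) dF cF.
have e0 : V (2 * PI) = V 0 by rewrite -{1}(Rplus_0_l (2 * PI)) hp.
rewrite e0 /m cis_2piZ Rmult_0_r cis_0 -/m in h.
rewrite (@Cint_ext _ (fun s => (0, m) * (V s * cis (m * s)) + V' s * cis (m * s))%C) in h; last by move=> s _; ring.
rewrite Cint_lin // in h.
set A := Cint _ _ _ in h; set B := Cint _ _ _ in h.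
rewrite -/A -/B.
have hB : B = (RtoC (-1) * (0, m) * A)%C.
  have -> : (B = ((0, m) * A + B) + RtoC (-1) * (0, m) * A)%C by ring.
  by rewrite h; ring.
have e1 : (RtoC (-1) * (0, m) = (0, IZR tau) :> C)%C.
  by rewrite /m opp_IZR /RtoC /Cmult /=; congr pair; ring.
by rewrite hB e1; ring.
Qed.

Section Fibre.
Variable om : R -> R.
Hypothesis Hw : weight_function om.
Hypothesis Hs : subadditive om.
Notation W := (W om).
Notation cd := (cd om).
Notation omZ := (omZ om).

Lemma omZ_neg s : omZ (- s) = omZ s.
Proof. by rewrite /omZ opp_IZR Rabs_Ropp. Qed.

Section Op.
Variables (N : nat) (cf : 'I_N -> R -> C) (B d0 : R).
Hypothesis Hd0 : 0 < d0.
Hypothesis HB0 : 0 <= B.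
Hypothesis Hcf : forall j, cd (lift1 (cf j)) B d0.
Notation gam := (gam cf).

(* The weight [min (del om) (kap - eps om)] makes the supremum finite a priori; its increments are still
   controlled by [om], so that the convolution estimate is uniform in [kap]. *)
Lemma reg : exists Gam, 1 <= Gam /\ forall del eps Cu xi u g A lam Bu M, 0 < del -> del <= d0 / 2 ->
  0 < eps -> eps <= d0 / 2 -> L1rel gam xi u g ->
  (forall tau, Cmod (u tau) <= Cu * exp (eps * omZ tau)) ->
  0 <= A -> 0 <= lam ->
  (forall tau, Cmod (g tau) <= A * exp (- del * omZ tau) + lam * Cmod (u tau)) ->
  1 <= M -> 4 * lam <= M -> 4 * nrm1 xi * Gam <= M ->
  (forall tau, Rabs (IZR tau) < M -> Cmod (u tau) <= Bu * exp (- del * omZ tau)) ->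
  forall tau, Cmod (u tau) <= 2 * (A + Bu) * exp (- del * omZ tau).
Proof.
have [K [hK HK]] := @zs_exp_omZ om Hw (d0 / 2) ltac:(lra).
exists (B * K + 1); split; first by have := Rmult_le_pos _ _ HB0 (Rlt_le _ _ hK); lra.
move=> del eps Cu xi u g A lam Bu M hdel hdel2 heps heps2 hL hu hA hlam hg hM1 hMl hM2 hBu tau0.
have hBK : 0 <= B * K by apply: Rmult_le_pos; lra.
have posf : forall x y a, 0 <= x -> x <= y * exp a -> 0 <= y.
  by move=> x y a h1 h2; have := exp_pos a; nra.
have hBu0 : 0 <= Bu by apply: posf (Cmod_ge_0 _) (hBu 0%Z _); rewrite Rabs_R0; lra.
have hCu : 0 <= Cu := posf _ _ _ (Cmod_ge_0 _) (hu 0%Z).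
(* Makes the two branches of the minimum agree at [tau0], where the bound is read off in the end. *)
pose kap := (del + eps) * omZ tau0.
pose lw s := Rmin (del * omZ s) (kap - eps * omZ s).
have lw1 : forall s, lw s <= del * omZ s by move=> s; apply: Rmin_l.
have lw2 : forall s, lw s <= kap - eps * omZ s by move=> s; apply: Rmin_r.
(* By subadditivity a shift by t changes either branch by at most (d0/2) omega(t), as both [del] and
   [eps] are at most d0/2. *)
have lw3 : forall s t, lw s <= lw (s - t)%Z + d0 / 2 * omZ t.
  move=> s t; have o1 := omZ_add Hw Hs (s - t) t; have o2 := omZ_add Hw Hs s (- t).
  rewrite omZ_neg in o2; have e1 : (s - t + t)%Z = s by lia.
  rewrite e1 in o1; have e2 : (s + - t)%Z = (s - t)%Z by lia.
  rewrite e2 in o2.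
  have p1 := omZ_ge0 Hw t; have p2 := omZ_ge0 Hw s; have p3 := omZ_ge0 Hw (s - t).
  have q1 := lw1 s; have q2 := lw2 s.
  have r1 : del * omZ s <= del * omZ (s - t) + d0 / 2 * omZ t by nra.
  have r2 : kap - eps * omZ s <= kap - eps * omZ (s - t) + d0 / 2 * omZ t by nra.
  have q3 : lw s - d0 / 2 * omZ t <= lw (s - t)%Z by apply: Rmin_glb; lra.
  lra.
pose E r := exists s, r = Cmod (u s) * exp (lw s).
have hE : bound E.
  exists (Cu * exp kap) => r [s ->].
  apply: Rle_trans (Rmult_le_compat_r _ _ _ (Rlt_le _ _ (exp_pos _)) (hu s)) _.
  rewrite Rmult_assoc -exp_plus; apply: Rmult_le_compat_l => //; apply: exp_le.
  by have := lw2 s; lra.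
have [S [hS1 hS2]] := completeness E hE ltac:(by exists (Cmod (u 0%Z) * exp (lw 0%Z)); exists 0%Z).
have hSu : forall s, Cmod (u s) <= S * exp (- lw s).
  move=> s; have h := hS1 _ (ex_intro _ s erefl).
  have := Rmult_le_compat_r _ _ _ (Rlt_le _ _ (exp_pos (- lw s))) h.
  by rewrite Rmult_assoc -exp_plus Rplus_opp_r exp_0 Rmult_1_r.
have hS0 : 0 <= S := posf _ _ _ (Cmod_ge_0 _) (hSu 0%Z).
(* For |tau| < M the bound [Bu] applies. For |tau| >= M the term in [lam] and the convolution are
   each at most M S / 4, so division by M leaves S / 2, which is then absorbed. *)
have key : forall s, Cmod (u s) * exp (lw s) <= A + Bu + S / 2.
  move=> s; have hel := exp_pos (lw s).
  case: (Rlt_dec (Rabs (IZR s)) M) => hs.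
    apply: Rle_trans (_ : Bu <= _); last lra.
    apply: Rle_trans (Rmult_le_compat_r _ _ _ (Rlt_le _ _ hel) (hBu s hs)) _.
    rewrite Rmult_assoc -exp_plus -{2}(Rmult_1_r Bu) -exp_0; apply: Rmult_le_compat_l => //.
    by apply: exp_le; have := lw1 s; lra.
  have [P [hP e]] := hL s.
  have hPb : forall j, Cmod (P j) <= B * K * (S * exp (- lw s)).
    move=> j; apply: (Cconv_le (hP j)) => r.
    apply: Rle_trans (@zs_dom_diff _ (fun t => exp (- (d0 / 2) * omZ t) * (B * (S * exp (- lw s)))) r _) _.
      move=> t; rewrite Cmod_mult.
      apply: Rle_trans (Rmult_le_compat _ _ _ _ (Cmod_ge_0 _) (Cmod_ge_0 _) (gam_bound Hcf j t) (hSu (s - t)%Z)) _.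
      have -> : B * exp (- d0 * omZ t) * (S * exp (- lw (s - t)%Z)) =
        B * S * (exp (- d0 * omZ t) * exp (- lw (s - t)%Z)) by ring.
      have -> : exp (- (d0 / 2) * omZ t) * (B * (S * exp (- lw s))) =
        B * S * (exp (- (d0 / 2) * omZ t) * exp (- lw s)) by ring.
      apply: Rmult_le_compat_l; first exact: Rmult_le_pos.
      rewrite -!exp_plus; apply: exp_le; have := lw3 s t; lra.
    have hz : 0 <= B * (S * exp (- lw s)).
      by apply: Rmult_le_pos => //; apply: Rmult_le_pos => //; apply: Rlt_le; apply: exp_pos.
    apply: Rle_trans (@zs_const_le r _ (fun t => exp (- (d0 / 2) * omZ t)) _ _ hz) _; first by move=> i; lra.
    have := Rmult_le_compat_r _ _ _ hz (HK r); lra.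
  have hsum : Cmod (sumC (fun j => (0, IZR (xi j)) * P j)%C) <= nrm1 xi * (B * K * (S * exp (- lw s))).
    apply: Rle_trans (Cmod_sumC _) _; rewrite Rmult_comm /nrm1 -sumR_scal; apply: sumR_le => j.
    rewrite Cmod_mult Cmod_imag Rmult_comm; apply: Rmult_le_compat_r; first exact: Rabs_pos.
    exact: hPb.
  have hts : Rabs (IZR s) * Cmod (u s) <= A * exp (- del * omZ s) + lam * Cmod (u s) + nrm1 xi * (B * K * (S * exp (- lw s))).
    have -> : Rabs (IZR s) * Cmod (u s) = Cmod ((0, IZR s) * u s)%C by rewrite Cmod_mult Cmod_imag.
    have -> : ((0, IZR s) * u s = g s - sumC (fun j => (0, IZR (xi j)) * P j))%C by rewrite e; ring.
    apply: Rle_trans (Cmod_triangle _ _) _; rewrite Cmod_opp; have := hg s; lra.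
  have h2 : Rabs (IZR s) * (Cmod (u s) * exp (lw s)) <= A + lam * (Cmod (u s) * exp (lw s)) + nrm1 xi * (B * K * S).
    rewrite -Rmult_assoc; apply: Rle_trans (Rmult_le_compat_r _ _ _ (Rlt_le _ _ hel) hts) _.
    rewrite !Rmult_plus_distr_r (Rmult_assoc lam).
    have -> : nrm1 xi * (B * K * (S * exp (- lw s))) * exp (lw s) =
       nrm1 xi * (B * K * S) * (exp (- lw s) * exp (lw s)) by ring.
    rewrite (Rmult_assoc A) -!exp_plus Rplus_opp_l exp_0 Rmult_1_r; apply: Rplus_le_compat_r; apply: Rplus_le_compat_r.
    rewrite -{2}(Rmult_1_r A) -exp_0; apply: Rmult_le_compat_l => //; apply: exp_le.
    by have := lw1 s; lra.
  have hn := nrm1_ge0 xi.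
  have h3 : nrm1 xi * (B * K * S) <= M / 4 * S.
    have -> : nrm1 xi * (B * K * S) = (nrm1 xi * (B * K)) * S by ring.
    apply: Rmult_le_compat_r => //; lra.
  have hM0 : M <= Rabs (IZR s) by lra.
  have hx : 0 <= Cmod (u s) * exp (lw s) by apply: Rmult_le_pos; [apply: Cmod_ge_0 | lra].
  have hXS : Cmod (u s) * exp (lw s) <= S by apply: hS1; exists s.
  set X := Cmod (u s) * _ in h2 hx hXS *.
  have h7 : lam * X <= M / 4 * S by apply: Rmult_le_compat => //; lra.
  have h4 : M * X <= Rabs (IZR s) * X by apply: Rmult_le_compat_r.
  have h5 : M * X <= M * (A + S / 2) by nra.
  have h6 : X <= A + S / 2 by apply: (Rmult_le_reg_l M); lra.
  lra.
have hS : S <= A + Bu + S / 2 by apply: hS2 => r [s ->]; apply: key.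
have := hSu tau0.
have -> : lw tau0 = del * omZ tau0.
  by rewrite /lw Rmin_left // /kap; lra.
move=> h; apply: Rle_trans h _.
have -> : - del * omZ tau0 = - (del * omZ tau0) by ring.
apply: Rmult_le_compat_r; [apply: Rlt_le; apply: exp_pos | lra].
Qed.

(** A uniform bound U replaces the bound at low frequencies: with M proportional to |xi| these have
    omega(tau) <= Gam omega(xi). The price exp(del Gam omega(xi)) is controlled by the choice of
    [del]. *)
Lemma reg_bounded : exists Gam, 0 < Gam /\ forall del xi u g A lam U, 0 < del -> del <= d0 / 2 ->
  1 <= nrm1 xi -> L1rel gam xi u g ->
  (forall tau, Cmod (u tau) <= U) -> 0 <= A -> 0 <= lam <= 1 ->
  (forall tau, Cmod (g tau) <= A * exp (- del * omZ tau) + lam * Cmod (u tau)) ->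
  forall tau, Cmod (u tau) <= 2 * (A + U * exp (del * Gam * W xi)) * exp (- del * omZ tau).
Proof.
have [G [hG H]] := reg.
exists (4 * G + 1); split; first lra.
move=> del xi u g A lam U hd hd2 hxi hL hU hA hlam hg tau.
have hU0 : 0 <= U by have := Cmod_ge_0 (u 0%Z); have := hU 0%Z; lra.
apply: (H del del U xi u g A lam _ (4 * G * nrm1 xi)) => //; [|lra|nra|nra|lra|].
  move=> s; apply: Rle_trans (hU s) _; rewrite -{1}(Rmult_1_r U); apply: Rmult_le_compat_l => //.
  by rewrite -exp_0; apply: exp_le; apply: Rmult_le_pos; [lra | apply: omZ_ge0].
move=> s hs; apply: Rle_trans (hU s) _; rewrite Rmult_assoc -exp_plus -{1}(Rmult_1_r U).
apply: Rmult_le_compat_l => //; rewrite -[X in X <= _]exp_0; apply: exp_le.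
have h1 : omZ s <= (4 * G + 1) * W xi.
  apply: Rle_trans (_ : om (4 * G * nrm1 xi) <= _).
    by apply: om_mono => //; [apply: Rabs_pos | lra].
  by apply: om_mulR => //; [lra | apply: nrm1_ge0].
have := Rmult_le_compat_l _ _ _ (Rlt_le _ _ hd) h1; lra.
Qed.

Definition cxi (xi : 'I_N -> Z) (t : R) : C := sumC (fun j => RtoC (IZR (xi j)) * cf j t)%C.

Lemma ode_L1rel xi V V' H : cder V V' -> ccont V' -> (forall t, V (t + 2 * PI) = V t) ->
  (forall t, V' t + (0, 1) * cxi xi t * V t = H t)%C -> L1rel gam xi (coef1 V) (coef1 H).
Proof.
move=> hd hc hp hH tau; have cV := cder_cont hd.
have [M [_ hM]] := periodic_bounded cV hp.
have fc : contC (lift1 V) by apply/ccont_lift1.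
exists (fun j => coef (fun x : pt 1 => cf j (x ord0) * lift1 V x)%C (cz tau)); split.
  move=> j; have := @prod_conv om Hw 0 (cf j) (lift1 V) B d0 M (cz tau) Hd0 (Hcf j) fc (fun x => hM _).
  apply: Cconv_ext => r; apply: zs_ext => s; congr (_ * coef _ _)%C.
  by rewrite (cz_eta (shz _ _)) /shz updz_same.
have hj : forall j, contC (fun x : pt 1 => (0, IZR (xi j)) * (cf j (x ord0) * lift1 V x))%C.
  by move=> j; apply: contC_mult; [exact: contC_const | apply: prod_cont => //; case: (Hcf j)].
have [s1 s2] := coef_sumC (cz tau) hj.
rewrite -(coef1_der tau hd hc hp).
rewrite (sumC_ext (G := fun j => coef (fun x : pt 1 => (0, IZR (xi j)) * (cf j (x ord0) * lift1 V x))%C (cz tau))); last first.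
  by move=> j; rewrite coef_scal //; apply: prod_cont => //; case: (Hcf j).
rewrite -s2 /coef1 -coef_plus //; last by apply/ccont_lift1.
congr coef; apply: functional_extensionality => x; rewrite /lift1 -hH; congr Cplus.
rewrite /cxi; symmetry.
rewrite (sumC_ext (G := fun j => ((0, 1) * V (x ord0)) * (RtoC (IZR (xi j)) * cf j (x ord0)))%C).
  by rewrite sumC_scal; ring.
move=> j; have -> : ((0, IZR (xi j)) = (0, 1) * RtoC (IZR (xi j)) :> C)%C.
  by rewrite /RtoC /Cmult /=; congr pair; ring.
ring.
Qed.

Lemma cxi_ccont xi : ccont (cxi xi).
Proof.
have : contC (fun x : pt 1 => sumC (fun j => RtoC (IZR (xi j)) * cf j (x ord0)))%C.
  apply: (proj1 (@coef_sumC N 1 (fun j (x : pt 1) => RtoC (IZR (xi j)) * cf j (x ord0))%C (cz 0) _)) => j.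
  by apply: contC_mult; [exact: contC_const | case: (Hcf j)].
by move=> h; apply/ccont_lift1.
Qed.

Lemma cf_periodic j t : cf j (t + 2 * PI) = cf j t.
Proof. by have [_ [h _]] := Hcf j; move/periodic_lift1: h. Qed.

Lemma cxi_periodic xi t : cxi xi (t + 2 * PI) = cxi xi t.
Proof. by apply: sumC_ext => j; rewrite cf_periodic. Qed.

(** Returns from coefficients to functions, so that the estimates for the differential equation
    apply. [H] is defined by the equation, and its coefficients agree with [g] by uniqueness of the
    convolution. *)
Lemma realize xi u g A del : 0 < del ->
  (forall tau, Cmod (u tau) <= A * exp (- del * omZ tau)) -> L1rel gam xi u g ->
  exists V V' H, cder V V' /\ ccont V' /\ (forall t, V (t + 2 * PI) = V t) /\
    ccont H /\ (forall t, H (t + 2 * PI) = H t) /\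
    (forall t, V' t + (0, 1) * cxi xi t * V t = H t)%C /\
    (forall tau, coef1 V tau = u tau) /\ forall tau, coef1 H tau = g tau.
Proof.
move=> hd hu hL.
have [K [hK HS]] := @synth om Hw 1 del hd.
have [v [hv [vc _]]] := HS (fun k => u (k ord0)) A ltac:(by move=> k; rewrite {2}(cz_eta k) W_cz; apply: hu).
have [K2 [hK2 H2]] := @cd_partial om Hw 1 del hd.
have [p1 [p2 p3]] := H2 _ _ ord0 hv.
pose V t := v (fun _ => t); pose V' t := partial ord0 v (fun _ => t).
have eV : lift1 V = v by apply: functional_extensionality => x; rewrite /lift1 /V -pt1_eta.
have eV' : lift1 V' = partial ord0 v by apply: functional_extensionality => x; rewrite /lift1 /V' -pt1_eta.
have updc : forall (x : pt 1) s, upd x ord0 s = fun _ => s.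
  by move=> x s; rewrite (pt1_eta (upd _ _ _)) upd_same.
have hV : cder V V'.
  move=> t; have [a1 a2] := p1 (fun _ => t); split.
    by apply: is_derive_ext a1 => s; rewrite updc.
  by apply: is_derive_ext a2 => s; rewrite updc.
have cV' : ccont V' by apply/ccont_lift1; rewrite eV'; case: p2.
have pV : forall t, V (t + 2 * PI) = V t by apply/periodic_lift1; rewrite eV; case: hv => _ [].
have pV' := cder_periodic hV pV.
pose H t := (V' t + (0, 1) * cxi xi t * V t)%C.
exists V, V', H; split=> //; split=> //; split=> //.
have cV := cder_cont hV.
have cH : ccont H.
  apply: ccont_plus => //; apply: ccont_mult => //; apply: ccont_mult; [exact: ccont_const | exact: cxi_ccont].
split=> //; split; first by move=> t; rewrite /H pV pV' cxi_periodic.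
split=> //.
have hcV : forall tau, coef1 V tau = u tau by move=> tau; rewrite /coef1 eV vc.
split=> // tau.
have [P [hP ->]] := @ode_L1rel xi V V' H hV cV' pV (fun t => erefl) tau.
have [Q [hQ ->]] := hL tau.
rewrite hcV; congr Cplus; apply: sumC_ext => j; congr Cmult.
apply: Cconv_unique (hP j) _; apply: Cconv_ext (hQ j) => r; apply: zs_ext => s.
by rewrite hcV.
Qed.

Lemma L1rel_zero xi u g : (forall j, xi j = 0%Z) -> L1rel gam xi u g ->
  forall tau, g tau = ((0, IZR tau) * u tau)%C.
Proof.
move=> h0 hL tau; have [P [_ ->]] := hL tau.
rewrite (sumC_ext (G := fun j => RtoC 0 * P j)%C); first by rewrite sumC_scal; ring.
by move=> j; rewrite h0.
Qed.

Lemma coef1_cd V A del : ccont V -> (forall t, V (t + 2 * PI) = V t) ->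
  (forall tau, Cmod (coef1 V tau) <= A * exp (- del * omZ tau)) -> cd (lift1 V) A del.
Proof.
move=> hc hp h; split; first by apply/ccont_lift1.
split; first by apply/periodic_lift1.
by move=> k; rewrite (cz_eta k) W_cz; apply: h.
Qed.

Lemma coef1_sup V M tau : ccont V -> (forall t, Cmod (V t) <= M) -> Cmod (coef1 V tau) <= M.
Proof. by move=> hc hM; apply: coef_bound; [apply/ccont_lift1 | move=> x; apply: hM]. Qed.

Lemma coef1_uniq V V2 : ccont V -> (forall t, V (t + 2 * PI) = V t) -> ccont V2 ->
  (forall t, V2 (t + 2 * PI) = V2 t) -> (forall tau, coef1 V tau = coef1 V2 tau) -> forall t, V t = V2 t.
Proof.
move=> c1 p1 c2 p2 h t.
have e : lift1 V = lift1 V2.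
  apply: cd_fun_eq; [by apply/ccont_lift1 | by apply/periodic_lift1 | by apply/ccont_lift1 | by apply/periodic_lift1 |].
  by move=> k; rewrite (cz_eta k); apply: h.
exact: (congr1 (fun f : Fn 1 => f (fun _ => t)) e).
Qed.

End Op.
End Fibre.

(** * Sufficiency *)

Lemma RInt_sumR n (F : 'I_n -> R -> R) p q : (forall j t, continuous (F j) t) ->
  (forall t, continuous (fun t => sumR (fun j => F j t)) t) /\
  RInt (fun t => sumR (fun j => F j t)) p q = sumR (fun j => RInt (F j) p q).
Proof.
move=> h.
have e : (fun t => sumR (fun j => F j t)) = fun t => foldr (fun j acc => F j t + acc) 0 (enum 'I_n) by [].
rewrite e /sumR; elim: (enum 'I_n) => [|j l [IH1 IH2]] /=.
  split; first by move=> t; apply: continuous_const.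
  by rewrite RInt_const /scal /= /mult /=; ring.
split.
  by move=> t; apply: (continuous_plus (F j) (fun t => foldr (fun j acc => F j t + acc) 0 l)).
rewrite -IH2; have := @RInt_lin (F j) _ p q 1 1 (h j) IH1.
rewrite !Rmult_1_l => <-; by apply: RInt_extR => s; ring.
Qed.

Lemma cd_uniform om n N (F : 'I_N -> Fn n) : weight_function om -> subadditive om ->
  (forall j, Eom om (F j)) -> exists B d, 0 <= B /\ 0 < d /\ forall j, cd om (F j) B d.
Proof.
move=> Hw Hs H.
suff [B [d [hB [hd h]]]] : exists B d, 0 <= B /\ 0 < d /\ forall j, j \in enum 'I_N -> cd om (F j) B d.
  by exists B, d; split=> //; split=> // j; apply: h; rewrite mem_enum.
elim: (enum 'I_N) => [|i l [B [d [hB [hd h]]]]]; first by exists 0, 1; split; [lra | split; [lra|]].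
have /(Eom_iff Hw Hs) [B' [d' [hd' hi]]] := H i.
exists (Rmax B B'), (Rmin d d'); split; first by apply: Rle_trans hB (Rmax_l _ _).
split; first exact: Rmin_pos.
move=> j; rewrite inE => /orP [/eqP -> | /h hj].
  by apply: (cd_weaken Hw hi); [apply: Rmax_r | apply: Rmin_r].
by apply: (cd_weaken Hw hj); [apply: Rmax_l | apply: Rmin_l].
Qed.

Lemma L1rel_fun N (gam : 'I_N -> Z -> C) xi u g g' : L1rel gam xi u g -> L1rel gam xi u g' ->
  forall tau, g tau = g' tau.
Proof.
move=> h h' tau; have [P [hP ->]] := h tau; have [Q [hQ ->]] := h' tau.
congr Cplus; apply: sumC_ext => j; congr Cmult; exact: Cconv_unique (hP j) (hQ j).
Qed.

Lemma L1rel_ext N (gam : 'I_N -> Z -> C) xi u u' g g' : (forall t, u t = u' t) -> (forall t, g t = g' t) ->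
  L1rel gam xi u g -> L1rel gam xi u' g'.
Proof.
move=> hu hg; have -> : u = u' by apply: functional_extensionality.
by have -> : g = g' by apply: functional_extensionality.
Qed.

Lemma nrm1_ge1 n (k : 'I_n -> Z) : (exists j, k j <> 0%Z) -> 1 <= nrm1 k.
Proof. by move=> [j hj]; apply: Rle_trans (Rabs_IZR_ge1 hj) (nrm1_term k j). Qed.

Lemma nrm1_lt1 n (k : 'I_n -> Z) : ~ 1 <= nrm1 k -> forall j, k j = 0%Z.
Proof.
by move=> h j; apply: NNPP => hj; apply: h; apply: nrm1_ge1; exists j.
Qed.

Section Main.
Variable om : R -> R.
Hypothesis Hw : weight_function om.
Hypothesis Hs : subadditive om.
Variables (N : nat) (a b : 'I_N -> R -> R) (B d0 : R).
Hypothesis Hd0 : 0 < d0.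
Hypothesis HB0 : 0 <= B.
Definition cf (j : 'I_N) (t : R) : C := (a j t, b j t).
Hypothesis Hcf : forall j, cd om (lift1 (cf j)) B d0.
Notation W := (W om).
Notation cd := (cd om).
Notation omZ := (omZ om).
Notation gam := (gam cf).

Definition ax (xi : 'I_N -> Z) (t : R) : R := sumR (fun j => IZR (xi j) * a j t).
Definition bx (xi : 'I_N -> Z) (t : R) : R := sumR (fun j => IZR (xi j) * b j t).
Definition xr (xi : 'I_N -> Z) : R := sumR (fun j => IZR (xi j) * mean (a j)).
Definition yr (xi : 'I_N -> Z) : R := sumR (fun j => IZR (xi j) * mean (b j)).

Lemma cxi_pair xi t : cxi cf xi t = (ax xi t, bx xi t).
Proof.
rewrite /cxi sumC_pair; congr pair; apply: sumR_ext => j; rewrite /cf /RtoC /Cmult /=; ring.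
Qed.

Lemma ab_cont j : (forall t, continuous (a j) t) /\ (forall t, continuous (b j) t).
Proof. by have [/ccont_lift1 /ccont_comp h _] := Hcf j. Qed.

Lemma ax_cont xi t : continuous (ax xi) t.
Proof.
have /ccont_comp [h _] := cxi_ccont Hcf xi.
by have := h t; rewrite (_ : (fun s => fst (cxi cf xi s)) = ax xi) //; apply: functional_extensionality => s; rewrite cxi_pair.
Qed.

Lemma bx_cont xi t : continuous (bx xi) t.
Proof.
have /ccont_comp [_ h] := cxi_ccont Hcf xi.
by have := h t; rewrite (_ : (fun s => snd (cxi cf xi s)) = bx xi) //; apply: functional_extensionality => s; rewrite cxi_pair.
Qed.

Arguments ax_cont : clear implicits.
Arguments bx_cont : clear implicits.

Lemma ax_per xi t : ax xi (t + 2 * PI) = ax xi t.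
Proof. by have := cxi_periodic Hcf xi t; rewrite !cxi_pair; case. Qed.

Lemma bx_per xi t : bx xi (t + 2 * PI) = bx xi t.
Proof. by have := cxi_periodic Hcf xi t; rewrite !cxi_pair; case. Qed.

Lemma mean_int (f : R -> R) : RInt f 0 (2 * PI) = 2 * PI * mean f.
Proof. by rewrite /mean -Rmult_assoc Rinv_r ?Rmult_1_l //; have := pi2_pos; lra. Qed.

Lemma RInt_scalR (f : R -> R) c p q : (forall t, continuous f t) -> RInt (fun t => c * f t) p q = c * RInt f p q.
Proof.
move=> h; have := @RInt_lin f f p q c 0 h h.
have -> : RInt (fun s => c * f s + 0 * f s) p q = RInt (fun t => c * f t) p q.
  by apply: RInt_extR => s; ring.
by rewrite Rmult_0_l Rplus_0_r.
Qed.

Lemma ax_int xi : RInt (ax xi) 0 (2 * PI) = 2 * PI * xr xi.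
Proof.
have [_ ->] := @RInt_sumR N (fun j t => IZR (xi j) * a j t) 0 (2 * PI)
   ltac:(by move=> j t; apply: (continuous_scal_r (IZR (xi j)) (a j)); case: (ab_cont j)).
rewrite /xr -sumR_scal; apply: sumR_ext => j; rewrite RInt_scalR ?mean_int; last by case: (ab_cont j).
ring.
Qed.

Lemma bx_int xi : RInt (bx xi) 0 (2 * PI) = 2 * PI * yr xi.
Proof.
have [_ ->] := @RInt_sumR N (fun j t => IZR (xi j) * b j t) 0 (2 * PI)
   ltac:(by move=> j t; apply: (continuous_scal_r (IZR (xi j)) (b j)); case: (ab_cont j)).
rewrite /yr -sumR_scal; apply: sumR_ext => j; rewrite RInt_scalR ?mean_int; last by case: (ab_cont j).
ring.
Qed.

Definition qx (xi : 'I_N -> Z) : C := qf (ax xi) (bx xi).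

Lemma qx_eq xi : qx xi = (RtoC (exp (- (2 * PI * yr xi))) * cis (2 * PI * xr xi))%C.
Proof. by rewrite /qx /qf /Ef /At /Bt ax_int bx_int. Qed.

(** If q = 1, the modulus gives <xi, beta_0> = 0, and [qlow] then produces an exact resonance. *)
Lemma qx_ne1 xi : (forall tau : Z, Cmod (IZR tau + xr xi, yr xi) <> 0) -> qx xi <> RtoC 1.
Proof.
move=> h hq; rewrite qx_eq in hq.
have hpi := PI_RGT_0.
have hm : exp (- (2 * PI * yr xi)) = 1.
  have := congr1 Cmod hq; rewrite Cmod_mult Cmod_cis Cmod_R Cmod_1 Rmult_1_r Rabs_right //.
  by apply: Rle_ge; apply: Rlt_le; apply: exp_pos.
have hy : yr xi = 0.
  rewrite -exp_0 in hm; have := exp_inv _ _ hm; nra.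
have [tau [_ ht]] := @qlow (xr xi) (yr xi) ltac:(lra).
rewrite hq in ht.
have e0 : (RtoC 1 - RtoC 1 = RtoC 0)%C by ring.
rewrite e0 Cmod_0 in ht; have := Cmod_ge_0 (IZR tau + xr xi, yr xi).
have := h tau; move: ht; rewrite /Rmin; case: Rle_dec => _; lra.
Qed.

Definition msum := sumR (fun j => Rabs (mean (a j))).

Lemma msum_ge0 : 0 <= msum.
Proof. by apply: sumR_ge0 => j; apply: Rabs_pos. Qed.

Lemma xr_le xi : Rabs (xr xi) <= msum * nrm1 xi.
Proof.
rewrite /xr /nrm1 -sumR_scal.
have h : forall n (F : 'I_n -> R), Rabs (sumR F) <= sumR (fun j => Rabs (F j)).
  move=> n F; rewrite /sumR; elim: (enum 'I_n) => [|j l IH] /=; first by rewrite Rabs_R0; lra.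
  by apply: Rle_trans (Rabs_triang _ _) _; lra.
apply: Rle_trans (h _ _) _; apply: sumR_le => j.
rewrite Rabs_mult Rmult_comm; apply: Rmult_le_compat_r; first exact: Rabs_pos.
by apply: (sumR_ge_term (F := fun j => Rabs (mean (a j)))) => i; apply: Rabs_pos.
Qed.

Lemma euclid_le (tau : Z) (xi : 'I_N -> Z) :
  sqrt (IZR tau ^ 2 + sumR (fun j => IZR (xi j) ^ 2)) <= Rabs (IZR tau) + nrm1 xi.
Proof.
have hn := nrm1_ge0 xi; have ht := Rabs_pos (IZR tau).
rewrite -(sqrt_pow2 (Rabs (IZR tau) + nrm1 xi)); last lra.
apply: sqrt_le_1_alt.
have h : sumR (fun j => IZR (xi j) ^ 2) <= nrm1 xi * nrm1 xi.
  rewrite {2}/nrm1 -sumR_scal; apply: sumR_le => j; rewrite -(pow2_abs (IZR (xi j))).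
  have := nrm1_term xi j; have := Rabs_pos (IZR (xi j)); simpl; nra.
have e := pow2_abs (IZR tau); nra.
Qed.

Lemma nrm1_le_euclid (tau : Z) (xi : 'I_N -> Z) :
  nrm1 xi <= INR N * sqrt (IZR tau ^ 2 + sumR (fun j => IZR (xi j) ^ 2)).
Proof.
rewrite -sumR_const; apply: sumR_le => j.
rewrite -sqrt_Rsqr_abs; apply: sqrt_le_1_alt; rewrite /Rsqr.
have := @sumR_ge_term N (fun j => IZR (xi j) ^ 2) j (fun i => pow2_ge_0 _); have := pow2_ge_0 (IZR tau).
simpl; lra.
Qed.

Hypothesis Hedc_om : EDC1 om (fun j => mean (a j)) (fun j => mean (b j)).

Lemma edc_ne xi : 1 <= nrm1 xi -> forall tau : Z, Cmod (IZR tau + xr xi, yr xi) <> 0.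
Proof.
move=> hxi tau; have [Ce [hCe H]] := Hedc_om Rlt_0_1.
have hx : exists j, xi j <> 0%Z.
  apply: NNPP => h; have : nrm1 xi = 0; last lra.
  rewrite /nrm1 (sumR_ext (G := fun _ => 0)) ?sumR_const ?Rmult_0_r // => j.
  have -> : xi j = 0%Z by apply: NNPP => h2; apply: h; exists j.
  by rewrite Rabs_R0.
have := H tau xi (or_intror hx); have := exp_pos (- (1) * om (sqrt (IZR tau ^ 2 + sumR (fun j => IZR (xi j) ^ 2)))).
rewrite -/(xr xi) -/(yr xi) => h1 h2; have := Rmult_lt_0_compat _ _ hCe h1; lra.
Qed.

(** For tau within 1/2 of -<xi, alpha_0> the norm of (tau, xi) is at most X |xi|, so the weight of
    the pair is replaced by (X + 1) omega(xi); the condition is used with eps / (X + 1) to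
    compensate. *)
Lemma edc_low eps : 0 < eps -> exists c, 0 < c /\ forall xi (tau : Z), 1 <= nrm1 xi ->
  Rabs (IZR tau + xr xi) <= 1 / 2 -> c * exp (- eps * W xi) <= Rmin (1 / 2) (Cmod (IZR tau + xr xi, yr xi)).
Proof.
move=> he; pose X := msum + 2.
have hm := msum_ge0.
have heX : 0 < eps / (X + 1) by apply: Rdiv_lt_0_compat; rewrite /X; lra.
have [Ce [hCe H]] := Hedc_om heX.
exists (Rmin (1 / 2) Ce); split; first by apply: Rmin_pos; lra.
move=> xi tau hxi ht.
have hW : 0 <= W xi by apply: W_ge0.
have hx : exists j, xi j <> 0%Z.
  apply: NNPP => h; have : nrm1 xi = 0; last lra.
  rewrite /nrm1 (sumR_ext (G := fun _ => 0)) ?sumR_const ?Rmult_0_r // => j.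
  have -> : xi j = 0%Z by apply: NNPP => h2; apply: h; exists j.
  by rewrite Rabs_R0.
have ho : om (sqrt (IZR tau ^ 2 + sumR (fun j => IZR (xi j) ^ 2))) <= (X + 1) * W xi.
  apply: Rle_trans (_ : om (X * nrm1 xi) <= _).
    apply: om_mono => //; first exact: sqrt_pos.
    apply: Rle_trans (euclid_le tau xi) _.
    have h1 := xr_le xi.
    have h2 : Rabs (IZR tau) <= 1 / 2 + Rabs (xr xi).
      have -> : IZR tau = (IZR tau + xr xi) + - xr xi by ring.
      by apply: Rle_trans (Rabs_triang _ _) _; rewrite Rabs_Ropp; lra.
    rewrite /X; lra.
  by apply: om_mulR => //; [rewrite /X; lra | lra].
have h1 : exp (- eps * W xi) <= exp (- (eps / (X + 1)) * om (sqrt (IZR tau ^ 2 + sumR (fun j => IZR (xi j) ^ 2)))).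
  apply: exp_le; have := Rmult_le_compat_l _ _ _ (Rlt_le _ _ heX) ho.
  have -> : eps / (X + 1) * ((X + 1) * W xi) = eps * W xi by field; rewrite /X; lra.
  lra.
have h2 : exp (- eps * W xi) <= 1 by rewrite -exp_0; apply: exp_le; nra.
have h3 := exp_pos (- eps * W xi).
have h4 := Rmin_l (1 / 2) Ce; have h5 := Rmin_r (1 / 2) Ce.
have h6 : 0 < Rmin (1 / 2) Ce by apply: Rmin_pos; lra.
apply: Rmin_glb; first nra.
have := H tau xi (or_intror hx); rewrite -/(xr xi) -/(yr xi) => h7.
apply: Rle_trans (Rge_le _ _ h7).
apply: Rmult_le_compat; lra.
Qed.

Lemma sup_bound xi V V' H M t : cder V V' -> ccont H -> (forall t, V (t + 2 * PI) = V t) ->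
  (forall t, V' t + (0, 1) * cxi cf xi t * V t = H t)%C ->
  ~ changes_sign (bx xi) -> (forall t, Cmod (H t) <= M) ->
  exists tau : Z, Rabs (IZR tau + xr xi) <= 1 / 2 /\
    Rmin (1 / 2) (Cmod (IZR tau + xr xi, yr xi)) * Cmod (V t) <= 2 * PI * M.
Proof.
move=> hV hH pV hE hs hM.
have hE' : forall t, (V' t + (0, 1) * (ax xi t, bx xi t) * V t)%C = H t by move=> s; rewrite -cxi_pair.
have ca := ax_cont xi; have cb := bx_cont xi; have pa := ax_per xi; have pb := bx_per xi.
have hpi := pi2_pos.
case: (classic (forall t, 0 <= bx xi t)) => hpos.
  have hy : 0 <= yr xi.
    have : 0 <= RInt (bx xi) 0 (2 * PI) by apply: RInt_ge_0 => //; [lra | exact: ex_RInt_cont].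
    by rewrite bx_int => h; apply: (Rmult_le_reg_l (2 * PI)) => //; rewrite Rmult_0_r.
  have [tau [h1 h2]] := qlow (xr xi) hy; exists tau; split=> //.
  rewrite -qx_eq in h2.
  have := ode_bound_pos ca cb pa pb hV hH hE' pV t hpos hM; rewrite -/(qx xi) => h3.
  by apply: Rle_trans h3; apply: Rmult_le_compat_r => //; apply: Cmod_ge_0.
have hneg : forall t, bx xi t <= 0.
  move=> s; apply: Rnot_lt_le => h; apply: hs; split; first by exists s.
  by apply: NNPP => h2; apply: hpos => r; apply: Rnot_lt_le => h3; apply: h2; exists r.
have hy : 0 <= - yr xi.
  have : RInt (bx xi) 0 (2 * PI) <= RInt (fun _ => 0) 0 (2 * PI).
    by apply: RInt_le => //; [lra | exact: ex_RInt_cont | apply: ex_RInt_const].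
  rewrite RInt_const bx_int /scal /= /mult /= Rmult_0_r => h.
  by apply: (Rmult_le_reg_l (2 * PI)) => //; rewrite Rmult_0_r; lra.
(* The factor |q| of [ode_bound_neg] cancels against |q - 1| = |q| |1/q - 1|, where 1/q is the
   multiplier of -xi, to which [qlow] applies. *)
have [tau [h1 h2]] := qlow (- xr xi) hy.
exists (- tau)%Z; rewrite opp_IZR; split.
  by rewrite -Rabs_Ropp (_ : - (- IZR tau + xr xi) = IZR tau + - xr xi) //; ring.
have eC : Cmod (- IZR tau + xr xi, yr xi) = Cmod (IZR tau + - xr xi, - yr xi).
  by rewrite -Cmod_opp; congr Cmod; rewrite /Copp /=; congr pair; ring.
rewrite eC.
have e1 : (qx xi * (RtoC (exp (- (2 * PI * - yr xi))) * cis (2 * PI * - xr xi)) = RtoC 1)%C.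
  rewrite qx_eq.
  have -> : (RtoC (exp (- (2 * PI * yr xi))) * cis (2 * PI * xr xi) * (RtoC (exp (- (2 * PI * - yr xi))) * cis (2 * PI * - xr xi)) =
   RtoC (exp (- (2 * PI * yr xi))) * RtoC (exp (- (2 * PI * - yr xi))) * (cis (2 * PI * xr xi) * cis (2 * PI * - xr xi)))%C by ring.
  rewrite -RtoC_mult -exp_plus -cis_add.
  have -> : 2 * PI * xr xi + 2 * PI * - xr xi = 0 by ring.
  have -> : - (2 * PI * yr xi) + - (2 * PI * - yr xi) = 0 by ring.
  by rewrite exp_0 cis_0; ring.
set qi := (_ * cis (2 * PI * - xr xi))%C in e1 h2.
have h3 := ode_bound_neg ca cb pa pb hV hH hE' pV t hneg hM; rewrite -/(qx xi) in h3.
have hq : 0 < Cmod (qx xi).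
  by apply/Cmod_gt_0 => h0; rewrite h0 in e1; have := congr1 Cmod e1; rewrite Cmult_0_l Cmod_0 Cmod_1; lra.
have e2 : Cmod (qx xi - RtoC 1)%C = Cmod (qx xi) * Cmod (qi - RtoC 1)%C.
  rewrite -Cmod_mult -Cmod_opp; congr Cmod.
  have -> : (qx xi * (qi - RtoC 1) = qx xi * qi - qx xi)%C by ring.
  by rewrite e1; ring.
rewrite e2 Rmult_assoc in h3.
have h4 := Rmult_le_reg_l _ _ _ hq h3.
by apply: Rle_trans h4; apply: Rmult_le_compat_r => //; apply: Cmod_ge_0.
Qed.

Hypothesis Hsign : forall xi, ~ changes_sign (bx xi).

(** Regularity is used twice. The first pass, with constants depending on u and xi, only ensures
    that u comes from a function V; the equation then bounds V uniformly in xi, and the second pass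
    turns this into uniform decay in tau. Half of the rate in xi pays for the small divisor and a
    quarter for [reg_bounded]. *)
Lemma est del : 0 < del -> del <= d0 / 2 -> exists K del', 0 < K /\ 0 < del' /\
  forall xi u g A Cu eps, 1 <= nrm1 xi -> L1rel gam xi u g -> 0 < eps -> eps <= d0 / 2 ->
   (forall tau, Cmod (u tau) <= Cu * exp (eps * omZ tau)) ->
   (forall tau, Cmod (g tau) <= A * exp (- del * (omZ tau + W xi))) ->
   forall tau, Cmod (u tau) <= K * A * exp (- del' * (omZ tau + W xi)).
Proof.
move=> hd hd2.
have [G [hG HG]] := reg Hw Hs Hd0 HB0 Hcf.
have [G2 [hG2 HG2]] := reg_bounded Hw Hs Hd0 HB0 Hcf.
have [K1 [hK1 HK1]] := @cd_Eom om Hw 1 del hd.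
have [c [hc Hc]] := @edc_low (del / 2) ltac:(lra).
have hpi := pi2_pos.
pose K2 := 2 * PI * K1 / c.
have hK2 : 0 < K2 by apply: Rdiv_lt_0_compat => //; apply: Rmult_lt_0_compat.
pose del1 := Rmin del (del / 4 / G2).
have hdel1 : 0 < del1 by apply: Rmin_pos => //; apply: Rdiv_lt_0_compat; lra.
have hdel1a : del1 <= del by apply: Rmin_l.
have hdel1b : del1 * G2 <= del / 4.
  apply: Rle_trans (_ : del / 4 / G2 * G2 <= _).
    by apply: Rmult_le_compat_r; [lra | apply: Rmin_r].
  by apply: Req_le; field; lra.
pose del' := Rmin del1 (del / 4).
have hdel' : 0 < del' by apply: Rmin_pos; lra.
exists (2 * (1 + K2)), del'; split; first lra.
split=> // xi u g A Cu eps hxi hL he he2 hu hg tau.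
have hW := W_ge0 Hw xi.
have hA : 0 <= A.
  by have := Rle_trans _ _ _ (Cmod_ge_0 _) (hg 0%Z); have := exp_pos (- del * (omZ 0 + W xi)); nra.
have hg1 : forall tau, Cmod (g tau) <= A * exp (- del * W xi) * exp (- del * omZ tau).
  move=> s; apply: Rle_trans (hg s) _; rewrite Rmult_assoc -exp_plus; apply: Req_le; congr Rmult; congr exp; ring.
have hA1 : 0 <= A * exp (- del * W xi) by apply: Rmult_le_pos => //; apply: Rlt_le; apply: exp_pos.
have hCu : 0 <= Cu.
  by have := Rle_trans _ _ _ (Cmod_ge_0 _) (hu 0%Z); have := exp_pos (eps * omZ 0); nra.
pose M := 4 * nrm1 xi * G.
have hM : 1 <= M by rewrite /M; nra.
have [Bu hBu] : exists Bu, forall tau, Rabs (IZR tau) < M -> Cmod (u tau) <= Bu * exp (- del * omZ tau).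
  exists (Cu * exp ((eps + del) * om M)) => s hsM; apply: Rle_trans (hu s) _.
  rewrite Rmult_assoc -exp_plus; apply: Rmult_le_compat_l => //; apply: exp_le.
  have : omZ s <= om M by apply: om_mono => //; [apply: Rabs_pos | lra].
  nra.
have hu1 := HG del eps Cu xi u g _ 0 Bu M hd hd2 he he2 hL hu hA1 (Rle_refl 0)
  ltac:(move=> s; rewrite Rmult_0_l Rplus_0_r; apply: hg1) hM ltac:(lra) (Rle_refl _) hBu.
have [V [V' [H [hV [cV' [pV [cH [pH [hE [cu cg]]]]]]]]]] := realize Hw Hd0 Hcf hd hu1 hL.
have cdH : cd (lift1 H) (A * exp (- del * W xi)) del.
  by apply: coef1_cd => // s; rewrite cg.
have [_ [supH _]] := HK1 _ _ cdH.
have hHM : forall t, Cmod (H t) <= K1 * (A * exp (- del * W xi)) by move=> t; apply: (supH (fun _ => t)).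
have hVs : forall t, Cmod (V t) <= K2 * A * exp (- (del / 2) * W xi).
  move=> t; have [s [hs1 hs2]] := sup_bound t hV cH pV hE (@Hsign xi) hHM.
  have h1 := Hc xi s hxi hs1.
  have hX := exp_pos (- (del / 2) * W xi).
  have h2 : c * exp (- (del / 2) * W xi) * Cmod (V t) <= 2 * PI * (K1 * (A * exp (- del * W xi))).
    by apply: Rle_trans hs2; apply: Rmult_le_compat_r => //; apply: Cmod_ge_0.
  have e1 : exp (- del * W xi) = exp (- (del / 2) * W xi) * exp (- (del / 2) * W xi).
    by rewrite -exp_plus; congr exp; field.
  rewrite e1 in h2; apply: (Rmult_le_reg_l (c * exp (- (del / 2) * W xi))).
    exact: Rmult_lt_0_compat.
  apply: Rle_trans h2 _; apply: Req_le; rewrite /K2; field; lra.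
have hub : forall tau, Cmod (u tau) <= K2 * A * exp (- (del / 2) * W xi).
  by move=> s; rewrite -cu; apply: coef1_sup => //; apply: cder_cont hV.
have hg2 : forall tau, Cmod (g tau) <= A * exp (- del * W xi) * exp (- del1 * omZ tau) + 0 * Cmod (u tau).
  move=> s; rewrite Rmult_0_l Rplus_0_r; apply: Rle_trans (hg1 s) _; apply: Rmult_le_compat_l => //.
  by apply: exp_le; have := omZ_ge0 Hw s; nra.
have hfin := HG2 del1 xi u g _ 0 _ hdel1 ltac:(lra) hxi hL hub hA1 ltac:(lra) hg2 tau.
apply: Rle_trans hfin _.
have ho := omZ_ge0 Hw tau.
have h1 : A * exp (- del * W xi) <= A * exp (- (del / 4) * W xi).
  by apply: Rmult_le_compat_l => //; apply: exp_le; nra.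
have h2 : K2 * A * exp (- (del / 2) * W xi) * exp (del1 * G2 * W xi) <= K2 * A * exp (- (del / 4) * W xi).
  rewrite Rmult_assoc -exp_plus; apply: Rmult_le_compat_l; first by apply: Rmult_le_pos; lra.
  apply: exp_le; have := Rmult_le_compat_r _ _ _ hW hdel1b; lra.
have h3 : exp (- (del / 4) * W xi) * exp (- del1 * omZ tau) <= exp (- del' * (omZ tau + W xi)).
  rewrite -exp_plus; apply: exp_le.
  have q1 : del' <= del1 by apply: Rmin_l. have q2 : del' <= del / 4 by apply: Rmin_r.
  nra.
apply: Rle_trans (_ : 2 * ((1 + K2) * A * exp (- (del / 4) * W xi)) * exp (- del1 * omZ tau) <= _).
  apply: Rmult_le_compat_r; [apply: Rlt_le; apply: exp_pos | lra].
have -> : 2 * ((1 + K2) * A * exp (- (del / 4) * W xi)) * exp (- del1 * omZ tau) =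
   2 * (1 + K2) * A * (exp (- (del / 4) * W xi) * exp (- del1 * omZ tau)) by ring.
apply: Rmult_le_compat_l => //; apply: Rmult_le_pos => //; lra.
Qed.

Lemma W_split_exp (del : R) tau (xi : 'I_N -> Z) : 0 <= del ->
  exp (- del * W (consz tau xi)) <= exp (- (del / 2) * (omZ tau + W xi)).
Proof.
move=> hd; apply: exp_le.
have := Rmult_le_compat_l _ _ _ hd (W_consz_l Hw tau xi).
have := Rmult_le_compat_l _ _ _ hd (W_consz_r Hw tau xi); lra.
Qed.

Lemma W_merge_exp (del : R) tau (xi : 'I_N -> Z) : 0 <= del ->
  exp (- del * (omZ tau + W xi)) <= exp (- del * W (consz tau xi)).
Proof. by move=> hd; apply: exp_le; have := W_consz Hs tau xi; nra. Qed.

Lemma est_all (U G : ('I_N.+1 -> Z) -> C) A del : 0 < del ->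
  (forall k, Cmod (G k) <= A * exp (- del * W k)) ->
  (forall xi, L1rel gam xi (fun tau => U (consz tau xi)) (fun tau => G (consz tau xi))) ->
  (forall xi, exists Cu eps, 0 < eps /\ eps <= d0 / 2 /\ forall tau, Cmod (U (consz tau xi)) <= Cu * exp (eps * omZ tau)) ->
  exists A' del', 0 < del' /\ forall k, Cmod (U k) <= A' * exp (- del' * W k).
Proof.
move=> hd hG hL hU.
have hA : 0 <= A.
  by have := Rle_trans _ _ _ (Cmod_ge_0 _) (hG (@zeroz _)); have := exp_pos (- del * W (@zeroz N.+1)); nra.
pose e := Rmin (del / 2) (d0 / 2).
have he : 0 < e by apply: Rmin_pos; lra.
have he1 : e <= del / 2 by apply: Rmin_l.
have he2 : e <= d0 / 2 by apply: Rmin_r.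
have [K [del' [hK [hdel' HE]]]] := @est e he he2.
pose dd := Rmin del' del.
have hdd : 0 < dd by apply: Rmin_pos.
have hdd1 : dd <= del' by apply: Rmin_l. have hdd2 : dd <= del by apply: Rmin_r.
(* The zero frequency is not seen by the equation; being a single coefficient, it goes into the
   constant. *)
pose u0 := Cmod (U (@zeroz _)) * exp (dd * W (@zeroz N.+1)).
have hu0 : 0 <= u0 by apply: Rmult_le_pos; [apply: Cmod_ge_0 | apply: Rlt_le; apply: exp_pos].
exists (K * A + A + u0), dd; split=> // k.
have hW := W_ge0 Hw k.
have hX := exp_pos (- dd * W k).
have hKA : 0 <= K * A by apply: Rmult_le_pos; lra.
pose tau := k ord0; pose xi := ztail k.
have ekk : consz tau xi = k by exact: consz_ztail.
case: (classic (1 <= nrm1 xi)) => hxi.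
  have [Cu [eps [h1 [h2 h3]]]] := hU xi.
  have hg : forall tau, Cmod (G (consz tau xi)) <= A * exp (- e * (omZ tau + W xi)).
    move=> s; apply: Rle_trans (hG _) _; apply: Rmult_le_compat_l => //.
    apply: Rle_trans (W_split_exp s xi (Rlt_le _ _ hd)) _.
    by apply: exp_le; have := omZ_ge0 Hw s; have := W_ge0 Hw xi; nra.
  have := HE xi _ _ A Cu eps hxi (hL xi) h1 h2 h3 hg tau.
  have h4 := @W_merge_exp del' tau xi (Rlt_le _ _ hdel').
  rewrite ekk in h4 *; move=> h7.
  have h5 : exp (- del' * W k) <= exp (- dd * W k) by apply: exp_le; nra.
  have h6 := Rmult_le_compat_l _ _ _ hKA (Rle_trans _ _ _ h4 h5).
  have : 0 <= (A + u0) * exp (- dd * W k) by apply: Rmult_le_pos; lra.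
  lra.
have hz := nrm1_lt1 hxi.
case: (Z.eq_dec tau 0) => ht.
  have -> : k = @zeroz N.+1.
    by apply: functional_extensionality => i; case: (unliftP ord0 i) => [j ->|->]; [apply: hz | apply: ht].
  have e1 : Cmod (U (@zeroz N.+1)) = u0 * exp (- dd * W (@zeroz N.+1)).
    by rewrite /u0 Rmult_assoc -exp_plus (_ : _ + _ = 0) ?exp_0 ?Rmult_1_r //; ring.
  rewrite {1}e1; apply: Rmult_le_compat_r; [apply: Rlt_le; apply: exp_pos | lra].
have := L1rel_zero hz (hL xi) tau.
rewrite ekk.
move=> eG; have := congr1 Cmod eG; rewrite Cmod_mult Cmod_imag => e1.
have h1 := Rabs_IZR_ge1 ht.
have h2 : Cmod (U k) <= Cmod (G k).
  by rewrite e1 -{1}(Rmult_1_l (Cmod (U k))); apply: Rmult_le_compat_r => //; apply: Cmod_ge_0.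
have h3 : A * exp (- del * W k) <= A * exp (- dd * W k).
  by apply: Rmult_le_compat_l => //; apply: exp_le; nra.
have h4 := hG k.
have : 0 <= (K * A + u0) * exp (- dd * W k) by apply: Rmult_le_pos; lra.
lra.
Qed.

Lemma cond_hypo : glob_hypoelliptic om a b.
Proof.
move=> mu hmu [g [hg Hg]]; have [h1 h2] := proj1 (ultra_iff Hw Hs mu) hmu.
have /(Eom_iff Hw Hs) [A [d [hd hgA]]] := hg.
have hv := vol_pos N.+1; set v := (2 * PI) ^ N.+1 in hv.
pose U k := mu (ek (negz k)); pose G k := (RtoC v * coef g k)%C.
have hL : forall xi, L1rel gam xi (fun tau => U (consz tau xi)) (fun tau => G (consz tau xi)).
  move=> xi; apply: L1rel_ext (LC_mu Hw Hs Hd0 Hcf xi h1 h2) => // t.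
  by rewrite /G /v -fdist_ek -Hg //; apply: Eom_ek.
have [A' [d' [hd' hU]]] : exists A' del', 0 < del' /\ forall k, Cmod (U k) <= A' * exp (- del' * W k).
  apply: (@est_all U G (v * A) d) => //.
    move=> k; rewrite /G Cmod_mult Cmod_R Rabs_right; last lra.
    by rewrite Rmult_assoc; apply: Rmult_le_compat_l; [lra | case: hgA => _ []].
  (* Continuity of [mu] at rate d0/2 gives the a priori growth that [reg] starts from. *)
  move=> xi; have [M [hM HM]] := h2 (d0 / 2) ltac:(lra).
  exists (M * exp (d0 / 2 * W xi)), (d0 / 2); split; first lra.
  split; first lra.
  move=> tau; apply: Rle_trans (HM _ _ (cd_ek om _ _)) _; rewrite W_neg Rmult_assoc -exp_plus.
  by apply: Rmult_le_compat_l => //; apply: exp_le; have := W_consz Hs tau xi; nra.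
have [K [_ HK]] := @synth om Hw N.+1 d' hd'.
have hvU : forall k, Cmod (RtoC (/ v) * U k)%C <= / v * A' * exp (- d' * W k).
  move=> k; have hi := Rinv_0_lt_compat _ hv.
  rewrite Cmod_mult Cmod_R Rabs_right; last lra.
  by rewrite Rmult_assoc; apply: Rmult_le_compat_l; [lra | apply: hU].
have [f [hf [cff _]]] := HK _ _ hvU.
exists f; have hfE : Eom om f by apply/(Eom_iff Hw Hs); exists (/ v * A'), d'.
split=> // h hh; have [f1 f2] := fdist_ultra Hw Hs hfE.
apply: (ultra_eq Hw Hs h1 h2 f1 f2) => // k.
rewrite -(negzK k) fdist_ek cff Cmult_assoc -RtoC_mult Rinv_r; last by rewrite -/v; lra.
by rewrite Cmult_1_l.
Qed.

(** Each fibre with xi <> 0 is solved separately, since q <> 1; [est] makes the solutions decay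
    jointly, and [synth] assembles them. *)
Lemma solve_E g : Eom om g -> coef g (@zeroz _) = RtoC 0 -> exists f, Eom om f /\ g = LC cf f.
Proof.
move=> hgE g0; have /(Eom_iff Hw Hs) [A [d [hd hg]]] := hgE.
have hA := cd_A_ge0 hg.
have hfib : forall xi, 1 <= nrm1 xi -> exists u M, (forall tau : Z, Cmod (u tau) <= M) /\
    L1rel gam xi u (fun tau => coef g (consz tau xi)).
  move=> xi hxi.
  have [K [_ HK]] := @synth om Hw 1 d hd.
  have [h [hh [ch _]]] := HK (fun k => coef g (consz (k ord0) xi)) A ltac:(move=> k;
    apply: Rle_trans (proj2 (proj2 hg) _) _; apply: Rmult_le_compat_l => //; apply: exp_le;
    rewrite (cz_eta k) W_cz; have := W_consz_l Hw (k ord0) xi; rewrite /cz; nra).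
  pose H t := h (fun _ => t).
  have eH : lift1 H = h by apply: functional_extensionality => x; rewrite /lift1 /H -pt1_eta.
  have cH : ccont H by apply/ccont_lift1; rewrite eH; case: hh.
  have pH : forall t, H (t + 2 * PI) = H t by apply/periodic_lift1; rewrite eH; case: hh => _ [].
  have [V [V' [hV [cV' [pV hE]]]]] := ode_exist (ax_cont xi) (bx_cont xi) (ax_per xi) (bx_per xi) cH pH (qx_ne1 (edc_ne hxi)).
  have cV := cder_cont hV.
  have [M [_ hM]] := periodic_bounded cV pV.
  exists (coef1 V), M; split; first by move=> tau; apply: coef1_sup.
  have hE' : forall t, (V' t + (0, 1) * cxi cf xi t * V t = H t)%C by move=> t; rewrite cxi_pair.
  apply: L1rel_ext (ode_L1rel Hw Hd0 Hcf hV cV' pV hE') => // t.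
  by rewrite /coef1 eH ch.
pose Pd xi p := (forall tau : Z, Cmod (fst p tau) <= snd p) /\ L1rel gam xi (fst p) (fun tau => coef g (consz tau xi)).
pose w xi : (Z -> C) * R := epsilon (inhabits (fun _ => RtoC 0, 0)) (Pd xi).
have hw : forall xi, 1 <= nrm1 xi -> Pd xi (w xi).
  by move=> xi hxi; apply: epsilon_spec; have [u [M h]] := hfib xi hxi; exists (u, M).
(* On xi = 0 the operator is d/dt. At the zero frequency this is a division by 0, whose value is
   multiplied by 0 again in L f. *)
pose U k := if Rle_dec 1 (nrm1 (ztail k)) then fst (w (ztail k)) (k ord0)
  else (coef g k / (0, IZR (k ord0)))%C.
pose e := Rmin (d / 2) (d0 / 2).
have he : 0 < e by apply: Rmin_pos; lra.
have he1 : e <= d / 2 by apply: Rmin_l.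
have he2 : e <= d0 / 2 by apply: Rmin_r.
have [K [del' [hK [hdel' HE]]]] := @est e he he2.
pose dd := Rmin del' d.
have hdd : 0 < dd by apply: Rmin_pos.
have hdd1 : dd <= del' by apply: Rmin_l. have hdd2 : dd <= d by apply: Rmin_r.
have hUb : forall k, Cmod (U k) <= (K * A + A + Cmod (U (@zeroz _)) * exp (dd * W (@zeroz N.+1))) * exp (- dd * W k).
  move=> k; have hX := exp_pos (- dd * W k).
  have hu0 : 0 <= Cmod (U (@zeroz _)) * exp (dd * W (@zeroz N.+1)).
    by apply: Rmult_le_pos; [apply: Cmod_ge_0 | apply: Rlt_le; apply: exp_pos].
  have hKA : 0 <= K * A by apply: Rmult_le_pos; lra.
  have hWk := W_ge0 Hw k.
  case: (classic (k = @zeroz _)) => [-> | hk].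
    have e1 : Cmod (U (@zeroz N.+1)) = Cmod (U (@zeroz N.+1)) * exp (dd * W (@zeroz N.+1)) * exp (- dd * W (@zeroz N.+1)).
      by rewrite Rmult_assoc -exp_plus (_ : _ + _ = 0) ?exp_0 ?Rmult_1_r //; ring.
    rewrite {1}e1; apply: Rmult_le_compat_r; [apply: Rlt_le; apply: exp_pos | lra].
  set u0 := _ * exp (dd * _) in hu0 *.
  rewrite {1}/U; case: Rle_dec => hxi /=.
    pose xi := ztail k; rewrite -/xi in hxi *.
    have [q1 q2] := hw xi hxi.
    have q0 : 0 <= snd (w xi) by apply: Rle_trans (Cmod_ge_0 _) (q1 0%Z).
    have hgx : forall tau, Cmod (coef g (consz tau xi)) <= A * exp (- e * (omZ tau + W xi)).
      move=> s; apply: Rle_trans (proj2 (proj2 hg) _) _; apply: Rmult_le_compat_l => //.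
      apply: Rle_trans (W_split_exp s xi (Rlt_le _ _ hd)) _.
      apply: exp_le; have := omZ_ge0 Hw s; have := W_ge0 Hw xi; nra.
    have h := HE xi _ _ A (snd (w xi)) (d0 / 2) hxi q2 ltac:(lra) (Rle_refl _) ltac:(move=> s;
      apply: Rle_trans (q1 s) _; rewrite -{1}(Rmult_1_r (snd (w xi))); apply: Rmult_le_compat_l => //;
      rewrite -exp_0; apply: exp_le; apply: Rmult_le_pos; [lra | exact: omZ_ge0]) hgx (k ord0).
    have h4 := @W_merge_exp del' (k ord0) xi (Rlt_le _ _ hdel').
    have h5 : exp (- del' * W (consz (k ord0) xi)) <= exp (- dd * W k).
      by rewrite /xi consz_ztail; apply: exp_le; nra.
    have h6 := Rmult_le_compat_l _ _ _ hKA (Rle_trans _ _ _ h4 h5).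
    have : 0 <= (A + u0) * exp (- dd * W k) by apply: Rmult_le_pos; lra.
    lra.
  have hz := nrm1_lt1 hxi.
  have ht : k ord0 <> 0%Z.
    by move=> ht; apply: hk; apply: functional_extensionality => i; case: (unliftP ord0 i) => [j ->|->]; [apply: hz | apply: ht].
  have h1 := Rabs_IZR_ge1 ht.
  rewrite Cmod_div; last by move=> [] /eq_IZR.
  rewrite Cmod_imag.
  have h2 : Cmod (coef g k) / Rabs (IZR (k ord0)) <= Cmod (coef g k).
    apply: (Rmult_le_reg_r (Rabs (IZR (k ord0)))); first lra.
    rewrite /Rdiv Rmult_assoc Rinv_l; last lra.
    have := Cmod_ge_0 (coef g k); nra.
  have h3 := proj2 (proj2 hg) k.
  have h4 : A * exp (- d * W k) <= A * exp (- dd * W k).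
    by apply: Rmult_le_compat_l => //; apply: exp_le; nra.
  have : 0 <= (K * A + u0) * exp (- dd * W k) by apply: Rmult_le_pos; lra.
  lra.
have [K5 [_ H5]] := @synth om Hw N.+1 dd hdd.
have [f [hf [cff _]]] := H5 U _ hUb.
have hfE : Eom om f by apply/(Eom_iff Hw Hs); eexists; exists dd; split; [exact: hdd | exact: hf].
exists f; split=> //.
have hLE := LC_Eom Hw Hs Hd0 Hcf hfE.
have /(Eom_iff Hw Hs) [A9 [d9 [_ [l1 [l2 _]]]]] := hLE.
apply: cd_fun_eq => //; [by case: hg | by case: hg => _ [] |].
move=> k; pose tau := k ord0; pose xi := ztail k.
have hL := LC_coef Hw Hs Hd0 Hcf xi hfE.
have ek' : consz tau xi = k by apply: consz_ztail.
case: (Rle_dec 1 (nrm1 xi)) => hxi.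
  have [_ q2] := hw xi hxi.
  have hL2 : L1rel gam xi (fst (w xi)) (fun tau => coef (LC cf f) (consz tau xi)).
    apply: L1rel_ext hL => // t; rewrite cff /U.
    case: Rle_dec => h /=; first by rewrite ztail_consz consz0.
    by exfalso; apply: h; rewrite ztail_consz.
  by have := L1rel_fun q2 hL2 tau; rewrite ek'.
have hz := nrm1_lt1 hxi.
have := L1rel_zero hz hL tau; rewrite ek' => ->; rewrite cff; rewrite -/xi in hxi.
case: (Z.eq_dec tau 0) => ht.
  have -> : k = @zeroz _.
    by apply: functional_extensionality => i; case: (unliftP ord0 i) => [j ->|->]; [apply: hz | apply: ht].
  rewrite g0 ht; have -> : ((0, 0) : C) = RtoC 0 by [].
  ring.
rewrite /U -/xi -/tau; case: Rle_dec => h /=; first by [].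
have hne : ((0, IZR tau) : C) <> RtoC 0 by move=> [] /eq_IZR.
by field.
Qed.

End Main.
Arguments ax_cont [om N a b B d0] Hcf xi t.
Arguments bx_cont [om N a b B d0] Hcf xi t.

(** * Range and kernel *)

Section Range.
Variable om : R -> R.
Hypothesis Hw : weight_function om.
Hypothesis Hs : subadditive om.
Variables (N : nat) (a b : 'I_N -> R -> R) (B d0 : R).
Hypothesis Hd0 : 0 < d0.
Hypothesis HB0 : 0 <= B.
Hypothesis Hcf : forall j, cd om (lift1 (cf a b j)) B d0.
Notation W := (W om).
Notation cd := (cd om).
Notation omZ := (omZ om).
Notation gam := (gam (cf a b)).
Notation LL := (LC (cf a b)).

Lemma consz_zero : consz 0 (@zeroz N) = @zeroz N.+1.
Proof.
by apply: functional_extensionality => i; case: (unliftP ord0 i) => [j ->|->]; rewrite ?consz_lift ?consz0.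
Qed.

Lemma range_coef0 f : Eom om f -> coef (LL f) (@zeroz N.+1) = RtoC 0.
Proof.
move=> hf; have h := LC_coef Hw Hs Hd0 Hcf (@zeroz N) hf.
have := L1rel_zero (fun j => erefl) h 0%Z; rewrite consz_zero => ->.
have -> : ((0, 0) : C) = RtoC 0 by []. 
ring.
Qed.

Lemma Estep_Eom n k (f : Fn n) : (1 <= k)%N -> Estep om k f -> Eom om f.
Proof.
move=> hk [h1 [h2 h3]]; split=> //; split=> //; exists (/ INR k); split=> //.
apply: Rinv_0_lt_compat; case: k hk {h3} => // k _; rewrite S_INR; have := pos_INR k; lra.
Qed.

Lemma coef_ultra n k : linE om (fun f : Fn n => coef f k) /\ cbd om (fun f : Fn n => coef f k).
Proof.
have cE : forall f : Fn n, Eom om f -> contC f.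
  by move=> f /(Eom_iff Hw Hs) [A [d [_ hh]]]; case: hh.
split; first by move=> f g c hf hg; apply: coef_lin; apply: cE.
move=> del hd; exists (exp (- del * W k)); split; first by apply: Rlt_le; apply: exp_pos.
by move=> f A [_ [_ h]]; rewrite Rmult_comm.
Qed.

(** The range is the kernel of one continuous functional, the zeroth coefficient, and this
    functional spans the kernel of the transpose. *)
Lemma cond_solv : EDC1 om (fun j => mean (a j)) (fun j => mean (b j)) ->
  (forall xi, ~ changes_sign (bx b xi)) -> strongly_solvable om a b.
Proof.
move=> hedc hsign.
have cE : forall n (f : Fn n), Eom om f -> contC f.
  by move=> n f /(Eom_iff Hw Hs) [A [d [_ hh]]]; case: hh.
have hsol := solve_E Hw Hs Hd0 HB0 Hcf hedc hsign.
have [cl cb] := coef_ultra (@zeroz N.+1).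
split.
  split; first by move=> _ [f [hf ->]]; apply: (LC_Eom Hw Hs Hd0 Hcf hf).
  split; first by move=> u [].
  move=> u [hu hnu].
  have hr : coef u (@zeroz N.+1) <> RtoC 0.
    by move=> h0; apply: hnu; have [f [h1 h2]] := hsol u hu h0; exists f.
  have hr0 : 0 < Cmod (coef u (@zeroz N.+1)) by apply/Cmod_gt_0.
  set r := Cmod _ in hr0.
  (* Adding [v] from this neighbourhood cannot cancel the mean of [u]. *)
  exists (fun v => Eom om v /\ Cmod (coef v (@zeroz N.+1)) < r); split; first by move=> v [].
  split.
    move=> f g c d [f1 f2] [g1 g2] hcd.
    have e : fadd (fscal c f) (fscal d g) = (fun x => c * f x + d * g x)%C by [].
    rewrite e; split; first by apply: Eom_lin => //; apply: Eom_scal.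
    rewrite coef_lin ?coef_scal; [|exact: cE|exact: cE|by apply: contC_mult; [exact: contC_const|exact: cE]].
    move: (coef f _) (coef g _) f2 g2 => p q f2 g2.
    apply: Rle_lt_trans (Cmod_triangle _ _) _; rewrite !Cmod_mult.
    have hc := Cmod_ge_0 c; have hd := Cmod_ge_0 d.
    have m1 := Rmax_l (Cmod p) (Cmod q); have m2 := Rmax_r (Cmod p) (Cmod q).
    have m3 : Rmax (Cmod p) (Cmod q) < r by apply: Rmax_lub_lt.
    move: m1 m2 m3; set m := Rmax _ _ => m1 m2 m3.
    have m4 : 0 <= m by apply: Rle_trans m1; apply: Cmod_ge_0.
    have := Rmult_le_compat_l _ _ _ hc m1; have := Rmult_le_compat_l _ _ _ hd m2; nra.
  split.
    move=> k hk; have hk0 : 0 < INR k by case: k hk => // k _; rewrite S_INR; have := pos_INR k; lra.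
    have [K [del [hK [hd H]]]] := @Eom_cd om Hw Hs N.+1 (/ INR k) (Rinv_0_lt_compat _ hk0).
    have hexp := exp_pos (- del * W (@zeroz N.+1)).
    have hKe : 0 < K * exp (- del * W (@zeroz N.+1)) by apply: Rmult_lt_0_compat.
    exists (r / (K * exp (- del * W (@zeroz N.+1)))); split; first by apply: Rdiv_lt_0_compat.
    move=> f hf hlt; split; first exact: Estep_Eom hf.
    case: hf => f1 [f2 f3]; have [_ [_ hc]] := H f f1 f2 f3.
    apply: Rle_lt_trans (hc _) _.
    have := Rmult_lt_compat_l _ _ _ hKe hlt.
    have -> : K * exp (- del * W (@zeroz N.+1)) * (r / (K * exp (- del * W (@zeroz N.+1)))) = r by field; lra.
    lra.
  move=> v [v1 v2]; have e : fadd u v = (fun x => u x + v x)%C by [].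
  rewrite e; split; first exact: Eom_plus.
  move=> [f [f1 f2]].
  have h0 := range_coef0 f1; rewrite -[LL f]/(Lop a b f) -f2 coef_plus in h0; [|exact: cE|exact: cE].
  have : Cmod (coef u (@zeroz N.+1)) = Cmod (coef v (@zeroz N.+1)).
    have -> : coef u (@zeroz N.+1) = (- coef v (@zeroz N.+1))%C.
      have -> : (coef u (@zeroz N.+1) = (coef u (@zeroz N.+1) + coef v (@zeroz N.+1)) - coef v (@zeroz N.+1))%C by ring.
      by rewrite h0; ring.
    exact: Cmod_opp.
  by rewrite -/r; lra.
exists 1%N, (fun _ f => coef f (@zeroz N.+1)); split.
  move=> _; split; first by apply/(ultra_iff Hw Hs).
  by move=> f hf; apply: range_coef0.
move=> mu [hmu hker]; have [h1 h2] := proj1 (ultra_iff Hw Hs mu) hmu.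
exists (fun _ => mu (ek (@zeroz N.+1))) => f hf.
rewrite sumC_S sumC_0.
(* Without its mean [f] lies in the range, where [mu] vanishes; so [mu f] is the mean times [mu] of
   the constant 1. *)
pose g := (fun x => (RtoC (-1) * coef f (@zeroz N.+1)) * ek (@zeroz N.+1) x + f x)%C.
have hg : Eom om g by apply: Eom_lin => //; apply: Eom_ek.
have [h [hh1 hh2]] : exists h, Eom om h /\ g = LL h.
  apply: hsol => //; rewrite coef_lin ?coef_ek_same; [ring | exact: ek_contC | exact: cE].
have := hker h hh1; rewrite -[Lop a b h]/(LL h) -hh2 /g h1 //; last exact: Eom_ek.
move=> e; have -> : (mu f = (RtoC (-1) * coef f (@zeroz N.+1) * mu (ek (@zeroz N.+1)) + mu f) + mu (ek (@zeroz N.+1)) * coef f (@zeroz N.+1))%C by ring.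
by rewrite e; ring.
Qed.

(** * Necessity *)

(* [V] is the mode and [H] its image under the fibre operator. *)
Definition badw (A del : R) (xi : 'I_N -> Z) (p : (R -> C) * (R -> C) * (R -> C)) : Prop :=
  let: (V, V', H) := p in
  cder V V' /\ ccont V' /\ (forall t, V (t + 2 * PI) = V t) /\ ccont H /\
  (forall t, V' t + (0, 1) * cxi (cf a b) xi t * V t = H t)%C /\
  (forall t, Cmod (V t) <= 1) /\ (exists t, Cmod (V t) = 1) /\
  forall tau, Cmod (coef1 H tau) <= A * exp (- del * (omZ tau + W xi)).

Definition bad A del xi : Prop := 1 <= nrm1 xi /\ exists p, badw A del xi p.

(** Modes are chosen on the bad fibres and extended by zero: a formal solution of L U = G with [U]
    merely bounded and [G] in the class. *)
Lemma bad_family A del : 0 < del -> exists (U G : ('I_N.+1 -> Z) -> C),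
  (forall k, Cmod (U k) <= 1) /\ (forall k, Cmod (G k) <= Rabs A * exp (- del * W k)) /\
  (forall xi, L1rel gam xi (fun tau => U (consz tau xi)) (fun tau => G (consz tau xi))) /\
  (forall xi, ~ bad A del xi -> forall tau, U (consz tau xi) = RtoC 0 /\ G (consz tau xi) = RtoC 0) /\
  (forall xi, bad A del xi -> exists V V' H, badw A del xi (V, V', H) /\
     (forall tau, U (consz tau xi) = coef1 V tau) /\ forall tau, G (consz tau xi) = coef1 H tau).
Proof.
move=> hd.
pose z0 : R -> C := fun _ => RtoC 0.
pose w xi := epsilon (inhabits (z0, z0, z0)) (badw A del xi).
pose U k := if excluded_middle_informative (bad A del (ztail k)) then coef1 (fst (fst (w (ztail k)))) (k ord0) else RtoC 0.
pose G k := if excluded_middle_informative (bad A del (ztail k)) then coef1 (snd (w (ztail k))) (k ord0) else RtoC 0.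
have hw : forall xi, bad A del xi -> badw A del xi (w xi).
  by move=> xi [_ h]; apply: (epsilon_spec (inhabits (z0, z0, z0)) (badw A del xi)).
have U1 : forall xi, bad A del xi -> forall tau, U (consz tau xi) = coef1 (fst (fst (w xi))) tau.
  move=> xi hb tau; rewrite /U; case: excluded_middle_informative => h /=; first by rewrite ztail_consz consz0.
  by exfalso; apply: h; rewrite ztail_consz.
have G1 : forall xi, bad A del xi -> forall tau, G (consz tau xi) = coef1 (snd (w xi)) tau.
  move=> xi hb tau; rewrite /G; case: excluded_middle_informative => h /=; first by rewrite ztail_consz consz0.
  by exfalso; apply: h; rewrite ztail_consz.
have U0 : forall xi, ~ bad A del xi -> forall tau, U (consz tau xi) = RtoC 0 /\ G (consz tau xi) = RtoC 0.
  by move=> xi hb tau; rewrite /U /G; case: excluded_middle_informative => h //=; rewrite ztail_consz in h.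
have hX : forall k : 'I_N.+1 -> Z, 0 <= Rabs A * exp (- del * W k).
  by move=> k; apply: Rmult_le_pos; [apply: Rabs_pos | apply: Rlt_le; apply: exp_pos].
exists U, G; split; [|split; [|split; [|split => //]]].
- move=> k; rewrite -(consz_ztail k); case: (classic (bad A del (ztail k))) => hb.
    rewrite U1 //; have := hw _ hb; case: (w _) => [[V V'] H] [hV [_ [_ [_ [_ [hV1 _]]]]]].
    by apply: coef1_sup => //; apply: cder_cont hV.
  by have [-> _] := U0 _ hb (k ord0); rewrite Cmod_0; lra.
- move=> k; rewrite -{1}(consz_ztail k); case: (classic (bad A del (ztail k))) => hb.
    rewrite G1 //; have := hw _ hb; case: (w _) => [[V V'] H] [_ [_ [_ [_ [_ [_ [_ hH]]]]]]] /=.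
    apply: Rle_trans (hH _) _.
    apply: Rle_trans (_ : Rabs A * exp (- del * (omZ (k ord0) + W (ztail k))) <= _).
      by apply: Rmult_le_compat_r; [apply: Rlt_le; apply: exp_pos | apply: Rle_abs].
    apply: Rmult_le_compat_l; first exact: Rabs_pos.
    rewrite -{3}(consz_ztail k); apply: exp_le; have := W_consz Hs (k ord0) (ztail k); nra.
  by have [_ ->] := U0 _ hb (k ord0); rewrite Cmod_0.
- move=> xi; case: (classic (bad A del xi)) => hb.
    have := hw _ hb; case ew : (w xi) => [[V V'] H] [hV [cV' [pV [_ [hE _]]]]].
    apply: L1rel_ext (ode_L1rel Hw Hd0 Hcf hV cV' pV hE) => t; [rewrite U1 | rewrite G1] => //; by rewrite ew.
  apply: (@L1rel_ext _ _ _ (fun _ => RtoC 0) _ (fun _ => RtoC 0)) => [t|t|].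
  - by case: (U0 _ hb t).
  - by case: (U0 _ hb t).
  - move=> tau; exists (fun _ => RtoC 0); split.
      move=> j; apply: Cconv_ext (Cconv_const (RtoC 0)) => r.
      rewrite (@zs_ext C Cplus r _ (fun _ => RtoC 0 * RtoC 0 + RtoC 0)%C); last by move=> i; ring.
      by elim: r => [|r IH] /=; rewrite -?IH; ring.
    rewrite (sumC_ext (G := fun j => RtoC 0 * (0, IZR (xi j)))%C); first by rewrite sumC_scal; ring.
    by move=> j; ring.
- move=> xi hb; have := hw _ hb; case ew : (w xi) => [[V V'] H] hh.
  exists V, V', H; split=> //; split=> tau; [rewrite U1 | rewrite G1] => //; by rewrite ew.
Qed.

Lemma W_infty X : exists R0, forall xi : 'I_N -> Z, R0 < nrm1 xi -> X <= W xi.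
Proof.
have [T [hT H]] := @om_infty om Hw X.
by exists T => xi hxi; apply: H; lra.
Qed.

(** Decay of [U] would bound the mode on the fibre xi by a constant times exp(-(d'/2) omega(xi)),
    below 1 for large xi, although its sup norm is 1. *)
Lemma not_decay A del U : 0 < del ->
  (forall xi, bad A del xi -> exists V V' H, badw A del xi (V, V', H) /\
     (forall tau, U (consz tau xi) = coef1 V tau)) ->
  (forall X, exists xi, X < nrm1 xi /\ bad A del xi) ->
  ~ exists A' del', 0 < del' /\ forall k, Cmod (U k) <= A' * exp (- del' * W k).
Proof.
move=> hd hb hu [A' [d' [hd' hU]]].
have hA' : 0 <= A'.
  by have := Rle_trans _ _ _ (Cmod_ge_0 _) (hU (@zeroz _)); have := exp_pos (- d' * W (@zeroz N.+1)); nra.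
have [K [hK HK]] := @cd_Eom om Hw 1 (d' / 2) ltac:(lra).
have [R0 hR0] := W_infty (2 / d' * ln (K * A' + 1) + 1).
have [xi [hxi hbx]] := hu R0.
have [V [V' [H [[hV [cV' [pV [cH [hE [hV1 [[t ht] _]]]]]]] hUV]]]] := hb xi hbx.
have cV := cder_cont hV.
have cdV : cd (lift1 V) (A' * exp (- (d' / 2) * W xi)) (d' / 2).
  apply: coef1_cd => // tau; rewrite -hUV; apply: Rle_trans (hU _) _.
  rewrite Rmult_assoc -exp_plus; apply: Rmult_le_compat_l => //; apply: exp_le.
  have := W_consz_l Hw tau xi; have := W_consz_r Hw tau xi; nra.
have [_ [hs _]] := HK _ _ cdV.
have := hs (fun _ => t); rewrite /lift1 ht => h1.
have hW := hR0 xi hxi.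
have hKA : 0 <= K * A' by apply: Rmult_le_pos; lra.
have h2 : exp (- (d' / 2) * W xi) < / (K * A' + 1).
  rewrite -(exp_ln (/ (K * A' + 1))); last by apply: Rinv_0_lt_compat; lra.
  rewrite ln_Rinv; last lra.
  apply: exp_increasing.
  have := Rmult_le_compat_l (d' / 2) _ _ ltac:(lra) hW.
  have -> : d' / 2 * (2 / d' * ln (K * A' + 1) + 1) = ln (K * A' + 1) + d' / 2 by field; lra.
  lra.
have h3 : (K * A' + 1) * exp (- (d' / 2) * W xi) < 1.
  apply: Rlt_le_trans (Rmult_lt_compat_l _ _ _ _ h2) _; first lra.
  by rewrite Rinv_r; lra.
have := exp_pos (- (d' / 2) * W xi); lra.
Qed.

Lemma neg_hypo A del : 0 < del -> (forall X, exists xi, X < nrm1 xi /\ bad A del xi) ->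
  ~ glob_hypoelliptic om a b.
Proof.
move=> hd hu hyp.
have [U [G [hU1 [hG [hL [h0 hb]]]]]] := bad_family A hd.
have hv := vol_pos N.+1; set v := (2 * PI) ^ N.+1 in hv.
have hvi := Rinv_0_lt_compat _ hv.
have hslow : slow om U.
  move=> eps he; exists 1 => k; apply: Rle_trans (hU1 k) _; rewrite Rmult_1_l -exp_0.
  by apply: exp_le; apply: Rmult_le_pos; [lra | apply: W_ge0].
have [mu [hmu emu]] := slow_ultra Hw Hs hslow.
have [m1 m2] := proj1 (ultra_iff Hw Hs mu) hmu.
have [K [_ HK]] := @synth om Hw N.+1 del hd.
have hGv : forall k, Cmod (RtoC (/ v) * G k)%C <= / v * Rabs A * exp (- del * W k).
  move=> k; rewrite Cmod_mult Cmod_R Rabs_right; last lra.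
  by rewrite Rmult_assoc; apply: Rmult_le_compat_l; [lra | apply: hG].
have [g [hg [cg _]]] := HK _ _ hGv.
have hgE : Eom om g by apply/(Eom_iff Hw Hs); eexists; exists del; split; [exact: hd | exact: hg].
have [f1 f2] := fdist_ultra Hw Hs hgE.
have [l1 l2] := LC_ultra Hw Hs Hd0 Hcf m1 m2.
have hLg : forall h, Eom om h -> (- mu (Lop a b h))%C = fdist g h.
  apply: (ultra_eq Hw Hs l1 l2 f1 f2) => k.
  rewrite -(negzK k) fdist_ek cg Cmult_assoc -RtoC_mult Rinv_r; last by rewrite -/v; lra.
  rewrite Cmult_1_l.
  set k' := negz k; rewrite -(consz_ztail k').
  set tau := k' ord0; set xi := ztail k'.
  have h1 := LC_mu Hw Hs Hd0 Hcf xi m1 m2.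
  have h2 : L1rel gam xi (fun tau => U (consz tau xi)) (fun tau => - mu (LL (ek (negz (consz tau xi)))))%C.
    by apply: L1rel_ext h1 => t //; rewrite emu.
  exact: (L1rel_fun h2 (hL xi)).
have [f [hf Hf]] := hyp mu hmu (ex_intro _ g (conj hgE hLg)).
have /(Eom_iff Hw Hs) [A' [d' [hd' hfA]]] := hf.
apply: (@not_decay A del U hd _ hu).
  by move=> xi /hb [V [V' [H [q1 [q2 _]]]]]; exists V, V', H.
exists (v * A'), d'; split=> // k.
rewrite -emu Hf; last exact: Eom_ek.
rewrite fdist_ek Cmod_mult Cmod_R Rabs_right; last by rewrite -/v; lra.
by rewrite Rmult_assoc; apply: Rmult_le_compat_l; [rewrite -/v; lra | case: hfA => _ []].
Qed.

(** If [F] were an image, the fibres of a preimage would have to agree with those of [U], since q <>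
    1 makes fibre solutions unique; this contradicts [not_decay]. *)
Lemma neg_solv A del : 0 < del -> del <= d0 / 2 ->
  (forall X, exists xi, X < nrm1 xi /\ bad A del xi) ->
  (forall xi, bad A del xi -> qx a b xi <> RtoC 1) -> ~ strongly_solvable om a b.
Proof.
move=> hd hd2 hu hq [[_ [_ hop]] _].
have [U [G [hU1 [hG [hL [h0 hb]]]]]] := bad_family A hd.
have [Gm [hGm Hreg]] := reg_bounded Hw Hs Hd0 HB0 Hcf.
have [K [hK HK]] := @synth om Hw N.+1 del hd.
have [F [hF [cF _]]] := HK G _ hG.
have hFE : Eom om F by apply/(Eom_iff Hw Hs); eexists; exists del; split; [exact: hd | exact: hF].
have hA0 := Rabs_pos A.
have hUdec : forall xi, 1 <= nrm1 xi -> forall tau,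
   Cmod (U (consz tau xi)) <= 2 * (Rabs A + 1 * exp (del * Gm * W xi)) * exp (- del * omZ tau).
  move=> xi hxi; apply: (Hreg del xi (fun tau => U (consz tau xi)) (fun tau => G (consz tau xi)) _ 0 1) => //; first lra.
  move=> tau; rewrite Rmult_0_l Rplus_0_r; apply: Rle_trans (hG _) _; apply: Rmult_le_compat_l => //.
  by apply: exp_le; have := W_consz_l Hw tau xi; nra.
(* The truncations of [F] to [nrm1 xi <= X] are images of truncations of [U] and converge to [F], which
   therefore lies in the range if the range is closed. *)
have htr : forall X, 0 <= X -> exists w, Eom om w /\
    forall k, coef (LL w) k = if Rle_dec (nrm1 (ztail k)) X then G k else RtoC 0.
  move=> X hX.
  pose UX k := if Rle_dec (nrm1 (ztail k)) X then U k else RtoC 0.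
  pose AX := 2 * (Rabs A + 1 * exp (del * Gm * om X)) * exp (del * om X).
  have hAX : 0 <= AX.
    apply: Rmult_le_pos; last by apply: Rlt_le; apply: exp_pos.
    by have := exp_pos (del * Gm * om X); lra.
  have hUX : forall k, Cmod (UX k) <= AX * exp (- del * W k).
    move=> k; have hz : 0 <= AX * exp (- del * W k) by apply: Rmult_le_pos => //; apply: Rlt_le; apply: exp_pos.
    rewrite /UX; case: Rle_dec => h /=; last by rewrite Cmod_0.
    case: (classic (bad A del (ztail k))) => hbk; last first.
      by have [e _] := h0 _ hbk (k ord0); rewrite -{1}(consz_ztail k) e Cmod_0.
    rewrite -{1}(consz_ztail k); apply: Rle_trans (hUdec _ (proj1 hbk) _) _.
    have hWX : W (ztail k) <= om X by apply: om_mono => //; apply: nrm1_ge0.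
    have h1 : exp (del * Gm * W (ztail k)) <= exp (del * Gm * om X).
      by apply: exp_le; apply: Rmult_le_compat_l => //; apply: Rmult_le_pos; lra.
    rewrite /AX (Rmult_assoc _ _ (exp (- del * W k))) -exp_plus.
    apply: Rmult_le_compat; [|by apply: Rlt_le; apply: exp_pos | lra |].
      by have := exp_pos (del * Gm * W (ztail k)); lra.
    apply: exp_le; have h2 := W_consz Hs (k ord0) (ztail k); rewrite consz_ztail in h2.
    nra.
  have [w [hw [cw _]]] := HK UX _ hUX.
  have hwE : Eom om w by apply/(Eom_iff Hw Hs); eexists; exists del; split; [exact: hd | exact: hw].
  exists w; split=> // k.
  have h1 := LC_coef Hw Hs Hd0 Hcf (ztail k) hwE.
  case: Rle_dec => h /=.
    have h2 : L1rel gam (ztail k) (fun tau => U (consz tau (ztail k))) (fun tau => coef (LL w) (consz tau (ztail k))).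
      apply: L1rel_ext h1 => // t; rewrite cw /UX ztail_consz; case: Rle_dec => //.
    by have := L1rel_fun h2 (hL (ztail k)) (k ord0); rewrite consz_ztail.
  have h2 : L1rel gam (ztail k) (fun tau => RtoC 0) (fun tau => coef (LL w) (consz tau (ztail k))).
    apply: L1rel_ext h1 => // t; rewrite cw /UX ztail_consz; case: Rle_dec => //.
  have [P [hP e]] := h2 (k ord0); rewrite consz_ztail in e; rewrite e.
  rewrite (sumC_ext (G := fun j => RtoC 0 * (0, IZR (ztail k j)))%C); first by rewrite sumC_scal; ring.
  move=> j; have -> : P j = RtoC 0; last by ring.
  apply: Cconv_unique (hP j) _; apply: Cconv_ext (Cconv_const (RtoC 0)) => r.
  rewrite (@zs_ext C Cplus r _ (fun _ => RtoC 0)); last by move=> i; ring.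
  by elim: r => [|r IH] //=; rewrite -IH; ring.
have hrange : exists f, Eom om f /\ F = Lop a b f.
  apply: NNPP => hnF.
  have [V [_ [_ [hball hV]]]] := hop F (conj hFE hnF).
  have [K2 [hK2 H2]] := @cd_Eom om Hw N.+1 (del / 2) ltac:(lra).
  (* Truncation leaves rate del/2, and the step 1/m must be at most half of it. *)
  have [m hm] := INR_unbounded (4 / del).
  have h4d : 0 < 4 / del by apply: Rdiv_lt_0_compat; lra.
  have hm0 : 0 < INR m by lra.
  have hm1 : (1 <= m)%N by case: m hm0 {hm} => //=; lra.
  have hl : 0 < / INR m by apply: Rinv_0_lt_compat.
  have hl2 : / INR m <= del / 2 / 2.
    have -> : del / 2 / 2 = / (4 / del) by field; lra.
    by apply: Rinv_le_contravar; lra.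
  have [eps [heps hbl]] := hball m hm1.
  have hden : 0 < K2 * (Rabs A + 1) by apply: Rmult_lt_0_compat; lra.
  (* From this cut-off on, the truncation error is below [eps] in the norm of the step m. *)
  have [T [hT0 hT]] := @om_infty om Hw (- ln (eps / (K2 * (Rabs A + 1))) * (2 / del)).
  have [w [hwE cw]] := htr T hT0.
  pose v : Fn N.+1 := fun x => (RtoC (-1) * F x + LL w x)%C.
  have hLw := LC_Eom Hw Hs Hd0 Hcf hwE.
  have /(Eom_iff Hw Hs) [A9 [d9 [_ [l1 [l2 _]]]]] := hLw.
  have cF0 : contC F by case: hF.
  have hcd : cd v (Rabs A * exp (- (del / 2) * om T)) (del / 2).
    split; first by apply: contC_plus => //; apply: contC_mult => //; exact: contC_const.
    split; first by move=> x j; rewrite /v l2; case: hF => _ [-> _].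
    move=> k; rewrite /v coef_lin // cw cF; case: Rle_dec => h /=.
      have -> : (RtoC (-1) * G k + G k = RtoC 0)%C by ring.
      by rewrite Cmod_0; apply: Rmult_le_pos; [apply: Rmult_le_pos => // |]; apply: Rlt_le; apply: exp_pos.
    have -> : (RtoC (-1) * G k + RtoC 0 = - G k)%C by ring.
    rewrite Cmod_opp; apply: Rle_trans (hG k) _; rewrite Rmult_assoc -exp_plus.
    apply: Rmult_le_compat_l => //; apply: exp_le.
    have h1 : om T <= W (ztail k) by apply: om_mono => //; lra.
    have h2 := W_consz_r Hw (k ord0) (ztail k); rewrite consz_ztail in h2.
    nra.
  have [s1 [_ s2]] := H2 _ _ hcd; have [u1 u2] := s2 _ hl hl2.
  have hvV : V v.
    apply: hbl; first by split; [case: hcd => _ [] | split].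
    apply: Rle_lt_trans u2 _.
    have hq0 : 0 < eps / (K2 * (Rabs A + 1)) by apply: Rdiv_lt_0_compat.
    have h1 : exp (- (del / 2) * om T) <= eps / (K2 * (Rabs A + 1)).
      rewrite -[X in _ <= X](exp_ln _ hq0); apply: exp_le.
      have := Rmult_le_compat_l (del / 2) _ _ ltac:(lra) (hT T (Rle_refl _)).
      have -> : del / 2 * (- ln (eps / (K2 * (Rabs A + 1))) * (2 / del)) = - ln (eps / (K2 * (Rabs A + 1))) by field; lra.
      lra.
    have h2 : K2 * (Rabs A + 1) * (eps / (K2 * (Rabs A + 1))) = eps by field; lra.
    have h3 := exp_pos (- (del / 2) * om T).
    have h4 : K2 * (Rabs A + 1) * exp (- (del / 2) * om T) <= eps.
      by rewrite -h2; apply: Rmult_le_compat_l; lra.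
    have : 0 < K2 * exp (- (del / 2) * om T) by apply: Rmult_lt_0_compat.
    lra.
  have [_ hnot] := hV v hvV; apply: hnot; exists w; split=> //.
  rewrite -[Lop a b w]/(LL w).
  apply: functional_extensionality => x; rewrite /fadd /v; ring.
have [w [hwE eF]] := hrange; rewrite -[Lop a b w]/(LL w) in eF.
have /(Eom_iff Hw Hs) [Aw [dw [hdw hw]]] := hwE.
have hAw := cd_A_ge0 hw.
apply: (@not_decay A del U hd _ hu).
  by move=> xi /hb [V [V' [H [q1 [q2 _]]]]]; exists V, V', H.
exists Aw, dw; split=> // k.
have hz : 0 <= Aw * exp (- dw * W k) by apply: Rmult_le_pos => //; apply: Rlt_le; apply: exp_pos.
case: (classic (bad A del (ztail k))) => hbk; last first.
  by have [e _] := h0 _ hbk (k ord0); rewrite -{1}(consz_ztail k) e Cmod_0.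
have [V [V' [H [[hV [cV' [pV [cH [hE _]]]]] [eU eG]]]]] := hb _ hbk.
set xi := ztail k in hbk hE eU eG.
have hLw : L1rel gam xi (fun tau => coef w (consz tau xi)) (fun tau => G (consz tau xi)).
  by apply: L1rel_ext (LC_coef Hw Hs Hd0 Hcf xi hwE) => // t; rewrite -eF cF.
have hwd : forall tau, Cmod (coef w (consz tau xi)) <= Aw * exp (- dw * omZ tau).
  move=> tau; apply: Rle_trans (proj2 (proj2 hw) _) _; apply: Rmult_le_compat_l => //; apply: exp_le.
  by have := W_consz_l Hw tau xi; nra.
have [V2 [V2' [H2 [hV2 [cV2' [pV2 [cH2 [pH2 [hE2 [cu cg]]]]]]]]]] := realize Hw Hd0 Hcf hdw hwd hLw.
have pH : forall t, H (t + 2 * PI) = H t.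
  by move=> t; rewrite -!hE pV (cder_periodic hV pV) (cxi_periodic Hcf).
have eH : forall t, H2 t = H t by apply: coef1_uniq => // tau; rewrite cg eG.
have dV : cder (fun t => V t + RtoC (-1) * V2 t)%C (fun t => V' t + RtoC (-1) * V2' t)%C.
  apply: cder_plus => //; apply: cder_ext (cder_mult (cder_const (RtoC (-1))) hV2) => t; ring.
have hE3 : forall t, ((V' t + RtoC (-1) * V2' t) + (0, 1) * (ax a xi t, bx b xi t) * (V t + RtoC (-1) * V2 t) = RtoC 0)%C.
  move=> t; rewrite -cxi_pair.
  have -> : ((V' t + RtoC (-1) * V2' t) + (0, 1) * cxi (cf a b) xi t * (V t + RtoC (-1) * V2 t) =
    (V' t + (0, 1) * cxi (cf a b) xi t * V t) + RtoC (-1) * (V2' t + (0, 1) * cxi (cf a b) xi t * V2 t))%C by ring.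
  by rewrite hE hE2 eH; ring.
have hper : forall t, (V (t + 2 * PI)%R + RtoC (-1) * V2 (t + 2 * PI)%R = V t + RtoC (-1) * V2 t)%C.
  by move=> t; rewrite pV pV2.
have eV : forall t, V t = V2 t.
  move=> t; have := ode_unique (ax_cont Hcf xi) (bx_cont Hcf xi) (ax_per Hcf xi) (bx_per Hcf xi) dV (ccont_const (RtoC 0)) hE3
    hper (hq _ hbk) (fun t => erefl) t => e.
  have -> : (V t = (V t + RtoC (-1) * V2 t) + V2 t)%C by ring.
  by rewrite e; ring.
rewrite -{1}(consz_ztail k) eU (_ : V = V2); last by apply: functional_extensionality.
by rewrite cu consz_ztail; case: hw => _ [].
Qed.

End Range.

Lemma periodic_max (V : R -> C) : ccont V -> (forall t, V (t + 2 * PI) = V t) ->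
  exists s, forall t, Cmod (V t) <= Cmod (V s).
Proof.
move=> cV pV.
have hc : forall c, 0 <= c <= 2 * PI -> continuity_pt (fun t => Cmod (V t)) c.
  move=> c _; apply/continuity_pt_filterlim; apply/(continuous_eps (fun t => Cmod (V t)) c) => eps he.
  have [d [hd H]] := cV c eps he; exists d; split=> // s hs.
  have h1 := H s hs; apply: Rle_lt_trans h1.
  apply: Rabs_le; have := Cmod_sub_le (V s) (V c); have := Cmod_sub_le (V c) (V s).
  by rewrite (Cmod_minus_sym (V c)); lra.
have [s [hs _]] := continuity_ab_maj (fun t => Cmod (V t)) 0 (2 * PI) (Rlt_le _ _ pi2_pos) hc.
exists s => t; have [r [hr ->]] := periodic_reduce 0 t pV; apply: hs; lra.
Qed.

(* A diagonal matrix with nonzero entries, infinite in both directions, has no factorisation of finite rank. *)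
Lemma diag_not_finite_rank m (c : nat -> 'I_m -> C) (e : 'I_m -> nat -> C) (w : nat -> C) :
  (forall p, w p <> RtoC 0) ->
  ~ forall p q, sumC (fun i => c p i * e i q)%C = if p == q then w p else RtoC 0.
Proof.
elim: m c e w => [|m IH] c e w hw H.
  by apply: (hw 0%N); have := H 0%N 0%N; rewrite sumC_0 eqxx.
(* Gaussian elimination: multiples of column [q0] clear the first row of [e]. Since [bump q0] skips
   row [q0], where alone that column of the product is nonzero, the product stays diagonal. *)
case: (classic (exists q, e ord0 q <> RtoC 0)) => [[q0 hq] | h0].
  pose r q := (e ord0 (bump q0 q) / e ord0 q0)%C.
  apply: (IH (fun p i => c (bump q0 p) (lift ord0 i))
     (fun i q => e (lift ord0 i) (bump q0 q) - r q * e (lift ord0 i) q0)%C (fun p => w (bump q0 p))) => // p q.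
  have hS q' : (c (bump q0 p) ord0 * e ord0 q' + sumC (fun i : 'I_m => c (bump q0 p) (lift ord0 i) * e (lift ord0 i) q') =
    if bump q0 p == q' then w (bump q0 p) else RtoC 0)%C by rewrite -H sumC_S.
  have h1 := hS (bump q0 q); have h2 := hS q0.
  rewrite (inj_eq (can_inj (bumpK q0))) in h1.
  rewrite eq_sym (negbTE (neq_bump q0 p)) in h2.
  rewrite -h1 /= (sumC_ext (G := fun i => c (bump q0 p) (lift ord0 i) * e (lift ord0 i) (bump q0 q) +
    (- r q) * (c (bump q0 p) (lift ord0 i) * e (lift ord0 i) q0))%C); last by move=> i; ring.
  rewrite sumC_plus sumC_scal.
  move: h2; set S0 := sumC (fun i => c (bump q0 p) (lift ord0 i) * e (lift ord0 i) q0)%C => h2.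
  have -> : S0 = ((c (bump q0 p) ord0 * e ord0 q0 + S0) - c (bump q0 p) ord0 * e ord0 q0)%C by ring.
  rewrite h2.
  by rewrite /r; change (m.+1.-1) with m; field.
apply: (IH (fun p i => c p (lift ord0 i)) (fun i q => e (lift ord0 i) q) w hw) => p q.
rewrite -H sumC_S; have -> : e ord0 q = RtoC 0 by apply: NNPP => h; apply: h0; exists q.
by rewrite Cmult_0_r Cplus_0_l.
Qed.

(** A ball contains finitely many lattice points; the sum of |f| over a box around it is a bound. *)
Lemma box_bounded n (f : ('I_n -> Z) -> R) X : exists M, 0 <= M /\ forall k, nrm1 k <= X -> f k <= M.
Proof.
have [r hr] := INR_unbounded X.
pose M := bs Rplus (enum 'I_n) r (fun k => Rabs (f k)) (@zeroz n).
have key : forall k, nrm1 k <= X -> Rabs (f k) <= M.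
  move=> k hk.
  have <- : bs Rplus (enum 'I_n) r (fun k' => if excluded_middle_informative (k' = k) then Rabs (f k) else 0) (@zeroz n) = Rabs (f k).
    rewrite (@bs_delta n R Rplus 0 _ r _ _ k) => [|x|x||k' hk'|j].
    - have -> : all (fun j => (Z.abs (k j) <=? Z.of_nat r)%Z) (enum 'I_n).
        apply/allP => j _; apply/Z.leb_le; apply: le_IZR; rewrite abs_IZR -INR_IZR_INZ.
        have := nrm1_term k j; lra.
      by case: excluded_middle_informative.
    - by ring.
    - by ring.
    - exact: enum_uniq.
    - by case: excluded_middle_informative.
    - by rewrite mem_enum.
  apply: (bs_rel (Rel := Rle)) => [x y x' y'|k' _]; first by lra.
  case: excluded_middle_informative => [h|_] /=; [rewrite h; exact: Rle_refl | exact: Rabs_pos].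
exists (Rabs M); split; first exact: Rabs_pos.
move=> k hk; have := key k hk; have := Rle_abs (f k); have := Rle_abs M; lra.
Qed.

(** * Failure of the Diophantine condition *)

Section CaseA.
Variable om : R -> R.
Hypothesis Hw : weight_function om.
Hypothesis Hs : subadditive om.
Variables (N : nat) (a b : 'I_N -> R -> R) (B d0 : R).
Hypothesis Hd0 : 0 < d0.
Hypothesis HB0 : 0 <= B.
Hypothesis Hcf : forall j, cd om (lift1 (cf a b j)) B d0.
Notation W := (W om).
Notation cd := (cd om).
Notation omZ := (omZ om).
Notation gam := (gam (cf a b)).
Notation LL := (LC (cf a b)).

(** Each homogeneous solution defines an element of the kernel supported on its own fibre. Paired
    with suitable characters these form an infinite diagonal matrix, against
    [diag_not_finite_rank]. *)
Lemma kernel_infinite (xs : nat -> 'I_N -> Z) : (forall p q, xs p = xs q -> p = q) ->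
  (forall p, exists V V', cder V V' /\ ccont V' /\ (forall t, V (t + 2 * PI) = V t) /\
    (forall t, V' t + (0, 1) * cxi (cf a b) (xs p) t * V t = RtoC 0)%C /\
    (forall t, Cmod (V t) <= 1) /\ exists t, Cmod (V t) = 1) -> ~ strongly_solvable om a b.
Proof.
move=> hinj hV [_ [m [nu [_ hker]]]].
have key : forall p, exists (mu : Fn N.+1 -> C) (tau : Z), in_ker_tL om a b mu /\
   mu (ek (negz (consz tau (xs p)))) <> RtoC 0 /\
   forall s q, q <> p -> mu (ek (negz (consz s (xs q)))) = RtoC 0.
  move=> p; have [V [V' [dV [cV' [pV [hE [hV1 [t ht]]]]]]]] := hV p.
  have cV := cder_cont dV.
  have [tau htau] : exists tau, coef1 V tau <> RtoC 0.
    apply: NNPP => h.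
    have e : V t = RtoC 0.
      apply: (@coef1_uniq V (fun _ => RtoC 0)) => //; first exact: ccont_const.
      move=> tau; rewrite [RHS](coef_0 (cz tau)).
      by apply: NNPP => h2; apply: h; exists tau.
    by rewrite e Cmod_0 in ht; lra.
  pose U k := if excluded_middle_informative (ztail k = xs p) then coef1 V (k ord0) else RtoC 0.
  have hslow : slow om U.
    move=> eps he; exists 1 => k; rewrite Rmult_1_l.
    apply: Rle_trans (_ : 1 <= _); last first.
      by rewrite -[X in X <= _]exp_0; apply: exp_le; apply: Rmult_le_pos; [lra | apply: W_ge0].
    rewrite /U; case: excluded_middle_informative => _ /=; last by rewrite Cmod_0; lra.
    exact: coef1_sup.
  have [mu [hmu emu]] := slow_ultra Hw Hs hslow.
  have [m1 m2] := proj1 (ultra_iff Hw Hs mu) hmu.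
  have [l1 l2] := LC_ultra Hw Hs Hd0 Hcf m1 m2.
  have [f1 f2] := fdist_ultra Hw Hs (Eom_0 Hw Hs N.+1).
  have e0 : forall h : Fn N.+1, fdist (fun _ => RtoC 0) h = RtoC 0.
    move=> h; rewrite /fdist (_ : (fun x => RtoC 0 * h x)%C = fun _ => RtoC 0).
      have := intT_lin (RtoC (-1)) (contC_const (RtoC 0)) (contC_const (RtoC 0)) (n := N.+1).
      rewrite (_ : (fun _ : pt N.+1 => (RtoC (-1) * RtoC 0 + RtoC 0)%C) = fun _ => RtoC 0) => [->|]; first by ring.
      by apply: functional_extensionality => x; ring.
    by apply: functional_extensionality => x; ring.
  exists mu, tau; split; [split=> // f hf | split].
  - have : (- mu (LL f))%C = RtoC 0; last first.
      rewrite -[Lop a b f]/(LL f) => e; have -> : mu (LL f) = (- - mu (LL f))%C by ring.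
      by rewrite e; ring.
    rewrite -(e0 f); apply: (ultra_eq Hw Hs l1 l2 f1 f2) => // k.
    rewrite e0 -(negzK k); set k' := negz k; rewrite -(consz_ztail k').
    set xi := ztail k'; set s := k' ord0.
    have h1 := LC_mu Hw Hs Hd0 Hcf xi m1 m2.
    case: (classic (xi = xs p)) => hxi.
      have h2 : L1rel gam xi (coef1 V) (fun tau => - mu (LL (ek (negz (consz tau xi)))))%C.
        apply: L1rel_ext h1 => r //; rewrite emu /U ztail_consz consz0.
        by case: excluded_middle_informative.
      have h3 : L1rel gam xi (coef1 V) (coef1 (fun _ => RtoC 0)).
        by apply: (ode_L1rel Hw Hd0 Hcf dV cV' pV) => r; rewrite hxi.
      by rewrite (L1rel_fun h2 h3 s); apply: coef_0.
    have h2 : L1rel gam xi (coef1 (fun _ => RtoC 0)) (fun tau => - mu (LL (ek (negz (consz tau xi)))))%C.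
      apply: L1rel_ext h1 => r //; rewrite emu /U ztail_consz.
      by case: excluded_middle_informative => [h|_] /=; [case: hxi | rewrite [RHS](coef_0 (cz r))].
    have dz : cder (fun _ => RtoC 0) (fun _ => RtoC 0) by apply: cder_const.
    have h3 : L1rel gam xi (coef1 (fun _ => RtoC 0)) (coef1 (fun _ => RtoC 0)).
      by apply: (ode_L1rel Hw Hd0 Hcf dz (ccont_const _)) => // r; ring.
    by rewrite (L1rel_fun h2 h3 s); apply: coef_0.
  - by rewrite emu /U ztail_consz consz0; case: excluded_middle_informative.
  - move=> s q hq; rewrite emu /U ztail_consz; case: excluded_middle_informative => // h.
    by exfalso; apply: hq; apply: hinj.
pose Pm p (x : (Fn N.+1 -> C) * Z) := in_ker_tL om a b (fst x) /\
   fst x (ek (negz (consz (snd x) (xs p)))) <> RtoC 0 /\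
   forall s q, q <> p -> fst x (ek (negz (consz s (xs q)))) = RtoC 0.
have [M hM] : exists M, forall p, Pm p (M p).
  by apply: choice => p; have [mu [tau h]] := key p; exists (mu, tau).
have [c hc] : exists c, forall p f, Eom om f -> fst (M p) f = sumC (fun i : 'I_m => c p i * nu i f)%C.
  by apply: (choice (fun p (c : 'I_m -> C) => forall f, Eom om f -> fst (M p) f = sumC (fun i : 'I_m => c i * nu i f)%C)) => p;
    apply: hker; case: (hM p).
apply: (@diag_not_finite_rank m c (fun i q => nu i (ek (negz (consz (snd (M q)) (xs q)))))
  (fun p => fst (M p) (ek (negz (consz (snd (M p)) (xs p)))))) => [p|p q]; first by case: (hM p) => _ [].
rewrite -hc; last exact: Eom_ek.
case: eqP => [->|h] //; have [_ [_]] := hM p; apply.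
by move=> e; apply: h.
Qed.

Definition lam (tau : Z) xi : C := (IZR tau + xr a xi, yr b xi).

(** The homogeneous solution [Ei] has multiplier 1/q. The factor exp(i lam t) makes it periodic for
    every integer tau and changes the right-hand side from 0 to i lam V. *)
Lemma quasi_mode tau xi : exists V V', cder V V' /\ ccont V' /\ (forall t, V (t + 2 * PI) = V t) /\
    (forall t, V' t + (0, 1) * cxi (cf a b) xi t * V t = (0, 1) * lam tau xi * V t)%C /\
    (forall t, Cmod (V t) <= 1) /\ exists t, Cmod (V t) = 1.
Proof.
pose al := ax a xi; pose be := bx b xi; pose r := IZR tau + xr a xi; pose y := yr b xi.
pose V0 t := (Ei al be t * (RtoC (exp (- y * t)) * cis (r * t)))%C.
have hl : forall c t, is_derive (fun t => c * t) t c by move=> c t; auto_derive => //; ring.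
have hE := Ei_der (ax_cont Hcf xi) (bx_cont Hcf xi).
have hF := cder_mult (cder_exp (hl (- y))) (cder_cis (hl r)).
pose V0' t := (((0, 1) * lam tau xi - (0, 1) * cxi (cf a b) xi t) * V0 t)%C.
have dV0 : cder V0 V0'.
  apply: cder_ext (cder_mult hE hF) => t; rewrite /V0' /V0 cxi_pair /lam -/r -/y -/al -/be.
  have -> : ((r, y) : C) = (RtoC r + (0, 1) * RtoC y)%C by rewrite /RtoC /Cmult /Cplus /=; congr pair; ring.
  have -> : ((0, r) : C) = ((0, 1) * RtoC r)%C by rewrite /RtoC /Cmult /=; congr pair; ring.
  have -> : RtoC (- y) = ((0, 1) * (0, 1) * RtoC y)%C by rewrite /RtoC /Cmult /=; congr pair; ring.
  ring.
have cV0 := cder_cont dV0.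
have pV0 : forall t, V0 (t + 2 * PI) = V0 t.
  move=> t; rewrite /V0 /Ei /At /Bt !RInt_quasi //; try by [apply: (ax_cont Hcf) | apply: (bx_cont Hcf) | apply: (ax_per Hcf) | apply: (bx_per Hcf)].
  rewrite (ax_int Hcf) (bx_int Hcf) -/y.
  have -> : - (2 * PI * xr a xi + RInt al 0 t) = - RInt al 0 t + - (2 * PI * xr a xi) by ring.
  have -> : r * (t + 2 * PI) = r * t + (IZR tau * (2 * PI) + 2 * PI * xr a xi) by rewrite /r; ring.
  have -> : - y * (t + 2 * PI) = - y * t + - (2 * PI * y) by ring.
  rewrite !exp_plus !cis_add cis_2piZ !RtoC_mult.
  have e1 : (RtoC (exp (2 * PI * y)) * RtoC (exp (- (2 * PI * y))))%C = RtoC 1.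
    by rewrite -RtoC_mult -exp_plus Rplus_opp_r exp_0.
  have e2 := cis_neg (2 * PI * xr a xi).
  transitivity ((RtoC (exp (2 * PI * y)) * RtoC (exp (- (2 * PI * y)))) * (cis (2 * PI * xr a xi) * cis (- (2 * PI * xr a xi))) *
     (RtoC (exp (RInt be 0 t)) * cis (- RInt al 0 t) * (RtoC (exp (- y * t)) * cis (r * t))))%C; first by ring.
  by rewrite e1 e2; ring.
have [s hs] := periodic_max cV0 pV0.
have h0 : 0 < Cmod (V0 s).
  rewrite /V0 /Ei !Cmod_mult !Cmod_cis !Cmod_R !Rmult_1_r.
  by apply: Rmult_lt_0_compat; apply: Rabs_pos_lt; apply: Rgt_not_eq; apply: exp_pos.
have hi := Rinv_0_lt_compat _ h0.
have em : forall t, Cmod (RtoC (/ Cmod (V0 s)) * V0 t)%C = / Cmod (V0 s) * Cmod (V0 t).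
  by move=> t; rewrite Cmod_mult Cmod_R Rabs_right //; lra.
have dV : cder (fun t => RtoC (/ Cmod (V0 s)) * V0 t)%C (fun t => RtoC (/ Cmod (V0 s)) * V0' t)%C.
  by apply: cder_ext (cder_mult (cder_const _) dV0) => t; ring.
eexists; eexists; split; [exact: dV | split; [|split; [|split; [|split]]]].
- apply: ccont_mult; first exact: ccont_const.
  apply: ccont_mult => //; apply: ccont_plus; first exact: ccont_const.
  have := ccont_mult (ccont_const (RtoC (-1) * (0, 1))%C) (cxi_ccont Hcf xi).
  by apply: ccont_ext => t; ring.
- by move=> t; rewrite pV0.
- by move=> t; rewrite /V0'; ring.
- move=> t; rewrite em -(Rinv_l (Cmod (V0 s))); last lra.
  by apply: Rmult_le_compat_l; [lra | apply: hs].
- by exists s; rewrite em Rinv_l; lra.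
Qed.

(** The image is lam times the mode itself, so its decay in tau comes from [reg_bounded], at the
    cost exp(del Gam omega(xi)); the smallness of lam covers this cost and the decay in xi. The 2 is
    the constant of [reg_bounded] with A = 0 and U = 1. *)
Lemma quasi_mode_bad : exists Gam, 0 < Gam /\ forall del eps tau xi, 0 < del -> del <= d0 / 2 ->
  del * (Gam + 1) <= eps -> 1 <= nrm1 xi -> Cmod (lam tau xi) <= exp (- eps * W xi) ->
  bad om a b 2 del xi.
Proof.
have [Gm [hGm H]] := reg_bounded Hw Hs Hd0 HB0 Hcf.
exists Gm; split=> // del eps tau xi hd hd2 hde hxi hl.
have [V [V' [dV [cV' [pV [hE [hV1 hVm]]]]]]] := quasi_mode tau xi.
have cV := cder_cont dV; have hW := W_ge0 Hw xi.
pose H0 t := ((0, 1) * lam tau xi * V t)%C.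
have cH : ccont H0 by apply: ccont_mult => //; apply: ccont_const.
have hL := ode_L1rel Hw Hd0 Hcf dV cV' pV hE.
have e1 : forall s, Cmod (coef1 H0 s) = Cmod (lam tau xi) * Cmod (coef1 V s).
  move=> s; rewrite /coef1 (_ : lift1 H0 = fun x => ((0, 1) * lam tau xi) * lift1 V x)%C //.
  rewrite coef_scal; last exact/ccont_lift1.
  by rewrite !Cmod_mult Cmod_imag Rabs_R1 Rmult_1_l.
have heps : 0 < eps by apply: Rlt_le_trans hde; apply: Rmult_lt_0_compat; lra.
have hl1 : Cmod (lam tau xi) <= 1.
  by apply: Rle_trans hl _; rewrite -[X in _ <= X]exp_0; apply: exp_le; nra.
split=> //; exists (V, V', H0); split=> //; split=> //; split=> //; split=> //; split=> //; split=> //; split=> // s.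
have hu := H del xi (coef1 V) (coef1 H0) 0 (Cmod (lam tau xi)) 1 hd hd2 hxi hL
  (fun t => coef1_sup t cV hV1) (Rle_refl 0) (conj (Cmod_ge_0 _) hl1)
  ltac:(move=> t; rewrite e1; lra) s.
rewrite e1; apply: Rle_trans (_ : exp (- eps * W xi) * (2 * (0 + 1 * exp (del * Gm * W xi)) * exp (- del * omZ s)) <= _).
  by apply: Rmult_le_compat => //; apply: Cmod_ge_0.
have -> : exp (- eps * W xi) * (2 * (0 + 1 * exp (del * Gm * W xi)) * exp (- del * omZ s)) =
  2 * exp (- eps * W xi + del * Gm * W xi + - del * omZ s) by rewrite !exp_plus; ring.
apply: Rmult_le_compat_l; first lra.
apply: exp_le; have := Rmult_le_compat_r _ _ _ hW hde; lra.
Qed.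

Lemma not_edc : ~ EDC1 om (fun j => mean (a j)) (fun j => mean (b j)) ->
  ~ glob_hypoelliptic om a b /\ ~ strongly_solvable om a b.
Proof.
move=> hn.
have [e0 [he0 hC]] : exists e0, 0 < e0 /\ forall C, 0 < C -> exists tau xi,
    (tau <> 0%Z \/ exists j, xi j <> 0%Z) /\
    Cmod (lam tau xi) < C * exp (- e0 * om (sqrt (IZR tau ^ 2 + sumR (fun j => IZR (xi j) ^ 2)))).
  apply: NNPP => h; apply: hn => eps he; apply: NNPP => h2; apply: h; exists eps; split=> // C hC.
  apply: NNPP => h3; apply: h2; exists C; split=> // tau xi hx.
  by apply: Rnot_lt_ge => h4; apply: h3; exists tau, xi.
have hN := pos_INR N.
(* Compensates omega(xi) <= (N + 1) omega(E), where E is the Euclidean norm. *)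
pose e1 := e0 / (INR N + 1).
have he1 : 0 < e1 by apply: Rdiv_lt_0_compat; lra.
have hC1 : forall C, 0 < C -> C <= 1 -> exists tau xi, 1 <= nrm1 xi /\ Cmod (lam tau xi) < C /\
    Cmod (lam tau xi) <= exp (- e1 * W xi).
  move=> C h0 h1; have [tau [xi [hx hlam]]] := hC C h0; exists tau, xi.
  set E := sqrt _ in hlam; have hE : 0 <= E by apply: sqrt_pos.
  have hoE := om_ge0 Hw hE.
  have hexp1 : exp (- e0 * om E) <= 1.
    by rewrite -[X in _ <= X]exp_0; apply: exp_le; nra.
  have hlC : Cmod (lam tau xi) < C.
    by apply: Rlt_le_trans hlam _; have := Rmult_le_compat_l _ _ _ (Rlt_le _ _ h0) hexp1; lra.
  split.
    (* For xi = 0 one has |lam| = |tau| >= 1, excluded by C <= 1. *)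
    apply: nrm1_ge1; case: hx => // ht; apply: NNPP => hz.
    have hz0 : forall j, xi j = 0%Z by move=> j; apply: NNPP => hj; apply: hz; exists j.
    have e : lam tau xi = RtoC (IZR tau).
      rewrite /lam /xr /yr (sumR_ext (G := fun _ => 0)); last by move=> j; rewrite hz0; ring.
      rewrite (sumR_ext (F := fun j => IZR (xi j) * mean (b j)) (G := fun _ => 0)); last by move=> j; rewrite hz0; ring.
      by rewrite sumR_const Rmult_0_r Rplus_0_r.
    by rewrite e Cmod_R in hlC; have := Rabs_IZR_ge1 ht; lra.
  split=> //.
  have hWE : W xi <= (INR N + 1) * om E.
    apply: Rle_trans (om_mulR Hw Hs hN hE).
    by apply: om_mono => //; [apply: nrm1_ge0 | apply: nrm1_le_euclid].
  have h2 : - e0 * om E <= - e1 * W xi.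
    have := Rmult_le_compat_l _ _ _ (Rlt_le _ _ he1) hWE.
    have -> : e1 * ((INR N + 1) * om E) = e0 * om E by rewrite /e1; field; lra.
    lra.
  have := exp_le h2; have := exp_pos (- e0 * om E); nra.
have [Gm [hGm Hbad]] := quasi_mode_bad.
pose del := Rmin (d0 / 2) (e1 / (Gm + 1)).
have hdel : 0 < del by apply: Rmin_pos; [lra | apply: Rdiv_lt_0_compat; lra].
have hdel2 : del <= d0 / 2 by apply: Rmin_l.
have hdel3 : del * (Gm + 1) <= e1.
  have := Rmult_le_compat_r (Gm + 1) _ _ ltac:(lra) (Rmin_r (d0 / 2) (e1 / (Gm + 1))).
  have -> : e1 / (Gm + 1) * (Gm + 1) = e1 by field; lra.
  by [].
(* An exact resonance makes q = 1, so the argument with a closed range does not apply; its integer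
   multiples are resonant too and give infinitely many kernel elements. *)
case: (classic (exists tau xi, 1 <= nrm1 xi /\ lam tau xi = RtoC 0)) => [[tau [xi [hxi hres]]] | hnr].
  pose xs (p : nat) : 'I_N -> Z := fun j => (Z.of_nat p.+1 * xi j)%Z.
  have hnx : forall p, nrm1 (xs p) = INR p.+1 * nrm1 xi.
    move=> p; rewrite /nrm1 -sumR_scal; apply: sumR_ext => j.
    by rewrite /xs mult_IZR -INR_IZR_INZ Rabs_mult (Rabs_right (INR _)) //; apply: Rle_ge; apply: pos_INR.
  have hlx : forall p, lam (Z.of_nat p.+1 * tau)%Z (xs p) = RtoC 0.
    move=> p; have [q1 q2] : IZR tau + xr a xi = 0 /\ yr b xi = 0 by case: hres.
    have q3 : xr a (xs p) = INR p.+1 * xr a xi.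
      by rewrite /xr -sumR_scal; apply: sumR_ext => j; rewrite /xs mult_IZR -INR_IZR_INZ; ring.
    have q4 : yr b (xs p) = INR p.+1 * yr b xi.
      by rewrite /yr -sumR_scal; apply: sumR_ext => j; rewrite /xs mult_IZR -INR_IZR_INZ; ring.
    rewrite /lam q3 q4 q2 mult_IZR -INR_IZR_INZ Rmult_0_r /RtoC; congr pair.
    by rewrite -Rmult_plus_distr_l q1 Rmult_0_r.
  have hp1 : forall p, 1 <= INR p.+1 by move=> p; rewrite S_INR; have := pos_INR p; lra.
  have hbx : forall p, 1 <= nrm1 (xs p) by move=> p; rewrite hnx; have := hp1 p; nra.
  split.
    apply: (@neg_hypo om Hw Hs N a b B d0 Hd0 Hcf 2 del hdel) => X.
    have [p hp] := INR_unbounded X; exists (xs p); split.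
      by rewrite hnx S_INR; have := pos_INR p; nra.
    apply: (Hbad del e1 (Z.of_nat p.+1 * tau)%Z) => //.
    by rewrite hlx Cmod_0; apply: Rlt_le; apply: exp_pos.
  apply: (kernel_infinite (xs := xs)) => [p q e|p].
    have := hnx p; rewrite e hnx => h; have : INR p.+1 = INR q.+1 by nra.
    by move=> /INR_eq [].
  have [V [V' [h1 [h2 [h3 [h4 [h5 h6]]]]]]] := quasi_mode (Z.of_nat p.+1 * tau)%Z (xs p).
  exists V, V'; do 3!split=> //; split=> // t.
  by rewrite h4 hlx; ring.
have hne : forall tau xi, 1 <= nrm1 xi -> 0 < Cmod (lam tau xi).
  by move=> tau xi hxi; apply/Cmod_gt_0 => h; apply: hnr; exists tau, xi.
(* Without resonances |lam| has a positive lower bound on bounded sets of (tau, xi), and tau is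
   bounded by xi when |lam| <= 1; hence smaller |lam| forces large xi. *)
have hub : forall X, exists xi, X < nrm1 xi /\ bad om a b 2 del xi.
  move=> X; pose X' := 1 + (msum a + 1) * Rabs X.
  have hms := msum_ge0 a; have hX := Rle_abs X; have hX0 := Rabs_pos X.
  have [M [hM0 hM]] := box_bounded (fun k : 'I_N.+1 -> Z => / Cmod (lam (k ord0) (fun j => k (lift ord0 j)))) X'.
  have hM1 : 0 < / (M + 1) by apply: Rinv_0_lt_compat; lra.
  have hM2 : / (M + 1) <= 1 by rewrite -[X in _ <= X]Rinv_1; apply: Rinv_le_contravar; lra.
  have [tau [xi [hxi [hl1 hl2]]]] := hC1 _ hM1 hM2.
  exists xi; split; last exact: (Hbad del e1 tau).
  apply: Rnot_le_lt => hle.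
  have h0 := hne tau xi hxi.
  have hr : Rabs (IZR tau + xr a xi) <= Cmod (lam tau xi) by apply: (Rle_trans _ _ _ _ (Rmax_Cmod (lam tau xi))); apply: Rmax_l.
  have hx := xr_le a xi.
  have ht : Rabs (IZR tau) <= 1 + msum a * nrm1 xi.
    have -> : IZR tau = (IZR tau + xr a xi) + - xr a xi by ring.
    by apply: Rle_trans (Rabs_triang _ _) _; rewrite Rabs_Ropp; lra.
  have := hM (consz tau xi); rewrite nrm1_consz consz0.
  rewrite (_ : (fun j => consz tau xi (lift ord0 j)) = xi); last by apply: functional_extensionality => j; rewrite consz_lift.
  have hms2 : msum a * nrm1 xi <= msum a * Rabs X by apply: Rmult_le_compat_l => //; lra.
  move=> /(_ ltac:(rewrite /X'; lra)) h1.
  have h2 := Rinv_lt_contravar _ _ ltac:(apply: Rmult_lt_0_compat; [exact: h0 | exact: hM1]) hl1.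
  rewrite Rinv_inv in h2; lra.
split; first exact: (@neg_hypo om Hw Hs N a b B d0 Hd0 Hcf 2 del hdel).
apply: (@neg_solv om Hw Hs N a b B d0 Hd0 HB0 Hcf 2 del hdel hdel2 hub) => xi [hxi _].
apply: (qx_ne1 Hcf) => tau h; have := hne tau xi hxi; rewrite /lam; lra.
Qed.

End CaseA.

(** * Change of sign *)

(** Away from the other zeros +-2 pi of 1 - cos, the quotient x^2 / (1 - cos x) is bounded. *)
Lemma sq_le_cos d x : 0 < d -> d <= PI -> Rabs x <= 2 * PI - d ->
  x ^ 2 <= 2 / (5 * d / (32 * PI)) ^ 2 * (1 - cos x).
Proof.
move=> hd hdp hx; have hpi := PI_RGT_0.
(* A slope valid up to y = PI - d/2: near the end sin y = sin (PI - y) >= (5/16)(d/2) = c PI. *)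
set c := 5 * d / (32 * PI).
have hc : 0 < c by apply: Rdiv_lt_0_compat; lra.
have ec : c * PI = 5 / 32 * d by rewrite /c; field; lra.
pose y := Rabs x / 2.
have hy : 0 <= y <= PI - d / 2 by have := Rabs_pos x; rewrite /y; lra.
have hs : c * y <= sin y.
  case: (Rle_dec y (PI / 2)) => h.
    have := @sin_low y ltac:(lra) => h1; have hc1 : c <= 5 / 16 by apply: (Rmult_le_reg_r PI) => //; lra.
    have := Rmult_le_compat_r y _ _ ltac:(lra) hc1; lra.
  have := @sin_low (PI - y) ltac:(lra); rewrite -sin_PI_x.
  have -> : PI - (PI - y) = y by ring.
  have := Rmult_le_compat_l c y PI ltac:(lra) ltac:(lra); rewrite -/y; lra.
have e1 : 1 - cos x = 2 * sin y ^ 2.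
  have -> : cos x = cos (Rabs x) by rewrite /Rabs; case: Rcase_abs => _ //; rewrite cos_neg.
  have -> : Rabs x = 2 * y by rewrite /y; field.
  by rewrite cos_2a_sin; ring.
have e2 : x ^ 2 = 4 * y ^ 2 by rewrite -pow2_abs /y; field.
rewrite e1 e2.
have h2 : (c * y) ^ 2 <= sin y ^ 2 by apply: pow_incr; split=> //; apply: Rmult_le_pos; lra.
apply: (Rmult_le_reg_l (c ^ 2)); first by apply: pow_lt.
have -> : c ^ 2 * (2 / c ^ 2 * (2 * sin y ^ 2)) = 4 * sin y ^ 2 by field; lra.
have -> : c ^ 2 * (4 * y ^ 2) = 4 * (c * y) ^ 2 by ring.
lra.
Qed.

(** By [Ik_rec] the right-hand side is nondecreasing in n. The mass of the kernel thus decays at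
    most polynomially, which an exponential gain outweighs. *)
Lemma Ik_low n : 2 * PI <= (2 * INR n + 1) * Ik n.
Proof.
elim: n => [|n IH].
  by rewrite /Ik /= RInt_const /scal /= /mult /=; lra.
have h := Ik_rec n; have hp := Ik_pos n.+1; rewrite S_INR; lra.
Qed.

Lemma Cint_cisZ (k : Z) c : k <> 0%Z -> Cint (fun s => cis (IZR k * s + c)) 0 (2 * PI) = RtoC 0.
Proof.
move=> hk.
have hl : forall t, is_derive (fun t => IZR k * t + c) t (IZR k) by move=> t; auto_derive => //; ring.
have hc := cder_cis hl; have cc := cder_cont hc.
have h1 : Cint (fun t => (0, IZR k) * cis (IZR k * t + c))%C 0 (2 * PI) = RtoC 0.
  rewrite (Cint_der _ _ hc); last by apply: ccont_mult => //; apply: ccont_const.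
  by rewrite !cis_add cis_2piZ Rmult_0_r cis_0; ring.
rewrite Cint_scal // in h1.
have hne : ((0, IZR k) : C) <> RtoC 0 by move=> [] /eq_IZR.
by apply: NNPP => h; apply: (Cmult_neq_0 _ _ hne h).
Qed.

Lemma Taylor1 (F f : R -> R) K s0 s : (forall t, is_derive F t (f t)) ->
  (forall t t', Rabs (f t - f t') <= K * Rabs (t - t')) -> 0 <= K ->
  Rabs (F s - F s0 - f s0 * (s - s0)) <= K * (s - s0) ^ 2.
Proof.
move=> hF hf hK.
have hd : forall t, is_derive (fun t => F t - f s0 * t) t (f t - f s0).
  move=> t; apply: (is_derive_minus F (fun t => f s0 * t)) => //.
  by auto_derive => //; ring.
have := @mvt_bound _ _ (K * Rabs (s - s0)) s0 s hd ltac:(move=> t ht; apply: Rle_trans (hf _ _) _;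
  apply: Rmult_le_compat_l => //; move: ht; rewrite /Rmin /Rmax /Rabs;
  case: Rle_dec => h1 [h2 h3]; case: Rcase_abs => h4; case: Rcase_abs => h5; lra).
have -> : F s - f s0 * s - (F s0 - f s0 * s0) = F s - F s0 - f s0 * (s - s0) by ring.
have -> : K * Rabs (s - s0) * Rabs (s - s0) = K * Rabs (s - s0) ^ 2 by ring.
by rewrite pow2_abs.
Qed.

(** * Wave packets at an interior minimum *)

Section Peak.
Variables al be : R -> R.
Hypothesis Hal : forall t, continuous al t.
Hypothesis Hbe : forall t, continuous be t.
Variable K : R.
Hypothesis HK : 0 <= K.
Hypothesis Lal : forall t t', Rabs (al t - al t') <= K * Rabs (t - t').
Hypothesis Lbe : forall t t', Rabs (be t - be t') <= K * Rabs (t - t').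
Variables q s0 : R.
Hypothesis Hq : q < s0 < q + 2 * PI.
Hypothesis Hmin : forall s, q <= s <= q + 2 * PI -> Bt be s0 <= Bt be s.

Lemma min_critical : be s0 = 0.
Proof.
have hd : derivable_pt_lim (Bt be) s0 (be s0) by apply/is_derive_Reals; apply: RInt_der.
pose pr : derivable_pt (Bt be) s0 := exist _ _ hd.
have := deriv_minimum (Bt be) q (q + 2 * PI) s0 pr (proj1 Hq) (proj2 Hq)
  (fun x h1 h2 => Hmin (conj (Rlt_le _ _ h1) (Rlt_le _ _ h2))).
by [].
Qed.

Notation sal m := (fun t => INR m * al t).
Notation sbe m := (fun t => INR m * be t).

Lemma Ef_scaled m s : Ef (sal m) (sbe m) s = (RtoC (exp (- (INR m * Bt be s))) * cis (INR m * At al s))%C.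
Proof. by rewrite /Ef /At /Bt !RInt_scalR. Qed.

(** The carrier -n is to cancel the phase of [Ef] to first order at [s0], n being close to m al(s0).
    The envelope keeps the packet a trigonometric polynomial, of degree at most |n| + p. *)
Definition wave (n : Z) p (s : R) : C := (cis (- IZR n * s + IZR n * s0) * RtoC (yk (s - s0) ^ p))%C.

Lemma wave_ccont n p : ccont (wave n p).
Proof.
apply: ccont_mult; last exact: yk_ccont.
have := ccont_mult (cis_contR (- IZR n)) (ccont_const (cis (IZR n * s0))).
by apply: ccont_ext => s; rewrite cis_add.
Qed.

Lemma wave_bound n p s : Cmod (wave n p s) <= 1.
Proof.
rewrite /wave Cmod_mult Cmod_cis Rmult_1_l Cmod_R.
have [h0 h1] := yk_range (s - s0); rewrite Rabs_right; last by apply: Rle_ge; apply: pow_le.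
by rewrite -(pow1 p); apply: pow_incr.
Qed.

Lemma wave_periodic n p s : wave n p (s + 2 * PI) = wave n p s.
Proof.
rewrite /wave (_ : s + 2 * PI - s0 = s - s0 + 2 * PI); last by ring.
rewrite yk_periodic (_ : - IZR n * (s + 2 * PI) + IZR n * s0 = (- IZR n * s + IZR n * s0) + IZR (- n) * (2 * PI)).
  by rewrite cis_add cis_2piZ; ring.
by rewrite opp_IZR; ring.
Qed.

Lemma wave_coef n p tau : (Z.abs n + Z.of_nat p < Z.abs tau)%Z -> coef1 (wave n p) tau = RtoC 0.
Proof.
move=> h; rewrite coef1_int; last exact: wave_ccont.
rewrite (@yk_moment (fun s => cis (- IZR n * s + IZR n * s0)) (Z.abs n) p s0) //; last first.
- by rewrite Z.abs_opp.
- move=> k hk; rewrite -(@Cint_cisZ (k - n) (IZR n * s0)); last by lia.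
  by apply: Cint_ext => s _; rewrite -cis_add minus_IZR; congr cis; ring.
- have := ccont_mult (cis_contR (- IZR n)) (ccont_const (cis (IZR n * s0))).
  by apply: ccont_ext => s; rewrite cis_add.
- ring.
Qed.

(** Laplace's method from below: after the value of [Ef] at [s0] is factored out, the remaining
    factor G differs from 1 by at most 1/4 plus O(m) (1 - cos (s - s0)). Against the kernel of
    exponent kap m the second part is O(1/kap), so at least half of the mass survives. *)
Lemma peak_integral : exists kap : nat, (1 <= kap)%N /\ forall m (n : Z), (1 <= m)%N ->
  Rabs (INR m * al s0 - IZR n) <= 1 ->
  exp (- (INR m * Bt be s0)) * (Ik (kap * m) / 2) <=
  Cmod (Cint (fun s => Ef (sal m) (sbe m) s * wave n (kap * m) s)%C q (q + 2 * PI)).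
Proof.
have hpi := PI_RGT_0.
(* Distance of [s0] from the ends of the period; it keeps s - s0 away from +-2 pi. *)
pose d := Rmin (s0 - q) (Rmin (q + 2 * PI - s0) PI).
have hd : 0 < d by apply: Rmin_pos; [lra | apply: Rmin_pos; lra].
have hd1 : d <= s0 - q by apply: Rmin_l.
have hd2 : d <= q + 2 * PI - s0 by apply: Rle_trans (Rmin_r _ _) (Rmin_l _ _).
have hd3 : d <= PI by apply: Rle_trans (Rmin_r _ _) (Rmin_r _ _).
pose Cd := 2 / (5 * d / (32 * PI)) ^ 2.
have hCd : 0 < Cd by apply: Rdiv_lt_0_compat; [lra | apply: pow_lt; apply: Rdiv_lt_0_compat; lra].
(* Ensures 4 E <= 2 kap m + 2 for the constant E below, for all m at once. *)
have [kap hkap] := INR_unbounded (4 * Cd * (1 + 2 * K)).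
have hCK : 0 < 4 * Cd * (1 + 2 * K) by nra.
have hk0 : (1 <= kap)%N by case: kap hkap => //=; lra.
exists kap; split=> // m n hm hn.
have hm1 : 1 <= INR m by case: m hm {hn} => // m _; rewrite S_INR; have := pos_INR m; lra.
have hal0 : forall t, is_derive (At al) t (al t) by move=> t; apply: RInt_der.
have hbe0 : forall t, is_derive (Bt be) t (be t) by move=> t; apply: RInt_der.
have hb0 := min_critical.
pose G s := (RtoC (exp (- (INR m * (Bt be s - Bt be s0)))) *
  cis (INR m * (At al s - At al s0) - IZR n * (s - s0)))%C.
set p := (kap * m)%N.
have cE : ccont (Ef (sal m) (sbe m)).
  have h1 : forall t, continuous (sal m) t by move=> t; apply: (continuous_scal_r (INR m) al).
  have h2 : forall t, continuous (sbe m) t by move=> t; apply: (continuous_scal_r (INR m) be).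
  exact: (cder_cont (Ef_der h1 h2)).
have e1 : forall s, (Ef (sal m) (sbe m) s * cis (- IZR n * s + IZR n * s0) = Ef (sal m) (sbe m) s0 * G s)%C.
  move=> s; rewrite !Ef_scaled /G.
  have -> : (RtoC (exp (- (INR m * Bt be s0))) * cis (INR m * At al s0) *
    (RtoC (exp (- (INR m * (Bt be s - Bt be s0)))) * cis (INR m * (At al s - At al s0) - IZR n * (s - s0))) =
    (RtoC (exp (- (INR m * Bt be s0)) * exp (- (INR m * (Bt be s - Bt be s0))))) *
    (cis (INR m * At al s0) * cis (INR m * (At al s - At al s0) - IZR n * (s - s0))))%C by rewrite RtoC_mult; ring.
  rewrite -exp_plus -cis_add -Cmult_assoc -cis_add.
  by congr (RtoC (exp _) * cis _)%C; ring.
have cG : ccont G.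
  have hne : Ef (sal m) (sbe m) s0 <> RtoC 0.
    by apply/Cmod_gt_0; rewrite Ef_mod; apply: exp_pos.
  have h1 : ccont (fun s => cis (- IZR n * s + IZR n * s0)).
    have := ccont_mult (cis_contR (- IZR n)) (ccont_const (cis (IZR n * s0))).
    by apply: ccont_ext => s; rewrite cis_add.
  have := ccont_mult (ccont_const (/ Ef (sal m) (sbe m) s0)%C) (ccont_mult cE h1).
  by apply: ccont_ext => s; rewrite e1; field.
have hG : forall s, q <= s <= q + 2 * PI -> Cmod (G s - RtoC 1)%C <= 1 / 4 + (1 + 2 * INR m * K) * (Cd * (1 - cos (s - s0))).
  move=> s hs; set x := s - s0.
  have hx : Rabs x <= 2 * PI - d by apply: Rabs_le; rewrite /x; lra.
  have hx2 := sq_le_cos hd hd3 hx; rewrite -/Cd in hx2.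
  have hu := Taylor1 s0 s hbe0 Lbe HK; rewrite hb0 Rmult_0_l Rminus_0_r -/x in hu.
  have ht := Taylor1 s0 s hal0 Lal HK; rewrite -/x in ht.
  set u := INR m * (Bt be s - Bt be s0).
  have hu0 : 0 <= u by apply: Rmult_le_pos; [lra | have := Hmin hs; lra].
  have hu1 : u <= INR m * (K * x ^ 2).
    by apply: Rmult_le_compat_l; [lra | have := Rle_abs (Bt be s - Bt be s0); lra].
  set th := INR m * (At al s - At al s0) - IZR n * x.
  have hth : Rabs th <= INR m * (K * x ^ 2) + Rabs x.
    have -> : th = INR m * (At al s - At al s0 - al s0 * x) + (INR m * al s0 - IZR n) * x by rewrite /th; ring.
    apply: Rle_trans (Rabs_triang _ _) _; rewrite !Rabs_mult (Rabs_right (INR m)); last lra.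
    have := Rmult_le_compat_l (INR m) _ _ ltac:(lra) ht.
    by have := Rmult_le_compat_r _ _ _ (Rabs_pos x) hn; lra.
  (* The error of at most 1 made by rounding m al(s0) contributes a linear term; its share 1/4 is
     affordable and the rest is quadratic. *)
  have hxx : Rabs x <= 1 / 4 + x ^ 2 by rewrite -pow2_abs /=; have := Rle_0_sqr (Rabs x - 1 / 2); rewrite /Rsqr; lra.
  have hee : Rabs (exp (- u) - 1) <= u.
    have h1 := exp_ineq1_le (- u); have h2 : exp (- u) <= 1 by rewrite -[X in _ <= X]exp_0; apply: exp_le; lra.
    by apply: Rabs_le; lra.
  have hee1 : 0 < exp (- u) <= 1.
    by split; [apply: exp_pos | rewrite -[X in _ <= X]exp_0; apply: exp_le; lra].
  have -> : (G s - RtoC 1 = RtoC (exp (- u)) * (cis th - RtoC 1) + RtoC (exp (- u) - 1))%C.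
    by rewrite /G -/u -/th RtoC_minus; ring.
  apply: Rle_trans (Cmod_triangle _ _) _; rewrite Cmod_mult !Cmod_R (Rabs_right (exp (- u))); last lra.
  have h3 := cis_lip th; have h4 := Cmod_ge_0 (cis th - RtoC 1)%C.
  have h5 := Rmult_le_compat_r _ _ _ h4 (proj2 hee1).
  have h6 : (1 + 2 * INR m * K) * x ^ 2 <= (1 + 2 * INR m * K) * (Cd * (1 - cos x)).
    by apply: Rmult_le_compat_l => //; have := Rmult_le_pos _ _ (pos_INR m) HK; lra.
  lra.
have e2 : Cint (fun s => Ef (sal m) (sbe m) s * wave n p s)%C q (q + 2 * PI) =
  (Ef (sal m) (sbe m) s0 * (RtoC (Ik p) + Cint (fun s => (G s - RtoC 1) * RtoC (yk (s - s0) ^ p))%C q (q + 2 * PI)))%C.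
  have cY := @yk_ccont p s0.
  have cG1 : ccont (fun s => (G s - RtoC 1) * RtoC (yk (s - s0) ^ p))%C.
    by apply: ccont_mult => //; apply: (ccont_plus cG (ccont_const (- RtoC 1)%C)).
  have -> : RtoC (Ik p) = Cint (fun s => RtoC (yk (s - s0) ^ p)) q (q + 2 * PI).
    rewrite /Cint /= Ik_shift /RtoC; congr pair.
    by rewrite RInt_const /scal /= /mult /=; ring.
  rewrite -(Cint_plus _ _ cY cG1) -Cint_scal; last exact: ccont_plus.
  by apply: Cint_ext => s _; rewrite /wave Cmult_assoc e1; ring.
have hE : Cmod (Ef (sal m) (sbe m) s0) = exp (- (INR m * Bt be s0)).
  by rewrite Ef_mod /Bt RInt_scalR.
rewrite e2 Cmod_mult hE; apply: Rmult_le_compat_l; first by apply: Rlt_le; apply: exp_pos.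
set J := Cint _ _ _.
pose E := (1 + 2 * INR m * K) * Cd * 2.
have hE0 : 0 <= E.
  have := Rmult_le_pos _ _ (pos_INR m) HK => h0.
  by apply: Rmult_le_pos; [apply: Rmult_le_pos|]; lra.
have hJ : Cmod J <= Ik p / 4 + E * (Ik p - Ik p.+1).
  have -> : Ik p / 4 + E * (Ik p - Ik p.+1) = RInt (fun s => (1 / 4 + E) * yk (s - s0) ^ p + (- E) * yk (s - s0) ^ p.+1) q (q + 2 * PI).
    by rewrite RInt_lin ?Ik_shift; [field | move=> t; apply: yk_cont | move=> t; apply: yk_cont].
  apply: Cint_le; [| |lra|].
  - by apply: ccont_mult; [apply: (ccont_plus cG (ccont_const (- RtoC 1)%C)) | apply: yk_ccont].
  - by move=> t; apply: continuous_lin; apply: yk_cont.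
  move=> s hs; have [h0 h1] := yk_range (s - s0).
  rewrite Cmod_mult Cmod_R Rabs_right; last by apply: Rle_ge; apply: pow_le.
  apply: Rle_trans (Rmult_le_compat_r _ _ _ (pow_le _ p h0) (hG s hs)) _.
  apply: Req_le; rewrite /E /yk /=; move: (pow _ _) => z; field.
rewrite Ik_diff in hJ.
have hI := Ik_pos p.
have hEI : E * (Ik p / (2 * INR p + 2)) <= Ik p / 4.
  have hp : 4 * E <= 2 * INR p + 2.
    rewrite /p mult_INR /E.
    have h1 : (1 + 2 * INR m * K) <= INR m * (1 + 2 * K) by nra.
    have h2 := Rmult_le_compat_l (8 * Cd) _ _ ltac:(lra) h1.
    have h3 := Rmult_le_compat_r (INR m) _ _ ltac:(lra) (Rlt_le _ _ hkap).
    lra.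
  have hp0 : 0 < 2 * INR p + 2 by have := pos_INR p; lra.
  apply: (Rmult_le_reg_r (2 * INR p + 2)) => //.
  have -> : E * (Ik p / (2 * INR p + 2)) * (2 * INR p + 2) = E * Ik p by field; lra.
  nra.
have := Cmod_sub_le (RtoC (Ik p)) (- J)%C.
have -> : (RtoC (Ik p) - - J = RtoC (Ik p) + J)%C by ring.
rewrite Cmod_opp Cmod_R Rabs_right; lra.
Qed.

End Peak.

(** * Large solutions along multiples of a sign-changing frequency *)

Section CaseB.
Variable om : R -> R.
Hypothesis Hw : weight_function om.
Hypothesis Hs : subadditive om.
Variables (N : nat) (a b : 'I_N -> R -> R) (B d0 : R).
Hypothesis Hd0 : 0 < d0.
Hypothesis HB0 : 0 <= B.
Hypothesis Hcf : forall j, cd om (lift1 (cf a b j)) B d0.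
Notation W := (W om).
Notation cd := (cd om).
Notation omZ := (omZ om).

Lemma ax_bx_lipschitz xi : exists K, 0 <= K /\
  (forall t t', Rabs (ax a xi t - ax a xi t') <= K * Rabs (t - t')) /\
  (forall t t', Rabs (bx b xi t - bx b xi t') <= K * Rabs (t - t')).
Proof.
have h1 : cd (lift1 (cxi (cf a b) xi)) (INR N * (nrm1 xi * B)) d0.
  apply: (@cd_sumC om N 1 (fun j x => RtoC (IZR (xi j)) * lift1 (cf a b j) x)%C) => j.
  apply: (cd_weaken Hw (cd_scal (RtoC (IZR (xi j))) (Hcf j))); last lra.
  by rewrite Cmod_R; apply: Rmult_le_compat_r => //; apply: nrm1_term.
have [K1 [_ H1]] := @cd_partial om Hw 1 d0 Hd0.
have [hp [hc _]] := H1 _ _ ord0 h1.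
have [K2 [_ H2]] := @cd_Eom om Hw 1 (d0 / 2) ltac:(lra).
have [_ [hb _]] := H2 _ _ hc.
set D := partial _ _ in hp hc hb; set M := K2 * _ in hb.
have hM : 0 <= M by apply: Rle_trans (Cmod_ge_0 _) (hb (fun _ => 0)).
have hd : forall t, is_derive (ax a xi) t (fst (D (fun _ => t))) /\ is_derive (bx b xi) t (snd (D (fun _ => t))).
  move=> t; have [q1 q2] := hp (fun _ => t); split.
    by apply: is_derive_ext q1 => s; rewrite /lift1 upd_same cxi_pair.
  by apply: is_derive_ext q2 => s; rewrite /lift1 upd_same cxi_pair.
exists M; split=> //; split=> t t'.
  apply: (mvt_bound (u' := fun t => fst (D (fun _ => t)))) => s; first by case: (hd s).
  move=> _; apply: Rle_trans (hb _); apply: Rle_trans (Rmax_Cmod _); exact: Rmax_l.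
apply: (mvt_bound (u' := fun t => snd (D (fun _ => t)))) => s; first by case: (hd s).
move=> _; apply: Rle_trans (hb _); apply: Rle_trans (Rmax_Cmod _); exact: Rmax_r.
Qed.

(** The period ends just after a point where be > 0, so that Bt increases there and its minimum is
    not at the right end; the nonpositive mean makes Bt at least as large at the left end. *)
Lemma interior_min (be : R -> R) t1 : (forall t, continuous be t) -> (forall t, be (t + 2 * PI) = be t) ->
  RInt be 0 (2 * PI) <= 0 -> 0 < be t1 ->
  exists q s0, q < s0 < q + 2 * PI /\ (forall s, q <= s <= q + 2 * PI -> Bt be s0 <= Bt be s) /\
    Bt be s0 < Bt be (q + 2 * PI) /\ Bt be (q + 2 * PI) <= Bt be q.
Proof.
move=> hc hp hm h1; have hpi := PI_RGT_0.
have hd : forall t, is_derive (Bt be) t (be t) by move=> t; apply: RInt_der.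
have [d [hd0 hd1]] := proj2 (continuous_eps be t1) (hc t1) _ h1.
pose e := Rmin (d / 2) PI.
have he : 0 < e by apply: Rmin_pos; lra.
have he1 : e <= d / 2 by apply: Rmin_l.
have he2 : e <= PI by apply: Rmin_r.
have hlt : Bt be t1 < Bt be (t1 + e).
  apply: (incr_function_le (Bt be) (Rbar.Finite t1) (Rbar.Finite (t1 + e)) be) => /=; try lra.
    by move=> x _ _; apply: hd.
  move=> x q1 q2; have := hd1 x ltac:(apply: Rabs_def1; lra).
  by move=> /Rabs_def2; lra.
pose q := t1 + e - 2 * PI.
have hB : Bt be (q + 2 * PI) <= Bt be q.
  by rewrite /Bt RInt_quasi //; lra.
have hcB : forall c, q <= c <= q + 2 * PI -> continuity_pt (Bt be) c.
  move=> c _; apply: derivable_continuous_pt; exists (be c); apply/is_derive_Reals; exact: hd.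
have [s0 [hs0 hs1]] := continuity_ab_min (Bt be) q (q + 2 * PI) ltac:(lra) hcB.
have e0 : q + 2 * PI = t1 + e by rewrite /q; ring.
have h2 : Bt be s0 < Bt be (q + 2 * PI).
  by rewrite e0; apply: Rle_lt_trans hlt; apply: hs0; rewrite e0 /q; lra.
exists q, s0; split; last by split.
have n1 : s0 <> q by move=> z; rewrite z in h2; lra.
have n2 : s0 <> q + 2 * PI by move=> z; rewrite -z in h2; lra.
lra.
Qed.

(** Over the period of [interior_min] the integral of Ef times the packet equals a difference of
    boundary values of Ef V. The former is at least about exp(-m Bt(s0)) / m, while |Ef| at both
    ends is at most exp(-m Bt(q + 2 pi)). So V is exponentially large, and division by its maximum
    gives the mode. *)
Lemma bad_multiple xi : 1 <= nrm1 xi -> yr b xi <= 0 -> (exists t, 0 < bx b xi t) ->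
  (forall xi, 1 <= nrm1 xi -> qx a b xi <> RtoC 1) ->
  exists A del, 0 < del /\ del <= d0 / 2 /\
    forall m, (1 <= m)%N -> bad om a b A del (fun j => (Z.of_nat m * xi j)%Z).
Proof.
move=> hxi hy [t1 ht1] hq; have hpi := PI_RGT_0.
pose al := ax a xi; pose be := bx b xi.
have cal : forall t, continuous al t by move=> t; apply: (ax_cont Hcf).
have cbe : forall t, continuous be t by move=> t; apply: (bx_cont Hcf).
have [K [hK [Lal Lbe]]] := ax_bx_lipschitz xi.
have hint : RInt be 0 (2 * PI) <= 0 by rewrite (bx_int Hcf); nra.
have [q [s0 [hs0 [hmin [hlt hle]]]]] := interior_min cbe (bx_per Hcf xi) hint ht1.
have [kap [hkap hpeak]] := peak_integral cal cbe hK Lal Lbe hs0 hmin.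
pose eta := Bt be (q + 2 * PI) - Bt be s0.
have heta : 0 < eta by rewrite /eta; lra.
have hk1 : 1 <= INR kap by case: kap hkap {hpeak} => // k _; rewrite S_INR; have := pos_INR k; lra.
have [c [hc0 hc]] := om_lin Hw Hs.
(* All frequencies involved have size at most m E; the summand 1 covers the rounding of m al(s0). *)
pose E := Rabs (al s0) + 1 + INR kap + nrm1 xi.
have hE : 1 <= E by rewrite /E; have := Rabs_pos (al s0); lra.
(* Small enough that the decay demanded at frequencies of size m E costs at most exp(m eta / 2),
   half of the gain. *)
pose del := Rmin (d0 / 2) (eta / (2 * (c * E + 1))).
have hcE : 0 <= c * E by apply: Rmult_le_pos; lra.
have hdel : 0 < del by apply: Rmin_pos; [lra | apply: Rdiv_lt_0_compat; lra].
have hdel2 : del * (c * E) <= eta / 2.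
  have := Rmult_le_compat_r (c * E + 1) _ _ ltac:(lra) (Rmin_r (d0 / 2) (eta / (2 * (c * E + 1)))).
  have -> : eta / (2 * (c * E + 1)) * (c * E + 1) = eta / 2 by field; lra.
  by rewrite -/del; lra.
(* The factor [exp (2 * del * c)] comes from the constant part of the two linear bounds of the
   weight, [2 / eta] from absorbing the factor m. *)
pose A := (2 * INR kap + 1) * (2 / eta) * exp (2 * del * c).
exists A, del; split=> //; split; first exact: Rmin_l.
move=> m hm; set xm := fun j => _.
have hm1 : 1 <= INR m by case: m hm {xm} => // m _; rewrite S_INR; have := pos_INR m; lra.
have eax : ax a xm = fun t => INR m * al t.
  apply: functional_extensionality => t; rewrite /al /ax -sumR_scal; apply: sumR_ext => j.
  by rewrite /xm mult_IZR -INR_IZR_INZ; ring.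
have ebx : bx b xm = fun t => INR m * be t.
  apply: functional_extensionality => t; rewrite /be /bx -sumR_scal; apply: sumR_ext => j.
  by rewrite /xm mult_IZR -INR_IZR_INZ; ring.
have enm : nrm1 xm = INR m * nrm1 xi.
  rewrite /nrm1 -sumR_scal; apply: sumR_ext => j.
  by rewrite /xm mult_IZR -INR_IZR_INZ Rabs_mult (Rabs_right (INR m)) //; lra.
have hxm : 1 <= nrm1 xm by rewrite enm; nra.
pose n := up (INR m * al s0).
have hn : Rabs (INR m * al s0 - IZR n) <= 1.
  by have [u1 u2] := archimed (INR m * al s0); apply: Rabs_le; rewrite /n; lra.
pose f := wave s0 n (kap * m).
have cf0 : ccont f by apply: wave_ccont.
have [V [V' [dV [cV' [pV hV]]]]] := ode_exist (ax_cont Hcf xm) (bx_cont Hcf xm) (ax_per Hcf xm) (bx_per Hcf xm)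
  cf0 (wave_periodic s0 n (kap * m)) (hq xm hxm).
have cV := cder_cont dV.
have [s1 hs1] := periodic_max cV pV.
have hVlow : exp (INR m * eta) <= (2 * INR kap + 1) * INR m * Cmod (V s1).
  have h1 := hpeak m n hm hn.
  have h2 := ode_int (ax_cont Hcf xm) (bx_cont Hcf xm) dV cf0 hV q (q + 2 * PI).
  rewrite eax ebx in h2; rewrite -/f h2 pV in h1.
  have h3 : forall t, Cmod (Ef (fun t => INR m * al t) (fun t => INR m * be t) t) = exp (- (INR m * Bt be t)).
    by move=> t; rewrite Ef_mod /Bt RInt_scalR.
  have h4 : exp (- (INR m * Bt be s0)) * (Ik (kap * m) / 2) <= 2 * exp (- (INR m * Bt be (q + 2 * PI))) * Cmod (V s1).
    apply: Rle_trans h1 _; apply: Rle_trans (Cmod_triangle _ _) _.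
    rewrite Cmod_opp (Cmod_mult (Ef _ _ (q + 2 * PI))) (Cmod_mult (Ef _ _ q)) !h3.
    have h5 : exp (- (INR m * Bt be q)) <= exp (- (INR m * Bt be (q + 2 * PI))).
      by apply: exp_le; have := Rmult_le_compat_l (INR m) _ _ ltac:(lra) hle; lra.
    have h6 := exp_pos (- (INR m * Bt be q)).
    have h7 := hs1 q; have h8 := Cmod_ge_0 (V q).
    have h9 : exp (- (INR m * Bt be (q + 2 * PI))) * Cmod (V q) <= exp (- (INR m * Bt be (q + 2 * PI))) * Cmod (V s1).
      by apply: Rmult_le_compat_l => //; lra.
    have := Rmult_le_compat_r _ _ _ h8 h5; lra.
  have h5 := exp_pos (INR m * Bt be (q + 2 * PI)).
  have h6 : exp (INR m * eta) * (Ik (kap * m) / 2) <= 2 * Cmod (V s1).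
    have := Rmult_le_compat_l _ _ _ (Rlt_le _ _ h5) h4.
    have -> : exp (INR m * Bt be (q + 2 * PI)) * (exp (- (INR m * Bt be s0)) * (Ik (kap * m) / 2)) =
       exp (INR m * eta) * (Ik (kap * m) / 2).
      by rewrite -Rmult_assoc -exp_plus; congr (exp _ * _); rewrite /eta; ring.
    have -> : exp (INR m * Bt be (q + 2 * PI)) * (2 * exp (- (INR m * Bt be (q + 2 * PI))) * Cmod (V s1)) =
       2 * Cmod (V s1); last by [].
    by rewrite exp_Ropp; field; apply: Rgt_not_eq.
  have h7 := Ik_low (kap * m); have h8 := PI2_3_2; rewrite mult_INR in h7.
  have h9 := exp_pos (INR m * eta).
  have hX : 0 < 2 * (INR kap * INR m) + 1 by nra.
  have h10 := Rmult_le_compat_l _ _ _ (Rlt_le _ _ hX) h6.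
  have h11 := Rmult_le_compat_l _ _ _ (Rlt_le _ _ h9) h7.
  have h12 : 4 * exp (INR m * eta) <= exp (INR m * eta) * (2 * PI) by nra.
  have h13 : exp (INR m * eta) <= (2 * (INR kap * INR m) + 1) * Cmod (V s1) by lra.
  apply: Rle_trans h13 _; apply: Rmult_le_compat_r; first exact: Cmod_ge_0.
  lra.
set Mx := Cmod (V s1) in hs1 hVlow.
have hMx : 0 < Mx.
  have := exp_pos (INR m * eta).
  have h0 : 0 < (2 * INR kap + 1) * INR m by apply: Rmult_lt_0_compat; lra.
  by have : 0 <= Mx by [apply: Cmod_ge_0]; nra.
have hi := Rinv_0_lt_compat _ hMx.
have em : forall z, Cmod (RtoC (/ Mx) * z)%C = / Mx * Cmod z.
  by move=> z; rewrite Cmod_mult Cmod_R Rabs_right //; lra.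
split=> //.
exists (fun t => RtoC (/ Mx) * V t, fun t => RtoC (/ Mx) * V' t, fun t => RtoC (/ Mx) * f t)%C.
split; [|split; [|split; [|split; [|split; [|split; [|split]]]]]].
- by apply: cder_ext (cder_mult (cder_const _) dV) => t; ring.
- by apply: ccont_mult => //; apply: ccont_const.
- by move=> t; rewrite pV.
- by apply: ccont_mult => //; apply: ccont_const.
- by move=> t; rewrite cxi_pair -/f -hV; ring.
- move=> t; rewrite em -(Rinv_l Mx); last lra.
  by apply: Rmult_le_compat_l; [lra | apply: hs1].
- by exists s1; rewrite em -/Mx Rinv_l; lra.
move=> tau.
have -> : coef1 (fun t => RtoC (/ Mx) * f t)%C tau = (RtoC (/ Mx) * coef1 f tau)%C.
  by rewrite /coef1 -coef_scal //; apply/ccont_lift1.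
have hA : 0 <= A * exp (- del * (omZ tau + W xm)).
  apply: Rmult_le_pos; last by apply: Rlt_le; apply: exp_pos.
  apply: Rmult_le_pos; last by apply: Rlt_le; apply: exp_pos.
  by apply: Rmult_le_pos; [lra | apply: Rlt_le; apply: Rdiv_lt_0_compat; lra].
rewrite em.
case: (classic (Z.abs n + Z.of_nat (kap * m) < Z.abs tau)%Z) => ht.
  by rewrite /f wave_coef // Cmod_0 Rmult_0_r.
have htau : Rabs (IZR tau) <= INR m * (Rabs (al s0) + INR kap) + 1.
  have : Rabs (IZR tau) <= Rabs (IZR n) + INR (kap * m).
    by rewrite INR_IZR_INZ -!abs_IZR -plus_IZR; apply: IZR_le; lia.
  rewrite mult_INR.
  have : Rabs (IZR n) <= INR m * Rabs (al s0) + 1.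
    have -> : IZR n = INR m * al s0 + - (INR m * al s0 - IZR n) by ring.
    apply: Rle_trans (Rabs_triang _ _) _; rewrite Rabs_Ropp Rabs_mult (Rabs_right (INR m)); lra.
  lra.
have hom : omZ tau + W xm <= c * (2 + INR m * E).
  have h1 := hc _ (Rabs_pos (IZR tau)); have h2 := hc _ (nrm1_ge0 xm).
  rewrite -/(omZ tau) in h1; rewrite -/(W xm) enm in h2.
  have h3 : c * (1 + Rabs (IZR tau)) + c * (1 + INR m * nrm1 xi) <= c * (2 + INR m * E).
    rewrite -Rmult_plus_distr_l; apply: Rmult_le_compat_l => //; rewrite /E; lra.
  lra.
have hf1 : Cmod (coef1 f tau) <= 1 by apply: coef1_sup => // t; apply: wave_bound.
apply: Rle_trans (_ : / Mx <= _).
  by rewrite -[X in _ <= X]Rmult_1_r; apply: Rmult_le_compat_l; lra.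
(* Half of the exponential absorbs the factor m left by the mass of the kernel. *)
have hX := exp_pos (INR m * eta / 2).
have hx2 : INR m * eta / 2 <= exp (INR m * eta / 2) by have := exp_ineq1_le (INR m * eta / 2); lra.
have e2 : exp (INR m * eta) = exp (INR m * eta / 2) * exp (INR m * eta / 2).
  by rewrite -exp_plus; congr exp; field.
have h1 : exp (INR m * eta / 2) * eta / 2 <= (2 * INR kap + 1) * Mx.
  apply: (Rmult_le_reg_r (INR m)); first lra.
  rewrite e2 in hVlow; have := Rmult_le_compat_l _ _ _ (Rlt_le _ _ hX) hx2; lra.
have h2 : / Mx <= (2 * INR kap + 1) * (2 / eta) * exp (- (INR m * eta / 2)).
  apply: (Rmult_le_reg_l (Mx * exp (INR m * eta / 2))); first exact: Rmult_lt_0_compat.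
  have -> : Mx * exp (INR m * eta / 2) * / Mx = exp (INR m * eta / 2) by field; lra.
  have -> : Mx * exp (INR m * eta / 2) * ((2 * INR kap + 1) * (2 / eta) * exp (- (INR m * eta / 2))) =
     (2 * INR kap + 1) * Mx * (2 / eta).
    by rewrite exp_Ropp; field; split; lra.
  have := Rmult_le_compat_r (2 / eta) _ _ ltac:(apply: Rlt_le; apply: Rdiv_lt_0_compat; lra) h1.
  have -> : exp (INR m * eta / 2) * eta / 2 * (2 / eta) = exp (INR m * eta / 2) by field; lra.
  by [].
apply: Rle_trans h2 _; rewrite /A (Rmult_assoc _ (exp _)) -exp_plus.
apply: Rmult_le_compat_l.
  by apply: Rmult_le_pos; [lra | apply: Rlt_le; apply: Rdiv_lt_0_compat; lra].
apply: exp_le.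
have q1 := Rmult_le_compat_l _ _ _ (Rlt_le _ _ hdel) hom.
have q2 := Rmult_le_compat_l _ _ _ (pos_INR m) hdel2.
lra.
Qed.

(** The Diophantine condition gives q <> 1 on all fibres xi <> 0, so that the equations with wave
    packets are solvable and solutions unique; its failure is the subject of [not_edc]. *)
Lemma sign_change xi : EDC1 om (fun j => mean (a j)) (fun j => mean (b j)) ->
  changes_sign (bx b xi) -> ~ glob_hypoelliptic om a b /\ ~ strongly_solvable om a b.
Proof.
move=> hedc hsc.
have hq : forall xi, 1 <= nrm1 xi -> qx a b xi <> RtoC 1.
  by move=> k hk; apply: (qx_ne1 Hcf) => tau; apply: (edc_ne hedc hk).
(* Passing from xi to -xi if necessary, the mean is nonpositive; a change of sign provides positive
   values in either case. *)
have [k [hk1 [hk2 hk3]]] : exists k, 1 <= nrm1 k /\ yr b k <= 0 /\ exists t, 0 < bx b k t.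
  have hn1 : 1 <= nrm1 xi.
    apply: NNPP => h; case: hsc => [[t ht] _].
    have e : bx b xi t = 0; last lra.
    rewrite /bx (sumR_ext (G := fun _ => 0)) ?sumR_const ?Rmult_0_r // => j.
    by rewrite (nrm1_lt1 h); ring.
  case: (Rle_dec (yr b xi) 0) => h; first by exists xi; case: hsc.
  exists (negz xi); rewrite nrm1_neg; split=> //; split.
    have -> : yr b (negz xi) = -1 * yr b xi; last lra.
    by rewrite /yr -sumR_scal; apply: sumR_ext => j; rewrite /negz opp_IZR; ring.
  case: hsc => _ [t ht]; exists t.
  have -> : bx b (negz xi) t = -1 * bx b xi t; last lra.
  by rewrite /bx -sumR_scal; apply: sumR_ext => j; rewrite /negz opp_IZR; ring.
have [A [del [hd [hd2 hbad]]]] := bad_multiple hk1 hk2 hk3 hq.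
have hub : forall X, exists xi, X < nrm1 xi /\ bad om a b A del xi.
  move=> X; have [p hp] := INR_unbounded X; eexists; split; last exact: (hbad p.+1).
  have -> : nrm1 (fun j => (Z.of_nat p.+1 * k j)%Z) = INR p.+1 * nrm1 k.
    rewrite /nrm1 -sumR_scal; apply: sumR_ext => j.
    by rewrite mult_IZR -INR_IZR_INZ Rabs_mult (Rabs_right (INR _)) //; apply: Rle_ge; apply: pos_INR.
  by rewrite S_INR; have := pos_INR p; nra.
split; first exact: (@neg_hypo om Hw Hs N a b B d0 Hd0 Hcf A del hd).
by apply: (@neg_solv om Hw Hs N a b B d0 Hd0 HB0 Hcf A del hd hd2 hub) => k' [hk' _]; apply: hq.
Qed.

End CaseB.

Theorem theorem2p4 (om : R -> R) (N : nat) (a b : 'I_N -> R -> R) :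
  weight_function om -> subadditive om ->
  (forall j, Eom om (fun x : pt 1 => RtoC (a j (x ord0)))) ->
  (forall j, Eom om (fun x : pt 1 => RtoC (b j (x ord0)))) ->
  (strongly_solvable om a b <-> glob_hypoelliptic om a b) /\
  (glob_hypoelliptic om a b <-> condition3 om a b).
Proof.
move=> Hw Hs ha hb.
(* The complex coefficients a_j + i b_j receive a common size and rate below. *)
have hcf : forall j, Eom om (lift1 (cf a b j)).
  move=> j; have -> : lift1 (cf a b j) = (fun x : pt 1 => (0, 1) * RtoC (b j (x ord0)) + RtoC (a j (x ord0)))%C.
    apply: functional_extensionality => x; rewrite /lift1 /cf /RtoC /Cmult /Cplus /=; congr pair; ring.
  exact: Eom_lin.
have [B [d0 [hB [hd Hcf]]]] := cd_uniform Hw Hs hcf.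
have suff_cond : condition3 om a b -> glob_hypoelliptic om a b /\ strongly_solvable om a b.
  move=> [hsign hedc]; split; first exact: (@cond_hypo om Hw Hs N a b B d0).
  exact: (@cond_solv om Hw Hs N a b B d0).
have nec_cond : ~ condition3 om a b -> ~ glob_hypoelliptic om a b /\ ~ strongly_solvable om a b.
  (* The Diophantine condition is decided first because the argument for a change of sign relies on
     it. *)
  move=> hn; case: (classic (EDC1 om (fun j => mean (a j)) (fun j => mean (b j)))) => hedc.
    have [xi hxi] : exists xi, changes_sign (bx b xi).
      by apply: NNPP => h; apply: hn; split=> // xi hxi; apply: h; exists xi.
    exact: (sign_change Hw Hs hd hB Hcf hedc hxi).
  exact: (not_edc Hw Hs hd hB Hcf hedc).
case: (classic (condition3 om a b)) => hc.
  by have [h1 h2] := suff_cond hc.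
by have [h1 h2] := nec_cond hc.
Qed.
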